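(* Let $x>0$, $0<\theta<1$, and let $\nu\in\mathbb{C}\setminus\mathbb{Z}$ with $\Re(\nu)\geq 0$. Let $N$ be any integer with $N\geq\lfloor\frac{\Re(\nu)+1}{2}\rfloor$, and suppose $x\notin\{(n-\theta)r:\ n,r\in\mathbb{N}\}$. Then \begin{align*} &8\pi x^{\nu/2}\sum_{n=1}^{\infty}n^{\nu/2}K_{\nu}(4\pi\sqrt{nx})\sum_{d\mid n}d^{-\nu}\cos(2\pi d\theta) =-\frac{\pi}{\cos(\frac{\pi\nu}{2})}\zeta(\nu+1)x^{\nu}\\ &\quad-\frac{\pi}{2\cos(\frac{\pi\nu}{2})}\bigl(\zeta(1-\nu,\theta)+\zeta(1-\nu,1-\theta)\bigr)-\frac{1}{2x\sin(\frac{\pi\nu}{2})}\bigl(\zeta(-\nu,\theta)+\zeta(-\nu,1-\theta)\bigr)\\ &\quad+\frac{1}{\sin(\frac{\pi\nu}{2})}\sum_{j=1}^{N}\zeta(2j)\bigl(\zeta(2j-\nu,\theta)+\zeta(2j-\nu,1-\theta)\bigr)x^{2j-1}\\ &\quad+\frac{1}{\sin(\frac{\pi\nu}{2})}x^{2N+1}\sum_{d=1}^{\infty}d^{-\nu}\sum_{m=0}^{\infty}\left\{\frac{(d(m+\theta))^{\nu-2N}-x^{\nu-2N}}{d^2(m+\theta)^2-x^2}+\frac{(d(m+1-\theta))^{\nu-2N}-x^{\nu-2N}}{d^2(m+1-\theta)^2-x^2}\right\}. \end{align*}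
   Context: $K_\nu$ denotes the modified Bessel function of the second kind of order $\nu$. $\zeta(s,\alpha)$ is the Hurwitz zeta function ($\sum_{n\ge0}(n+\alpha)^{-s}$ for $\Re s>1$, meromorphically continued to $\mathbb{C}$), $\zeta(s)$ the Riemann zeta function. $\mathbb{N}=\{1,2,\dots\}$.
   Formalization: The formal theorem also assumes x is not of the form (n−(1−θ))r with n, r in ℕ; at such x a summand with denominator d²(m+θ)²−x² is 0/0, so the stated formula is undefined there (e.g. θ = x = 1/3). *)

(* Defs.v *)
From Stdlib Require Import Reals ZArith List.
From Coquelicot Require Import Coquelicot.
Open Scope R_scope.

Definition cexp (z : C) : C :=
  (exp (Re z) * cos (Im z), exp (Re z) * sin (Im z)).

Definition cpow (x : R) (s : C) : C := cexp (Cmult s (RtoC (ln x))).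

Definition ccosh (z : C) : C := Cdiv (Cplus (cexp z) (cexp (Copp z))) (RtoC 2).
Definition ccos (z : C) : C :=
  Cdiv (Cplus (cexp (Cmult Ci z)) (cexp (Copp (Cmult Ci z)))) (RtoC 2).
Definition csin (z : C) : C :=
  Cdiv (Cminus (cexp (Cmult Ci z)) (cexp (Copp (Cmult Ci z)))) (Cmult (RtoC 2) Ci).

Definition cseries (a : nat -> C) (l : C) : Prop :=
  @is_series C_AbsRing C_NormedModule a l.

Definition BesselK (nu : C) (y : R) : C :=
  @RInt_gen C_R_CompleteNormedModule (fun t : R => Cmult (RtoC (exp (- (y * cosh t)))) (ccosh (Cmult nu (RtoC t))))
           (at_point 0) (Rbar_locally p_infty).

(* Hurwitz zeta function zeta(s, alpha) for alpha > 0, as the value at s of the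
   (unique) holomorphic function on C \ {1} which equals sum_{n>=0} (n+alpha)^{-s}
   for Re s > 1 (meromorphic continuation). *)
Definition is_hurwitz_continuation (alpha : R) (F : C -> C) : Prop :=
  (forall w : C, w <> RtoC 1 -> @ex_derive C_AbsRing C_NormedModule F w) /\
  (forall w : C, 1 < Re w ->
     cseries (fun n => cpow (INR n + alpha) (Copp w)) (F w)).

Definition HurwitzZeta (s : C) (alpha : R) : C :=
  @iota C_CompleteNormedModule (fun z : C => exists F, is_hurwitz_continuation alpha F /\ F s = z).

Definition RiemannZeta (s : C) : C := HurwitzZeta s 1.

Definition divisor_sum (n : nat) (f : nat -> C) : C :=
  fold_right Cplus (RtoC 0)
    (map f (filter (fun d => Nat.eqb (Nat.modulo n d) 0) (seq 1 n))).

Definition csum1 (N : nat) (f : nat -> C) : C :=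
  fold_right Cplus (RtoC 0) (map f (seq 1 N)).

(* Main.v *)
Require Import Defs.
From Stdlib Require Import Reals ZArith List Psatz ClassicalEpsilon PropExtensionality.
From Coquelicot Require Import Coquelicot.
Open Scope R_scope.

(** Write [t = e^u]. With [A(t) = sum_k cos(2 pi k theta) e^(-2 pi k t)] and [B(y) = 1 / (e^(2 pi y) - 1)],
    the integral representation of [K_nu] and the Dirichlet convolution turn the left-hand side into
    [4 pi int_R e^(nu u) A(e^u) B(x e^(-u)) du].  Poisson summation (proved by Herglotz' trick) expands
    [A + 1/2] into the Cauchy kernels [t / (t^2 + v^2)], [v = m + theta, m + 1 - theta], and, at [theta = 0],
    [B = P + B_N] with [P] a finite Laurent expansion whose coefficients are the [zeta(2j)] and [B_N] a series of
    Cauchy kernels.  For [2N - 1 <= Re nu < 2N + 1] the part [(A + 1/2) B_N] integrates termwise to the double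
    series, while the remaining terms are Mellin transforms of [A] and [B] at [nu], [nu + 1], [nu - (2i + 1)];
    these are given by the functional equation of the Hurwitz zeta function, extended from a strip of convergence
    by the identity theorem.  Larger [N] follow by splitting off the geometric term
    [(d v)^(nu - 2N - 2)] of the double series. *)

(** In the variable u every complex power is some [cexp (s * u)], and every convergence question
    becomes a bound [K * exp (- del * |u|)]; these bounds carry all exchanges of sum and integral.
    The smallest admissible N is the only N0 with 2 N0 - 1 <= Re nu < 2 N0 + 1. The upper edge comes
    from u -> +oo, where A + 1/2 is bounded and B_N (x e^(-u)) has order e^(-(2N+1)u). At u -> -oo
    the Cauchy kernels in B_N have order e^((2N-1)|u|), so at Re nu = 2N - 1 the transform of B_N
    alone no longer converges absolutely; its value there is a limit from the right. The product
    with A + 1/2 still converges there, because 0 < theta < 1 keeps every v away from 0 and makes A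
    + 1/2 vanish linearly in t. The Hurwitz zeta function is given by a description, so existence
    and uniqueness of the continuation belong to the proof: uniqueness rests on Goursat's theorem
    through mean values on circles, existence on the trapezoidal rule, whose error term is continued
    by repeated integration by parts. *)

(** * Real and imaginary parts, modulus *)

Lemma C_ext (z w : C) : Re z = Re w -> Im z = Im w -> z = w.
Proof. destruct z, w; simpl; intros; subst; reflexivity. Qed.

Lemma Re_plus z w : Re (z + w)%C = Re z + Re w. Proof. reflexivity. Qed.
Lemma Im_plus z w : Im (z + w)%C = Im z + Im w. Proof. reflexivity. Qed.
Lemma Re_opp z : Re (- z)%C = - Re z. Proof. reflexivity. Qed.
Lemma Im_opp z : Im (- z)%C = - Im z. Proof. reflexivity. Qed.
Lemma Re_minus z w : Re (z - w)%C = Re z - Re w. Proof. reflexivity. Qed.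
Lemma Im_minus z w : Im (z - w)%C = Im z - Im w. Proof. reflexivity. Qed.
Lemma Re_mult z w : Re (z * w)%C = Re z * Re w - Im z * Im w. Proof. reflexivity. Qed.
Lemma Im_mult z w : Im (z * w)%C = Re z * Im w + Im z * Re w. Proof. reflexivity. Qed.
Lemma Re_RtoC r : Re (RtoC r) = r. Proof. reflexivity. Qed.
Lemma Im_RtoC r : Im (RtoC r) = 0. Proof. reflexivity. Qed.
Lemma Re_Ci : Re Ci = 0. Proof. reflexivity. Qed.
Lemma Im_Ci : Im Ci = 1. Proof. reflexivity. Qed.
#[export] Hint Rewrite Re_plus Im_plus Re_opp Im_opp Re_minus Im_minus Re_mult Im_mult
  Re_RtoC Im_RtoC Re_Ci Im_Ci : cparts.

Lemma im_le_Cmod (z : C) : Rabs (Im z) <= Cmod z.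
Proof.
  apply Rle_trans with (2 := Rmax_Cmod z). apply Rmax_r.
Qed.

Lemma Cmod_le_parts (z : C) : Cmod z <= Rabs (Re z) + Rabs (Im z).
Proof.
  replace z with (RtoC (Re z) + Ci * RtoC (Im z))%C at 1
    by (apply C_ext; autorewrite with cparts; ring).
  eapply Rle_trans; [apply Cmod_triangle|].
  rewrite Cmod_mult, Cmod_Ci, !Cmod_R. lra.
Qed.

Lemma Cmod_minus_sym (z w : C) : Cmod (z - w)%C = Cmod (w - z)%C.
Proof. rewrite <- Cmod_opp. f_equal. ring. Qed.

Lemma Cmod_triangle_minus (z w : C) : Cmod (z - w)%C <= Cmod z + Cmod w.
Proof. unfold Cminus. eapply Rle_trans; [apply Cmod_triangle|]. rewrite Cmod_opp. lra. Qed.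

Lemma Cmod_triangle_inv (z w : C) : Cmod z - Cmod w <= Cmod (z - w)%C.
Proof.
  assert (H := Cmod_triangle (z - w) w).
  replace (z - w + w)%C with z in H by ring. lra.
Qed.

(** * Complex exponential *)

Lemma exp_le_compat (a b : R) : a <= b -> exp a <= exp b.
Proof. intros [H|H]; [left; now apply exp_increasing|rewrite H; apply Rle_refl]. Qed.

Lemma cexp_plus (z w : C) : cexp (z + w) = (cexp z * cexp w)%C.
Proof.
  unfold cexp. autorewrite with cparts. rewrite exp_plus, cos_plus, sin_plus.
  apply C_ext; autorewrite with cparts; simpl; ring.
Qed.

Lemma cexp_0 : cexp 0 = 1%C.
Proof. unfold cexp; simpl. rewrite exp_0, cos_0, sin_0. apply C_ext; simpl; ring. Qed.

Lemma Cmod_cexp (z : C) : Cmod (cexp z) = exp (Re z).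
Proof.
  unfold Cmod, cexp; simpl.
  replace (_ + _) with (Rsqr (exp (Re z)) * (Rsqr (sin (Im z)) + Rsqr (cos (Im z))))
    by (unfold Rsqr; ring).
  rewrite sin2_cos2, Rmult_1_r, sqrt_Rsqr; [reflexivity|]. left; apply exp_pos.
Qed.

Lemma cexp_neq_0 (z : C) : cexp z <> 0%C.
Proof.
  intro H. assert (H1 := Cmod_cexp z). rewrite H, Cmod_0 in H1.
  generalize (exp_pos (Re z)); lra.
Qed.

Lemma cexp_opp (z : C) : cexp (- z) = (/ cexp z)%C.
Proof.
  assert (H : (cexp (- z) * cexp z = 1)%C).
  { rewrite <- cexp_plus, <- cexp_0. f_equal. ring. }
  rewrite <- (Cmult_1_r (cexp (- z))), <- (Cinv_r (cexp z)) by apply cexp_neq_0.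
  rewrite Cmult_assoc, H. ring.
Qed.

Lemma cexp_minus (z w : C) : cexp (z - w) = (cexp z / cexp w)%C.
Proof. unfold Cminus. rewrite cexp_plus, cexp_opp. reflexivity. Qed.

Lemma cexp_RtoC (r : R) : cexp (RtoC r) = RtoC (exp r).
Proof. unfold cexp; simpl. rewrite cos_0, sin_0. apply C_ext; simpl; ring. Qed.

Lemma cexp_Ci (r : R) : cexp (Ci * RtoC r) = (cos r, sin r).
Proof.
  unfold cexp. autorewrite with cparts.
  replace (0 * r - 1 * 0) with 0 by ring. replace (0 * 0 + 1 * r) with r by ring.
  rewrite exp_0. apply C_ext; simpl; ring.
Qed.

Lemma Cmod_cpow (y : R) (s : C) : Cmod (cpow y s) = exp (Re s * ln y).
Proof. unfold cpow. rewrite Cmod_cexp. f_equal. autorewrite with cparts. ring. Qed.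

Lemma cpow_plus (y : R) (s w : C) : cpow y (s + w) = (cpow y s * cpow y w)%C.
Proof. unfold cpow. rewrite <- cexp_plus. f_equal. ring. Qed.

Lemma cpow_opp (y : R) (s : C) : cpow y (- s) = (/ cpow y s)%C.
Proof. unfold cpow. rewrite <- cexp_opp. f_equal. ring. Qed.

Lemma cpow_neq_0 (y : R) (s : C) : cpow y s <> 0%C.
Proof. apply cexp_neq_0. Qed.

Lemma cpow_mult_base (y z : R) (s : C) : 0 < y -> 0 < z ->
  cpow (y * z) s = (cpow y s * cpow z s)%C.
Proof.
  intros Hy Hz. unfold cpow. rewrite ln_mult, <- cexp_plus by assumption. f_equal.
  rewrite RtoC_plus. ring.
Qed.

Lemma cpow_inv_base (y : R) (s : C) : 0 < y -> cpow (/ y) s = (/ cpow y s)%C.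
Proof.
  intros Hy. unfold cpow. rewrite ln_Rinv, <- cexp_opp by assumption. f_equal.
  rewrite RtoC_opp. ring.
Qed.

Lemma cpow_nat (y : R) (n : nat) : 0 < y -> cpow y (RtoC (INR n)) = RtoC (y ^ n).
Proof.
  intros Hy. unfold cpow. rewrite <- RtoC_mult, cexp_RtoC. f_equal.
  rewrite <- (exp_ln (y ^ n)) by now apply pow_lt.
  rewrite ln_pow by assumption. reflexivity.
Qed.

(** * Integrals of complex-valued functions *)

(** Continuity, derivative and integral of complex functions of a real variable are taken
    componentwise, so that real integration theory applies directly; [ccont_eps] recovers the form
    with the modulus. *)
Definition ccont (f : R -> C) (t : R) : Prop :=
  continuous (fun u => Re (f u)) t /\ continuous (fun u => Im (f u)) t.

Definition rder (f : R -> C) (t : R) (l : C) : Prop :=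
  is_derive (fun u => Re (f u)) t (Re l) /\ is_derive (fun u => Im (f u)) t (Im l).

Definition Cint (f : R -> C) (a b : R) : C :=
  (RInt (fun u => Re (f u)) a b, RInt (fun u => Im (f u)) a b).

Lemma ccont_plus f g t : ccont f t -> ccont g t -> ccont (fun u => f u + g u)%C t.
Proof.
  intros [H1 H2] [H3 H4]; split.
  - exact (continuous_plus (V := R_NormedModule) _ _ _ H1 H3).
  - exact (continuous_plus (V := R_NormedModule) _ _ _ H2 H4).
Qed.

Lemma ccont_minus f g t : ccont f t -> ccont g t -> ccont (fun u => f u - g u)%C t.
Proof.
  intros [H1 H2] [H3 H4]; split.
  - exact (continuous_minus (V := R_NormedModule) _ _ _ H1 H3).
  - exact (continuous_minus (V := R_NormedModule) _ _ _ H2 H4).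
Qed.

Lemma ccont_mult f g t : ccont f t -> ccont g t -> ccont (fun u => f u * g u)%C t.
Proof.
  intros [H1 H2] [H3 H4]; split.
  - refine (continuous_minus (V := R_NormedModule) _ _ _ _ _);
      apply (continuous_mult (K := R_AbsRing)); assumption.
  - refine (continuous_plus (V := R_NormedModule) _ _ _ _ _);
      apply (continuous_mult (K := R_AbsRing)); assumption.
Qed.

Lemma ccont_const (c : C) t : ccont (fun _ => c) t.
Proof. split; apply continuous_const. Qed.

Lemma ccont_RtoC (f : R -> R) t : continuous f t -> ccont (fun u => RtoC (f u)) t.
Proof. intros H; split; [exact H|apply continuous_const]. Qed.

Lemma ccont_comp (f : R -> C) (g : R -> R) t :
  continuous g t -> ccont f (g t) -> ccont (fun u => f (g u)) t.
Proof.
  intros H [H1 H2]; split.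
  - exact (continuous_comp g (fun u => Re (f u)) t H H1).
  - exact (continuous_comp g (fun u => Im (f u)) t H H2).
Qed.

Lemma continuous_exp_R (x : R) : continuous exp x.
Proof. apply (ex_derive_continuous (V := R_NormedModule)). auto_derive; trivial. Qed.

Lemma continuous_eps (f : R -> R) (t : R) :
  continuous f t <->
  forall eps, 0 < eps -> exists del, 0 < del /\
    forall u, Rabs (u - t) < del -> Rabs (f u - f t) < eps.
Proof.
  split.
  - intros H eps He.
    assert (H1 : locally t (fun u => ball (f t) (mkposreal eps He) (f u))).
    { apply H. now exists (mkposreal eps He). }
    destruct H1 as [d Hd]. exists d; split; [apply cond_pos|].
    intros u Hu. apply (Hd u). exact Hu.
  - intros H. apply filterlim_locally. intros [eps He].
    destruct (H eps He) as [d [Hd Hu]]. exists (mkposreal d Hd). intros u Hb.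
    apply (Hu u). exact Hb.
Qed.

Lemma ccont_eps (f : R -> C) (t : R) :
  (forall eps, 0 < eps -> exists del, 0 < del /\
    forall u, Rabs (u - t) < del -> Cmod (f u - f t) < eps) <-> ccont f t.
Proof.
  split.
  - intros H; split; apply continuous_eps; intros eps He; destruct (H eps He) as [d [Hd Hu]];
      exists d; (split; [exact Hd|]); intros u Hb; specialize (Hu u Hb).
    + eapply Rle_lt_trans; [|exact Hu]. rewrite <- Re_minus. apply re_le_Cmod.
    + eapply Rle_lt_trans; [|exact Hu]. rewrite <- Im_minus. apply im_le_Cmod.
  - intros [H1 H2] eps He. rewrite continuous_eps in H1, H2.
    destruct (H1 (eps/2) ltac:(lra)) as [d1 [Hd1 Hu1]].
    destruct (H2 (eps/2) ltac:(lra)) as [d2 [Hd2 Hu2]].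
    exists (Rmin d1 d2); split; [now apply Rmin_pos|]. intros u Hu.
    eapply Rle_lt_trans; [apply Cmod_le_parts|]. rewrite Re_minus, Im_minus.
    specialize (Hu1 u (Rlt_le_trans _ _ _ Hu (Rmin_l _ _))).
    specialize (Hu2 u (Rlt_le_trans _ _ _ Hu (Rmin_r _ _))). lra.
Qed.

Lemma ccont_ext_loc (f g : R -> C) t :
  (exists del, 0 < del /\ forall u, Rabs (u - t) < del -> f u = g u) ->
  ccont f t -> ccont g t.
Proof.
  intros [d [Hd H]] Hf. rewrite <- ccont_eps in Hf |- *. intros eps He.
  destruct (Hf eps He) as [d1 [Hd1 H1]].
  exists (Rmin d d1); split; [now apply Rmin_pos|]. intros u Hu.
  rewrite <- !H.
  - apply H1. eapply Rlt_le_trans; [exact Hu|apply Rmin_r].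
  - rewrite Rminus_diag, Rabs_R0; assumption.
  - eapply Rlt_le_trans; [exact Hu|apply Rmin_l].
Qed.

Lemma ccont_ext (f g : R -> C) t : (forall u, f u = g u) -> ccont f t -> ccont g t.
Proof. intros H. apply ccont_ext_loc. exists 1; split; [lra|auto]. Qed.

Lemma ccont_Cmod f t : ccont f t -> continuous (fun u => Cmod (f u)) t.
Proof.
  intros H. rewrite <- ccont_eps in H. apply continuous_eps. intros eps He.
  destruct (H eps He) as [d [Hd Hu]]. exists d; split; [exact Hd|].
  intros u Hb. specialize (Hu u Hb).
  assert (H1 := Cmod_triangle_inv (f u) (f t)).
  assert (H2 := Cmod_triangle_inv (f t) (f u)). rewrite Cmod_minus_sym in H2.
  apply Rabs_def1; lra.
Qed.

Lemma ccont_ex_RInt f a b : (forall t, Rmin a b <= t <= Rmax a b -> ccont f t) ->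
  ex_RInt (fun u => Re (f u)) a b /\ ex_RInt (fun u => Im (f u)) a b.
Proof.
  intros H; split; apply (ex_RInt_continuous (V := R_CompleteNormedModule));
    intros t Ht; apply (H t Ht).
Qed.

Lemma Cint_plus f g a b :
  (forall t, Rmin a b <= t <= Rmax a b -> ccont f t) ->
  (forall t, Rmin a b <= t <= Rmax a b -> ccont g t) ->
  Cint (fun u => f u + g u)%C a b = (Cint f a b + Cint g a b)%C.
Proof.
  intros Hf Hg. apply ccont_ex_RInt in Hf, Hg. destruct Hf, Hg.
  apply C_ext; [apply (RInt_plus (V := R_CompleteNormedModule) (fun u => Re (f u)) (fun u => Re (g u)))
               |apply (RInt_plus (V := R_CompleteNormedModule) (fun u => Im (f u)) (fun u => Im (g u)))]; assumption.
Qed.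

Lemma Cint_minus f g a b :
  (forall t, Rmin a b <= t <= Rmax a b -> ccont f t) ->
  (forall t, Rmin a b <= t <= Rmax a b -> ccont g t) ->
  Cint (fun u => f u - g u)%C a b = (Cint f a b - Cint g a b)%C.
Proof.
  intros Hf Hg. apply ccont_ex_RInt in Hf, Hg. destruct Hf, Hg.
  apply C_ext; [apply (RInt_minus (V := R_CompleteNormedModule) (fun u => Re (f u)) (fun u => Re (g u)))
               |apply (RInt_minus (V := R_CompleteNormedModule) (fun u => Im (f u)) (fun u => Im (g u)))]; assumption.
Qed.

Lemma Cint_scal c f a b :
  (forall t, Rmin a b <= t <= Rmax a b -> ccont f t) ->
  Cint (fun u => c * f u)%C a b = (c * Cint f a b)%C.
Proof.
  intros Hf. apply ccont_ex_RInt in Hf. destruct Hf as [H1 H2].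
  assert (S1 := fun k => RInt_scal (V := R_CompleteNormedModule) _ a b k H1).
  assert (S2 := fun k => RInt_scal (V := R_CompleteNormedModule) _ a b k H2).
  assert (E1 := fun k => ex_RInt_scal (V := R_CompleteNormedModule) _ a b k H1).
  assert (E2 := fun k => ex_RInt_scal (V := R_CompleteNormedModule) _ a b k H2).
  apply C_ext.
  - assert (M := RInt_minus (V := R_CompleteNormedModule) _ _ a b (E1 (Re c)) (E2 (Im c))).
    rewrite S1, S2 in M. exact M.
  - assert (M := RInt_plus (V := R_CompleteNormedModule) _ _ a b (E2 (Re c)) (E1 (Im c))).
    rewrite S1, S2 in M. exact M.
Qed.

Lemma Cint_ext f g a b : (forall t, Rmin a b < t < Rmax a b -> f t = g t) ->
  Cint f a b = Cint g a b.
Proof.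
  intros H. unfold Cint. f_equal; apply (RInt_ext (V := R_CompleteNormedModule));
    intros t Ht; now rewrite H.
Qed.

Lemma Cint_Chasles f a b c :
  (forall t, Rmin a b <= t <= Rmax a b -> ccont f t) ->
  (forall t, Rmin b c <= t <= Rmax b c -> ccont f t) ->
  (Cint f a b + Cint f b c)%C = Cint f a c.
Proof.
  intros H1 H2. apply ccont_ex_RInt in H1, H2. destruct H1, H2.
  apply C_ext; apply (RInt_Chasles (V := R_CompleteNormedModule)); assumption.
Qed.

Lemma Cint_point f a : Cint f a a = 0%C.
Proof. apply C_ext; apply (RInt_point (V := R_CompleteNormedModule)). Qed.

Lemma Cint_const c a b : Cint (fun _ => c) a b = (RtoC (b - a) * c)%C.
Proof.
  unfold Cint. rewrite !(RInt_const (V := R_CompleteNormedModule)).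
  apply C_ext; unfold scal; simpl; unfold mult; simpl; unfold Re, Im; ring.
Qed.

Lemma Cint_FTC (F f : R -> C) a b :
  (forall t, Rmin a b <= t <= Rmax a b -> rder F t (f t)) ->
  (forall t, Rmin a b <= t <= Rmax a b -> ccont f t) ->
  Cint f a b = (F b - F a)%C.
Proof.
  intros H1 H2. apply C_ext; apply (is_RInt_unique (V := R_CompleteNormedModule)).
  - exact (is_RInt_derive (V := R_CompleteNormedModule) (fun u => Re (F u)) (fun u => Re (f u)) a b (fun t Ht => proj1 (H1 t Ht)) (fun t Ht => proj1 (H2 t Ht))).
  - exact (is_RInt_derive (V := R_CompleteNormedModule) (fun u => Im (F u)) (fun u => Im (f u)) a b (fun t Ht => proj2 (H1 t Ht)) (fun t Ht => proj2 (H2 t Ht))).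
Qed.

(* The modulus is recovered as the real part after multiplying by the conjugate of the integral. *)
Lemma Cint_Cmod_le f (g : R -> R) a b : a <= b ->
  (forall t, a <= t <= b -> ccont f t) -> (forall t, a <= t <= b -> continuous g t) ->
  (forall t, a <= t <= b -> Cmod (f t) <= g t) ->
  Cmod (Cint f a b) <= RInt g a b.
Proof.
  intros Hab Hf Hg Hle.
  assert (Hf' : forall t, Rmin a b <= t <= Rmax a b -> ccont f t)
    by (rewrite Rmin_left, Rmax_right by assumption; assumption).
  assert (Eg : ex_RInt g a b).
  { apply (ex_RInt_continuous (V := R_CompleteNormedModule)).
    rewrite Rmin_left, Rmax_right by assumption; assumption. }
  assert (G0 : 0 <= RInt g a b).
  { apply RInt_ge_0; [assumption|assumption|]. intros t Ht.
    apply Rle_trans with (2 := Hle t ltac:(lra)). apply Cmod_ge_0. }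
  set (I := Cint f a b).
  destruct (Req_dec (Cmod I) 0) as [H0|H0]; [rewrite H0; exact G0|].
  assert (HI : 0 < Cmod I) by (assert (Q := Cmod_ge_0 I); lra).
  assert (H1 := Cint_scal (Cconj I) f a b Hf'). fold I in H1.
  assert (H2 : Re (Cconj I * I)%C = Cmod I ^ 2).
  { rewrite Cmult_comm, <- Cmod2_conj. reflexivity. }
  rewrite <- H1 in H2. simpl in H2.
  assert (H3 : RInt (fun u => Re (Cconj I * f u)%C) a b <= RInt (fun u => Cmod I * g u) a b).
  { apply RInt_le; [assumption| | |].
    - apply (ccont_ex_RInt (fun u => Cconj I * f u)%C).
      intros t Ht. apply ccont_mult; [apply ccont_const|now apply Hf'].
    - now apply (ex_RInt_scal (V := R_CompleteNormedModule)).
    - intros t Ht. eapply Rle_trans; [apply Rle_abs|].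
      eapply Rle_trans; [apply re_le_Cmod|].
      rewrite Cmod_mult, Cmod_conj.
      apply Rmult_le_compat_l; [apply Cmod_ge_0|apply Hle; lra]. }
  assert (H4 : RInt (fun u => Cmod I * g u) a b = Cmod I * RInt g a b)
    by now apply (RInt_scal (V := R_CompleteNormedModule)).
  rewrite H4 in H3. simpl in H3. rewrite H2 in H3.
  apply Rmult_le_reg_l with (Cmod I); [assumption|]. simpl in H3. lra.
Qed.

Lemma Cint_Cmod_le_const f M a b : a <= b ->
  (forall t, a <= t <= b -> ccont f t) ->
  (forall t, a <= t <= b -> Cmod (f t) <= M) ->
  Cmod (Cint f a b) <= (b - a) * M.
Proof.
  intros Hab Hf H.
  assert (K := Cint_Cmod_le f (fun _ => M) a b Hab Hf (fun t _ => continuous_const M t) H).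
  rewrite RInt_const in K. exact K.
Qed.

(** * Second-order estimate of the exponential *)

Lemma rder_ccont f t l : rder f t l -> ccont f t.
Proof.
  intros [H1 H2]; split; apply (ex_derive_continuous (V := R_NormedModule)); eexists; eassumption.
Qed.

Lemma rder_eq f t l l' : l = l' -> rder f t l -> rder f t l'.
Proof. now intros <-. Qed.

Lemma rder_cexp_lin (a w : C) (t : R) :
  rder (fun u => cexp (a + w * RtoC u)) t (w * cexp (a + w * RtoC t))%C.
Proof.
  split; unfold cexp; simpl; auto_derive; trivial; unfold Re, Im; simpl; unfold Rminus; ring.
Qed.

Lemma ccont_cexp_lin (a w : C) (t : R) : ccont (fun u => cexp (a + w * RtoC u)) t.
Proof. exact (rder_ccont _ _ _ (rder_cexp_lin a w t)). Qed.

Lemma ccont_cexp_scal (w : C) (t : R) : ccont (fun u => cexp (w * RtoC u)) t.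
Proof.
  apply ccont_ext with (2 := ccont_cexp_lin 0 w t). intros u. f_equal. ring.
Qed.

(** The entire function (e^w - 1) / w. The integral form needs no case distinction at w = 0 and
    later supplies removable singularities in closed form. *)
Definition cexpint (w : C) : C := Cint (fun t => cexp (w * RtoC t)) 0 1.

Lemma cexpint_spec (w : C) : (w * cexpint w = cexp w - 1)%C.
Proof.
  unfold cexpint. rewrite <- Cint_scal by (intros; apply ccont_cexp_scal).
  rewrite (Cint_FTC (fun t => cexp (0 + w * RtoC t)) _ 0 1).
  - rewrite !Cplus_0_l, Cmult_1_r, Cmult_0_r, cexp_0. reflexivity.
  - intros t _. eapply rder_eq; [|apply rder_cexp_lin]. f_equal; f_equal; ring.
  - intros t _. apply ccont_mult; [apply ccont_const|apply ccont_cexp_scal].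
Qed.

Lemma cexp_m1_le (w : C) : Cmod (cexp w - 1) <= Cmod w * exp (Cmod w).
Proof.
  rewrite <- cexpint_spec, Cmod_mult. apply Rmult_le_compat_l; [apply Cmod_ge_0|].
  unfold cexpint. eapply Rle_trans; [apply (Cint_Cmod_le_const _ (exp (Cmod w)))|lra].
  - lra.
  - intros; apply ccont_cexp_scal.
  - intros t Ht. rewrite Cmod_cexp.
    assert (H : Re (w * RtoC t)%C <= Cmod w).
    { autorewrite with cparts. assert (H1 := re_le_Cmod w).
      assert (H2 := Rle_abs (Re w)). assert (H3 := Rabs_pos (Re w)). nra. }
    now apply exp_le_compat.
Qed.

Lemma cexpint_m1_le (w : C) : Cmod (cexpint w - 1) <= Cmod w * exp (Cmod w).
Proof.
  replace (cexpint w - 1)%C with (Cint (fun t => cexp (w * RtoC t) - 1)%C 0 1).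
  2:{ unfold cexpint. rewrite Cint_minus, Cint_const.
      - f_equal. apply C_ext; simpl; ring.
      - intros; apply ccont_cexp_scal.
      - intros; apply ccont_const. }
  eapply Rle_trans; [apply (Cint_Cmod_le_const _ (Cmod w * exp (Cmod w)))|lra].
  - lra.
  - intros; apply ccont_minus; [apply ccont_cexp_scal|apply ccont_const].
  - intros t Ht. eapply Rle_trans; [apply cexp_m1_le|].
    rewrite Cmod_mult, Cmod_R, Rabs_right by lra.
    assert (H := Cmod_ge_0 w).
    apply Rmult_le_compat; [nra|left; apply exp_pos|nra|].
    apply exp_le_compat. nra.
Qed.

Lemma cexp_m1_lin_le (w : C) : Cmod (cexp w - 1 - w) <= Cmod w ^ 2 * exp (Cmod w).
Proof.
  rewrite <- cexpint_spec. replace (w * cexpint w - w)%C with (w * (cexpint w - 1))%C by ring.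
  rewrite Cmod_mult. assert (H := cexpint_m1_le w). assert (H1 := Cmod_ge_0 w).
  simpl. rewrite Rmult_1_r, Rmult_assoc. now apply Rmult_le_compat_l.
Qed.

(** Gives the derivative 1/2 of [cexpint] at 0, the one point where the quotient rule does not
    apply. *)
Lemma cexpint_m1_lin_le (w : C) :
  Cmod (cexpint w - 1 - w / 2) <= Cmod w ^ 2 * exp (Cmod w).
Proof.
  replace (cexpint w - 1 - w / 2)%C
    with (Cint (fun t => cexp (w * RtoC t) - 1 - w * RtoC t)%C 0 1).
  2:{ unfold cexpint.
      assert (Hc : forall t, ccont (fun t => w * RtoC t)%C t).
      { intros. apply ccont_mult; [apply ccont_const|apply ccont_RtoC, continuous_id]. }
      rewrite !Cint_minus, Cint_const.
      - f_equal; [f_equal; apply C_ext; simpl; ring|].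
        rewrite (Cint_FTC (fun t => w * RtoC (t ^ 2) / 2)%C _ 0 1).
        + rewrite !RtoC_pow. field.
        + intros t _. split; simpl; auto_derive; trivial; field.
        + intros; apply Hc.
      - intros; apply ccont_cexp_scal.
      - intros; apply ccont_const.
      - intros; apply ccont_minus; [apply ccont_cexp_scal|apply ccont_const].
      - intros; apply Hc. }
  eapply Rle_trans; [apply (Cint_Cmod_le_const _ (Cmod w ^ 2 * exp (Cmod w)))|lra].
  - lra.
  - intros; apply ccont_minus; [apply ccont_minus; [apply ccont_cexp_scal|apply ccont_const]|].
    apply ccont_mult; [apply ccont_const|apply ccont_RtoC, continuous_id].
  - intros t Ht. eapply Rle_trans; [apply cexp_m1_lin_le|].
    rewrite Cmod_mult, Cmod_R, Rabs_right by lra.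
    assert (H := Cmod_ge_0 w).
    apply Rmult_le_compat; [apply pow2_ge_0|left; apply exp_pos| |apply exp_le_compat; nra].
    rewrite Rpow_mult_distr. assert (0 <= Cmod w ^ 2) by apply pow2_ge_0. assert (t ^ 2 <= 1) by nra. nra.
Qed.

(** * Complex differentiability *)

Definition cder (f : C -> C) (z l : C) : Prop := @is_derive C_AbsRing C_NormedModule f z l.

Lemma cder_eps (f : C -> C) (z l : C) :
  cder f z l <->
  forall eps, 0 < eps -> exists del, 0 < del /\
    forall w, Cmod (w - z) < del -> Cmod (f w - f z - l * (w - z)) <= eps * Cmod (w - z).
Proof.
  split.
  - intros [_ H] eps He.
    destruct (H z (fun P HP => HP) (mkposreal eps He)) as [d Hd].
    exists d; split; [apply cond_pos|]. intros w Hw.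
    specialize (Hd w Hw). change (Cmod (f w - f z - (w - z) * l)%C <= eps * Cmod (w - z)%C) in Hd.
    now rewrite (Cmult_comm l).
  - intros H. split.
    + apply (is_linear_scal_l (K := C_AbsRing) (V := C_NormedModule)).
    + intros y Hy eps.
      assert (E : y = z).
      { symmetry. apply (is_filter_lim_locally_unique (K := C_AbsRing) (V := AbsRing_NormedModule C_AbsRing)). exact Hy. }
      subst y. destruct (H eps (cond_pos eps)) as [d [Hd Hu]].
      exists (mkposreal d Hd). intros w Hw.
      change (Cmod (f w - f z - (w - z) * l)%C <= eps * Cmod (w - z)%C).
      rewrite (Cmult_comm _ l). apply Hu. exact Hw.
Qed.

Lemma cder_eq f z l l' : l = l' -> cder f z l -> cder f z l'.
Proof. now intros <-. Qed.

Lemma cder_const (c z : C) : cder (fun _ => c) z 0.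
Proof. exact (is_derive_const (K := C_AbsRing) (V := C_NormedModule) c z). Qed.

Lemma cder_id (z : C) : cder (fun w => w) z 1.
Proof.
  apply cder_eps. intros eps He. exists 1; split; [lra|]. intros w _.
  replace (w - z - 1 * (w - z))%C with (RtoC 0) by ring. rewrite Cmod_0.
  apply Rmult_le_pos; [lra|apply Cmod_ge_0].
Qed.

Lemma cder_plus f g z l m : cder f z l -> cder g z m -> cder (fun w => f w + g w)%C z (l + m)%C.
Proof. exact (is_derive_plus (K := C_AbsRing) (V := C_NormedModule) f g z l m). Qed.

Lemma cder_opp f z l : cder f z l -> cder (fun w => - f w)%C z (- l)%C.
Proof. exact (is_derive_opp (K := C_AbsRing) (V := C_NormedModule) f z l). Qed.

Lemma cder_minus f g z l m : cder f z l -> cder g z m -> cder (fun w => f w - g w)%C z (l - m)%C.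
Proof. exact (is_derive_minus (K := C_AbsRing) (V := C_NormedModule) f g z l m). Qed.

Lemma cder_cont f z l : cder f z l ->
  forall eps, 0 < eps -> exists del, 0 < del /\
    forall w, Cmod (w - z) < del -> Cmod (f w - f z) < eps.
Proof.
  intros H eps He. rewrite cder_eps in H. destruct (H 1 Rlt_0_1) as [d [Hd Hu]].
  assert (HL : 0 < 1 + Cmod l) by (generalize (Cmod_ge_0 l); lra).
  exists (Rmin d (eps / (1 + Cmod l))). split.
  - apply Rmin_pos; [assumption|]. now apply Rdiv_lt_0_compat.
  - intros w Hw.
    assert (H1 := Rlt_le_trans _ _ _ Hw (Rmin_l _ _)).
    assert (H2 := Rlt_le_trans _ _ _ Hw (Rmin_r _ _)).
    specialize (Hu w H1).
    replace (f w - f z)%C with ((f w - f z - l * (w - z)) + l * (w - z))%C by ring.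
    eapply Rle_lt_trans; [apply Cmod_triangle|]. rewrite Cmod_mult.
    apply Rle_lt_trans with ((1 + Cmod l) * Cmod (w - z)%C); [lra|].
    apply Rmult_lt_compat_l with (r := 1 + Cmod l) in H2; [|assumption].
    replace ((1 + Cmod l) * (eps / (1 + Cmod l))) with eps in H2 by (field; lra). exact H2.
Qed.

Lemma cder_comp f g z l m : cder f (g z) l -> cder g z m ->
  cder (fun w => f (g w)) z (l * m)%C.
Proof.
  intros Hf Hg. assert (Hc := cder_cont _ _ _ Hg). rewrite cder_eps in Hf, Hg. apply cder_eps.
  intros eps He.
  set (K := 1 + Cmod m). assert (HK : 0 < K) by (unfold K; generalize (Cmod_ge_0 m); lra).
  set (L := 1 + Cmod l). assert (HL : 0 < L) by (unfold L; generalize (Cmod_ge_0 l); lra).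
  destruct (Hf (eps / 2 / K) ltac:(apply Rdiv_lt_0_compat; lra)) as [d1 [Hd1 H1]].
  destruct (Hg (Rmin 1 (eps / 2 / L))
    ltac:(apply Rmin_pos; [lra|apply Rdiv_lt_0_compat; lra])) as [d2 [Hd2 H2]].
  destruct (Hc d1 Hd1) as [d3 [Hd3 H3]].
  exists (Rmin d2 d3); split; [now apply Rmin_pos|]. intros w Hw.
  specialize (H3 w (Rlt_le_trans _ _ _ Hw (Rmin_r _ _))).
  specialize (H1 _ H3).
  specialize (H2 w (Rlt_le_trans _ _ _ Hw (Rmin_l _ _))).
  assert (Hm0 := Cmod_ge_0 (w - z)%C).
  assert (G1 : Cmod (g w - g z - m * (w - z))%C <= Cmod (w - z)%C).
  { eapply Rle_trans; [exact H2|]. rewrite <- (Rmult_1_l (Cmod (w - z)%C)) at 2.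
    apply Rmult_le_compat_r; [assumption|apply Rmin_l]. }
  assert (G2 : Cmod (g w - g z - m * (w - z))%C <= eps / 2 / L * Cmod (w - z)%C).
  { eapply Rle_trans; [exact H2|]. apply Rmult_le_compat_r; [assumption|apply Rmin_r]. }
  assert (G3 : Cmod (g w - g z)%C <= K * Cmod (w - z)%C).
  { replace (g w - g z)%C with ((g w - g z - m * (w - z)) + m * (w - z))%C by ring.
    eapply Rle_trans; [apply Cmod_triangle|]. rewrite Cmod_mult. unfold K. lra. }
  replace (f (g w) - f (g z) - l * m * (w - z))%C
    with ((f (g w) - f (g z) - l * (g w - g z)) + l * (g w - g z - m * (w - z)))%C by ring.
  eapply Rle_trans; [apply Cmod_triangle|]. rewrite Cmod_mult.
  assert (E1 : Cmod (f (g w) - f (g z) - l * (g w - g z))%C <= eps / 2 * Cmod (w - z)%C).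
  { eapply Rle_trans; [exact H1|].
    apply Rle_trans with (eps / 2 / K * (K * Cmod (w - z)%C)).
    - apply Rmult_le_compat_l; [|assumption].
      apply Rlt_le, Rdiv_lt_0_compat; lra.
    - right. field. lra. }
  assert (E2 : Cmod l * Cmod (g w - g z - m * (w - z))%C <= eps / 2 * Cmod (w - z)%C).
  { apply Rle_trans with (L * (eps / 2 / L * Cmod (w - z)%C)).
    - apply Rmult_le_compat; [apply Cmod_ge_0|apply Cmod_ge_0|unfold L; lra|assumption].
    - right. field. lra. }
  lra.
Qed.

Lemma cder_mult f g z l m : cder f z l -> cder g z m ->
  cder (fun w => f w * g w)%C z (l * g z + f z * m)%C.
Proof.
  intros Hf Hg. assert (Hc := cder_cont _ _ _ Hg). rewrite cder_eps in Hf, Hg. apply cder_eps.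
  intros eps He.
  set (G := 1 + Cmod (g z)). assert (HG : 0 < G) by (unfold G; generalize (Cmod_ge_0 (g z)); lra).
  set (F := 1 + Cmod (f z)). assert (HF : 0 < F) by (unfold F; generalize (Cmod_ge_0 (f z)); lra).
  set (L := 1 + Cmod l). assert (HL : 0 < L) by (unfold L; generalize (Cmod_ge_0 l); lra).
  destruct (Hf (eps / 3 / G) ltac:(apply Rdiv_lt_0_compat; lra)) as [d1 [Hd1 H1]].
  destruct (Hg (eps / 3 / F) ltac:(apply Rdiv_lt_0_compat; lra)) as [d2 [Hd2 H2]].
  destruct (Hc (Rmin 1 (eps / 3 / L)) ltac:(apply Rmin_pos; [lra|apply Rdiv_lt_0_compat; lra]))
    as [d3 [Hd3 H3]].
  exists (Rmin d1 (Rmin d2 d3)); split; [repeat apply Rmin_pos; assumption|]. intros w Hw.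
  assert (W1 := Rlt_le_trans _ _ _ Hw (Rmin_l _ _)).
  assert (W2 := Rlt_le_trans _ _ _ (Rlt_le_trans _ _ _ Hw (Rmin_r _ _)) (Rmin_l _ _)).
  assert (W3 := Rlt_le_trans _ _ _ (Rlt_le_trans _ _ _ Hw (Rmin_r _ _)) (Rmin_r _ _)).
  specialize (H1 w W1). specialize (H2 w W2). specialize (H3 w W3).
  assert (Hm0 := Cmod_ge_0 (w - z)%C).
  assert (H3a := Rlt_le_trans _ _ _ H3 (Rmin_l _ _)).
  assert (H3b := Rlt_le_trans _ _ _ H3 (Rmin_r _ _)).
  assert (Gw : Cmod (g w) <= G).
  { assert (H := Cmod_triangle_inv (g w) (g z)). unfold G. lra. }
  replace (f w * g w - f z * g z - (l * g z + f z * m) * (w - z))%C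
    with ((f w - f z - l * (w - z)) * g w + f z * (g w - g z - m * (w - z))
          + l * (w - z) * (g w - g z))%C by ring.
  eapply Rle_trans; [apply Cmod_triangle|].
  eapply Rle_trans; [apply Rplus_le_compat_r, Cmod_triangle|].
  rewrite !Cmod_mult.
  assert (E1 : Cmod (f w - f z - l * (w - z)) * Cmod (g w) <= eps / 3 * Cmod (w - z)).
  { apply Rle_trans with ((eps / 3 / G * Cmod (w - z)%C) * G).
    - apply Rmult_le_compat; try apply Cmod_ge_0; assumption.
    - right; field; lra. }
  assert (E2 : Cmod (f z) * Cmod (g w - g z - m * (w - z)) <= eps / 3 * Cmod (w - z)).
  { apply Rle_trans with (F * (eps / 3 / F * Cmod (w - z)%C)).
    - apply Rmult_le_compat; try apply Cmod_ge_0; [unfold F; lra|assumption].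
    - right; field; lra. }
  assert (E3 : Cmod l * Cmod (w - z) * Cmod (g w - g z) <= eps / 3 * Cmod (w - z)).
  { apply Rle_trans with (L * Cmod (w - z) * (eps / 3 / L)).
    - apply Rmult_le_compat; try apply Cmod_ge_0; [| |lra].
      + apply Rmult_le_pos; apply Cmod_ge_0.
      + apply Rmult_le_compat_r; [assumption|unfold L; lra].
    - right; field; lra. }
  lra.
Qed.

Lemma cder_ext_loc f g z l :
  (exists del, 0 < del /\ forall w, Cmod (w - z) < del -> f w = g w) ->
  cder f z l -> cder g z l.
Proof.
  intros [d [Hd He]] H. rewrite cder_eps in H |- *. intros eps Hp.
  destruct (H eps Hp) as [d1 [Hd1 H1]].
  exists (Rmin d d1); split; [now apply Rmin_pos|]. intros w Hw.
  rewrite <- !He.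
  - apply H1. eapply Rlt_le_trans; [exact Hw|apply Rmin_r].
  - replace (z - z)%C with (RtoC 0) by ring. now rewrite Cmod_0.
  - eapply Rlt_le_trans; [exact Hw|apply Rmin_l].
Qed.

Lemma cder_ext f g z l : (forall w, f w = g w) -> cder f z l -> cder g z l.
Proof. intros H. apply cder_ext_loc. exists 1; split; [lra|auto]. Qed.

Lemma cder_inv_id (z : C) : z <> 0%C -> cder (fun w => / w)%C z (- / (z * z))%C.
Proof.
  intros Hz. apply cder_eps. intros eps He.
  assert (Hm : 0 < Cmod z) by now apply Cmod_gt_0.
  assert (Hz3 : 0 < Cmod z ^ 3) by now apply pow_lt.
  (* The error is (w - z)^2 / (w z^2). The first bound keeps |w| above |z| / 2, the second makes |w
     - z| at most eps |w| |z|^2. *)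
  exists (Rmin (Cmod z / 2) (eps * Cmod z ^ 3 / 2)). split.
  { apply Rmin_pos; [lra|]. apply Rdiv_lt_0_compat; [|lra]. now apply Rmult_lt_0_compat. }
  intros w Hw.
  assert (W1 := Rlt_le_trans _ _ _ Hw (Rmin_l _ _)).
  assert (W2 := Rlt_le_trans _ _ _ Hw (Rmin_r _ _)).
  assert (Hw1 : Cmod z / 2 < Cmod w).
  { assert (H := Cmod_triangle_inv z w). rewrite Cmod_minus_sym in H. lra. }
  assert (Hw0 : w <> 0%C) by (apply Cmod_gt_0; lra).
  replace (/ w - / z - - / (z * z) * (w - z))%C with ((w - z) * ((w - z) / (w * (z * z))))%C
    by (field; auto).
  rewrite Cmod_mult, Rmult_comm. apply Rmult_le_compat_r; [apply Cmod_ge_0|].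
  rewrite Cmod_div by (repeat apply Cmult_neq_0; assumption).
  rewrite !Cmod_mult.
  apply Rmult_le_reg_r with (Cmod w * (Cmod z * Cmod z)).
  { repeat apply Rmult_lt_0_compat; lra. }
  unfold Rdiv. rewrite Rmult_assoc, Rinv_l, Rmult_1_r.
  2:{ apply Rgt_not_eq. repeat apply Rmult_lt_0_compat; lra. }
  apply Rle_trans with (eps * (Cmod z / 2 * (Cmod z * Cmod z))); [simpl in W2; lra|].
  apply Rmult_le_compat_l; [lra|]. apply Rmult_le_compat_r; [nra|lra].
Qed.

Lemma cder_inv (f : C -> C) (z l : C) : f z <> 0%C -> cder f z l ->
  cder (fun w => / f w)%C z (- / (f z * f z) * l)%C.
Proof. intros H Hf. exact (cder_comp (fun w => / w)%C f z _ _ (cder_inv_id _ H) Hf). Qed.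

Lemma cder_cexp (z : C) : cder cexp z (cexp z).
Proof.
  apply cder_eps. intros eps He.
  set (K := Cmod (cexp z) * exp 1).
  assert (HK : 0 < K).
  { unfold K. rewrite Cmod_cexp. apply Rmult_lt_0_compat; apply exp_pos. }
  exists (Rmin 1 (eps / K)). split; [apply Rmin_pos; [lra|now apply Rdiv_lt_0_compat]|].
  intros w Hw.
  assert (W1 := Rlt_le_trans _ _ _ Hw (Rmin_l _ _)).
  assert (W2 := Rlt_le_trans _ _ _ Hw (Rmin_r _ _)).
  replace (cexp w) with (cexp z * cexp (w - z))%C by (rewrite <- cexp_plus; f_equal; ring).
  replace (cexp z * cexp (w - z) - cexp z - cexp z * (w - z))%C
    with (cexp z * (cexp (w - z) - 1 - (w - z)))%C by ring.
  rewrite Cmod_mult.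
  assert (H := cexp_m1_lin_le (w - z)). assert (H0 := Cmod_ge_0 (w - z)%C).
  apply Rle_trans with (Cmod (cexp z) * (Cmod (w - z) ^ 2 * exp 1)).
  - apply Rmult_le_compat_l; [apply Cmod_ge_0|]. eapply Rle_trans; [exact H|].
    apply Rmult_le_compat_l; [apply pow2_ge_0|]. apply exp_le_compat. lra.
  - replace (Cmod (cexp z) * (Cmod (w - z) ^ 2 * exp 1))
      with (K * Cmod (w - z) * Cmod (w - z)) by (unfold K; ring).
    apply Rmult_le_compat_r; [assumption|].
    apply Rmult_lt_compat_l with (r := K) in W2; [|assumption].
    replace (K * (eps / K)) with eps in W2 by (field; lra). lra.
Qed.

Lemma cder_cexp_comp f z l : cder f z l -> cder (fun w => cexp (f w)) z (cexp (f z) * l)%C.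
Proof. intros H. exact (cder_comp cexp f z _ _ (cder_cexp _) H). Qed.

(** * Goursat's theorem on rectangles *)

(** The contour integral of [h] along the boundary of [a, b] x [c, d], counterclockwise. *)
Definition rect_int (h : C -> C) (a b c d : R) : C :=
  (Cint (fun x => h (x, c)) a b - Cint (fun x => h (x, d)) a b
   + Ci * (Cint (fun y => h (b, y)) c d - Cint (fun y => h (a, y)) c d))%C.

Lemma Cmod_horiz (x x' y : R) : Cmod ((x, y) - (x', y))%C = Rabs (x - x').
Proof.
  replace ((x, y) - (x', y))%C with (RtoC (x - x')) by (apply C_ext; simpl; ring).
  apply Cmod_R.
Qed.

Lemma Cmod_vert (x y y' : R) : Cmod ((x, y) - (x, y'))%C = Rabs (y - y').
Proof.
  replace ((x, y) - (x, y'))%C with (Ci * RtoC (y - y'))%C by (apply C_ext; simpl; ring).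
  rewrite Cmod_mult, Cmod_Ci, Cmod_R. ring.
Qed.

Lemma cder_ccont_horiz h x y l : cder h (x, y) l -> ccont (fun u => h (u, y)) x.
Proof.
  intros H. apply ccont_eps. intros eps He. destruct (cder_cont _ _ _ H eps He) as [d [Hd Hu]].
  exists d; split; [assumption|]. intros u Hb. apply Hu. now rewrite Cmod_horiz.
Qed.

Lemma cder_ccont_vert h x y l : cder h (x, y) l -> ccont (fun u => h (x, u)) y.
Proof.
  intros H. apply ccont_eps. intros eps He. destruct (cder_cont _ _ _ H eps He) as [d [Hd Hu]].
  exists d; split; [assumption|]. intros u Hb. apply Hu. now rewrite Cmod_vert.
Qed.

Definition holo_rect (h : C -> C) (a b c d : R) : Prop :=
  forall x y, a <= x <= b -> c <= y <= d -> exists l, cder h (x, y) l.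

Lemma holo_rect_sub h a b c d a' b' c' d' :
  holo_rect h a b c d -> a <= a' -> b' <= b -> c <= c' -> d' <= d -> holo_rect h a' b' c' d'.
Proof. intros H ? ? ? ? x y Hx Hy. apply H; lra. Qed.

Lemma holo_rect_horiz h a b c d y : a <= b -> holo_rect h a b c d -> c <= y <= d ->
  forall x, Rmin a b <= x <= Rmax a b -> ccont (fun u => h (u, y)) x.
Proof.
  intros Hab H Hy x Hx. rewrite Rmin_left, Rmax_right in Hx by assumption.
  destruct (H x y Hx Hy) as [l Hl]. now apply cder_ccont_horiz with l.
Qed.

Lemma holo_rect_vert h a b c d x : c <= d -> holo_rect h a b c d -> a <= x <= b ->
  forall y, Rmin c d <= y <= Rmax c d -> ccont (fun u => h (x, u)) y.
Proof.
  intros Hcd H Hx y Hy. rewrite Rmin_left, Rmax_right in Hy by assumption.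
  destruct (H x y Hx Hy) as [l Hl]. now apply cder_ccont_vert with l.
Qed.

Lemma rect_int_split_x h a m b c d : a <= m <= b -> c <= d -> holo_rect h a b c d ->
  rect_int h a b c d = (rect_int h a m c d + rect_int h m b c d)%C.
Proof.
  intros Hm Hcd H. unfold rect_int.
  assert (H1 : holo_rect h a m c d) by (apply (holo_rect_sub _ _ _ _ _ _ _ _ _ H); lra).
  assert (H2 : holo_rect h m b c d) by (apply (holo_rect_sub _ _ _ _ _ _ _ _ _ H); lra).
  rewrite <- (Cint_Chasles (fun x => h (x, c)) a m b),
          <- (Cint_Chasles (fun x => h (x, d)) a m b); [ring| | | |];
    eapply holo_rect_horiz; try eassumption; lra.
Qed.

Lemma rect_int_split_y h a b c m d : a <= b -> c <= m <= d -> holo_rect h a b c d ->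
  rect_int h a b c d = (rect_int h a b c m + rect_int h a b m d)%C.
Proof.
  intros Hab Hm H. unfold rect_int.
  assert (H1 : holo_rect h a b c m) by (apply (holo_rect_sub _ _ _ _ _ _ _ _ _ H); lra).
  assert (H2 : holo_rect h a b m d) by (apply (holo_rect_sub _ _ _ _ _ _ _ _ _ H); lra).
  rewrite <- (Cint_Chasles (fun y => h (b, y)) c m d),
          <- (Cint_Chasles (fun y => h (a, y)) c m d); [ring| | | |];
    eapply holo_rect_vert; try eassumption; lra.
Qed.

(** An affine function has an explicit primitive, so each side contributes a difference of its
    values at two corners and the four differences cancel. This removes the linear part of [h] in
    Goursat's argument. *)
Lemma rect_int_affine (al be z0 : C) a b c d :
  rect_int (fun z => al + be * (z - z0))%C a b c d = 0%C.
Proof.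
  set (F := fun z => (al * z + be * ((z - z0) * (z - z0)) / 2)%C).
  assert (Hh : forall y, Cint (fun x => al + be * ((x, y) - z0))%C a b = (F (b, y) - F (a, y))%C).
  { intros y. apply (Cint_FTC (fun x => F (x, y))).
    - intros t _. split; unfold F; simpl; auto_derive; trivial; simpl; field.
    - intros t _. split; apply (ex_derive_continuous (V := R_NormedModule)); simpl; auto_derive; trivial. }
  assert (Hv : forall x, Cint (fun y => Ci * (al + be * ((x, y) - z0)))%C c d = (F (x, d) - F (x, c))%C).
  { intros x. apply (Cint_FTC (fun y => F (x, y))).
    - intros t _. split; unfold F; simpl; auto_derive; trivial; simpl; field.
    - intros t _. split; apply (ex_derive_continuous (V := R_NormedModule)); simpl; auto_derive; trivial. }
  assert (Hv' : forall x, (Ci * Cint (fun y => al + be * ((x, y) - z0)) c d = F (x, d) - F (x, c))%C).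
  { intros x. rewrite <- Hv, Cint_scal; [reflexivity|].
    intros t _. split; apply (ex_derive_continuous (V := R_NormedModule)); simpl; auto_derive; trivial. }
  unfold rect_int. rewrite !Hh.
  replace (Ci * (Cint (fun y => al + be * ((b, y) - z0)) c d - Cint (fun y => al + be * ((a, y) - z0)) c d))%C
    with ((F (b, d) - F (b, c)) - (F (a, d) - F (a, c)))%C by (rewrite <- !Hv'; ring).
  ring.
Qed.

(** Subtracting the affine approximation does not change the integral. The remainder is at most
    [eps] times the half perimeter D on the boundary, whose length is 2 D, whence the bound 2 eps
    D^2. *)
Lemma rect_int_small h z0 l eps a b c d : a <= b -> c <= d ->
  holo_rect h a b c d -> a <= Re z0 <= b -> c <= Im z0 <= d ->
  0 <= eps ->
  (forall x y, a <= x <= b -> c <= y <= d ->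
     Cmod (h (x, y) - h z0 - l * ((x, y) - z0)) <= eps * Cmod ((x, y) - z0)) ->
  Cmod (rect_int h a b c d) <= 2 * eps * ((b - a) + (d - c)) ^ 2.
Proof.
  intros Hab Hcd H Hz1 Hz2 He Hs.
  set (A := fun z => (h z0 + l * (z - z0))%C).
  set (r := fun z => (h z - A z)%C).
  assert (HA : forall z, cder A z l).
  { intros z. eapply cder_eq; [|apply cder_plus; [apply cder_const|]].
    2:{ apply cder_mult; [apply cder_const|]. apply cder_minus; [apply cder_id|apply cder_const]. }
    simpl. ring. }
  assert (HAr : holo_rect A a b c d) by (intros x y _ _; exists l; apply HA).
  assert (Hr : holo_rect r a b c d).
  { intros x y Hx Hy. destruct (H x y Hx Hy) as [m Hm]. exists (m - l)%C.
    now apply cder_minus. }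
  assert (E : rect_int h a b c d = rect_int r a b c d).
  { replace (rect_int h a b c d) with (rect_int h a b c d - rect_int A a b c d)%C
      by (unfold A; rewrite rect_int_affine; ring).
    unfold rect_int, r.
    rewrite (Cint_minus (fun x => h (x, c)) (fun x => A (x, c))),
            (Cint_minus (fun x => h (x, d)) (fun x => A (x, d))),
            (Cint_minus (fun y => h (a, y)) (fun y => A (a, y))),
            (Cint_minus (fun y => h (b, y)) (fun y => A (b, y))).
    1: ring.
    all: match goal with
      | |- forall t, _ -> ccont (fun u => ?k (u, _)) _ => eapply (holo_rect_horiz k a b c d)
      | |- forall t, _ -> ccont (fun u => ?k (_, u)) _ => eapply (holo_rect_vert k a b c d)
      end; solve [eassumption | lra]. }
  rewrite E.
  set (D := (b - a) + (d - c)). assert (HD : 0 <= D) by (unfold D; lra).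
  assert (Bd : forall x y, a <= x <= b -> c <= y <= d -> Cmod (r (x, y)) <= eps * D).
  { intros x y Hx Hy. unfold r, A.
    replace (h (x, y) - (h z0 + l * ((x, y) - z0)))%C
      with (h (x, y) - h z0 - l * ((x, y) - z0))%C by ring.
    eapply Rle_trans; [apply Hs; assumption|]. apply Rmult_le_compat_l; [assumption|].
    eapply Rle_trans; [apply Cmod_le_parts|]. rewrite Re_minus, Im_minus. simpl.
    assert (Rabs (x - Re z0) <= b - a) by (apply Rabs_le; lra).
    assert (Rabs (y - Im z0) <= d - c) by (apply Rabs_le; lra). unfold D. lra. }
  assert (B1 : forall y, c <= y <= d -> Cmod (Cint (fun x => r (x, y)) a b) <= (b - a) * (eps * D)).
  { intros y Hy. apply Cint_Cmod_le_const; [assumption| |intros; now apply Bd].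
    intros t Ht. destruct (Hr t y Ht Hy) as [m Hm]. now apply cder_ccont_horiz with m. }
  assert (B2 : forall x, a <= x <= b -> Cmod (Cint (fun y => r (x, y)) c d) <= (d - c) * (eps * D)).
  { intros x Hx. apply Cint_Cmod_le_const; [assumption| |intros; now apply Bd].
    intros t Ht. destruct (Hr x t Hx Ht) as [m Hm]. now apply cder_ccont_vert with m. }
  unfold rect_int.
  eapply Rle_trans; [apply Cmod_triangle|]. rewrite Cmod_mult, Cmod_Ci, Rmult_1_l.
  assert (T1 := Cmod_triangle_minus (Cint (fun x => r (x, c)) a b) (Cint (fun x => r (x, d)) a b)).
  assert (T2 := Cmod_triangle_minus (Cint (fun y => r (b, y)) c d) (Cint (fun y => r (a, y)) c d)).
  assert (Q1 := B1 c ltac:(lra)). assert (Q2 := B1 d ltac:(lra)).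
  assert (Q3 := B2 a ltac:(lra)). assert (Q4 := B2 b ltac:(lra)).
  replace (2 * eps * D ^ 2) with (2 * ((b - a) * (eps * D)) + 2 * ((d - c) * (eps * D)))
    by (unfold D; ring).
  lra.
Qed.

Lemma nested_intervals (a b : nat -> R) :
  (forall n, a n <= a (S n)) -> (forall n, b (S n) <= b n) -> (forall n, a n <= b n) ->
  exists x, forall n, a n <= x <= b n.
Proof.
  intros Ha Hb Hab.
  assert (Ma : forall n k, a n <= a (n + k)%nat).
  { intros n k. induction k as [|k IH]; [rewrite Nat.add_0_r; lra|].
    rewrite Nat.add_succ_r. eapply Rle_trans; [exact IH|apply Ha]. }
  assert (Mb : forall n k, b (n + k)%nat <= b n).
  { intros n k. induction k as [|k IH]; [rewrite Nat.add_0_r; lra|].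
    rewrite Nat.add_succ_r. eapply Rle_trans; [apply Hb|exact IH]. }
  assert (M : forall m n, a m <= b n).
  { intros m n. eapply Rle_trans; [apply (Ma m n)|]. eapply Rle_trans; [apply Hab|].
    rewrite Nat.add_comm. apply Mb. }
  destruct (completeness (fun y => exists n, y = a n)) as [x [Hx1 Hx2]].
  - exists (b 0%nat). intros y [n ->]. apply M.
  - now exists (a 0%nat), 0%nat.
  - exists x. intros n. split; [apply Hx1; now exists n|].
    apply Hx2. intros y [m ->]. apply M.
Qed.

(** The four quarter rectangles add up to the whole, so they cannot all have less than a quarter of
    its modulus. *)
Lemma rect_int_quarter h p q a c : 0 <= p -> 0 <= q ->
  holo_rect h a (a + p) c (c + q) ->
  exists a' c', a <= a' /\ a' + p / 2 <= a + p /\ c <= c' /\ c' + q / 2 <= c + q /\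
    Cmod (rect_int h a (a + p) c (c + q)) <= 4 * Cmod (rect_int h a' (a' + p / 2) c' (c' + q / 2)).
Proof.
  intros Hp Hq H.
  rewrite (rect_int_split_x h a (a + p / 2) (a + p) c (c + q)) by (try assumption; lra).
  rewrite (rect_int_split_y h a (a + p / 2) c (c + q / 2) (c + q))
    by (try (apply (holo_rect_sub _ _ _ _ _ _ _ _ _ H)); lra).
  rewrite (rect_int_split_y h (a + p / 2) (a + p) c (c + q / 2) (c + q))
    by (try (apply (holo_rect_sub _ _ _ _ _ _ _ _ _ H)); lra).
  assert (T : forall z1 z2 z3 z4 : C, Cmod (z1 + z2 + (z3 + z4)) <=
             Cmod z1 + Cmod z2 + (Cmod z3 + Cmod z4)).
  { intros. eapply Rle_trans; [apply Cmod_triangle|].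
    apply Rplus_le_compat; apply Cmod_triangle. }
  match goal with |- context [Cmod (?x1 + ?x2 + (?x3 + ?x4))] => specialize (T x1 x2 x3 x4) end.
  apply NNPP. intro N.
  assert (Q : forall a' c', (a' = a \/ a' = a + p / 2) -> (c' = c \/ c' = c + q / 2) ->
    4 * Cmod (rect_int h a' (a' + p / 2) c' (c' + q / 2)) <
    Cmod (rect_int h a (a + p / 2) c (c + q / 2) + rect_int h a (a + p / 2) (c + q / 2) (c + q) +
     (rect_int h (a + p / 2) (a + p) c (c + q / 2) + rect_int h (a + p / 2) (a + p) (c + q / 2) (c + q)))).
  { intros a' c' Ha Hc. apply Rnot_le_lt. intro L. apply N. exists a', c'.
    destruct Ha, Hc; repeat split; try assumption; lra. }
  assert (Q1 := Q a c (or_introl eq_refl) (or_introl eq_refl)).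
  assert (Q2 := Q a _ (or_introl eq_refl) (or_intror eq_refl)).
  assert (Q3 := Q _ c (or_intror eq_refl) (or_introl eq_refl)).
  assert (Q4 := Q _ _ (or_intror eq_refl) (or_intror eq_refl)).
  replace (a + p / 2 + p / 2) with (a + p) in * by field.
  replace (c + q / 2 + q / 2) with (c + q) in * by field.
  lra.
Qed.

(** Repeated quartering loses a factor 4 per step, and the half perimeter is halved. At the limit
    point differentiability bounds the integral by an arbitrarily small multiple of the squared half
    perimeter, so the factor 4^n is compensated exactly. *)
Theorem goursat_rect h a b c d : a <= b -> c <= d -> holo_rect h a b c d ->
  rect_int h a b c d = 0%C.
Proof.
  intros Hab Hcd H.
  set (p := b - a). set (q := d - c).
  set (P := fun n (s : R * R) => a <= fst s /\ fst s + p / 2 ^ n <= b /\ c <= snd s /\ snd s + q / 2 ^ n <= d).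
  set (G := fun n (s : R * R) => Cmod (rect_int h (fst s) (fst s + p / 2 ^ n) (snd s) (snd s + q / 2 ^ n))).
  assert (Hp : forall n, 0 <= p / 2 ^ n).
  { intros n. apply Rmult_le_pos; [unfold p; lra|]. left; apply Rinv_0_lt_compat, pow_lt; lra. }
  assert (Hq : forall n, 0 <= q / 2 ^ n).
  { intros n. apply Rmult_le_pos; [unfold q; lra|]. left; apply Rinv_0_lt_compat, pow_lt; lra. }
  assert (half : forall r n, r / 2 ^ n / 2 = r / 2 ^ S n).
  { intros r n. simpl. field. apply pow_nonzero; lra. }
  (* The existence statement is turned into a function, so that the recursion [sq] can carry the
     invariant [P] along with the corner. *)
  assert (step : forall n s, P n s -> { s' | P (S n) s' /\ fst s <= fst s' /\
     fst s' + p / 2 ^ S n <= fst s + p / 2 ^ n /\ snd s <= snd s' /\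
     snd s' + q / 2 ^ S n <= snd s + q / 2 ^ n /\ G n s <= 4 * G (S n) s' }).
  { intros n [x y] (P1 & P2 & P3 & P4). apply constructive_indefinite_description.
    simpl in P1, P2, P3, P4.
    destruct (rect_int_quarter h (p / 2 ^ n) (q / 2 ^ n) x y (Hp n) (Hq n)) as (x' & y' & Q).
    { apply (holo_rect_sub _ _ _ _ _ _ _ _ _ H); assumption. }
    rewrite !half in Q. exists (x', y'). unfold P, G. simpl fst; simpl snd.
    destruct Q as (? & ? & ? & ? & ?). repeat split; try assumption; lra. }
  assert (P0 : P 0%nat (a, c)).
  { unfold P, p, q; simpl. rewrite !Rdiv_1_r. repeat split; lra. }
  set (sq := fix sq n : { s | P n s } :=
    match n with
    | O => exist _ (a, c) P0
    | S m => exist _ (proj1_sig (step m (proj1_sig (sq m)) (proj2_sig (sq m))))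
               (proj1 (proj2_sig (step m (proj1_sig (sq m)) (proj2_sig (sq m)))))
    end).
  set (s := fun n => proj1_sig (sq n)).
  assert (Hs : forall n, P n (s n)) by (intros n; exact (proj2_sig (sq n))).
  assert (Hst : forall n, fst (s n) <= fst (s (S n)) /\
     fst (s (S n)) + p / 2 ^ S n <= fst (s n) + p / 2 ^ n /\ snd (s n) <= snd (s (S n)) /\
     snd (s (S n)) + q / 2 ^ S n <= snd (s n) + q / 2 ^ n /\ G n (s n) <= 4 * G (S n) (s (S n))).
  { intros n. exact (proj2 (proj2_sig (step n (proj1_sig (sq n)) (proj2_sig (sq n))))). }
  clearbody s. clear sq step.
  destruct (nested_intervals (fun n => fst (s n)) (fun n => fst (s n) + p / 2 ^ n)) as [x Hx];
    [intros; apply Hst|intros; apply Hst|intros n; generalize (Hp n); lra|].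
  destruct (nested_intervals (fun n => snd (s n)) (fun n => snd (s n) + q / 2 ^ n)) as [y Hy];
    [intros; apply Hst|intros; apply Hst|intros n; generalize (Hq n); lra|].
  assert (Gn : forall n, G 0%nat (a, c) <= 4 ^ n * G n (s n)).
  { assert (S0 : s 0%nat = (a, c)).
    { assert (Q := Hs 0%nat). unfold P, p, q in Q. simpl in Q. rewrite !Rdiv_1_r in Q.
      apply injective_projections; simpl; lra. }
    induction n as [|n IH]; [rewrite S0; simpl; lra|].
    eapply Rle_trans; [exact IH|]. assert (Q := proj2 (proj2 (proj2 (proj2 (Hst n))))).
    simpl pow. replace (4 * 4 ^ n * G (S n) (s (S n))) with (4 ^ n * (4 * G (S n) (s (S n)))) by ring.
    apply Rmult_le_compat_l; [apply pow_le; lra|exact Q]. }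
  assert (E0 : G 0%nat (a, c) = Cmod (rect_int h a b c d)).
  { unfold G; simpl. rewrite !Rdiv_1_r. unfold p, q. f_equal. f_equal; ring. }
  destruct (H x y) as [l Hl].
  { assert (Q := Hs 0%nat). unfold P in Q. assert (Q1 := Hx 0%nat). simpl in Q1. lra. }
  { assert (Q := Hs 0%nat). unfold P in Q. assert (Q1 := Hy 0%nat). simpl in Q1. lra. }
  apply Cmod_eq_0. apply Rle_antisym; [|apply Cmod_ge_0].
  apply le_epsilon. intros eta Heta. rewrite Rplus_0_l.
  (* With eta / K as slope error, the final bound is eta * 2 (p + q)^2 / K <= eta; the summand 1
     keeps K positive for a degenerate rectangle. *)
  set (K := 2 * (p + q) ^ 2 + 1).
  assert (HK : 0 < K) by (unfold K; generalize (pow2_ge_0 (p + q)); lra).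
  rewrite cder_eps in Hl. destruct (Hl (eta / K) ltac:(now apply Rdiv_lt_0_compat)) as [del [Hdel Hd]].
  assert (exists n, (p + q) / 2 ^ n < del) as [n Hn].
  { assert (Hg : 0 <= p + q) by (unfold p, q; lra).
    destruct (Pow_x_infinity 2 ltac:(rewrite Rabs_right; lra) ((p + q + 1) / del)) as [n Hn].
    exists n. specialize (Hn n (Nat.le_refl _)).
    assert (P2 : 0 < 2 ^ n) by (apply pow_lt; lra).
    rewrite Rabs_right in Hn by lra.
    apply Rmult_lt_reg_r with (2 ^ n); [assumption|]. unfold Rdiv. rewrite Rmult_assoc, Rinv_l by lra.
    apply Rge_le in Hn. apply Rmult_le_compat_r with (r := del) in Hn; [|lra].
    unfold Rdiv in Hn. rewrite Rmult_assoc, Rinv_l in Hn by lra. lra. }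
  rewrite <- E0. eapply Rle_trans; [apply (Gn n)|].
  assert (Hsn := Hs n). unfold P in Hsn. specialize (Hx n). specialize (Hy n). simpl in Hx, Hy.
  assert (B : G n (s n) <= 2 * (eta / K) * (p / 2 ^ n + q / 2 ^ n) ^ 2).
  { unfold G. 
    replace (p / 2 ^ n + q / 2 ^ n)
      with ((fst (s n) + p / 2 ^ n - fst (s n)) + (snd (s n) + q / 2 ^ n - snd (s n))) by ring.
    assert (Q1 := Hp n). assert (Q2 := Hq n).
    apply rect_int_small with (z0 := (x, y)) (l := l); simpl; try lra.
    - apply (holo_rect_sub _ _ _ _ _ _ _ _ _ H); lra.
    - left. now apply Rdiv_lt_0_compat.
    - intros x' y' Hx' Hy'. apply Hd. eapply Rle_lt_trans; [apply Cmod_le_parts|]. simpl.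
      eapply Rle_lt_trans; [|exact Hn].
      assert (Rabs (x' + - x) <= p / 2 ^ n) by (apply Rabs_le; lra).
      assert (Rabs (y' + - y) <= q / 2 ^ n) by (apply Rabs_le; lra).
      unfold Rdiv in *. lra. }
  assert (P4 : 4 ^ n = 2 ^ n * 2 ^ n) by (rewrite <- Rpow_mult_distr; f_equal; ring).
  assert (P2 : 0 < 2 ^ n) by (apply pow_lt; lra).
  apply Rle_trans with (4 ^ n * (2 * (eta / K) * (p / 2 ^ n + q / 2 ^ n) ^ 2)).
  - apply Rmult_le_compat_l; [rewrite P4; nra|exact B].
  - replace (4 ^ n * (2 * (eta / K) * (p / 2 ^ n + q / 2 ^ n) ^ 2)) with (eta * ((2 * (p + q) ^ 2) / K))
      by (rewrite P4; field; lra).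
    assert (2 * (p + q) ^ 2 / K <= 1).
    { apply Rmult_le_reg_r with K; [assumption|]. unfold Rdiv. rewrite Rmult_assoc, Rinv_l by lra.
      unfold K. lra. }
    nra.
Qed.

(** * Mean value property and the identity theorem *)

Lemma cexp_period (z : C) : cexp (z + Ci * RtoC (2 * PI)) = cexp z.
Proof.
  rewrite cexp_plus, cexp_Ci, cos_2PI, sin_2PI.
  apply C_ext; autorewrite with cparts; simpl; ring.
Qed.

Lemma cexp_period_nat (z : C) (n : nat) : cexp (z + Ci * RtoC (2 * PI * INR n)) = cexp z.
Proof.
  induction n as [|n IH].
  - simpl INR. rewrite Rmult_0_r. f_equal. ring.
  - rewrite S_INR, Rmult_plus_distr_l, Rmult_1_r, RtoC_plus, Cmult_plus_distr_l, Cplus_assoc.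
    now rewrite cexp_period.
Qed.

Lemma cexp_period_Z (z : C) (k : Z) : cexp (z + Ci * RtoC (2 * PI * IZR k)) = cexp z.
Proof.
  destruct k as [|p|p].
  - rewrite Rmult_0_r. f_equal. ring.
  - rewrite <- (positive_nat_Z p), <- INR_IZR_INZ. apply cexp_period_nat.
  - rewrite <- (cexp_period_nat (z + Ci * RtoC (2 * PI * IZR (Z.neg p))) (Pos.to_nat p)).
    f_equal. rewrite <- Pos2Z.opp_pos, opp_IZR, INR_IZR_INZ, positive_nat_Z.
    rewrite Ropp_mult_distr_r_reverse, RtoC_opp. ring.
Qed.

Lemma cexp_eq_1 (z : C) : cexp z = 1%C -> exists k : Z, z = (Ci * RtoC (2 * PI * IZR k))%C.
Proof.
  intros H. assert (Hm := Cmod_cexp z). rewrite H, Cmod_1 in Hm.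
  assert (Hr : Re z = 0) by (apply exp_inv; rewrite exp_0; now symmetry).
  unfold cexp in H. rewrite Hr, exp_0 in H. 
  assert (Hc := f_equal Re H). assert (Hs := f_equal Im H). simpl in Hc, Hs.
  rewrite Rmult_1_l in Hc, Hs.
  destruct (sin_eq_0_0 _ Hs) as [k Hk].
  destruct (Zeven_odd_dec k) as [Ev|Od].
  - destruct (Zeven_ex _ Ev) as [j ->]. exists j. apply C_ext; simpl; [rewrite Hr; ring|].
    rewrite Hk, mult_IZR. ring.
  (* At an odd multiple of PI the cosine is -1, so the exponential would be -1 instead of 1. *)
  - exfalso. destruct (Zodd_ex _ Od) as [j ->].
    assert (Q := cexp_period_Z (Ci * RtoC PI) j).
    rewrite <- Cmult_plus_distr_l, <- RtoC_plus, !cexp_Ci, cos_PI in Q.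
    replace (PI + 2 * PI * IZR j) with (Im z) in Q by (rewrite Hk, plus_IZR, mult_IZR; ring).
    inversion Q. lra.
Qed.

(* In the coordinate [w = ln r + i y] the two horizontal sides of the rectangle cancel by
   periodicity, so the circle mean does not depend on the radius. *)
Lemma circle_mean (g : C -> C) (z : C) (b : R) :
  (forall w, Cmod (w - z) <= exp b -> exists l, cder g w l) ->
  Cint (fun y => g (z + cexp (b, y))%C) 0 (2 * PI) = (RtoC (2 * PI) * g z)%C.
Proof.
  intros Hg.
  set (h := fun w => g (z + cexp w)%C).
  assert (Hpi := PI_RGT_0).
  assert (Hh : forall a, a <= b -> holo_rect h a b 0 (2 * PI)).
  { intros a Hab x y Hx Hy. destruct (Hg (z + cexp (x, y))%C) as [l Hl].
    - replace (z + cexp (x, y) - z)%C with (cexp (x, y)) by ring.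
      rewrite Cmod_cexp. apply exp_le_compat. simpl. lra.
    - eexists. eapply (cder_comp g (fun w => z + cexp w)%C); [exact Hl|].
      apply cder_plus; [apply cder_const|apply cder_cexp]. }
  set (J := fun a => Cint (fun y => h (a, y)) 0 (2 * PI)).
  assert (E : forall a, a <= b -> J a = J b).
  { intros a Hab. assert (G := goursat_rect h a b 0 (2 * PI) Hab ltac:(lra) (Hh a Hab)).
    unfold rect_int in G. fold (J a) (J b) in G.
    rewrite (Cint_ext (fun x => h (x, 2 * PI)) (fun x => h (x, 0))) in G.
    - replace (Cint (fun x => h (x, 0)) a b - Cint (fun x => h (x, 0)) a b)%C with (RtoC 0) in G by ring.
      rewrite Cplus_0_l in G.
      assert (G2 : (J b - J a = - Ci * (Ci * (J b - J a)))%C).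
      { rewrite Cmult_assoc. replace (- Ci * Ci)%C with (RtoC 1) by (apply C_ext; simpl; ring). ring. }
      rewrite G, Cmult_0_r in G2.
      replace (J a) with (J b - (J b - J a))%C by ring. rewrite G2. ring.
    - intros x _. unfold h. f_equal. f_equal.
      replace (x, 2 * PI) with ((x, 0) + Ci * RtoC (2 * PI))%C by (apply C_ext; simpl; ring).
      apply cexp_period. }
  change (J b = (RtoC (2 * PI) * g z)%C).
  assert (D : (J b - RtoC (2 * PI) * g z)%C = 0).
  { apply Cmod_eq_0. apply Rle_antisym; [|apply Cmod_ge_0].
    apply le_epsilon. intros eps He. rewrite Rplus_0_l.
    destruct (Hg z) as [l Hl].
    { replace (z - z)%C with (RtoC 0) by ring. rewrite Cmod_0. left; apply exp_pos. }
    destruct (cder_cont _ _ _ Hl (eps / (2 * PI)) ltac:(apply Rdiv_lt_0_compat; lra)) as [d [Hd Hc]].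
    (* A radius e^a <= d / 2 < d: on this small circle [g] is within eps / (2 PI) of its value at
       the centre. *)
    set (a := Rmin b (ln (d / 2))).
    assert (Ha : a <= b) by apply Rmin_l.
    rewrite <- (E a Ha).
    replace (RtoC (2 * PI) * g z)%C with (Cint (fun _ => g z) 0 (2 * PI))
      by (rewrite Cint_const; f_equal; f_equal; ring).
    assert (Hca : forall t, Rmin 0 (2 * PI) <= t <= Rmax 0 (2 * PI) -> ccont (fun y => h (a, y)) t).
    { apply (holo_rect_vert h a b 0 (2 * PI) a); [lra|now apply Hh|lra]. }
    unfold J. rewrite <- Cint_minus; [|assumption|intros; apply ccont_const].
    eapply Rle_trans; [apply (Cint_Cmod_le_const _ (eps / (2 * PI)))|].
    - lra.
    - intros t Ht. apply ccont_minus; [|apply ccont_const]. apply Hca.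
      rewrite Rmin_left, Rmax_right by lra. exact Ht.
    - intros t Ht. unfold h. left. apply Hc.
      replace (z + cexp (a, t) - z)%C with (cexp (a, t)) by ring.
      rewrite Cmod_cexp. simpl. apply Rle_lt_trans with (exp (ln (d / 2))).
      + apply exp_le_compat, Rmin_r.
      + rewrite exp_ln; lra.
    - right; field; lra. }
  replace (J b) with (J b - RtoC (2 * PI) * g z + RtoC (2 * PI) * g z)%C by ring.
  rewrite D. ring.
Qed.

(** This weak maximum principle takes the place of Cauchy's estimates: the identity theorem is
    derived from it without power series. *)
Lemma circle_bound (g : C -> C) (z : C) (r M : R) : 0 < r ->
  (forall w, Cmod (w - z) <= r -> exists l, cder g w l) ->
  (forall y, Cmod (g (z + cexp (ln r, y))%C) <= M) -> Cmod (g z) <= M.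
Proof.
  intros Hr Hg HM. assert (Hpi := PI_RGT_0).
  assert (E := circle_mean g z (ln r)). rewrite exp_ln in E by assumption.
  specialize (E Hg).
  assert (B : Cmod (Cint (fun y => g (z + cexp (ln r, y))%C) 0 (2 * PI)) <= (2 * PI - 0) * M).
  { apply Cint_Cmod_le_const; [lra| |intros; apply HM].
    intros t _. destruct (Hg (z + cexp (ln r, t))%C) as [l Hl].
    - replace (z + cexp (ln r, t) - z)%C with (cexp (ln r, t)) by ring.
      rewrite Cmod_cexp. simpl. rewrite exp_ln; lra.
    - apply (cder_ccont_vert (fun w => g (z + cexp w)%C) (ln r) t
        (l * cexp (ln r, t))%C).
      apply (cder_comp g (fun w => z + cexp w)%C); [exact Hl|].
      eapply cder_eq; [|apply cder_plus; [apply cder_const|apply cder_cexp]]. ring. }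
  rewrite E, Cmod_mult, Cmod_R, Rabs_right in B by lra.
  apply Rmult_le_reg_l with (2 * PI); lra.
Qed.

Lemma cder_pow (f : C -> C) (z l : C) (n : nat) : cder f z l ->
  exists m, cder (fun w => Cpow (f w) n) z m.
Proof.
  intros H. induction n as [|n [m IH]].
  - exists (RtoC 0). exact (cder_const 1 z).
  - eexists. exact (cder_mult _ _ _ _ _ H IH).
Qed.

(* [f] vanishes to infinite order at [z0], so [f / (. - z0)^n] is holomorphic for every [n];
   bounding it by its values on a circle about [w] staying away from [z0] lets [n] tend to infinity. *)
Lemma vanish_spread (f : C -> C) (z0 : C) (rho eps : R) : 0 < rho -> 0 < eps ->
  (forall w, Cmod (w - z0) < rho -> exists l, cder f w l) ->
  (forall w, Cmod (w - z0) < eps -> f w = 0%C) ->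
  forall w, Cmod (w - z0) < rho / 4 -> f w = 0%C.
Proof.
  intros Hrho Heps Hf Hv w Hw.
  destruct (classic (w = z0)) as [->|Hwz].
  { apply Hv. replace (z0 - z0)%C with (RtoC 0) by ring. now rewrite Cmod_0. }
  assert (Hwz' : 0 < Cmod (w - z0)).
  { apply Cmod_gt_0. intro H. apply Hwz. replace w with (w - z0 + z0)%C by ring. rewrite H. ring. }
  (* Since |w - z0| < rho / 4, the circle of radius rho / 2 about w stays inside the disc of radius
     rho about z0 and farther than rho / 4 from z0. *)
  assert (exists r, r = rho / 2) as [r Er] by eauto. assert (Hr : 0 < r) by lra.
  assert (Hcirc : forall y, rho / 4 < Cmod (w + cexp (ln r, y) - z0) < rho).
  { intros y. assert (Hm : Cmod (cexp (ln r, y)) = r) by (rewrite Cmod_cexp; simpl; now rewrite exp_ln).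
    split.
    - assert (T := Cmod_triangle_inv (cexp (ln r, y)) (- (w - z0))).
      replace (cexp (ln r, y) - - (w - z0))%C with (w + cexp (ln r, y) - z0)%C in T by ring.
      rewrite Cmod_opp, Hm in T. lra.
    - replace (w + cexp (ln r, y) - z0)%C with (cexp (ln r, y) + (w - z0))%C by ring.
      eapply Rle_lt_trans; [apply Cmod_triangle|]. rewrite Hm. lra. }
  assert (Hbd : exists M, forall y, Cmod (f (w + cexp (ln r, y))%C) <= M).
  { assert (Hc : forall t, ccont (fun y => f (w + cexp (ln r, y))%C) t).
    { intros t. destruct (Hf (w + cexp (ln r, t))%C) as [l Hl]; [apply Hcirc|].
      apply (cder_ccont_vert (fun v => f (w + cexp v)%C) (ln r) t (l * cexp (ln r, t))%C).
      apply (cder_comp f (fun v => w + cexp v)%C); [exact Hl|].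
      eapply cder_eq; [|apply cder_plus; [apply cder_const|apply cder_cexp]]. ring. }
    destruct (continuity_ab_maj (fun y => Cmod (f (w + cexp (ln r, y))%C)) 0 (2 * PI)) as [m [Hm _]].
    - assert (H := PI_RGT_0). lra.
    - intros t _. apply continuity_pt_filterlim. apply (ccont_Cmod _ _ (Hc t)).
    - exists (Cmod (f (w + cexp (ln r, m))%C)). intros y.
      assert (Hpi := PI_RGT_0).
      destruct (archimed (y / (2 * PI))) as [A1 A2].
      set (k := (up (y / (2 * PI)) - 1)%Z).
      assert (Hk : IZR k <= y / (2 * PI) <= IZR k + 1) by (unfold k; rewrite minus_IZR; lra).
      assert (Hy : 0 <= y - IZR k * (2 * PI) <= 2 * PI).
      { destruct Hk as [K1 K2].
        apply Rmult_le_compat_r with (r := 2 * PI) in K1; [|lra].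
        apply Rmult_le_compat_r with (r := 2 * PI) in K2; [|lra].
        unfold Rdiv in K1, K2. rewrite Rmult_assoc, Rinv_l in K1 by lra.
        rewrite Rmult_assoc, Rinv_l in K2 by lra. lra. }
      specialize (Hm _ Hy).
      replace (cexp (ln r, y)) with (cexp (ln r, y - IZR k * (2 * PI))); [exact Hm|].
      rewrite <- (cexp_period_Z (ln r, y - IZR k * (2 * PI)) k). f_equal.
      apply C_ext; simpl; ring. }
  destruct Hbd as [M HM].
  (* At v = z0 the value of the formal inverse does not matter: [f], hence [g n], is identically 0
     near z0. *)
  set (g := fun n v => (f v * Cpow (/ (v - z0)) n)%C).
  assert (Hg : forall n v, Cmod (v - z0) < rho -> exists l, cder (g n) v l).
  { intros n v Hvr. destruct (classic (v = z0)) as [->|Hvz].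
    - exists 0%C. apply cder_ext_loc with (f := fun _ => RtoC 0); [|apply cder_const].
      exists eps; split; [assumption|]. intros u Hu. unfold g. rewrite (Hv u Hu). ring.
    - destruct (Hf v Hvr) as [l Hl].
      destruct (cder_pow (fun u => / (u - z0))%C v (- / ((v - z0) * (v - z0)) * (1 - 0))%C n) as [m Hm].
      { apply (cder_inv (fun u => u - z0)%C).
        - intro H. apply Hvz. rewrite <- (Cplus_0_l z0), <- H. ring.
        - apply cder_minus; [apply cder_id|apply cder_const]. }
      eexists. exact (cder_mult _ _ _ _ _ Hl Hm). }
  assert (Hgb : forall n, Cmod (g n w) <= M * (/ (rho / 4)) ^ n).
  { intros n. apply (circle_bound (g n) w r); [assumption| |].
    - intros v Hvr. apply Hg.
      replace (v - z0)%C with ((v - w) + (w - z0))%C by ring.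
      eapply Rle_lt_trans; [apply Cmod_triangle|]. lra.
    - intros y. unfold g. rewrite Cmod_mult, Cmod_pow.
      assert (Hy := Hcirc y).
      rewrite Cmod_inv.
      2:{ apply Cmod_gt_0. lra. }
      apply Rmult_le_compat; [apply Cmod_ge_0| |apply HM|].
      + apply pow_le. left. apply Rinv_0_lt_compat. lra.
      + apply pow_incr. split; [left; apply Rinv_0_lt_compat; lra|].
        apply Rinv_le_contravar; lra. }
  assert (Hfw : forall n, Cmod (f w) <= M * (Cmod (w - z0) / (rho / 4)) ^ n).
  { intros n. specialize (Hgb n). unfold g in Hgb.
    assert (Hne : (w - z0)%C <> 0%C) by (apply Cmod_gt_0; assumption).
    rewrite Cmod_mult, Cmod_pow, Cmod_inv in Hgb by assumption.
    assert (Hp : 0 < Cmod (w - z0) ^ n) by now apply pow_lt.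
    apply Rmult_le_compat_r with (r := Cmod (w - z0) ^ n) in Hgb; [|lra].
    rewrite Rmult_assoc, <- Rpow_mult_distr, Rinv_l, pow1, Rmult_1_r in Hgb by lra.
    eapply Rle_trans; [exact Hgb|]. unfold Rdiv. rewrite Rpow_mult_distr. right; ring. }
  apply Cmod_eq_0. apply Rle_antisym; [|apply Cmod_ge_0].
  assert (HM0 : 0 <= M) by (apply Rle_trans with (2 := HM 0); apply Cmod_ge_0).
  apply le_epsilon. intros e He. rewrite Rplus_0_l.
  assert (Hq : Rabs (Cmod (w - z0) / (rho / 4)) < 1).
  { rewrite Rabs_right.
    - apply Rmult_lt_reg_r with (rho / 4); [lra|].
      unfold Rdiv at 1. rewrite Rmult_assoc, Rinv_l; lra.
    - apply Rle_ge. apply Rmult_le_pos; [lra|]. left; apply Rinv_0_lt_compat; lra. }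
  destruct (pow_lt_1_zero _ Hq (e / (M + 1)) ltac:(apply Rdiv_lt_0_compat; lra)) as [n Hn].
  specialize (Hn n (Nat.le_refl _)). eapply Rle_trans; [apply (Hfw n)|].
  assert (Hn' := Rle_lt_trans _ _ _ (Rle_abs _) Hn).
  apply Rle_trans with (M * (e / (M + 1))).
  - apply Rmult_le_compat_l; [assumption|lra].
  - apply Rmult_le_reg_r with (M + 1); [lra|].
    unfold Rdiv. rewrite Rmult_assoc, Rmult_assoc, Rinv_l by lra. nra.
Qed.

(** Vanishing is carried along the segment in K steps of length at most rho / 8. A disc of radius
    rho / 4 about one point, on which [vanish_spread] gives zero, contains the disc of radius rho /
    8 about the next. *)
Theorem identity_segment (f : C -> C) (z0 z1 : C) (rho eps : R) : 0 < rho -> 0 < eps ->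
  (forall t w, 0 <= t <= 1 -> Cmod (w - (z0 + RtoC t * (z1 - z0))) < rho -> exists l, cder f w l) ->
  (forall w, Cmod (w - z0) < eps -> f w = 0%C) ->
  forall w, Cmod (w - z1) < rho / 4 -> f w = 0%C.
Proof.
  intros Hrho Heps Hf Hv.
  set (D := Cmod (z1 - z0)). assert (HD : 0 <= D) by apply Cmod_ge_0.
  destruct (INR_unbounded (8 * D / rho)) as [K HK].
  assert (HK0 : 0 < INR K).
  { eapply Rle_lt_trans; [|exact HK]. apply Rmult_le_pos; [lra|left; now apply Rinv_0_lt_compat]. }
  set (zk := fun k => (z0 + RtoC (INR k / INR K) * (z1 - z0))%C).
  assert (Hstep : forall k, Cmod (zk (S k) - zk k) <= rho / 8).
  { intros k. unfold zk. rewrite S_INR.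
    replace (z0 + RtoC ((INR k + 1) / INR K) * (z1 - z0) - (z0 + RtoC (INR k / INR K) * (z1 - z0)))%C
      with (RtoC (/ INR K) * (z1 - z0))%C.
    2:{ replace ((INR k + 1) / INR K) with (INR k / INR K + / INR K) by (field; lra).
        rewrite RtoC_plus. ring. }
    rewrite Cmod_mult, Cmod_R, Rabs_right by (left; now apply Rinv_0_lt_compat).
    fold D. apply Rmult_le_reg_l with (INR K); [assumption|].
    rewrite <- Rmult_assoc, Rinv_r, Rmult_1_l by lra.
    apply Rmult_lt_compat_r with (r := rho / 8) in HK; [|lra].
    replace (8 * D / rho * (rho / 8)) with D in HK by (field; lra). lra. }
  assert (Hk : forall k, (k <= K)%nat -> exists e, 0 < e /\ forall w, Cmod (w - zk k) < e -> f w = 0%C).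
  { induction k as [|k IH]; intros Hk.
    - exists eps; split; [assumption|]. intros w Hw. apply Hv.
      unfold zk in Hw. simpl INR in Hw.
      replace (w - z0)%C with (w - (z0 + RtoC (0 / INR K) * (z1 - z0)))%C; [exact Hw|].
      unfold Rdiv. rewrite Rmult_0_l. ring.
    - destruct (IH ltac:(lia)) as [e [He Hz]].
      exists (rho / 8); split; [lra|]. intros w Hw.
      apply (vanish_spread f (zk k) rho e); try assumption.
      + intros v Hvr. apply (Hf (INR k / INR K)); [|exact Hvr].
        assert (INR k <= INR K) by (apply le_INR; lia). assert (0 <= INR k) by apply pos_INR.
        split; [apply Rmult_le_pos; [assumption|left; now apply Rinv_0_lt_compat]|].
        apply Rmult_le_reg_r with (INR K); [assumption|]. unfold Rdiv.
        rewrite Rmult_assoc, Rinv_l; lra.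
      + replace (w - zk k)%C with ((w - zk (S k)) + (zk (S k) - zk k))%C by ring.
        eapply Rle_lt_trans; [apply Cmod_triangle|]. specialize (Hstep k). lra. }
  destruct (Hk K (Nat.le_refl _)) as [e [He Hz]].
  assert (EK : zk K = z1).
  { unfold zk, Rdiv. rewrite Rinv_r by lra. ring. }
  rewrite EK in Hz.
  apply (vanish_spread f z1 rho e); try assumption.
  intros v Hvr. apply (Hf 1); [lra|].
  replace (z0 + RtoC 1 * (z1 - z0))%C with z1 by ring. exact Hvr.
Qed.

(** * Complex series *)

Definition csum_n (a : nat -> C) (n : nat) : C := @sum_n C_AbelianMonoid a n.

Lemma csum_n_0 a : csum_n a 0 = a 0%nat.
Proof. unfold csum_n. now rewrite sum_O. Qed.

Lemma csum_n_S a n : csum_n a (S n) = (csum_n a n + a (S n))%C.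
Proof. unfold csum_n. now rewrite sum_Sn. Qed.

Lemma Re_csum_n a n : Re (csum_n a n) = sum_n (fun k => Re (a k)) n.
Proof.
  induction n as [|n IH]; [now rewrite csum_n_0, sum_O|].
  rewrite csum_n_S, sum_Sn, Re_plus, IH. reflexivity.
Qed.

Lemma cseries_eps (a : nat -> C) (l : C) :
  cseries a l <-> forall eps, 0 < eps -> exists N, forall n, (N <= n)%nat ->
    Cmod (csum_n a n - l) < eps.
Proof.
  unfold cseries, is_series. split.
  - intros H eps He.
    assert (H1 : locally (T := C_UniformSpace) l (fun z => Cmod (z - l) < eps)).
    { apply locally_C. now exists (mkposreal eps He). }
    destruct (H _ H1) as [N HN]. exists N. exact HN.
  - intros H P HP. apply locally_C in HP. destruct HP as [e He].
    destruct (H e (cond_pos e)) as [N HN]. exists N. intros n Hn. apply He. now apply HN.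
Qed.

Lemma cseries_unique a l m : cseries a l -> cseries a m -> l = m.
Proof.
  rewrite !cseries_eps. intros H1 H2.
  assert (E : Cmod (l - m) = 0).
  { apply Rle_antisym; [|apply Cmod_ge_0]. apply le_epsilon. intros eps He. rewrite Rplus_0_l.
    destruct (H1 (eps/2) ltac:(lra)) as [N1 HN1]. destruct (H2 (eps/2) ltac:(lra)) as [N2 HN2].
    specialize (HN1 (N1 + N2)%nat ltac:(lia)). specialize (HN2 (N1 + N2)%nat ltac:(lia)).
    replace (l - m)%C with ((csum_n a (N1 + N2) - m) - (csum_n a (N1 + N2) - l))%C by ring.
    eapply Rle_trans; [apply Cmod_triangle_minus|]. lra. }
  apply Cmod_eq_0 in E. replace l with (l - m + m)%C by ring. rewrite E. ring.
Qed.

Lemma cseries_ext a b l : (forall n, a n = b n) -> cseries a l -> cseries b l.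
Proof. intros H. exact (is_series_ext a b l H). Qed.

Lemma cseries_plus a b l m : cseries a l -> cseries b m -> cseries (fun n => a n + b n)%C (l + m)%C.
Proof. exact (is_series_plus a b l m). Qed.

Lemma cseries_scal c a l : cseries a l -> cseries (fun n => c * a n)%C (c * l)%C.
Proof. exact (is_series_scal (K := C_AbsRing) (V := C_NormedModule) c a l). Qed.

Lemma cseries_minus a b l m : cseries a l -> cseries b m -> cseries (fun n => a n - b n)%C (l - m)%C.
Proof. exact (is_series_minus a b l m). Qed.

Lemma is_series_RtoC (a : nat -> R) (l : R) : is_series a l -> cseries (fun n => RtoC (a n)) (RtoC l).
Proof.
  intros H. apply cseries_eps. intros eps He.
  assert (H1 : locally l (fun y => Rabs (y - l) < eps)) by now exists (mkposreal eps He).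
  destruct (H _ H1) as [N HN]. exists N. intros n Hn.
  replace (csum_n (fun k => RtoC (a k)) n) with (RtoC (sum_n a n)).
  - rewrite <- RtoC_minus, Cmod_R. now apply HN.
  - clear. induction n as [|n IH]; [now rewrite csum_n_0, sum_O|].
    rewrite csum_n_S, sum_Sn, <- IH. apply RtoC_plus.
Qed.

Lemma cseries_Re a l : cseries a l -> is_series (fun n => Re (a n)) (Re l).
Proof.
  intros H. rewrite cseries_eps in H. intros P [e He].
  destruct (H e (cond_pos e)) as [N HN]. exists N. intros n Hn. apply He.
  change (Rabs (sum_n (fun n0 => Re (a n0)) n - Re l) < e).
  rewrite <- Re_csum_n, <- Re_minus. eapply Rle_lt_trans; [apply re_le_Cmod|]. now apply HN.
Qed.

Lemma sum_n_le_Series (b : nat -> R) n : (forall k, 0 <= b k) -> ex_series b -> sum_n b n <= Series b.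
Proof.
  intros Hb Eb. apply Series_correct in Eb.
  apply (is_lim_seq_incr_compare (sum_n b)); [exact Eb|].
  intros k. rewrite sum_Sn. unfold plus; simpl. generalize (Hb (S k)); lra.
Qed.

Lemma Series_tail_small (b : nat -> R) eps : ex_series b -> 0 < eps -> exists N, forall n, (N <= n)%nat ->
  Rabs (Series b - sum_n b n) < eps.
Proof.
  intros Eb He. apply Series_correct in Eb.
  assert (H1 : locally (Series b) (fun y => Rabs (y - Series b) < eps)) by now exists (mkposreal eps He).
  destruct (Eb _ H1) as [N HN]. exists N. intros n Hn. rewrite Rabs_minus_sym. now apply HN.
Qed.

(** Besides convergence, the tail bound is kept explicitly: it becomes the uniform estimate that
    allows termwise integration. *)
Lemma cseries_dominated (a : nat -> C) (b : nat -> R) :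
  (forall n, Cmod (a n) <= b n) -> ex_series b ->
  exists l, cseries a l /\ Cmod l <= Series b /\
    forall n, Cmod (l - csum_n a n) <= Series b - sum_n b n.
Proof.
  intros H Eb.
  assert (Hb : forall k, 0 <= b k) by (intros k; apply Rle_trans with (2 := H k); apply Cmod_ge_0).
  destruct (ex_series_le (K := C_AbsRing) (V := C_CompleteNormedModule) a b) as [l Hl].
  - intros n. apply H.
  - exact Eb.
  - assert (Hl' : cseries a l) by exact Hl. rewrite cseries_eps in Hl'.
    exists l. split; [exact Hl|].
    assert (D : forall n m, Cmod (csum_n a (n + m) - csum_n a n) <= sum_n b (n + m) - sum_n b n).
    { intros n m. induction m as [|m IH].
      - rewrite Nat.add_0_r. replace (csum_n a n - csum_n a n)%C with (RtoC 0) by ring. rewrite Cmod_0. lra.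
      - rewrite Nat.add_succ_r, csum_n_S, sum_Sn. unfold plus; simpl.
        replace (csum_n a (n + m) + a (S (n + m)) - csum_n a n)%C
          with ((csum_n a (n + m) - csum_n a n) + a (S (n + m)))%C by ring.
        eapply Rle_trans; [apply Cmod_triangle|]. specialize (H (S (n + m))). lra. }
    assert (T : forall n, Cmod (l - csum_n a n) <= Series b - sum_n b n).
    { intros n. apply le_epsilon. intros eps He.
      destruct (Hl' eps He) as [N HN]. specialize (HN (n + N)%nat ltac:(lia)).
      replace (l - csum_n a n)%C with ((csum_n a (n + N) - csum_n a n) - (csum_n a (n + N) - l))%C by ring.
      eapply Rle_trans; [apply Cmod_triangle_minus|]. specialize (D n N).
      assert (S1 := sum_n_le_Series b (n + N) Hb Eb). lra. }
    split; [|exact T].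
    replace l with ((l - csum_n a 0) + csum_n a 0)%C by ring.
    eapply Rle_trans; [apply Cmod_triangle|]. specialize (T 0%nat).
    rewrite csum_n_0, sum_O in *. specialize (H 0%nat). lra.
Qed.

Lemma cseries_tail_le (a : nat -> C) (b : nat -> R) l :
  (forall n, Cmod (a n) <= b n) -> ex_series b -> cseries a l ->
  forall n, Cmod (l - csum_n a n) <= Series b - sum_n b n.
Proof.
  intros H Eb Hl. destruct (cseries_dominated a b H Eb) as (m & Hm & _ & T).
  now rewrite (cseries_unique _ _ _ Hl Hm).
Qed.

Lemma cseries_Cmod_le (a : nat -> C) (b : nat -> R) l :
  (forall n, Cmod (a n) <= b n) -> ex_series b -> cseries a l -> Cmod l <= Series b.
Proof.
  intros H Eb Hl. destruct (cseries_dominated a b H Eb) as (m & Hm & T & _).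
  now rewrite (cseries_unique _ _ _ Hl Hm).
Qed.

(** * Integrals over a half-line *)

Definition is_hint (f : R -> C) (l : C) : Prop :=
  forall eps, 0 < eps -> exists M, 0 <= M /\ forall b, M <= b -> Cmod (Cint f 0 b - l) <= eps.

(** A total operator obtained by choice; its value has a meaning only where some limit satisfies
    [is_hint], which [hdom] ensures. *)
Definition Hint (f : R -> C) : C := epsilon (inhabits (RtoC 0)) (is_hint f).

Definition hcont (f : R -> C) : Prop := forall t, 0 <= t -> ccont f t.

(** The integrability criterion used throughout. The constants stay visible because [K / del] bounds
    the integral and the truncation error. *)
Definition hdom (f : R -> C) (K del : R) : Prop :=
  0 < del /\ hcont f /\ forall t, 0 <= t -> Cmod (f t) <= K * exp (- del * t).

Lemma hcont_Cint f a b : 0 <= a -> 0 <= b -> hcont f ->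
  forall t, Rmin a b <= t <= Rmax a b -> ccont f t.
Proof.
  intros Ha Hb Hf t [Ht _]. apply Hf. apply Rle_trans with (2 := Ht). now apply Rmin_glb.
Qed.

Lemma is_hint_unique f l m : is_hint f l -> is_hint f m -> l = m.
Proof.
  intros H1 H2.
  assert (E : Cmod (l - m) = 0).
  { apply Rle_antisym; [|apply Cmod_ge_0]. apply le_epsilon. intros eps He. rewrite Rplus_0_l.
    destruct (H1 (eps/2) ltac:(lra)) as [M1 [HM1 B1]]. destruct (H2 (eps/2) ltac:(lra)) as [M2 [HM2 B2]].
    specialize (B1 (M1 + M2) ltac:(lra)). specialize (B2 (M1 + M2) ltac:(lra)).
    replace (l - m)%C with ((Cint f 0 (M1 + M2) - m) - (Cint f 0 (M1 + M2) - l))%C by ring.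
    eapply Rle_trans; [apply Cmod_triangle_minus|]. lra. }
  apply Cmod_eq_0 in E. replace l with (l - m + m)%C by ring. rewrite E. ring.
Qed.

Lemma is_hint_Hint f l : is_hint f l -> Hint f = l.
Proof.
  intros H. apply is_hint_unique with f; [|exact H].
  unfold Hint. apply epsilon_spec. now exists l.
Qed.

Lemma RInt_exp_decay K del a b : 0 < del -> a <= b ->
  RInt (fun t => K * exp (- del * t)) a b <= K / del * exp (- del * a) - K / del * exp (- del * b).
Proof.
  intros Hd Hab. right. apply is_RInt_unique.
  replace (K / del * exp (- del * a) - K / del * exp (- del * b))
    with (minus (- (K / del) * exp (- del * b)) (- (K / del) * exp (- del * a)))
    by (unfold minus, plus, opp; simpl; ring).
  apply (is_RInt_derive (V := R_CompleteNormedModule) (fun t => - (K / del) * exp (- del * t))).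
  - intros t _. auto_derive; trivial. field. lra.
  - intros t _. apply (ex_derive_continuous (V := R_NormedModule)). auto_derive; trivial.
Qed.

Lemma hdom_K_ge0 f K del : hdom f K del -> 0 <= K.
Proof.
  intros (_ & _ & H). specialize (H 0 (Rle_refl 0)). rewrite Rmult_0_r, exp_0, Rmult_1_r in H.
  apply Rle_trans with (2 := H). apply Cmod_ge_0.
Qed.

Lemma hdom_Cint_tail f K del a b : hdom f K del -> 0 <= a -> a <= b ->
  Cmod (Cint f 0 b - Cint f 0 a) <= K / del * exp (- del * a).
Proof.
  intros Hd Ha Hab. assert (HK := hdom_K_ge0 _ _ _ Hd). destruct Hd as (Hdel & Hc & H).
  rewrite <- (Cint_Chasles f 0 a b) by (apply hcont_Cint; try assumption; lra).
  replace (Cint f 0 a + Cint f a b - Cint f 0 a)%C with (Cint f a b) by ring.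
  eapply Rle_trans; [apply (Cint_Cmod_le f (fun t => K * exp (- del * t)) a b Hab)|].
  - intros t Ht. apply Hc; lra.
  - intros t _. apply (ex_derive_continuous (V := R_NormedModule)). auto_derive; trivial.
  - intros t Ht. apply H; lra.
  - eapply Rle_trans; [now apply RInt_exp_decay|].
    assert (0 <= K / del * exp (- del * b)).
    { apply Rmult_le_pos; [|left; apply exp_pos].
      apply Rmult_le_pos; [assumption|left; now apply Rinv_0_lt_compat]. }
    lra.
Qed.

Lemma exp_decay_small K del eps : 0 <= K -> 0 < del -> 0 < eps ->
  exists M, 0 <= M /\ forall t, M <= t -> K * exp (- del * t) <= eps.
Proof.
  intros HK Hd He. exists (K / (del * eps)). split.
  - apply Rmult_le_pos; [assumption|]. left. apply Rinv_0_lt_compat. now apply Rmult_lt_0_compat.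
  - intros t Ht. replace (- del * t) with (- (del * t)) by ring. rewrite exp_Ropp.
    assert (H1 := exp_ineq1_le (del * t)). assert (H2 := exp_pos (del * t)).
    apply Rmult_le_reg_r with (exp (del * t)); [assumption|].
    rewrite Rmult_assoc, Rinv_l, Rmult_1_r by lra.
    apply Rle_trans with (eps * (del * t)); [|apply Rmult_le_compat_l; lra].
    apply Rmult_le_compat_l with (r := del * eps) in Ht; [|apply Rlt_le; now apply Rmult_lt_0_compat].
    replace (del * eps * (K / (del * eps))) with K in Ht by (field; split; lra). lra.
Qed.

(** The integrals up to integers form a Cauchy sequence by the exponential tail bound; the limit is
    taken componentwise, and the same bound then controls all real upper limits. *)
Lemma hdom_is_hint f K del : hdom f K del -> is_hint f (Hint f) /\
  forall a, 0 <= a -> Cmod (Cint f 0 a - Hint f) <= K / del * exp (- del * a).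
Proof.
  intros Hd. assert (HK := hdom_K_ge0 _ _ _ Hd).
  assert (Hdel := proj1 Hd).
  assert (HK' : 0 <= K / del) by (apply Rmult_le_pos; [assumption|left; now apply Rinv_0_lt_compat]).
  assert (CS : forall eps, 0 < eps -> exists N : nat, forall n m, (N <= n)%nat -> (N <= m)%nat ->
     Cmod (Cint f 0 (INR n) - Cint f 0 (INR m)) < eps).
  { intros eps He. destruct (exp_decay_small (K / del) del (eps / 2) HK' Hdel ltac:(lra)) as [M [HM B]].
    destruct (INR_unbounded M) as [N HN]. exists N.
    assert (Q : forall n m, (N <= n)%nat -> (n <= m)%nat -> Cmod (Cint f 0 (INR m) - Cint f 0 (INR n)) < eps).
    { intros n m Hn Hm. apply le_INR in Hn, Hm.
      eapply Rle_lt_trans; [apply (hdom_Cint_tail f K del (INR n) (INR m) Hd)|]; try lra.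
      specialize (B (INR n) ltac:(lra)). lra. }
    intros n m Hn Hm. destruct (Nat.le_ge_cases n m).
    - rewrite Cmod_minus_sym. now apply Q.
    - now apply Q. }
  assert (EL : forall p : C -> R, (forall z w, p (z - w)%C = p z - p w) -> (forall z, Rabs (p z) <= Cmod z) ->
    exists l : R, is_lim_seq (fun n => p (Cint f 0 (INR n))) l).
  { intros p Hp1 Hp2.
    destruct (proj2 (ex_lim_seq_cauchy_corr (fun n => p (Cint f 0 (INR n))))) as [l Hl].
    - intros eps. destruct (CS eps (cond_pos eps)) as [N HN]. exists N. intros n m Hn Hm.
      rewrite <- Hp1. eapply Rle_lt_trans; [apply Hp2|now apply HN].
    - now exists l. }
  destruct (EL Re (fun z w => eq_refl) re_le_Cmod) as [l1 H1].
  destruct (EL Im (fun z w => eq_refl) im_le_Cmod) as [l2 H2].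
  set (l := (l1, l2) : C).
  assert (T : forall a, 0 <= a -> Cmod (Cint f 0 a - l) <= K / del * exp (- del * a)).
  { intros a Ha. apply le_epsilon. intros eps He.
    apply is_lim_seq_spec in H1, H2.
    destruct (H1 (mkposreal (eps/2) ltac:(lra))) as [N1 HN1].
    destruct (H2 (mkposreal (eps/2) ltac:(lra))) as [N2 HN2].
    destruct (INR_unbounded a) as [N3 HN3].
    set (n := (N1 + N2 + N3)%nat).
    specialize (HN1 n ltac:(unfold n; lia)). specialize (HN2 n ltac:(unfold n; lia)). simpl in HN1, HN2.
    assert (HN4 : a <= INR n) by (apply Rle_trans with (INR N3); [lra|apply le_INR; unfold n; lia]).
    assert (Q := hdom_Cint_tail f K del a (INR n) Hd Ha HN4).
    replace (Cint f 0 a - l)%C with ((Cint f 0 (INR n) - l) - (Cint f 0 (INR n) - Cint f 0 a))%C by ring.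
    eapply Rle_trans; [apply Cmod_triangle_minus|].
    assert (P := Cmod_le_parts (Cint f 0 (INR n) - l)%C). rewrite Re_minus, Im_minus in P.
    unfold l in P |- *. simpl in P. lra. }
  assert (IS : is_hint f l).
  { intros eps He. destruct (exp_decay_small (K / del) del eps HK' Hdel He) as [M [HM B]].
    exists M; split; [assumption|]. intros b Hb.
    eapply Rle_trans; [apply T; lra|]. now apply B. }
  rewrite (is_hint_Hint _ _ IS). split; assumption.
Qed.

Lemma Hint_Cmod_le f K del : hdom f K del -> Cmod (Hint f) <= K / del.
Proof.
  intros Hd. destruct (hdom_is_hint _ _ _ Hd) as [_ H]. specialize (H 0 (Rle_refl 0)).
  rewrite Cint_point, Rmult_0_r, exp_0, Rmult_1_r in H.
  replace (0 - Hint f)%C with (- Hint f)%C in H by ring. now rewrite Cmod_opp in H.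
Qed.

Lemma Hint_ext f g : (forall t, 0 <= t -> f t = g t) -> Hint f = Hint g.
Proof.
  intros H.
  assert (E : forall b, 0 <= b -> Cint f 0 b = Cint g 0 b).
  { intros b Hb. apply Cint_ext. intros t Ht. apply H. rewrite Rmin_left in Ht; lra. }
  assert (E2 : forall l, is_hint f l <-> is_hint g l).
  { intros l; split; intros Hl eps He; destruct (Hl eps He) as [M [HM B]]; exists M;
      (split; [assumption|]); intros b Hb; specialize (B b Hb);
      [rewrite <- E|rewrite E]; solve [assumption|lra]. }
  destruct (classic (exists l, is_hint f l)) as [[l Hl]|N].
  - rewrite (is_hint_Hint _ _ Hl). symmetry. apply is_hint_Hint. now apply E2.
  (* Without a limit the two choices agree only because the predicates themselves are equal, by
     extensionality. *)
  - unfold Hint. f_equal. apply FunctionalExtensionality.functional_extensionality. intros l.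
    apply PropExtensionality.propositional_extensionality. apply E2.
Qed.

Lemma hcont_plus f g : hcont f -> hcont g -> hcont (fun u => f u + g u)%C.
Proof. intros Hf Hg t Ht. apply ccont_plus; auto. Qed.

Lemma hcont_minus f g : hcont f -> hcont g -> hcont (fun u => f u - g u)%C.
Proof. intros Hf Hg t Ht. apply ccont_minus; auto. Qed.

Lemma hcont_mult f g : hcont f -> hcont g -> hcont (fun u => f u * g u)%C.
Proof. intros Hf Hg t Ht. apply ccont_mult; auto. Qed.

Lemma hcont_ext f g : (forall u, f u = g u) -> hcont f -> hcont g.
Proof. intros E Hf t Ht. apply ccont_ext with f; auto. Qed.

Definition hint_able (f : R -> C) : Prop := hcont f /\ exists K del, hdom f K del.

Lemma hdom_able f K del : hdom f K del -> hint_able f.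
Proof. intros H. split; [apply H|now exists K, del]. Qed.

Lemma hint_able_spec f : hint_able f -> is_hint f (Hint f).
Proof. intros (_ & K & del & H). exact (proj1 (hdom_is_hint _ _ _ H)). Qed.

Lemma hdom_scal c f K del : hdom f K del -> hdom (fun u => c * f u)%C (Cmod c * K) del.
Proof.
  intros (Hd & Hc & H). split; [assumption|split].
  - intros t Ht. apply ccont_mult; [apply ccont_const|auto].
  - intros t Ht. rewrite Cmod_mult, Rmult_assoc. apply Rmult_le_compat_l; [apply Cmod_ge_0|auto].
Qed.

Lemma hdom_plus f g K L del eta : hdom f K del -> hdom g L eta ->
  hdom (fun u => f u + g u)%C (K + L) (Rmin del eta).
Proof.
  intros Hf Hg. assert (HK := hdom_K_ge0 _ _ _ Hf). assert (HL := hdom_K_ge0 _ _ _ Hg).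
  destruct Hf as (H1 & H2 & H3), Hg as (H4 & H5 & H6).
  split; [now apply Rmin_pos|split; [now apply hcont_plus|]].
  intros t Ht. eapply Rle_trans; [apply Cmod_triangle|].
  assert (M1 := Rmin_l del eta). assert (M2 := Rmin_r del eta).
  assert (E1 : exp (- del * t) <= exp (- Rmin del eta * t)) by (apply exp_le_compat; nra).
  assert (E2 : exp (- eta * t) <= exp (- Rmin del eta * t)) by (apply exp_le_compat; nra).
  specialize (H3 t Ht). specialize (H6 t Ht).
  rewrite Rmult_plus_distr_r. apply Rplus_le_compat; [eapply Rle_trans; [exact H3|]|eapply Rle_trans; [exact H6|]];
    apply Rmult_le_compat_l; assumption.
Qed.

Lemma hint_able_plus f g : hint_able f -> hint_able g -> hint_able (fun u => f u + g u)%C.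
Proof.
  intros (Hf & K & d & H1) (Hg & L & e & H2). eapply hdom_able. now apply hdom_plus; eassumption.
Qed.

Lemma hint_able_scal c f : hint_able f -> hint_able (fun u => c * f u)%C.
Proof. intros (Hf & K & d & H1). eapply hdom_able. apply hdom_scal; eassumption. Qed.

Lemma hint_able_ext f g : (forall u, f u = g u) -> hint_able f -> hint_able g.
Proof.
  intros E (Hf & K & d & H1 & H2 & H3). apply (hdom_able _ K d). split; [assumption|].
  split; [now apply hcont_ext with f|]. intros t Ht. rewrite <- E. auto.
Qed.

Lemma Hint_plus f g : hint_able f -> hint_able g ->
  Hint (fun u => f u + g u)%C = (Hint f + Hint g)%C.
Proof.
  intros Hf Hg. apply is_hint_Hint. intros eps He.
  destruct (hint_able_spec _ Hf (eps/2) ltac:(lra)) as [M1 [HM1 B1]].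
  destruct (hint_able_spec _ Hg (eps/2) ltac:(lra)) as [M2 [HM2 B2]].
  exists (M1 + M2); split; [lra|]. intros b Hb.
  specialize (B1 b ltac:(lra)). specialize (B2 b ltac:(lra)).
  rewrite Cint_plus by (apply hcont_Cint; try apply Hf; try apply Hg; lra).
  replace (Cint f 0 b + Cint g 0 b - (Hint f + Hint g))%C
    with ((Cint f 0 b - Hint f) + (Cint g 0 b - Hint g))%C by ring.
  eapply Rle_trans; [apply Cmod_triangle|]. lra.
Qed.

Lemma Hint_scal c f : hint_able f -> Hint (fun u => c * f u)%C = (c * Hint f)%C.
Proof.
  intros Hf. apply is_hint_Hint. intros eps He.
  assert (Hc := Cmod_ge_0 c).
  destruct (hint_able_spec _ Hf (eps / (Cmod c + 1)) ltac:(apply Rdiv_lt_0_compat; lra)) as [M1 [HM1 B1]].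
  exists M1; split; [lra|]. intros b Hb. specialize (B1 b Hb).
  rewrite Cint_scal by (apply hcont_Cint; try apply Hf; lra).
  replace (c * Cint f 0 b - c * Hint f)%C with (c * (Cint f 0 b - Hint f))%C by ring.
  rewrite Cmod_mult. apply Rle_trans with (Cmod c * (eps / (Cmod c + 1))).
  - apply Rmult_le_compat_l; assumption.
  - apply Rmult_le_reg_r with (Cmod c + 1); [lra|].
    unfold Rdiv. rewrite Rmult_assoc, Rmult_assoc, Rinv_l by lra. nra.
Qed.

Lemma Hint_minus f g : hint_able f -> hint_able g ->
  Hint (fun u => f u - g u)%C = (Hint f - Hint g)%C.
Proof.
  intros Hf Hg.
  replace (Hint f - Hint g)%C with (Hint f + (-(1)) * Hint g)%C by ring.
  rewrite <- (Hint_scal _ _ Hg), <- (Hint_plus _ _ Hf (hint_able_scal _ _ Hg)).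
  apply Hint_ext. intros t _. ring.
Qed.

Lemma hint_able_minus f g : hint_able f -> hint_able g -> hint_able (fun u => f u - g u)%C.
Proof.
  intros Hf Hg. apply (hint_able_ext (fun u => f u + (-(1)) * g u)%C); [intros; ring|].
  apply hint_able_plus; [assumption|now apply hint_able_scal].
Qed.

Lemma Hint_FTC (F f : R -> C) K del : 0 < del ->
  (forall t, 0 <= t -> rder F t (f t)) -> hcont f ->
  (forall t, 0 <= t -> Cmod (F t) <= K * exp (- del * t)) ->
  is_hint f (- F 0)%C.
Proof.
  intros Hd HF Hf HB eps He.
  assert (HK : 0 <= K).
  { specialize (HB 0 (Rle_refl 0)). rewrite Rmult_0_r, exp_0, Rmult_1_r in HB.
    apply Rle_trans with (2 := HB). apply Cmod_ge_0. }
  destruct (exp_decay_small K del eps HK Hd He) as [M [HM B]].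
  exists M; split; [assumption|]. intros b Hb.
  rewrite (Cint_FTC F f 0 b).
  - replace (F b - F 0 - - F 0)%C with (F b) by ring.
    eapply Rle_trans; [apply HB; lra|]. now apply B.
  - intros t Ht. apply HF. rewrite Rmin_left in Ht; lra.
  - apply hcont_Cint; try assumption; lra.
Qed.

(** All terms share the decay rate [del] and have summable constants, so the remainder after n terms
    is dominated with the tail of [M] as constant; its integral is at most that tail divided by
    [del]. *)
Lemma Hint_series (f : nat -> R -> C) (F : R -> C) (M : nat -> R) (del : R) :
  0 < del -> (forall n, hcont (f n)) -> hcont F ->
  (forall n t, 0 <= t -> Cmod (f n t) <= M n * exp (- del * t)) -> ex_series M ->
  (forall t, 0 <= t -> cseries (fun n => f n t) (F t)) ->
  hint_able F /\ cseries (fun n => Hint (f n)) (Hint F).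
Proof.
  intros Hd Hf HF Hb EM Hs.
  assert (Hfn : forall n, hdom (f n) (M n) del) by (intros n; split; [assumption|split; [apply Hf|apply Hb]]).
  assert (HM0 : forall n, 0 <= M n) by (intros n; apply (hdom_K_ge0 _ _ _ (Hfn n))).
  assert (Eb : forall t, ex_series (fun n => M n * exp (- del * t))).
  { intros t. apply (ex_series_scal_r); exact EM. }
  assert (Sb : forall t, Series (fun n => M n * exp (- del * t)) = Series M * exp (- del * t))
    by (intros t; apply Series_scal_r).
  assert (sb : forall t n, sum_n (fun n => M n * exp (- del * t)) n = sum_n M n * exp (- del * t)).
  { intros t n. apply (sum_n_mult_r (K := R_Ring)). }
  assert (HFd : hdom F (Series M) del).
  { split; [assumption|split; [assumption|]]. intros t Ht. rewrite <- Sb.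
    apply (cseries_Cmod_le _ _ _ (fun n => Hb n t Ht) (Eb t) (Hs t Ht)). }
  assert (HFa := hdom_able _ _ _ HFd). split; [assumption|].
  assert (Hpart : forall n, hint_able (fun t => csum_n (fun k => f k t) n) /\
            Hint (fun t => csum_n (fun k => f k t) n) = csum_n (fun k => Hint (f k)) n).
  { induction n as [|n [IH1 IH2]].
    - split.
      + apply (hint_able_ext (f 0%nat)); [intros; now rewrite csum_n_0|]. eapply hdom_able, Hfn.
      + rewrite csum_n_0. apply Hint_ext. intros; now rewrite csum_n_0.
    - assert (E : forall t, csum_n (fun k => f k t) (S n) = (csum_n (fun k => f k t) n + f (S n) t)%C)
        by (intros; apply csum_n_S).
      assert (A := hdom_able _ _ _ (Hfn (S n))).
      split.
      + apply (hint_able_ext (fun t => csum_n (fun k => f k t) n + f (S n) t)%C); [intros; now rewrite E|].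
        now apply hint_able_plus.
      + rewrite csum_n_S, <- IH2, <- Hint_plus by assumption. apply Hint_ext. intros; apply E. }
  apply cseries_eps. intros eps He.
  destruct (Series_tail_small M (eps * del) EM ltac:(now apply Rmult_lt_0_compat)) as [N HN].
  exists N. intros n Hn. destruct (Hpart n) as [P1 P2].
  rewrite <- P2, Cmod_minus_sym, <- Hint_minus by assumption.
  assert (D : hdom (fun t => F t - csum_n (fun k => f k t) n)%C (Series M - sum_n M n) del).
  { split; [assumption|split].
    - apply hcont_minus; [assumption|apply P1].
    - intros t Ht. rewrite Rmult_minus_distr_r, <- Sb, <- sb.
      apply (cseries_tail_le _ _ _ (fun n => Hb n t Ht) (Eb t) (Hs t Ht)). }
  eapply Rle_lt_trans; [apply (Hint_Cmod_le _ _ _ D)|].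
  specialize (HN n Hn). apply Rmult_lt_reg_r with del; [assumption|].
  unfold Rdiv. rewrite Rmult_assoc, Rinv_l, Rmult_1_r by lra.
  eapply Rle_lt_trans; [apply Rle_abs|exact HN].
Qed.

(** * Laplace transforms *)

Definition lt_fun (g : R -> C) (s : C) (u : R) : C := (cexp (- s * RtoC u) * g u)%C.
Definition LT (g : R -> C) (s : C) : C := Hint (lt_fun g s).

Definition exp_order (g : R -> C) (K p : R) : Prop :=
  hcont g /\ forall t, 0 <= t -> Cmod (g t) <= K * exp (p * t).

Lemma Cmod_lt_fun g s u : Cmod (lt_fun g s u) = exp (- Re s * u) * Cmod (g u).
Proof.
  unfold lt_fun. rewrite Cmod_mult, Cmod_cexp. f_equal. f_equal. autorewrite with cparts. ring.
Qed.

Lemma hcont_lt_fun g s : hcont g -> hcont (lt_fun g s).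
Proof. intros H t Ht. apply ccont_mult; [apply ccont_cexp_scal|auto]. Qed.

Lemma exp_order_hdom g K p s : exp_order g K p -> p < Re s -> hdom (lt_fun g s) K (Re s - p).
Proof.
  intros [Hc H] Hs. split; [lra|split].
  - now apply hcont_lt_fun.
  - intros t Ht. rewrite Cmod_lt_fun.
    replace (- (Re s - p) * t) with (- Re s * t + p * t) by ring. rewrite exp_plus.
    specialize (H t Ht). assert (E := exp_pos (- Re s * t)). nra.
Qed.

Lemma LT_able g K p s : exp_order g K p -> p < Re s -> hint_able (lt_fun g s).
Proof. intros H Hs. eapply hdom_able, exp_order_hdom; eassumption. Qed.

Lemma exp_ge_sq (y : R) : 0 <= y -> y ^ 2 <= 4 * exp y.
Proof.
  intros Hy.
  assert (H : 1 + y / 2 <= exp (y / 2)) by apply exp_ineq1_le.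
  replace (exp y) with (exp (y / 2) * exp (y / 2)) by (rewrite <- exp_plus; f_equal; field).
  nra.
Qed.

(** Differentiation under the integral: the derivative is minus the transform of u g(u), and the
    second-order estimate of the exponential makes the remainder quadratic in h. *)
Lemma LT_cder g K p s : exp_order g K p -> p < Re s -> exists l, cder (LT g) s l.
Proof.
  (* The gap is cut in three: one part absorbs the factor u^2 through y^2 <= 4 e^y, one absorbs
     e^(|h| u), and one remains as decay of the remainder. *)
  intros Hg Hs. set (d := (Re s - p) / 3). assert (Hd : 0 < d) by (unfold d; lra).
  assert (HK : 0 <= K).
  { destruct Hg as [_ H]. specialize (H 0 (Rle_refl 0)). rewrite Rmult_0_r, exp_0, Rmult_1_r in H.
    apply Rle_trans with (2 := H). apply Cmod_ge_0. }
  assert (Ht : exp_order (fun u => RtoC u * g u)%C (K / d) (p + d)).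
  { destruct Hg as [Hc H]. split.
    - intros t Ht. apply ccont_mult; [apply ccont_RtoC, continuous_id|auto].
    - intros t Ht. rewrite Cmod_mult, Cmod_R, Rabs_right by lra.
      assert (H1 : t <= exp (d * t) / d).
      { apply Rmult_le_reg_r with d; [assumption|]. unfold Rdiv. rewrite Rmult_assoc, Rinv_l by lra.
        assert (Q := exp_ineq1_le (d * t)). lra. }
      replace ((p + d) * t) with (d * t + p * t) by ring. rewrite exp_plus.
      apply Rle_trans with (exp (d * t) / d * (K * exp (p * t))).
      + apply Rmult_le_compat; [assumption|apply Cmod_ge_0|assumption|auto].
      + right. field. lra. }
  exists (- LT (fun u => RtoC u * g u)%C s)%C.
  apply cder_eps. intros eps He.
  set (Q := 4 * K / d ^ 2 / d + 1).
  assert (Hd2 : 0 < d ^ 2) by now apply pow_lt.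
  assert (HQ : 0 < Q).
  { unfold Q. assert (0 <= 4 * K / d ^ 2 / d); [|lra].
    unfold Rdiv. repeat apply Rmult_le_pos; try lra; left; apply Rinv_0_lt_compat; assumption. }
  exists (Rmin d (eps / Q)); split; [apply Rmin_pos; [assumption|now apply Rdiv_lt_0_compat]|].
  intros w Hw. set (h := (w - s)%C) in *.
  assert (W1 := Rlt_le_trans _ _ _ Hw (Rmin_l _ _)).
  assert (W2 := Rlt_le_trans _ _ _ Hw (Rmin_r _ _)).
  assert (Hws : Re w >= Re s - d).
  { assert (R1 := re_le_Cmod h). unfold h in R1 at 1. rewrite Re_minus in R1.
    assert (R2 := Rle_abs (- (Re w - Re s))). rewrite Rabs_Ropp in R2. lra. }
  assert (A1 := LT_able g K p w Hg ltac:(unfold d in *; lra)).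
  assert (A2 := LT_able g K p s Hg Hs).
  assert (A3 := LT_able _ _ _ s Ht ltac:(unfold d in *; lra)).
  set (r := fun u => (lt_fun g w u - lt_fun g s u + h * lt_fun (fun u => RtoC u * g u)%C s u)%C).
  assert (E : (LT g w - LT g s - - LT (fun u => RtoC u * g u)%C s * h)%C = Hint r).
  { unfold r, LT. rewrite Hint_plus, Hint_minus, Hint_scal; try assumption; [ring| |].
    - now apply hint_able_minus.
    - now apply hint_able_scal. }
  fold h. rewrite E.
  assert (Dr : hdom r (Cmod h ^ 2 * (4 * K / d ^ 2)) d).
  { split; [assumption|split].
    - unfold r. apply hcont_plus; [apply hcont_minus|]; [apply A1|apply A2|].
      apply hcont_mult; [intros t _; apply ccont_const|apply A3].
    - intros u Hu.
      replace (r u) with (cexp (- s * RtoC u) * (cexp (- h * RtoC u) - 1 - (- h * RtoC u)) * g u)%C.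
      2:{ unfold r, lt_fun. replace (- w * RtoC u)%C with (- s * RtoC u + - h * RtoC u)%C by (unfold h; ring).
          rewrite cexp_plus. ring. }
      rewrite !Cmod_mult, Cmod_cexp.
      replace (Re (- s * RtoC u)%C) with (- Re s * u) by (autorewrite with cparts; ring).
      assert (B1 := cexp_m1_lin_le (- h * RtoC u)).
      rewrite Cmod_mult, Cmod_opp, Cmod_R, (Rabs_right u) in B1 by lra.
      assert (B2 : (d * u) ^ 2 <= 4 * exp (d * u)) by (apply exp_ge_sq; nra).
      assert (B3 : exp (Cmod h * u) <= exp (d * u)) by (apply exp_le_compat; nra).
      assert (B4 := proj2 Hg u Hu).
      assert (B5 : (Cmod h * u) ^ 2 * exp (Cmod h * u) <= Cmod h ^ 2 * (4 / d ^ 2) * exp (d * u) * exp (d * u)).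
      { apply Rmult_le_compat; [apply pow2_ge_0|left; apply exp_pos| |assumption].
        rewrite Rpow_mult_distr, Rmult_assoc. apply Rmult_le_compat_l; [apply pow2_ge_0|].
        apply Rmult_le_reg_l with (d ^ 2); [assumption|].
        replace (d ^ 2 * (4 / d ^ 2 * exp (d * u))) with (4 * exp (d * u)) by (field; lra).
        rewrite <- Rpow_mult_distr. exact B2. }
      apply Rle_trans with (exp (- Re s * u) * (Cmod h ^ 2 * (4 / d ^ 2) * exp (d * u) * exp (d * u)) * (K * exp (p * u))).
      + apply Rmult_le_compat; [|apply Cmod_ge_0| |assumption].
        * apply Rmult_le_pos; [left; apply exp_pos|apply Cmod_ge_0].
        * apply Rmult_le_compat_l; [left; apply exp_pos|]. eapply Rle_trans; [exact B1|exact B5].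
      + right. transitivity (Cmod h ^ 2 * (4 * K / d ^ 2) * (exp (- Re s * u) * exp (d * u) * exp (d * u) * exp (p * u))).
        * field. lra.
        * rewrite <- !exp_plus. f_equal. f_equal. unfold d. field. }
  eapply Rle_trans; [apply (Hint_Cmod_le _ _ _ Dr)|].
  replace (Cmod h ^ 2 * (4 * K / d ^ 2) / d) with ((4 * K / d ^ 2 / d) * Cmod h * Cmod h) by (field; lra).
  apply Rmult_le_compat_r; [apply Cmod_ge_0|].
  apply Rle_trans with (Q * Cmod h); [apply Rmult_le_compat_r; [apply Cmod_ge_0|unfold Q; lra]|].
  apply Rmult_lt_compat_l with (r := Q) in W2; [|assumption].
  replace (Q * (eps / Q)) with eps in W2 by (field; lra). lra.
Qed.

(** * Integrals over the line *)

Definition Rint (f : R -> C) : C := (Hint f + Hint (fun u => f (- u)%R))%C.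

Definition rdom (f : R -> C) (K del : R) : Prop :=
  0 < del /\ (forall t, ccont f t) /\ forall t, Cmod (f t) <= K * exp (- del * Rabs t).

Lemma ccont_flip f t : ccont f (- t) -> ccont (fun u => f (- u)) t.
Proof.
  apply (ccont_comp f Ropp). apply (continuous_opp (V := R_NormedModule)), continuous_id.
Qed.

Lemma rdom_right f K del : rdom f K del -> hdom f K del.
Proof.
  intros (H1 & H2 & H3). split; [assumption|split; [intros t _; apply H2|]].
  intros t Ht. specialize (H3 t). rewrite Rabs_right in H3 by lra. exact H3.
Qed.

Lemma rdom_left f K del : rdom f K del -> hdom (fun u => f (- u)) K del.
Proof.
  intros (H1 & H2 & H3). split; [assumption|split; [intros t _; apply ccont_flip, H2|]].
  intros t Ht. specialize (H3 (- t)). rewrite Rabs_Ropp, Rabs_right in H3 by lra. exact H3.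
Qed.

Lemma Cint_shift f c a b : (forall t, ccont f t) -> Cint (fun u => f (u + c)) a b = Cint f (a + c) (b + c).
Proof.
  intros Hf. apply C_ext; unfold Cint; simpl.
  - assert (Q := RInt_comp_lin (V := R_CompleteNormedModule) (fun u => Re (f u)) 1 c a b).
    rewrite !Rmult_1_l in Q. rewrite <- Q.
    + apply RInt_ext. intros t _. unfold scal; simpl; unfold mult; simpl. now rewrite !Rmult_1_l.
    + apply (ccont_ex_RInt f). intros; apply Hf.
  - assert (Q := RInt_comp_lin (V := R_CompleteNormedModule) (fun u => Im (f u)) 1 c a b).
    rewrite !Rmult_1_l in Q. rewrite <- Q.
    + apply RInt_ext. intros t _. unfold scal; simpl; unfold mult; simpl. now rewrite !Rmult_1_l.
    + apply (ccont_ex_RInt f). intros; apply Hf.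
Qed.

Lemma Cint_flip f a b : (forall t, ccont f t) -> Cint (fun u => f (- u)) a b = Cint f (- b) (- a).
Proof.
  intros Hf. apply C_ext; unfold Cint; simpl.
  - assert (Q := RInt_comp_lin (V := R_CompleteNormedModule) (fun u => Re (f u)) (-1) 0 a b).
    replace (-1 * a + 0) with (- a) in Q by ring. replace (-1 * b + 0) with (- b) in Q by ring.
    rewrite <- (opp_RInt_swap (V := R_CompleteNormedModule) (fun u => Re (f u)) (- a) (- b)) by (apply (ccont_ex_RInt f); intros; apply Hf).
    rewrite <- Q by (apply (ccont_ex_RInt f); intros; apply Hf).
    rewrite <- (RInt_opp (V := R_CompleteNormedModule)).
    + apply RInt_ext. intros t _. unfold scal, opp; simpl; unfold mult; simpl.
      replace (-1 * t + 0) with (- t) by ring. ring.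
    + apply (ex_RInt_scal (V := R_CompleteNormedModule)), (ccont_ex_RInt (fun t => f (-1 * t + 0))). intros t _.
      apply (ccont_ext (fun u => f (- u))); [intros u; f_equal; ring|]. apply ccont_flip, Hf.
  - assert (Q := RInt_comp_lin (V := R_CompleteNormedModule) (fun u => Im (f u)) (-1) 0 a b).
    replace (-1 * a + 0) with (- a) in Q by ring. replace (-1 * b + 0) with (- b) in Q by ring.
    rewrite <- (opp_RInt_swap (V := R_CompleteNormedModule) (fun u => Im (f u)) (- a) (- b)) by (apply (ccont_ex_RInt f); intros; apply Hf).
    rewrite <- Q by (apply (ccont_ex_RInt f); intros; apply Hf).
    rewrite <- (RInt_opp (V := R_CompleteNormedModule)).
    + apply RInt_ext. intros t _. unfold scal, opp; simpl; unfold mult; simpl.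
      replace (-1 * t + 0) with (- t) by ring. ring.
    + apply (ex_RInt_scal (V := R_CompleteNormedModule)), (ccont_ex_RInt (fun t => f (-1 * t + 0))). intros t _.
      apply (ccont_ext (fun u => f (- u))); [intros u; f_equal; ring|]. apply ccont_flip, Hf.
Qed.

Lemma rdom_shift f K del c : rdom f K del -> rdom (fun u => f (u + c)) (K * exp (del * Rabs c)) del.
Proof.
  intros H. assert (HK := hdom_K_ge0 _ _ _ (rdom_right _ _ _ H)). destruct H as (H1 & H2 & H3).
  split; [assumption|split].
  - intros t. apply (ccont_comp f (fun u => u + c)); [|apply H2].
    apply (continuous_plus (V := R_NormedModule)); [apply continuous_id|apply continuous_const].
  - intros t. eapply Rle_trans; [apply H3|]. rewrite Rmult_assoc, <- exp_plus.
    apply Rmult_le_compat_l; [assumption|]. apply exp_le_compat.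
    assert (Q := Rabs_triang (t + c) (- c)). rewrite Rabs_Ropp in Q.
    replace (t + c + - c) with t in Q by ring. nra.
Qed.

(** Translation in u is scaling in t = e^u. Both sides are limits of the integral over
    [-b + c, b + c], split once at 0 and once at c. *)
Lemma Rint_shift f K del c : rdom f K del -> Rint (fun u => f (u + c)) = Rint f.
Proof.
  intros Hf. assert (Hg := rdom_shift _ _ _ c Hf).
  assert (I1 := proj1 (hdom_is_hint _ _ _ (rdom_right _ _ _ Hf))).
  assert (I2 := proj1 (hdom_is_hint _ _ _ (rdom_left _ _ _ Hf))).
  assert (I3 := proj1 (hdom_is_hint _ _ _ (rdom_right _ _ _ Hg))).
  assert (I4 := proj1 (hdom_is_hint _ _ _ (rdom_left _ _ _ Hg))).
  destruct Hf as (_ & Hf & _). destruct Hg as (_ & Hg & _). unfold Rint.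
  set (L1 := Hint f) in *. set (L2 := Hint (fun u => f (- u))) in *.
  set (L3 := Hint (fun u => f (u + c))) in *. set (L4 := Hint (fun u => f (- u + c))) in *.
  assert (E : Cmod (L3 + L4 - (L1 + L2)) = 0).
  { apply Rle_antisym; [|apply Cmod_ge_0]. apply le_epsilon. intros eps He. rewrite Rplus_0_l.
    destruct (I1 (eps/4) ltac:(lra)) as [M1 [_ B1]]. destruct (I2 (eps/4) ltac:(lra)) as [M2 [_ B2]].
    destruct (I3 (eps/4) ltac:(lra)) as [M3 [_ B3]]. destruct (I4 (eps/4) ltac:(lra)) as [M4 [_ B4]].
    set (b := Rmax (Rmax M1 M2) (Rmax M3 M4) + Rabs c).
    assert (m1 := Rmax_l M1 M2). assert (m2 := Rmax_r M1 M2). assert (m3 := Rmax_l M3 M4).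
    assert (m4 := Rmax_r M3 M4). assert (m5 := Rmax_l (Rmax M1 M2) (Rmax M3 M4)).
    assert (m6 := Rmax_r (Rmax M1 M2) (Rmax M3 M4)).
    assert (Rc1 := Rle_abs c). assert (Rc2 := Rle_abs (- c)). rewrite Rabs_Ropp in Rc2.
    specialize (B1 (b + c) ltac:(unfold b; lra)). specialize (B2 (b - c) ltac:(unfold b; lra)).
    specialize (B3 b ltac:(unfold b; lra)). specialize (B4 b ltac:(unfold b; lra)).
    assert (Q1 : Cint (fun u => f (- u + c)) 0 b = Cint f (- b + c) c).
    { rewrite (Cint_flip (fun u => f (u + c)) 0 b) by assumption.
      rewrite Cint_shift by assumption. f_equal. ring. }
    assert (Q2 : Cint (fun u => f (- u)) 0 (b - c) = Cint f (- b + c) 0).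
    { rewrite Cint_flip by assumption. f_equal; ring. }
    rewrite Cint_shift, Rplus_0_l in B3 by assumption. rewrite Q1 in B4. rewrite Q2 in B2.
    assert (S1 := Cint_Chasles f (- b + c) 0 (b + c) ltac:(auto) ltac:(auto)).
    assert (S2 := Cint_Chasles f (- b + c) c (b + c) ltac:(auto) ltac:(auto)).
    replace (L3 + L4 - (L1 + L2))%C with
      (((Cint f 0 (b + c) - L1) + (Cint f (- b + c) 0 - L2)) - ((Cint f c (b + c) - L3) + (Cint f (- b + c) c - L4))
       + ((Cint f (- b + c) c + Cint f c (b + c)) - (Cint f (- b + c) 0 + Cint f 0 (b + c))))%C by ring.
    rewrite S1, S2.
    replace (Cint f (- b + c) (b + c) - Cint f (- b + c) (b + c))%C with (RtoC 0) by ring.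
    rewrite Cplus_0_r. eapply Rle_trans; [apply Cmod_triangle_minus|].
    assert (T1 := Cmod_triangle (Cint f 0 (b + c) - L1) (Cint f (- b + c) 0 - L2)).
    assert (T2 := Cmod_triangle (Cint f c (b + c) - L3) (Cint f (- b + c) c - L4)). lra. }
  apply Cmod_eq_0 in E. 
  replace (L3 + L4)%C with ((L3 + L4 - (L1 + L2)) + (L1 + L2))%C by ring. rewrite E. ring.
Qed.

(** * Convergence of Hurwitz-type series *)

Lemma ex_series_bounded (a : nat -> R) (B : R) :
  (forall n, 0 <= a n) -> (forall n, sum_n a n <= B) -> ex_series a.
Proof.
  intros Ha HB. destruct (ex_finite_lim_seq_incr (sum_n a) B) as [l Hl].
  - intros n. rewrite sum_Sn. unfold plus; simpl. generalize (Ha (S n)); lra.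
  - exact HB.
  - now exists l.
Qed.

Lemma ex_series_compare (a b : nat -> R) : (forall n, 0 <= a n <= b n) -> ex_series b -> ex_series a.
Proof.
  intros H Eb. apply (ex_series_le (K := R_AbsRing) (V := R_CompleteNormedModule) a b); [|exact Eb].
  intros n. change (Rabs (a n) <= b n). rewrite Rabs_right; [apply H|apply Rle_ge, H].
Qed.

(** Mean value theorem on [y, y + 1]; the right side telescopes in [ex_series_hurwitz]. *)
Lemma Rpower_step (p y : R) : 1 < p -> 0 < y ->
  (p - 1) * Rpower (y + 1) (- p) <= Rpower y (1 - p) - Rpower (y + 1) (1 - p).
Proof.
  intros Hp Hy.
  destruct (MVT_gen (fun z => Rpower z (1 - p)) y (y + 1) (fun z => (1 - p) * Rpower z (- p))) as [c [Hc E]].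
  - intros z Hz. rewrite Rmin_left, Rmax_right in Hz by lra.
    apply is_derive_Reals.
    replace ((1 - p) * Rpower z (- p)) with ((1 - p) * Rpower z (1 - p - 1)) by (f_equal; f_equal; ring).
    apply (derivable_pt_lim_power z (1 - p)). lra.
  - intros z Hz. rewrite Rmin_left, Rmax_right in Hz by lra.
    apply continuity_pt_filterlim.
    apply (ex_derive_continuous (V := R_NormedModule) (fun z => Rpower z (1 - p))).
    exists ((1 - p) * Rpower z (1 - p - 1)). apply is_derive_Reals.
    apply (derivable_pt_lim_power z (1 - p)). lra.
  - rewrite Rmin_left, Rmax_right in Hc by lra.
    replace (y + 1 - y) with 1 in E by ring.
    assert (Q : Rpower (y + 1) (- p) <= Rpower c (- p)).
    { unfold Rpower. apply exp_le_compat.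
      assert (ln c <= ln (y + 1)) by (apply ln_le; lra). nra. }
    nra.
Qed.

Lemma ex_series_hurwitz (p al : R) : 1 < p -> 0 < al ->
  ex_series (fun n => Rpower (INR n + al) (- p)).
Proof.
  intros Hp Hal. apply ex_series_incr_1.
  apply ex_series_bounded with (B := Rpower al (1 - p) / (p - 1)).
  - intros n. left. apply exp_pos.
  - intros n. apply Rle_trans with ((Rpower al (1 - p) - Rpower (INR (S n) + al) (1 - p)) / (p - 1)).
    + induction n as [|n IH].
      * rewrite sum_O. assert (Q := Rpower_step p al Hp Hal). simpl INR. rewrite (Rplus_comm 1).
        apply Rmult_le_reg_r with (p - 1); [lra|]. unfold Rdiv. rewrite Rmult_assoc, Rinv_l by lra. lra.
      * rewrite sum_Sn. unfold plus; simpl.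
        assert (Q := Rpower_step p (INR (S n) + al) Hp ltac:(assert (H := pos_INR (S n)); lra)).
        replace (INR (S n) + al + 1) with (INR (S (S n)) + al) in Q by (rewrite (S_INR (S n)); ring).
        change (match n with 0%nat => 1 | S _ => INR n + 1 end) with (INR (S n)) in *.
        change (INR (S n) + 1) with (INR (S (S n))) in *.
        apply Rle_trans with ((Rpower al (1 - p) - Rpower (INR (S n) + al) (1 - p)) / (p - 1)
           + (Rpower (INR (S n) + al) (1 - p) - Rpower (INR (S (S n)) + al) (1 - p)) / (p - 1)).
        -- apply Rplus_le_compat; [exact IH|].
           apply Rmult_le_reg_r with (p - 1); [lra|]. unfold Rdiv. rewrite Rmult_assoc, Rinv_l by lra. lra.
        -- right. field. lra.
    + apply Rmult_le_compat_r; [left; apply Rinv_0_lt_compat; lra|].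
      assert (H : 0 < Rpower (INR (S n) + al) (1 - p)) by apply exp_pos. lra.
Qed.

Lemma Rpower_m2 (y : R) : 0 < y -> Rpower y (- (2)) = / y ^ 2.
Proof. intros Hy. rewrite Rpower_Ropp. f_equal. apply (Rpower_pow 2 y Hy). Qed.

Lemma ex_series_inv_sq : ex_series (fun n => / (INR n + 1) ^ 2).
Proof.
  apply ex_series_ext with (2 := ex_series_hurwitz 2 1 ltac:(lra) ltac:(lra)).
  intros n. apply Rpower_m2. assert (H := pos_INR n); lra.
Qed.

(** * The Poisson kernel *)

(** The terms n = m and n = -(m + 1) of the sum of 1 / (t^2 + (n + th)^2) over all integers n,
    paired so that the index runs over [nat]. *)
Definition lat_term (th t : R) (m : nat) : R :=
  / (t ^ 2 + (INR m + th) ^ 2) + / (t ^ 2 + (INR m + 1 - th) ^ 2).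

(** The closed form of the lattice sum. Multiplied by t / PI it is the Poisson kernel of the unit
    disc at radius e^(-2 pi t) and angle 2 pi th. *)
Definition poisson (th t : R) : R := PI * sinh (2 * PI * t) / (t * (cosh (2 * PI * t) - cos (2 * PI * th))).

Lemma sinh_dbl (y : R) : sinh (2 * y) = 2 * sinh y * cosh y.
Proof.
  unfold sinh, cosh. replace (2 * y) with (y + y) by ring. rewrite Ropp_plus_distr, !exp_plus. field.
Qed.

Lemma cosh_dbl (y : R) : cosh (2 * y) = 1 + 2 * sinh y ^ 2.
Proof.
  unfold sinh, cosh. replace (2 * y) with (y + y) by ring. rewrite Ropp_plus_distr, !exp_plus.
  assert (H : exp y * exp (- y) = 1) by (rewrite <- exp_plus, Rplus_opp_r; apply exp_0). nra.
Qed.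

Lemma cosh2_sinh2 (y : R) : cosh y ^ 2 = 1 + sinh y ^ 2.
Proof.
  unfold sinh, cosh.
  assert (H : exp y * exp (- y) = 1) by (rewrite <- exp_plus, Rplus_opp_r; apply exp_0). nra.
Qed.

Lemma sinh_gt_0 (y : R) : 0 < y -> 0 < sinh y.
Proof. intros Hy. unfold sinh. assert (exp (- y) < exp y) by (apply exp_increasing; lra). lra. Qed.

Lemma cosh_ge_1 (y : R) : 1 <= cosh y.
Proof.
  assert (H := cosh2_sinh2 y). assert (0 < cosh y) by (unfold cosh; generalize (exp_pos y) (exp_pos (- y)); lra).
  assert (0 <= sinh y ^ 2) by apply pow2_ge_0. nra.
Qed.

Lemma cosh_gt_1 (y : R) : 0 < y -> 1 < cosh y.
Proof.
  intros Hy. assert (H := cosh2_sinh2 y). assert (H1 := cosh_ge_1 y). assert (H2 := sinh_gt_0 y Hy). nra.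
Qed.

Lemma poisson_den_pos (th t : R) : 0 < t -> 0 < cosh (2 * PI * t) - cos (2 * PI * th).
Proof.
  intros Ht. assert (Hpi := PI_RGT_0).
  assert (H := cosh_gt_1 (2 * PI * t) ltac:(apply Rmult_lt_0_compat; lra)).
  assert (H1 := COS_bound (2 * PI * th)). lra.
Qed.

Lemma poisson_doubling (th t : R) : 0 < t ->
  poisson th t = / 4 * (poisson (th / 2) (t / 2) + poisson ((th + 1) / 2) (t / 2)).
Proof.
  intros Ht. assert (Hpi := PI_RGT_0).
  assert (D := poisson_den_pos th t Ht).
  assert (D1 := poisson_den_pos (th / 2) (t / 2) ltac:(lra)).
  assert (D2 := poisson_den_pos ((th + 1) / 2) (t / 2) ltac:(lra)).
  unfold poisson.
  replace (2 * PI * (t / 2)) with (PI * t) in * by field.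
  replace (2 * PI * (th / 2)) with (PI * th) in * by field.
  replace (2 * PI * ((th + 1) / 2)) with (PI * th + PI) in * by field.
  rewrite neg_cos in *.
  replace (2 * PI * t) with (2 * (PI * t)) in * by ring.
  replace (2 * PI * th) with (2 * (PI * th)) in * by ring.
  rewrite sinh_dbl, cosh_dbl, cos_2a_cos in *.
  (* This is cosh 2a - cos 2b = 2 (cosh a - cos b) (cosh a + cos b); the two factors are the
     denominators on the right side, which thus becomes a partial fraction identity. *)
  replace (1 + 2 * sinh (PI * t) ^ 2 - (2 * cos (PI * th) * cos (PI * th) - 1))
    with (2 * ((cosh (PI * t) - cos (PI * th)) * (cosh (PI * t) - - cos (PI * th))))
    by (generalize (cosh2_sinh2 (PI * t)); nra).
  field. repeat split; lra.
Qed.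

Lemma lat_term_bound (th t : R) (m : nat) : 0 < t -> 0 <= th <= 1 ->
  0 <= lat_term th t (S m) <= 2 * / (INR m + 1) ^ 2.
Proof.
  intros Ht Hth. unfold lat_term. assert (Hm := pos_INR m). rewrite S_INR.
  assert (P1 : 0 < (INR m + 1) ^ 2) by (apply pow_lt; lra).
  assert (0 < t ^ 2) by now apply pow_lt.
  assert (Q1 : (INR m + 1) ^ 2 <= t ^ 2 + (INR m + 1 + th) ^ 2) by nra.
  assert (Q2 : (INR m + 1) ^ 2 <= t ^ 2 + (INR m + 1 + 1 - th) ^ 2) by nra.
  assert (R1 := Rinv_le_contravar _ _ P1 Q1). assert (R2 := Rinv_le_contravar _ _ P1 Q2).
  assert (0 < / (t ^ 2 + (INR m + 1 + th) ^ 2)) by (apply Rinv_0_lt_compat; lra).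
  assert (0 < / (t ^ 2 + (INR m + 1 + 1 - th) ^ 2)) by (apply Rinv_0_lt_compat; lra).
  lra.
Qed.

Lemma ex_series_lat (th t : R) : 0 < t -> 0 <= th <= 1 -> ex_series (lat_term th t).
Proof.
  intros Ht Hth. apply ex_series_incr_1.
  apply ex_series_compare with (b := fun m => 2 * / (INR m + 1) ^ 2).
  - intros m. now apply lat_term_bound.
  - apply (ex_series_scal_l (K := R_AbsRing) (V := R_NormedModule) 2). apply ex_series_inv_sq.
Qed.

Lemma Series_pairs (f : nat -> R) : ex_series f ->
  is_series (fun m => f (2 * m)%nat + f (2 * m + 1)%nat) (Series f).
Proof.
  intros Ef. apply Series_correct in Ef.
  assert (E : forall n, sum_n (fun m => f (2 * m)%nat + f (2 * m + 1)%nat) n = sum_n f (2 * n + 1)).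
  { induction n as [|n IH].
    - rewrite sum_O. change (2 * 0 + 1)%nat with 1%nat. rewrite sum_Sn, sum_O. reflexivity.
    - rewrite sum_Sn, IH. replace (2 * S n + 1)%nat with (S (S (2 * n + 1))) by lia.
      rewrite !sum_Sn. replace (2 * S n)%nat with (S (2 * n + 1)) by lia.
      replace (S (2 * n + 1) + 1)%nat with (S (S (2 * n + 1))) by lia.
      unfold plus; simpl. ring. }
  change (is_lim_seq (sum_n (fun m => f (2 * m)%nat + f (2 * m + 1)%nat)) (Series f)).
  apply (is_lim_seq_ext (fun n => sum_n f (2 * n + 1)%nat)); [intros; now rewrite E|].
  apply (is_lim_seq_subseq (sum_n f)); [|exact Ef].
  apply eventually_subseq. intros n. lia.
Qed.

(** The four lattice points belonging to the indices 2m and 2m + 1 are, after scaling by 2, those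
    belonging to the index m for th / 2 and for (th + 1) / 2. *)
Lemma lat_doubling (th t : R) : 0 < t -> 0 <= th <= 1 ->
  Series (lat_term th t) =
  / 4 * (Series (lat_term (th / 2) (t / 2)) + Series (lat_term ((th + 1) / 2) (t / 2))).
Proof.
  intros Ht Hth.
  assert (E1 := ex_series_lat (th / 2) (t / 2) ltac:(lra) ltac:(lra)).
  assert (E2 := ex_series_lat ((th + 1) / 2) (t / 2) ltac:(lra) ltac:(lra)).
  assert (H := Series_pairs _ (ex_series_lat th t Ht Hth)).
  apply is_series_unique in H. rewrite <- H, <- Series_plus, <- Series_scal_l by assumption.
  apply Series_ext. intros m. unfold lat_term. assert (Hm := pos_INR m).
  rewrite !plus_INR, !mult_INR. simpl INR.
  assert (0 < t ^ 2) by now apply pow_lt.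
  assert (P : forall y, t ^ 2 + y ^ 2 <> 0) by (intros y; assert (0 <= y ^ 2) by apply pow2_ge_0; lra).
  assert (Q : forall y, (t / 2) ^ 2 + y ^ 2 = (t ^ 2 + (2 * y) ^ 2) / 4) by (intros; field).
  rewrite !Q.
  replace (2 * (INR m + th / 2)) with (2 * INR m + th) by field.
  replace (2 * (INR m + 1 - th / 2)) with (2 * INR m + 1 + 1 - th) by field.
  replace (2 * (INR m + (th + 1) / 2)) with (2 * INR m + 1 + th) by field.
  replace (2 * (INR m + 1 - (th + 1) / 2)) with (2 * INR m + 1 - th) by field.
  field. repeat split; try (apply (P (2 * INR m + th))); apply P.
Qed.

Lemma cosh_m1_le (y : R) : 0 <= y -> cosh y - 1 <= y ^ 2 * exp y.
Proof.
  intros Hy. unfold cosh.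
  assert (H1 := cexp_m1_lin_le (RtoC y)). assert (H2 := cexp_m1_lin_le (RtoC (- y))).
  rewrite cexp_RtoC, <- !RtoC_minus, !Cmod_R in H1, H2.
  rewrite Rabs_Ropp in H2. rewrite (Rabs_right y) in H1, H2 by lra.
  assert (A1 := Rle_abs (exp y - 1 - y)). assert (A2 := Rle_abs (exp (- y) - 1 - - y)). lra.
Qed.

Lemma sinh_bounds (y : R) : 0 <= y -> y <= sinh y <= y + y ^ 3 * exp y.
Proof.
  intros Hy.
  destruct (MVT_gen sinh 0 y cosh) as [c [Hc E]].
  - intros z _. unfold sinh, cosh. auto_derive; trivial. field.
  - intros z _. apply continuity_pt_filterlim. apply (ex_derive_continuous (V := R_NormedModule)).
    unfold sinh. auto_derive; trivial.
  - rewrite Rmin_left, Rmax_right in Hc by lra. rewrite sinh_0, !Rminus_0_r in E. rewrite E.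
    assert (H1 := cosh_ge_1 c). assert (H2 := cosh_m1_le c ltac:(lra)).
    assert (H3 : c ^ 2 * exp c <= y ^ 2 * exp y).
    { apply Rmult_le_compat; [apply pow2_ge_0|left; apply exp_pos|apply pow_incr; lra|apply exp_le_compat; lra]. }
    split; [nra|]. replace (y + y ^ 3 * exp y) with ((1 + y ^ 2 * exp y) * y) by ring.
    apply Rmult_le_compat_r; lra.
Qed.

(** Near the origin both terms have the same singular part, since sinh a cosh a = a + O(a^3) and
    sinh^2 a + sin^2 b = a^2 + b^2 + O((a^2 + b^2)^2). For a > 1 each term is bounded separately.
    Only the uniformity of the constant in a and b matters. *)
Lemma kernel_bound (a b : R) : 0 < a -> 0 <= b <= PI / 2 ->
  Rabs (sinh a * cosh a / (a * (sinh a ^ 2 + sin b ^ 2)) - / (a ^ 2 + b ^ 2)) <= 400.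
Proof.
  intros Ha Hb. assert (Hs := sinh_gt_0 a Ha). assert (Hc := cosh_ge_1 a).
  assert (Sb : 0 <= sin b ^ 2) by apply pow2_ge_0.
  assert (Pb : 0 <= b ^ 2) by apply pow2_ge_0.
  assert (Pa : 0 < a ^ 2) by now apply pow_lt.
  assert (Ps : 0 < sinh a ^ 2) by now apply pow_lt.
  destruct (Rle_dec a 1) as [Ha1|Ha1].
  - assert (He : exp 1 <= 3) by apply exp_le_3.
    assert (He2 : exp (2 * a) <= 9).
    { apply Rle_trans with (exp (1 + 1)); [apply exp_le_compat; lra|]. rewrite exp_plus.
      assert (0 < exp 1) by apply exp_pos. nra. }
    assert (He1 : exp a <= 3) by (apply Rle_trans with (exp 1); [apply exp_le_compat|]; lra).
    destruct (sinh_bounds a ltac:(lra)) as [L1 U1].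
    destruct (sinh_bounds (2 * a) ltac:(lra)) as [L2 U2]. rewrite sinh_dbl in L2, U2.
    assert (Pa3 : 0 < a ^ 3) by now apply pow_lt.
    set (X := sinh a * cosh a) in *.
    assert (LX : a <= X) by (unfold X; nra).
    assert (UX : X <= a + 36 * a ^ 3).
    { unfold X. replace ((2 * a) ^ 3) with (8 * a ^ 3) in U2 by ring. nra. }
    set (Sa := sinh a ^ 2) in *. set (sb := sin b ^ 2) in *.
    assert (LS : a ^ 2 <= Sa) by (unfold Sa; apply pow_incr; lra).
    assert (US : Sa <= a ^ 2 + 15 * a ^ 4).
    { assert (sinh a <= a + 3 * a ^ 3) by nra.
      assert (Sa <= (a + 3 * a ^ 3) ^ 2) by (apply pow_incr; lra).
      assert (a ^ 6 <= a ^ 4).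
      { replace (a ^ 6) with (a ^ 4 * a ^ 2) by ring.
        assert (0 <= a ^ 4) by (apply pow_le; lra). assert (a ^ 2 <= 1) by nra. nra. }
      nra. }
    assert (Hpi4 := PI_4).
    assert (Hb2 : b ^ 2 <= 4) by nra.
    assert (Lb : b - b ^ 3 / 6 <= sin b).
    { destruct (Req_dec b 0) as [->|Hb0]; [rewrite sin_0; lra|].
      assert (Q := SIN (b) ltac:(lra) ltac:(lra)). destruct Q as [Q _].
      unfold sin_lb, sin_approx, sin_term in Q. simpl in Q.
      eapply Rle_trans; [|exact Q].
      (* The Taylor bound goes up to degree 7; b^5 / 120 - b^7 / 5040 is nonnegative because b^2 <=
         42, so it may be dropped. *)
      assert (b ^ 7 <= 42 * b ^ 5).
      { replace (b ^ 7) with (b ^ 5 * b ^ 2) by ring. assert (0 <= b ^ 5) by (apply pow_le; lra). nra. }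
      apply Rminus_le. field_simplify. nra. }
    assert (Ub : sin b <= b).
    { destruct (Req_dec b 0) as [->|Hb0]; [rewrite sin_0; lra|]. left. apply sin_lt_x. lra. }
    assert (Usb : sb <= b ^ 2).
    { unfold sb. assert (0 <= sin b) by (apply sin_ge_0; lra). nra. }
    assert (Lbb : b / 3 <= sin b).
    { eapply Rle_trans; [|exact Lb]. replace (b ^ 3) with (b * b ^ 2) by ring. nra. }
    assert (Lsb1 : b ^ 2 / 9 <= sb) by (unfold sb; nra).
    assert (Lsb2 : b ^ 2 - b ^ 4 / 3 <= sb).
    { unfold sb. assert (0 <= b - b ^ 3 / 6) by (replace (b ^ 3) with (b * b ^ 2) by ring; nra).
      assert ((b - b ^ 3 / 6) ^ 2 <= sin b ^ 2) by (apply pow_incr; lra).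
      assert (0 <= b ^ 6) by (apply pow_le; lra). nra. }
    clearbody X Sa sb.
    set (r := a ^ 2 + b ^ 2) in *. set (q := Sa + sb).
    (* The denominator satisfies q >= r / 9, and the numerator is shown below to be at most 37 a r^2
       in modulus; 9 * 37 = 333 is below 400. *)
    assert (Hr : 0 < r) by (unfold r; lra). assert (Hq : r / 9 <= q) by (unfold q, r; lra).
    assert (Hq0 : 0 < q) by lra.
    replace (X / (a * q) - / r) with ((X * r - a * q) / (a * q * r)) by (field; lra).
    rewrite Rabs_div; [|apply Rgt_not_eq; repeat apply Rmult_lt_0_compat; assumption].
    rewrite (Rabs_right (a * q * r)) by (left; repeat apply Rmult_lt_0_compat; assumption).
    apply Rmult_le_reg_r with (a * q * r); [repeat apply Rmult_lt_0_compat; assumption|].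
    unfold Rdiv. rewrite Rmult_assoc, Rinv_l, Rmult_1_r
      by (apply Rgt_not_eq; repeat apply Rmult_lt_0_compat; assumption).
    assert (Ha2 : a ^ 2 <= r) by (unfold r; lra). assert (Hb2' : b ^ 2 <= r) by (unfold r; lra).
    assert (Hb4 : b ^ 4 <= r ^ 2) by (replace (b ^ 4) with ((b ^ 2) ^ 2) by ring; apply pow_incr; lra).
    assert (Ha4 : a ^ 4 <= r ^ 2) by (replace (a ^ 4) with ((a ^ 2) ^ 2) by ring; apply pow_incr; lra).
    assert (Har : a * r ^ 2 / 9 <= a * q * r) by (replace (a * r ^ 2 / 9) with (a * r * (r / 9)) by field;
      replace (a * q * r) with (a * r * q) by ring; apply Rmult_le_compat_l; [nra|assumption]).
    assert (Ua : X * r - a * q <= 37 * (a * r ^ 2)).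
    { apply Rle_trans with ((a + 36 * a ^ 3) * r - a * (r - b ^ 4 / 3)).
      - apply Rplus_le_compat; [apply Rmult_le_compat_r; lra|].
        apply Ropp_le_contravar, Rmult_le_compat_l; [lra|unfold r, q; lra].
      - replace ((a + 36 * a ^ 3) * r - a * (r - b ^ 4 / 3)) with (a * (36 * (a ^ 2 * r) + b ^ 4 / 3)) by field.
        replace (37 * (a * r ^ 2)) with (a * (37 * r ^ 2)) by ring.
        apply Rmult_le_compat_l; [lra|]. assert (a ^ 2 * r <= r ^ 2) by (simpl; nra). lra. }
    assert (La : - (15 * (a * r ^ 2)) <= X * r - a * q).
    { apply Rle_trans with (a * r - a * (r + 15 * a ^ 4)).
      - replace (a * r - a * (r + 15 * a ^ 4)) with (- (15 * (a * a ^ 4))) by ring.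
        apply Ropp_le_contravar. apply Rmult_le_compat_l; [lra|]. apply Rmult_le_compat_l; lra.
      - apply Rplus_le_compat; [apply Rmult_le_compat_r; lra|].
        apply Ropp_le_contravar, Rmult_le_compat_l; [lra|unfold r, q; lra]. }
    assert (0 < a * r ^ 2) by (apply Rmult_lt_0_compat; [assumption|apply pow_lt; assumption]).
    apply Rabs_le. lra.
  - assert (Hsa : 1 <= sinh a) by (generalize (sinh_bounds a ltac:(lra)); lra).
    assert (Hcs : cosh a <= 2 * sinh a) by (generalize (cosh2_sinh2 a); nra).
    assert (Q1 : 0 < a * (sinh a ^ 2 + sin b ^ 2)) by (apply Rmult_lt_0_compat; lra).
    assert (B1 : 0 <= sinh a * cosh a / (a * (sinh a ^ 2 + sin b ^ 2)) <= 2).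
    { split.
      - apply Rmult_le_pos; [nra|left; now apply Rinv_0_lt_compat].
      - apply Rmult_le_reg_r with (1 := Q1). unfold Rdiv. rewrite Rmult_assoc, Rinv_l, Rmult_1_r by lra.
        assert (1 * (sinh a ^ 2 + sin b ^ 2) <= a * (sinh a ^ 2 + sin b ^ 2)) by (apply Rmult_le_compat_r; lra).
        nra. }
    assert (B2 : 0 <= / (a ^ 2 + b ^ 2) <= 1).
    { split; [left; apply Rinv_0_lt_compat; lra|]. rewrite <- Rinv_1. apply Rinv_le_contravar; nra. }
    apply Rabs_le. lra.
Qed.

(** For th <= 1/2 only the lattice point at distance th can approach 0. Its term 1 / (t^2 + th^2) is
    compared with the closed form through [kernel_bound] at a = PI t, b = PI th; its partner is at
    most 4, and the remaining terms have a uniform majorant. *)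
Lemma poisson_defect_half (th t : R) : 0 < t -> 0 <= th <= 1 / 2 ->
  Rabs (poisson th t - Series (lat_term th t)) <=
  400 * PI ^ 2 + 4 + Series (fun m => 2 * / (INR m + 1) ^ 2).
Proof.
  intros Ht Hth. assert (Hpi := PI_RGT_0).
  assert (Ha : 0 < PI * t) by (apply Rmult_lt_0_compat; lra).
  assert (K := kernel_bound (PI * t) (PI * th) Ha ltac:(split; nra)).
  assert (Es := ex_series_lat th t Ht ltac:(lra)).
  rewrite (Series_incr_1 _ Es).
  assert (Hs := sinh_gt_0 _ Ha).
  assert (Pt : 0 < t ^ 2) by now apply pow_lt. assert (Pth : 0 <= th ^ 2) by apply pow2_ge_0.
  assert (D := poisson_den_pos th t Ht).
  replace (2 * PI * t) with (2 * (PI * t)) in D by ring. replace (2 * PI * th) with (2 * (PI * th)) in D by ring.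
  rewrite cosh_dbl, cos_2a_sin in D.
  assert (E : poisson th t - / (t ^ 2 + th ^ 2) =
    PI ^ 2 * (sinh (PI * t) * cosh (PI * t) / (PI * t * (sinh (PI * t) ^ 2 + sin (PI * th) ^ 2)) -
              / ((PI * t) ^ 2 + (PI * th) ^ 2))).
  { unfold poisson.
    replace (2 * PI * t) with (2 * (PI * t)) by ring. replace (2 * PI * th) with (2 * (PI * th)) by ring.
    rewrite sinh_dbl, cosh_dbl, cos_2a_sin.
    replace ((PI * t) ^ 2 + (PI * th) ^ 2) with (PI ^ 2 * (t ^ 2 + th ^ 2)) by ring.
    field. repeat split; try lra; nra. }
  assert (B : Rabs (poisson th t - / (t ^ 2 + th ^ 2)) <= 400 * PI ^ 2).
  { rewrite E, Rabs_mult, (Rabs_right (PI ^ 2)) by (apply Rle_ge, pow2_ge_0).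
    rewrite Rmult_comm. apply Rmult_le_compat_r; [apply pow2_ge_0|exact K]. }
  assert (B0 : 0 <= lat_term th t 0 - / (t ^ 2 + th ^ 2) <= 4).
  { unfold lat_term. simpl INR. rewrite !Rplus_0_l.
    assert (Q : 1 / 4 <= t ^ 2 + (1 - th) ^ 2) by nra.
    assert (0 < / (t ^ 2 + (1 - th) ^ 2)) by (apply Rinv_0_lt_compat; lra).
    assert (/ (t ^ 2 + (1 - th) ^ 2) <= / (1 / 4)) by (apply Rinv_le_contravar; lra). lra. }
  assert (Eb : ex_series (fun m => 2 * / (INR m + 1) ^ 2)).
  { apply (ex_series_scal_l (K := R_AbsRing) (V := R_NormedModule) 2). apply ex_series_inv_sq. }
  assert (Hle := Series_le _ _ (fun m => lat_term_bound th t m Ht ltac:(lra)) Eb).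
  assert (H0 : 0 <= Series (fun m => lat_term th t (S m))).
  { rewrite <- (Rmult_0_l (Series (fun m => lat_term th t (S m)))), <- Series_scal_l.
    apply Series_le; [|exact (proj1 (ex_series_incr_1 _) Es)].
    intros m. assert (Q := lat_term_bound th t m Ht ltac:(lra)). lra. }
  apply Rabs_le_between in B. apply Rabs_le. lra.
Qed.

(** Both sides are invariant under th -> 1 - th. The bound has to be uniform in th and t, as the
    doubling step changes both. *)
Lemma poisson_defect_bound : exists M, forall th t, 0 < t -> 0 <= th <= 1 ->
  Rabs (poisson th t - Series (lat_term th t)) <= M.
Proof.
  exists (400 * PI ^ 2 + 4 + Series (fun m => 2 * / (INR m + 1) ^ 2)).
  intros th t Ht Hth. destruct (Rle_dec th (1 / 2)) as [H|H].
  - apply poisson_defect_half; lra.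
  - replace (poisson th t) with (poisson (1 - th) t).
    + rewrite (Series_ext (lat_term th t) (lat_term (1 - th) t)).
      * apply poisson_defect_half; lra.
      * intros m. unfold lat_term. rewrite Rplus_comm. f_equal; f_equal; f_equal; f_equal; ring.
    + unfold poisson. replace (2 * PI * (1 - th)) with (2 * PI - 2 * PI * th) by ring.
      rewrite cos_minus, cos_2PI, sin_2PI. do 4 f_equal. ring.
Qed.

(* Herglotz' trick: the defect [V] of the expansion satisfies
   [V (th, t) = (V (th/2, t/2) + V ((th+1)/2, t/2)) / 4] and is bounded, hence vanishes. *)
Theorem poisson_series (th t : R) : 0 < t -> 0 <= th <= 1 ->
  is_series (lat_term th t) (poisson th t).
Proof.
  intros Ht0 Hth0. destruct poisson_defect_bound as [M HM].
  (* The doubling relation has two terms of weight 1/4, so each application halves the bound. *)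
  assert (It : forall n th t, 0 < t -> 0 <= th <= 1 ->
    Rabs (poisson th t - Series (lat_term th t)) <= M * (/ 2) ^ n).
  { clear t Ht0 th Hth0. induction n as [|n IH]; intros th t Ht Hth.
    - rewrite pow_O, Rmult_1_r. now apply HM.
    - rewrite poisson_doubling, lat_doubling by assumption.
      assert (H1 := IH (th / 2) (t / 2) ltac:(lra) ltac:(lra)).
      assert (H2 := IH ((th + 1) / 2) (t / 2) ltac:(lra) ltac:(lra)).
      apply Rabs_le_between in H1, H2. simpl pow. apply Rabs_le. lra. }
  assert (Z : Rabs (poisson th t - Series (lat_term th t)) = 0).
  { apply Rle_antisym; [|apply Rabs_pos]. apply le_epsilon. intros eps He. rewrite Rplus_0_l.
    assert (M0 : 0 <= M) by (apply Rle_trans with (2 := HM th t Ht0 Hth0); apply Rabs_pos).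
    destruct (pow_lt_1_zero (/ 2) ltac:(rewrite Rabs_right; lra) (eps / (M + 1)) ltac:(apply Rdiv_lt_0_compat; lra))
      as [n Hn].
    specialize (Hn n (Nat.le_refl _)). eapply Rle_trans; [apply (It n); assumption|].
    assert (Hn' := Rle_lt_trans _ _ _ (Rle_abs _) Hn).
    apply Rle_trans with (M * (eps / (M + 1))); [apply Rmult_le_compat_l; lra|].
    apply Rmult_le_reg_r with (M + 1); [lra|].
    unfold Rdiv. rewrite Rmult_assoc, Rmult_assoc, Rinv_l by lra. nra. }
  apply Rabs_eq_0 in Z. replace (poisson th t) with (Series (lat_term th t)) by lra.
  apply Series_correct, ex_series_lat; assumption.
Qed.

(** * Linearity and truncation of integrals over the line *)

Definition rable (f : R -> C) : Prop := exists K del, rdom f K del.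

Lemma rable_right f : rable f -> hint_able f.
Proof. intros (K & d & H). eapply hdom_able, rdom_right, H. Qed.

Lemma rable_left f : rable f -> hint_able (fun u => f (- u)).
Proof. intros (K & d & H). eapply hdom_able, rdom_left, H. Qed.

Lemma rdom_scal c f K del : rdom f K del -> rdom (fun u => c * f u)%C (Cmod c * K) del.
Proof.
  intros (Hd & Hc & H). split; [assumption|split].
  - intros t. apply ccont_mult; [apply ccont_const|auto].
  - intros t. rewrite Cmod_mult, Rmult_assoc. apply Rmult_le_compat_l; [apply Cmod_ge_0|auto].
Qed.

Lemma rdom_plus f g K L del eta : rdom f K del -> rdom g L eta ->
  rdom (fun u => f u + g u)%C (K + L) (Rmin del eta).
Proof.
  intros Hf Hg. assert (HK := hdom_K_ge0 _ _ _ (rdom_right _ _ _ Hf)).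
  assert (HL := hdom_K_ge0 _ _ _ (rdom_right _ _ _ Hg)).
  destruct Hf as (H1 & H2 & H3), Hg as (H4 & H5 & H6).
  split; [now apply Rmin_pos|split; [intros t; now apply ccont_plus|]].
  intros t. eapply Rle_trans; [apply Cmod_triangle|].
  assert (M1 := Rmin_l del eta). assert (M2 := Rmin_r del eta). assert (Ht := Rabs_pos t).
  assert (E1 : exp (- del * Rabs t) <= exp (- Rmin del eta * Rabs t)) by (apply exp_le_compat; nra).
  assert (E2 : exp (- eta * Rabs t) <= exp (- Rmin del eta * Rabs t)) by (apply exp_le_compat; nra).
  specialize (H3 t). specialize (H6 t).
  rewrite Rmult_plus_distr_r. apply Rplus_le_compat; [eapply Rle_trans; [exact H3|]|eapply Rle_trans; [exact H6|]];
    apply Rmult_le_compat_l; assumption.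
Qed.

Lemma rable_plus f g : rable f -> rable g -> rable (fun u => f u + g u)%C.
Proof. intros (K & d & H) (L & e & H'). do 2 eexists. apply rdom_plus; eassumption. Qed.

Lemma rable_scal c f : rable f -> rable (fun u => c * f u)%C.
Proof. intros (K & d & H). do 2 eexists. apply rdom_scal; eassumption. Qed.

Lemma Rint_plus f g : rable f -> rable g -> Rint (fun u => f u + g u)%C = (Rint f + Rint g)%C.
Proof.
  intros Hf Hg. unfold Rint.
  rewrite (Hint_plus f g (rable_right _ Hf) (rable_right _ Hg)),
    (Hint_plus _ _ (rable_left _ Hf) (rable_left _ Hg)). ring.
Qed.

Lemma Rint_scal c f : rable f -> Rint (fun u => c * f u)%C = (c * Rint f)%C.
Proof.
  intros Hf. unfold Rint.
  rewrite (Hint_scal c f (rable_right _ Hf)), (Hint_scal c _ (rable_left _ Hf)). ring.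
Qed.

Lemma Rint_ext f g : (forall u, f u = g u) -> Rint f = Rint g.
Proof. intros H. unfold Rint. f_equal; apply Hint_ext; intros; apply H. Qed.

Lemma rdom_ext f g K del : (forall u, f u = g u) -> rdom f K del -> rdom g K del.
Proof.
  intros E (H1 & H2 & H3). split; [assumption|split].
  - intros t. apply ccont_ext with f; auto.
  - intros t. rewrite <- E. apply H3.
Qed.

Lemma Rint_tail f K del b : rdom f K del -> 0 <= b ->
  Cmod (Cint f (- b) b - Rint f) <= 2 * (K / del) * exp (- del * b).
Proof.
  intros Hf Hb. assert (R1 := proj2 (hdom_is_hint _ _ _ (rdom_right _ _ _ Hf)) b Hb).
  assert (R2 := proj2 (hdom_is_hint _ _ _ (rdom_left _ _ _ Hf)) b Hb).
  destruct Hf as (_ & Hc & _). unfold Rint.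
  rewrite Cint_flip, Ropp_0 in R2 by assumption.
  rewrite <- (Cint_Chasles f (- b) 0 b) by auto.
  replace (Cint f (- b) 0 + Cint f 0 b - (Hint f + Hint (fun u => f (- u)%R)))%C
    with ((Cint f 0 b - Hint f) + (Cint f (- b) 0 - Hint (fun u => f (- u)%R)))%C by ring.
  eapply Rle_trans; [apply Cmod_triangle|]. lra.
Qed.

(** * The Mellin transform of t / (t^2 + v^2) *)

(** With w = i pi s / 2, vanishing of the cosine means e^(2w) = -1, that is e^(2w - i pi) = 1, and
    [cexp_eq_1] applies. *)
Lemma ccos_half_zero (s : C) : ccos (RtoC PI * s / 2) = 0%C -> exists k : Z, s = RtoC (2 * IZR k + 1).
Proof.
  intros H. unfold ccos in H.
  set (w := (Ci * (RtoC PI * s / 2))%C) in *.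
  assert (H1 : (cexp w + cexp (- w))%C = 0%C).
  { replace (cexp w + cexp (- w))%C with ((cexp w + cexp (- w)) / 2 * 2)%C by (field; intro Q; apply RtoC_inj in Q; lra).
    rewrite H. ring. }
  assert (H2 : cexp (w + w - Ci * RtoC PI) = 1%C).
  { rewrite cexp_minus, cexp_plus, cexp_Ci, cos_PI, sin_PI.
    replace (cexp w * cexp w)%C with (cexp w * (cexp w + cexp (- w)) - 1)%C.
    2:{ rewrite Cmult_plus_distr_l, <- (cexp_plus w (- w)). replace (w + - w)%C with (RtoC 0) by ring.
        rewrite cexp_0. ring. }
    rewrite H1. replace (-1, 0) with (- RtoC 1)%C by (apply C_ext; simpl; ring).
    field. }
  destruct (cexp_eq_1 _ H2) as [k Hk]. exists k. unfold w in Hk.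
  assert (Hpi := PI_RGT_0).
  assert (E : (Ci * RtoC PI * (s - RtoC (2 * IZR k + 1)))%C = 0%C).
  { rewrite RtoC_plus, !RtoC_mult in *.
    replace (Ci * RtoC PI * (s - (2 * IZR k + 1)))%C
      with ((Ci * (RtoC PI * s / 2) + Ci * (RtoC PI * s / 2) - Ci * RtoC PI) - Ci * (2 * RtoC PI * IZR k))%C by field.
    rewrite Hk. ring. }
  replace s with (s - RtoC (2 * IZR k + 1) + RtoC (2 * IZR k + 1))%C by ring.
  replace (s - RtoC (2 * IZR k + 1))%C with (/ (Ci * RtoC PI) * (Ci * RtoC PI * (s - RtoC (2 * IZR k + 1))))%C.
  - rewrite E. ring.
  - field. split; intro Q; [apply RtoC_inj in Q; lra|inversion Q; lra].
Qed.

Lemma csin_half_zero (s : C) : csin (RtoC PI * s / 2) = 0%C -> exists k : Z, s = RtoC (2 * IZR k).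
Proof.
  intros H. unfold csin in H.
  set (w := (Ci * (RtoC PI * s / 2))%C) in *.
  assert (HCi : Ci <> 0%C) by (intro Q; inversion Q; lra).
  assert (H1 : (cexp w - cexp (- w))%C = 0%C).
  { replace (cexp w - cexp (- w))%C with ((cexp w - cexp (- w)) / (2 * Ci) * (2 * Ci))%C
      by (field; assumption).
    rewrite H. ring. }
  assert (H2 : cexp (w + w) = 1%C).
  { rewrite cexp_plus.
    replace (cexp w * cexp w)%C with (cexp w * (cexp w - cexp (- w)) + 1)%C.
    2:{ unfold Cminus. rewrite Cmult_plus_distr_l. replace (cexp w * - cexp (- w))%C with (- (cexp w * cexp (- w)))%C by ring.
        rewrite <- (cexp_plus w (- w)). replace (w + - w)%C with (RtoC 0) by ring.
        rewrite cexp_0. ring. }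
    rewrite H1. ring. }
  destruct (cexp_eq_1 _ H2) as [k Hk]. exists k. unfold w in Hk.
  assert (Hpi := PI_RGT_0).
  assert (E : (Ci * RtoC PI * (s - RtoC (2 * IZR k)))%C = 0%C).
  { rewrite !RtoC_mult in *.
    replace (Ci * RtoC PI * (s - (2 * IZR k)))%C
      with ((Ci * (RtoC PI * s / 2) + Ci * (RtoC PI * s / 2)) - Ci * (2 * RtoC PI * IZR k))%C by field.
    rewrite Hk. ring. }
  replace s with (s - RtoC (2 * IZR k) + RtoC (2 * IZR k))%C by ring.
  replace (s - RtoC (2 * IZR k))%C with (/ (Ci * RtoC PI) * (Ci * RtoC PI * (s - RtoC (2 * IZR k))))%C.
  - rewrite E. ring.
  - field. split; [intro Q; apply RtoC_inj in Q; lra|assumption].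
Qed.

Lemma cexpint_0 : cexpint 0 = 1%C.
Proof.
  assert (H := cexpint_m1_le 0). rewrite Cmod_0, Rmult_0_l in H.
  assert (E : (cexpint 0 - 1)%C = 0%C) by (apply Cmod_eq_0, Rle_antisym; [exact H|apply Cmod_ge_0]).
  replace (cexpint 0) with (cexpint 0 - 1 + 1)%C by ring. rewrite E. ring.
Qed.

Lemma cexpint_neq0 (w : C) : w <> 0%C -> cexpint w = ((cexp w - 1) * / w)%C.
Proof. intros H. rewrite <- cexpint_spec. field. exact H. Qed.

Lemma cexpint_cder (w : C) : exists l, cder cexpint w l.
Proof.
  destruct (classic (w = 0%C)) as [->|Hw].
  - exists (/ 2)%C. apply cder_eps. intros eps He.
    exists (Rmin 1 (eps / exp 1)); split; [apply Rmin_pos; [lra|apply Rdiv_lt_0_compat; [lra|apply exp_pos]]|].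
    intros z Hz. rewrite cexpint_0. replace (z - 0)%C with z in * by ring.
    assert (W1 := Rlt_le_trans _ _ _ Hz (Rmin_l _ _)).
    assert (W2 := Rlt_le_trans _ _ _ Hz (Rmin_r _ _)).
    replace (cexpint z - 1 - / 2 * z)%C with (cexpint z - 1 - z / 2)%C by (unfold Cdiv; ring).
    eapply Rle_trans; [apply cexpint_m1_lin_le|].
    assert (H0 := Cmod_ge_0 z). assert (H1 := exp_pos 1).
    apply Rle_trans with (Cmod z ^ 2 * exp 1).
    + apply Rmult_le_compat_l; [apply pow2_ge_0|]. apply exp_le_compat. lra.
    + replace (Cmod z ^ 2 * exp 1) with (Cmod z * exp 1 * Cmod z) by ring.
      apply Rmult_le_compat_r; [assumption|].
      apply Rmult_lt_compat_r with (r := exp 1) in W2; [|assumption].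
      unfold Rdiv in W2. rewrite Rmult_assoc, Rinv_l in W2 by lra. lra.
  - eexists. apply (cder_ext_loc (fun z => (cexp z - 1) * / z)%C).
    + exists (Cmod w); split; [now apply Cmod_gt_0|]. intros z Hz. symmetry. apply cexpint_neq0.
      intros ->. replace (0 - w)%C with (- w)%C in Hz by ring. rewrite Cmod_opp in Hz. lra.
    + apply cder_mult; [apply cder_minus; [apply cder_cexp|apply cder_const]|now apply cder_inv_id].
Qed.

(** The zeros of (e^(2v) - 1) / (2v) are the nonzero multiples of i pi, all outside the strip |Im v|
    <= pi / 2. *)
Lemma cexpint_double_neq0 (v : C) : Rabs (Im v) <= PI / 2 -> cexpint (2 * v) <> 0%C.
Proof.
  intros Hv H. assert (Hpi := PI_RGT_0).
  assert (E := cexpint_spec (2 * v)). rewrite H, Cmult_0_r in E.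
  assert (E1 : cexp (2 * v) = 1%C) by (replace (cexp (2 * v)) with (cexp (2 * v) - 1 + 1)%C by ring; rewrite <- E; ring).
  destruct (cexp_eq_1 _ E1) as [k Hk].
  assert (Hi : Im (2 * v)%C = 2 * PI * IZR k) by (rewrite Hk; simpl; ring).
  assert (Hre : Re (2 * v)%C = 0) by (rewrite Hk; simpl; ring).
  simpl in Hi, Hre. rewrite Rmult_0_l in Hi, Hre.
  assert (Hk0 : k = 0%Z).
  { apply Rabs_le_between in Hv. unfold Im in Hv.
    assert (IZR k < 1) by nra. assert (-1 < IZR k) by nra.
    apply lt_IZR in H0, H1. lia. }
  subst k. assert (v = 0%C) by (apply C_ext; unfold Re, Im; simpl; lra). subst v.
  rewrite Cmult_0_r, cexpint_0 in H. apply RtoC_inj in H. lra.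
Qed.

Definition sech_exp (s : C) (u : R) : C := (cexp (s * RtoC u) * RtoC (/ (exp u + exp (- u))))%C.

Lemma exp_cosh_ge (u : R) : exp (Rabs u) <= exp u + exp (- u).
Proof.
  assert (H1 := exp_pos u). assert (H2 := exp_pos (- u)).
  destruct (Rle_dec 0 u); [rewrite Rabs_right|rewrite Rabs_left]; lra.
Qed.

Lemma sech_exp_rdom (s : C) : Rabs (Re s) < 1 -> rdom (sech_exp s) 1 (1 - Rabs (Re s)).
Proof.
  intros Hs. split; [lra|split].
  - intros t. apply ccont_mult; [apply ccont_cexp_scal|]. apply ccont_RtoC.
    apply (ex_derive_continuous (V := R_NormedModule)). auto_derive.
    generalize (exp_pos t) (exp_pos (- t)); lra.
  - intros t. unfold sech_exp. rewrite Cmod_mult, Cmod_cexp, Cmod_R.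
    assert (Hp : 0 < exp t + exp (- t)) by (generalize (exp_pos t) (exp_pos (- t)); lra).
    rewrite Rabs_right by (left; now apply Rinv_0_lt_compat).
    replace (Re (s * RtoC t)%C) with (Re s * t) by (rewrite Re_mult, Re_RtoC, Im_RtoC; ring).
    rewrite Rmult_1_l. replace (- (1 - Rabs (Re s)) * Rabs t) with (Rabs (Re s) * Rabs t + - Rabs t) by ring.
    rewrite exp_plus, (exp_Ropp (Rabs t)). apply Rmult_le_compat.
    + left; apply exp_pos.
    + left; now apply Rinv_0_lt_compat.
    + apply exp_le_compat. rewrite <- Rabs_mult. apply Rle_abs.
    + apply Rinv_le_contravar; [apply exp_pos|apply exp_cosh_ge].
Qed.

(** The primitive -arctan(e^(-u)) tends to 0 like e^(-u) because arctan y <= y; each half-line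
    contributes pi / 4. *)
Lemma sech_integral_0 : Rint (sech_exp 0) = RtoC (PI / 2).
Proof.
  assert (E : forall u, sech_exp 0 u = RtoC (/ (exp u + exp (- u)))).
  { intros u. unfold sech_exp. rewrite Cmult_0_l, cexp_0. ring. }
  assert (H : is_hint (fun u => RtoC (/ (exp u + exp (- u)))) (- (RtoC (- atan (exp (- 0)))))%C).
  { apply (Hint_FTC (fun u => RtoC (- atan (exp (- u)))) _ 1 1); [lra| | |].
    - intros t _. split; simpl; [|exact (is_derive_const (K := R_AbsRing) (V := R_NormedModule) 0 t)].
      auto_derive; trivial. rewrite exp_Ropp. assert (H := exp_pos t). field. split; nra.
    - intros t _. apply ccont_RtoC. apply (ex_derive_continuous (V := R_NormedModule)). auto_derive.
      generalize (exp_pos t) (exp_pos (- t)); lra.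
    - intros t _. rewrite Cmod_R, Rabs_Ropp, Rabs_right.
      + replace (- (1) * t) with (- t) by ring. rewrite Rmult_1_l. assert (H := exp_pos (- t)).
        destruct (MVT_gen atan 0 (exp (- t)) (fun y => / (1 + y ^ 2))) as [c [Hc Ec]].
        * intros y _. auto_derive; trivial. unfold Rsqr. field. nra.
        * intros y _. apply continuity_pt_filterlim. apply (ex_derive_continuous (V := R_NormedModule)). auto_derive; trivial.
        * rewrite atan_0, !Rminus_0_r in Ec. rewrite Ec.
          rewrite <- (Rmult_1_l (exp (- t))) at 2. apply Rmult_le_compat_r; [lra|].
          rewrite <- Rinv_1. apply Rinv_le_contravar; nra.
      + apply Rle_ge. left. rewrite <- atan_0. apply atan_increasing, exp_pos. }
  apply is_hint_Hint in H. unfold Rint.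
  rewrite (Hint_ext _ _ (fun t _ => E t)), H.
  rewrite (Hint_ext (fun u => sech_exp 0 (- u)) (fun u => RtoC (/ (exp u + exp (- u))))), H.
  - rewrite Ropp_0, exp_0, atan_1, <- !RtoC_opp, <- RtoC_plus. f_equal. field.
  - intros t _. rewrite E, Ropp_involutive, Rplus_comm. reflexivity.
Qed.

(* [(e^(sz) - e^(s z0)) / (2 cosh z)] has a removable singularity at [z0 = i pi / 2]; here it is in closed form. *)
Definition sech_kernel (s z : C) : C :=
  let v := (z - Ci * RtoC (PI / 2))%C in
  (cexp (s * (Ci * RtoC (PI / 2))) * cexp v * s * cexpint (s * v) * / (2 * Ci * cexpint (2 * v)))%C.

Lemma Ci_neq0 : Ci <> 0%C.
Proof. intro Q; inversion Q; lra. Qed.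

(** With z = i pi / 2 + v one has e^z + e^(-z) = i e^(-v) (e^(2v) - 1); its factor v cancels the one
    in e^(sv) - 1. *)
Lemma sech_kernel_spec (s z : C) : 0 <= Im z <= PI -> z <> (Ci * RtoC (PI / 2))%C ->
  (sech_kernel s z * (cexp z + cexp (- z)) = cexp (s * z) - cexp (s * (Ci * RtoC (PI / 2))))%C.
Proof.
  intros Hz Hne. unfold sech_kernel. set (z0 := (Ci * RtoC (PI / 2))%C) in *. set (v := (z - z0)%C).
  assert (Hv : v <> 0%C) by (intro Q; apply Hne; replace z with (v + z0)%C by (unfold v; ring); rewrite Q; ring).
  assert (Hi : Rabs (Im v) <= PI / 2).
  { unfold v. rewrite Im_minus. unfold z0. simpl. apply Rabs_le. lra. }
  assert (HE := cexpint_double_neq0 v Hi). assert (HC := Ci_neq0).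
  assert (E0 : cexp z0 = Ci).
  { unfold z0. rewrite cexp_Ci, cos_PI2, sin_PI2. reflexivity. }
  assert (E1 : cexp z = (Ci * cexp v)%C).
  { rewrite <- E0, <- cexp_plus. f_equal. unfold v. ring. }
  assert (E2 : cexp (- z) = (- Ci * / cexp v)%C).
  { rewrite cexp_opp, E1. assert (Q := cexp_neq_0 v).
    replace (/ (Ci * cexp v))%C with (/ Ci * / cexp v)%C by (field; split; assumption).
    f_equal. apply C_ext; simpl; field. }
  assert (E3 := cexpint_spec (2 * v)).
  replace (2 * v)%C with (v + v)%C in E3 at 3 by ring. rewrite cexp_plus in E3.
  assert (E4 := cexpint_spec (s * v)).
  assert (E5 : cexp (s * z) = (cexp (s * z0) * cexp (s * v))%C).
  { rewrite <- cexp_plus. f_equal. unfold v. ring. }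
  rewrite E1, E2, E5.
  replace (cexp (s * v)) with (1 + s * v * cexpint (s * v))%C by (rewrite E4; ring).
  set (X := cexp v) in *. assert (HX : X <> 0%C) by apply cexp_neq_0.
  set (Y := cexpint (2 * v)) in *.
  replace (Ci * X + - Ci * / X)%C with (Ci * (X * X - 1) * / X)%C by (field; assumption).
  rewrite <- E3. field. repeat split; assumption.
Qed.

Lemma sech_kernel_holo (s z : C) : 0 <= Im z <= PI -> exists l, cder (sech_kernel s) z l.
Proof.
  intros Hz. unfold sech_kernel. set (z0 := (Ci * RtoC (PI / 2))%C).
  assert (Hi : Rabs (Im (z - z0)%C) <= PI / 2).
  { rewrite Im_minus. unfold z0. simpl. apply Rabs_le. lra. }
  assert (HE := cexpint_double_neq0 (z - z0) Hi).
  assert (Dv : cder (fun w => w - z0)%C z (1 - 0)) by (apply cder_minus; [apply cder_id|apply cder_const]).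
  assert (Dl : forall c, cder (fun w => c * (w - z0))%C z (0 * (z - z0) + c * (1 - 0))%C)
    by (intros c; exact (cder_mult (fun _ => c) (fun w => w - z0)%C z 0 (1 - 0) (cder_const c z) Dv)).
  destruct (cexpint_cder (s * (z - z0))) as [l1 H1].
  destruct (cexpint_cder (2 * (z - z0))) as [l2 H2].
  eexists. apply cder_mult.
  - apply cder_mult; [|exact (cder_comp cexpint (fun w => s * (w - z0))%C z _ _ H1 (Dl s))].
    apply cder_mult; [|apply cder_const].
    apply cder_mult; [apply cder_const|apply cder_cexp_comp, Dv].
  - apply (cder_inv (fun w => 2 * Ci * cexpint (2 * (w - z0)))%C).
    + apply Cmult_neq_0; [apply Cmult_neq_0; [|apply Ci_neq0]|exact HE].
      intro Q; apply RtoC_inj in Q; lra.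
    + apply cder_mult; [apply cder_const|exact (cder_comp cexpint (fun w => RtoC 2 * (w - z0))%C z _ _ H2 (Dl (RtoC 2)))].
Qed.

(** Goursat's theorem on [-b, b] x [0, pi]. On the upper side cosh changes sign, so bottom minus top
    is the integral of [G], with q = e^(i pi s / 2). Letting b grow gives (1 + q^2) I(s) = 2 q I(0),
    and 1 + q^2 = 2 q cos(pi s / 2). Subtracting e^(s z0) beforehand has removed the pole, so no
    residue occurs. *)
Lemma sech_integral (s : C) : Rabs (Re s) < 1 ->
  Rint (sech_exp s) = (RtoC PI / (2 * ccos (RtoC PI * s / 2)))%C.
Proof.
  intros Hs. assert (Hpi := PI_RGT_0).
  set (z0 := (Ci * RtoC (PI / 2))%C). set (q := cexp (s * z0)).
  assert (Dec : Rabs (Re 0) < 1) by (simpl; rewrite Rabs_R0; lra).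
  assert (D1 := sech_exp_rdom s Hs). assert (D0 := sech_exp_rdom 0 Dec).
  set (G := fun u => ((1 + q * q) * sech_exp s u + (- (2) * q) * sech_exp 0 u)%C).
  assert (DG := rdom_plus _ _ _ _ _ _ (rdom_scal (1 + q * q) _ _ _ D1) (rdom_scal (- (2) * q) _ _ _ D0)).
  fold G in DG.
  assert (RG : Rint G = 0%C).
  2:{ assert (B1 : rable (sech_exp s)) by (do 2 eexists; exact D1). assert (B0 : rable (sech_exp 0)) by (do 2 eexists; exact D0).
      unfold G in RG. rewrite (Rint_plus _ _ (rable_scal _ _ B1) (rable_scal _ _ B0)), (Rint_scal _ _ B1), (Rint_scal _ _ B0) in RG.
      rewrite sech_integral_0 in RG.
      assert (Hc : ccos (RtoC PI * s / 2) <> 0%C).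
      { intro Q. destruct (ccos_half_zero s Q) as [k Hk]. rewrite Hk in Hs. simpl in Hs.
        apply Rabs_def2 in Hs. assert (A1 : IZR k < 0) by lra. assert (A2 : -1 < IZR k) by lra.
        apply lt_IZR in A1, A2. lia. }
      assert (Ec : (1 + q * q = 2 * q * ccos (RtoC PI * s / 2))%C).
      { unfold ccos. replace (Ci * (RtoC PI * s / 2))%C with (s * z0)%C
          by (unfold z0; rewrite RtoC_div by lra; field).
        fold q. rewrite cexp_opp. fold q. field. apply cexp_neq_0. }
      assert (Hq : q <> 0%C) by apply cexp_neq_0.
      rewrite Ec in RG.
      replace (Rint (sech_exp s)) with
        ((2 * q * ccos (RtoC PI * s / 2) * Rint (sech_exp s) + - (2) * q * RtoC (PI / 2))
          * / (2 * q * ccos (RtoC PI * s / 2)) + RtoC PI / (2 * ccos (RtoC PI * s / 2)))%C.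
      - rewrite RG. ring.
      - rewrite RtoC_div by lra. field. split; assumption. }
  apply Cmod_eq_0. apply Rle_antisym; [|apply Cmod_ge_0].
  apply le_epsilon. intros eps He. rewrite Rplus_0_l.
  set (KG := Cmod (1 + q * q) * 1 + Cmod (- (2) * q) * 1) in *.
  set (dG := Rmin (1 - Rabs (Re s)) (1 - Rabs (Re 0))) in *.
  assert (HdG := proj1 DG). assert (HKG := hdom_K_ge0 _ _ _ (rdom_right _ _ _ DG)).
  (* On a vertical side the numerator e^(sz) - q is at most B e^(|Re s| b), since 0 <= Im z <=
     pi. *)
  set (B := exp (Rabs (Im s) * PI) + Cmod q). 
  assert (HB : 0 <= B) by (unfold B; generalize (exp_pos (Rabs (Im s) * PI)) (Cmod_ge_0 q); lra).
  destruct (exp_decay_small (2 * (KG / dG)) dG (eps / 2)) as [M1 [HM1 B1]]; [|assumption|lra|].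
  { apply Rmult_le_pos; [lra|]. apply Rmult_le_pos; [assumption|left; now apply Rinv_0_lt_compat]. }
  destruct (exp_decay_small (4 * PI * B) (1 - Rabs (Re s)) (eps / 2)) as [M2 [HM2 B2]]; [|lra|lra|].
  { apply Rmult_le_pos; [lra|assumption]. }
  (* The summand 1 gives b >= 1, hence 2 e^(-b) <= e^b and |e^z + e^(-z)| >= e^b / 2 on the vertical
     sides. *)
  set (b := M1 + M2 + 1). specialize (B1 b ltac:(unfold b; lra)). specialize (B2 b ltac:(unfold b; lra)).
  assert (Hb : 1 <= b) by (unfold b; lra).
  assert (T := Rint_tail G KG dG b DG ltac:(lra)).
  assert (Gs := goursat_rect (sech_kernel s) (- b) b 0 PI ltac:(lra) ltac:(lra)
    (fun x y _ Hy => sech_kernel_holo s (x, y) Hy)).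
  unfold rect_int in Gs.
  assert (Hcosh : forall x : R, RtoC (exp x + exp (- x)) <> 0%C).
  { intros x Q. apply RtoC_inj in Q. generalize (exp_pos x) (exp_pos (- x)); lra. }
  assert (EG : (Cint (fun x => sech_kernel s (x, 0)) (- b) b - Cint (fun x => sech_kernel s (x, PI)) (- b) b)%C = Cint G (- b) b).
  { rewrite <- Cint_minus.
    - apply Cint_ext. intros x _.
      assert (S0 := sech_kernel_spec s (x, 0) ltac:(simpl; lra)
        ltac:(intro Q; apply (f_equal Im) in Q; simpl in Q; lra)).
      assert (S1 := sech_kernel_spec s (x, PI) ltac:(simpl; lra)
        ltac:(intro Q; apply (f_equal Im) in Q; simpl in Q; lra)).
      replace (x, 0) with (RtoC x) in * by reflexivity.
      replace (x, PI) with (RtoC x + Ci * RtoC PI)%C in * by (apply C_ext; simpl; ring).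
      assert (EP : cexp (Ci * RtoC PI) = RtoC (-1)) by (rewrite cexp_Ci, cos_PI, sin_PI; reflexivity).
      rewrite Copp_plus_distr, !cexp_plus, (cexp_opp (Ci * RtoC PI)), EP, <- RtoC_opp, !cexp_RtoC in S1.
      rewrite <- RtoC_opp, !cexp_RtoC, <- RtoC_plus in S0.
      rewrite (Cmult_plus_distr_l s), cexp_plus in S1.
      fold z0 q in S0, S1.
      replace (cexp (s * (Ci * RtoC PI))) with (q * q)%C in S1.
      2:{ unfold q. rewrite <- cexp_plus. f_equal. unfold z0. rewrite RtoC_div by lra. field. }
      unfold G, sech_exp. rewrite Cmult_0_l, cexp_0, RtoC_inv by (intro Q; apply (Hcosh x); now rewrite Q).
      specialize (Hcosh x). set (Y := RtoC (exp x + exp (- x))) in *.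
      replace (RtoC (exp x) * RtoC (-1) + RtoC (exp (- x)) * / RtoC (-1))%C with (- Y)%C in S1.
      2:{ unfold Y. rewrite RtoC_plus. replace (RtoC (-1)) with (- RtoC 1)%C by (apply C_ext; simpl; ring). field. }
      replace (sech_kernel s x) with (sech_kernel s x * Y * / Y)%C by (field; assumption).
      replace (sech_kernel s (x + Ci * PI)) with (- (sech_kernel s (x + Ci * PI) * - Y) * / Y)%C by (field; assumption).
      rewrite S0, S1. ring.
    - intros t _. destruct (sech_kernel_holo s (t, 0)) as [l Hl]; [simpl; lra|]. now apply cder_ccont_horiz with l.
    - intros t _. destruct (sech_kernel_holo s (t, PI)) as [l Hl]; [simpl; lra|]. now apply cder_ccont_horiz with l. }
  rewrite EG in Gs.
  assert (Side : forall x, Rabs x = b -> Cmod (Cint (fun y => sech_kernel s (x, y)) 0 PI) <= PI * (2 * B * exp (- (1 - Rabs (Re s)) * b))).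
  { intros x Hx. rewrite <- (Rminus_0_r PI) at 2. apply Cint_Cmod_le_const; [lra| |].
    - intros t Ht. destruct (sech_kernel_holo s (x, t) Ht) as [l Hl]. now apply cder_ccont_vert with l.
    - intros y Hy.
      assert (S := sech_kernel_spec s (x, y) Hy ltac:(intro Q; apply (f_equal Re) in Q; simpl in Q;
        replace x with 0 in Hx by lra; rewrite Rabs_R0 in Hx; lra)).
      apply (f_equal Cmod) in S. rewrite Cmod_mult in S.
      assert (L : exp b / 2 <= Cmod (cexp (x, y) + cexp (- (x, y)))).
      { assert (Q1 := Cmod_triangle_inv (cexp (x, y)) (- cexp (- (x, y)))).
        assert (Q2 := Cmod_triangle_inv (cexp (- (x, y))) (- cexp (x, y))).
        replace (cexp (x, y) - - cexp (- (x, y)))%C with (cexp (x, y) + cexp (- (x, y)))%C in Q1 by ring.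
        replace (cexp (- (x, y)) - - cexp (x, y))%C with (cexp (x, y) + cexp (- (x, y)))%C in Q2 by ring.
        rewrite Cmod_opp, !Cmod_cexp in Q1, Q2. simpl in Q1, Q2.
        assert (Eb : 2 * exp (- b) <= exp b).
        { rewrite exp_Ropp. assert (P := exp_ineq1_le b). assert (P1 := exp_pos b).
          apply Rmult_le_reg_r with (exp b); [assumption|]. rewrite Rmult_assoc, Rinv_l by lra. nra. }
        destruct (Rle_dec 0 x).
        - rewrite Rabs_right in Hx by lra. subst x. lra.
        - rewrite Rabs_left in Hx by lra. rewrite <- Hx in *. rewrite Ropp_involutive in Eb. lra. }
      assert (N : Cmod (cexp (s * (x, y)) - cexp (s * (Ci * RtoC (PI / 2)))) <= B * exp (Rabs (Re s) * b)).
      { eapply Rle_trans; [apply Cmod_triangle_minus|]. fold z0 q. unfold B. rewrite Rmult_plus_distr_r.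
        apply Rplus_le_compat.
        - rewrite Cmod_cexp, <- exp_plus. apply exp_le_compat. rewrite Re_mult. simpl.
          assert (A1 : Re s * x <= Rabs (Re s) * b) by (rewrite <- Hx, <- Rabs_mult; apply Rle_abs).
          assert (A2 : - (Im s * y) <= Rabs (Im s) * PI).
          { apply Rle_trans with (Rabs (Im s * y)); [rewrite <- Rabs_Ropp; apply Rle_abs|].
            rewrite Rabs_mult, (Rabs_right y) by lra. apply Rmult_le_compat_l; [apply Rabs_pos|lra]. }
          lra.
        - rewrite <- (Rmult_1_r (Cmod q)) at 1. apply Rmult_le_compat_l; [apply Cmod_ge_0|].
          rewrite <- exp_0. apply exp_le_compat. apply Rmult_le_pos; [apply Rabs_pos|lra]. }
      rewrite <- S in N.
      apply Rmult_le_reg_r with (exp b / 2); [generalize (exp_pos b); lra|].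
      replace (2 * B * exp (- (1 - Rabs (Re s)) * b) * (exp b / 2)) with (B * (exp (- (1 - Rabs (Re s)) * b) * exp b)) by field.
      rewrite <- exp_plus. replace (- (1 - Rabs (Re s)) * b + b) with (Rabs (Re s) * b) by ring.
      eapply Rle_trans; [|exact N]. apply Rmult_le_compat_l; [apply Cmod_ge_0|exact L]. }
  assert (Sb := Side b ltac:(apply Rabs_right; lra)).
  assert (Smb := Side (- b) ltac:(rewrite Rabs_Ropp; apply Rabs_right; lra)).
  set (Z := Cint G (- b) b) in *.
  match type of Gs with (_ + Ci * (?r - ?l))%C = _ => set (Rr := r) in *; set (Ll := l) in * end.
  assert (BZ : Cmod Z <= eps / 2).
  { replace Z with ((Z + Ci * (Rr - Ll)) - Ci * (Rr - Ll))%C by ring. rewrite Gs.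
    replace (0 - Ci * (Rr - Ll))%C with (- (Ci * (Rr - Ll)))%C by ring.
    rewrite Cmod_opp, Cmod_mult, Cmod_Ci, Rmult_1_l.
    eapply Rle_trans; [apply Cmod_triangle_minus|]. lra. }
  replace (Rint G) with (Z - (Z - Rint G))%C by ring.
  eapply Rle_trans; [apply Cmod_triangle_minus|]. lra.
Qed.

Definition cauchy_exp (s : C) (v u : R) : C :=
  (cexp (s * RtoC u) * RtoC (exp u / (exp (2 * u) + v ^ 2)))%C.

(** Scaling t by v reduces the kernel t / (t^2 + v^2) to v = 1, where it is 1 / (2 cosh u). *)
Lemma cauchy_exp_shift (s : C) (v u : R) : 0 < v ->
  cauchy_exp s v (u + ln v) = (cpow v (s - 1) * sech_exp s u)%C.
Proof.
  intros Hv. unfold cauchy_exp, sech_exp, cpow.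
  rewrite RtoC_plus, Cmult_plus_distr_l, cexp_plus.
  replace ((s - 1) * RtoC (ln v))%C with (s * RtoC (ln v) + RtoC (- ln v))%C by (rewrite RtoC_opp; ring).
  rewrite (cexp_plus (s * RtoC (ln v))), cexp_RtoC.
  replace (exp (u + ln v) / (exp (2 * (u + ln v)) + v ^ 2)) with (exp (- ln v) * / (exp u + exp (- u))).
  - rewrite RtoC_mult. ring.
  - rewrite !exp_plus, !exp_Ropp. replace (2 * (u + ln v)) with (u + u + (ln v + ln v)) by ring.
    rewrite !exp_plus, exp_ln by assumption. assert (H := exp_pos u). field. repeat split; nra.
Qed.

Lemma cauchy_exp_rable (s : C) (v : R) : 0 < v -> Rabs (Re s) < 1 -> rable (cauchy_exp s v).
Proof.
  intros Hv Hs. assert (D := rdom_scal (cpow v (s - 1)) _ _ _ (sech_exp_rdom s Hs)).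
  apply (rdom_shift _ _ _ (- ln v)) in D. do 2 eexists.
  eapply rdom_ext; [|exact D]. intros u. simpl.
  rewrite <- cauchy_exp_shift by assumption. f_equal. ring.
Qed.

Theorem cauchy_integral (s : C) (v : R) : 0 < v -> Rabs (Re s) < 1 ->
  Rint (cauchy_exp s v) = (cpow v (s - 1) * (RtoC PI / (2 * ccos (RtoC PI * s / 2))))%C.
Proof.
  intros Hv Hs. destruct (cauchy_exp_rable s v Hv Hs) as (K & d & D).
  rewrite <- (Rint_shift _ K d (ln v) D).
  rewrite (Rint_ext _ (fun u => cpow v (s - 1) * sech_exp s u)%C) by (intros; now apply cauchy_exp_shift).
  rewrite Rint_scal by (do 2 eexists; now apply sech_exp_rdom).
  now rewrite sech_integral.
Qed.

(** * The identity theorem on a punctured strip *)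

Lemma Rabs_Re_minus (z w : C) : Rabs (Re z - Re w) <= Cmod (z - w).
Proof. rewrite <- Re_minus. apply re_le_Cmod. Qed.

Lemma Rabs_Im_minus (z w : C) : Rabs (Im z - Im w) <= Cmod (z - w).
Proof. rewrite <- Im_minus. apply im_le_Cmod. Qed.

(** A point whose height differs from that of p is joined horizontally to the substrip, along a
    segment that avoids p. A point at the height of p is then reached vertically from the point one
    unit above it. In both cases [rho] stays below the distances to p and to the edges of the
    strip. *)
Theorem identity_strip (f : C -> C) (p : C) (a a' b' b : R) : a <= a' -> a' < b' -> b' <= b ->
  (forall w, a < Re w < b -> w <> p -> exists l, cder f w l) ->
  (forall w, a' < Re w < b' -> w <> p -> f w = 0%C) ->
  forall s, a < Re s < b -> s <> p -> f s = 0%C.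
Proof.
  intros Ha Hab Hb Hf Hz.
  assert (Off : forall s, a < Re s < b -> Im s <> Im p -> f s = 0%C).
  { intros s Hs Him. set (c := (a' + b') / 2).
    set (rho := Rmin (Rabs (Im s - Im p)) (Rmin (Rmin (Re s - a) (b - Re s)) (Rmin (c - a') (b' - c)))).
    assert (Hrho : 0 < rho).
    { unfold rho, c. repeat apply Rmin_pos; try lra. apply Rabs_pos_lt. lra. }
    assert (R1 : rho <= Rabs (Im s - Im p)) by apply Rmin_l.
    assert (R2 : rho <= Rmin (Rmin (Re s - a) (b - Re s)) (Rmin (c - a') (b' - c))) by apply Rmin_r.
    assert (R3 := Rle_trans _ _ _ R2 (Rmin_l _ _)). assert (R4 := Rle_trans _ _ _ R2 (Rmin_r _ _)).
    assert (R5 := Rle_trans _ _ _ R3 (Rmin_l _ _)). assert (R6 := Rle_trans _ _ _ R3 (Rmin_r _ _)).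
    assert (R7 := Rle_trans _ _ _ R4 (Rmin_l _ _)). assert (R8 := Rle_trans _ _ _ R4 (Rmin_r _ _)).
    apply (identity_segment f (c, Im s) s rho rho Hrho Hrho).
    - intros t w Ht Hw. apply Hf.
      + assert (Q := Rle_lt_trans _ _ _ (Rabs_Re_minus _ _) Hw). apply Rabs_def2 in Q.
        replace (Re ((c, Im s) + RtoC t * (s - (c, Im s)))%C) with (c + t * (Re s - c)) in Q
          by (unfold Re, Im; simpl; ring).
        assert (T : Rmin c (Re s) <= c + t * (Re s - c) <= Rmax c (Re s)).
        { unfold Rmin, Rmax. destruct (Rle_dec c (Re s)); nra. }
        unfold Rmin, Rmax in T. destruct (Rle_dec c (Re s)); lra.
      + intros ->. assert (Q := Rle_lt_trans _ _ _ (Rabs_Im_minus _ _) Hw).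
        replace (Im ((c, Im s) + RtoC t * (s - (c, Im s)))%C) with (Im s) in Q
          by (unfold Re, Im; simpl; ring).
        rewrite Rabs_minus_sym in Q. lra.
    - intros w Hw. assert (Q1 := Rle_lt_trans _ _ _ (Rabs_Re_minus _ _) Hw).
      assert (Q2 := Rle_lt_trans _ _ _ (Rabs_Im_minus _ _) Hw). simpl in Q1, Q2.
      apply Rabs_def2 in Q1. apply Hz; [lra|]. intros ->. rewrite Rabs_minus_sym in Q2. lra.
    - replace (s - s)%C with (RtoC 0) by ring. rewrite Cmod_0. lra. }
  intros s Hs Hsp. destruct (Req_dec (Im s) (Im p)) as [Ei|Ni]; [|now apply Off].
  assert (Hr : Re s <> Re p) by (intro E; apply Hsp; now apply C_ext).
  set (rho := Rmin (Rabs (Re s - Re p)) (Rmin 1 (Rmin (Re s - a) (b - Re s)))).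
  assert (Hrho : 0 < rho).
  { unfold rho. repeat apply Rmin_pos; try lra. apply Rabs_pos_lt. lra. }
  assert (R1 : rho <= Rabs (Re s - Re p)) by apply Rmin_l.
  assert (R2 : rho <= Rmin 1 (Rmin (Re s - a) (b - Re s))) by apply Rmin_r.
  assert (R3 := Rle_trans _ _ _ R2 (Rmin_l _ _)). assert (R4 := Rle_trans _ _ _ R2 (Rmin_r _ _)).
  assert (R5 := Rle_trans _ _ _ R4 (Rmin_l _ _)). assert (R6 := Rle_trans _ _ _ R4 (Rmin_r _ _)).
  apply (identity_segment f (Re s, Im s + 1) s rho rho Hrho Hrho).
  - intros t w Ht Hw. assert (Q := Rle_lt_trans _ _ _ (Rabs_Re_minus _ _) Hw).
    replace (Re ((Re s, (Im s + 1)%R) + RtoC t * (s - (Re s, (Im s + 1)%R)))%C) with (Re s) in Q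
      by (unfold Re, Im; simpl; ring).
    apply Hf.
    + apply Rabs_def2 in Q. lra.
    + intros ->. rewrite Rabs_minus_sym in Q. lra.
  - intros w Hw. assert (Q1 := Rle_lt_trans _ _ _ (Rabs_Re_minus _ _) Hw).
    assert (Q2 := Rle_lt_trans _ _ _ (Rabs_Im_minus _ _) Hw). simpl in Q1, Q2.
    apply Rabs_def2 in Q1, Q2. apply Off; lra.
  - replace (s - s)%C with (RtoC 0) by ring. rewrite Cmod_0. lra.
Qed.

(** * Continuation of the Hurwitz zeta function *)

(** Both continuations have the same series for 1 < Re w < 2; the strip is widened until it contains
    s. *)
Lemma hurwitz_unique (al : R) (F G : C -> C) (s : C) :
  is_hurwitz_continuation al F -> is_hurwitz_continuation al G -> s <> RtoC 1 -> F s = G s.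
Proof.
  intros [HF1 HF2] [HG1 HG2] Hs.
  assert (E : (F s - G s)%C = 0%C).
  { apply (identity_strip (fun w => F w - G w)%C (RtoC 1) (Rmin (Re s) 1 - 1) 1 2 (Rmax (Re s) 2 + 1)).
    - assert (H := Rmin_r (Re s) 1). lra.
    - lra.
    - assert (H := Rmax_r (Re s) 2). lra.
    - intros w _ Hw. destruct (HF1 w Hw) as [l Hl], (HG1 w Hw) as [m Hm].
      exists (l - m)%C. now apply cder_minus.
    - intros w Hw _. rewrite (cseries_unique _ _ _ (HF2 w ltac:(lra)) (HG2 w ltac:(lra))). ring.
    - assert (H := Rmin_l (Re s) 1). assert (H1 := Rmax_l (Re s) 2). lra.
    - assumption. }
  replace (F s) with (F s - G s + G s)%C by ring. rewrite E. ring.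
Qed.

(** The description in [HurwitzZeta] ranges over all continuations; they agree away from the pole,
    so any one of them may be used to compute. *)
Lemma HurwitzZeta_eq (al : R) (F : C -> C) (s : C) :
  is_hurwitz_continuation al F -> s <> RtoC 1 -> HurwitzZeta s al = F s.
Proof.
  intros HF Hs. unfold HurwitzZeta. apply (iota_unique (V := C_CompleteNormedModule)).
  - intros z [G [HG <-]]. now apply (hurwitz_unique al).
  - now exists F.
Qed.

(** * Continuation of Laplace transforms of periodic functions *)

(** Mean zero makes the primitive periodic and hence bounded, so integration by parts can be
    repeated indefinitely. *)
Definition per0 (phi : R -> R) : Prop :=
  (forall t, continuous phi t) /\ (forall t, phi (t + 1) = phi t) /\ RInt phi 0 1 = 0.

Lemma per0_bounded phi : per0 phi -> exists B, 0 <= B /\ forall t, 0 <= t -> Rabs (phi t) <= B.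
Proof.
  intros (Hc & Hp & _).
  destruct (continuity_ab_maj (fun t => Rabs (phi t)) 0 1) as [m [Hm _]]; [lra| |].
  { intros t _. apply continuity_pt_filterlim. apply (continuous_comp phi Rabs); [apply Hc|].
    apply continuous_Rabs. }
  exists (Rabs (phi m)). split; [apply Rabs_pos|].
  assert (Q : forall n t, INR n <= t <= INR n + 1 -> Rabs (phi t) <= Rabs (phi m)).
  { induction n as [|n IH]; intros t Ht; [apply Hm; simpl in Ht; lra|].
    rewrite S_INR in Ht. replace t with (t - 1 + 1) by ring. rewrite Hp. apply IH. lra. }
  intros t Ht. destruct (nfloor_ex t Ht) as [n Hn]. apply (Q n). lra.
Qed.

Lemma per0_primitive phi : per0 phi ->
  exists Phi, per0 Phi /\ forall t, is_derive Phi t (phi t).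
Proof.
  intros (Hc & Hp & H0).
  assert (Ex : forall a b, ex_RInt phi a b)
    by (intros; apply (ex_RInt_continuous (V := R_CompleteNormedModule)); intros; apply Hc).
  set (P := fun t => RInt phi 0 t).
  assert (DP : forall t, is_derive P t (phi t)).
  { intros t. apply (is_derive_RInt (V := R_CompleteNormedModule) phi P 0).
    - apply filter_forall. intros y. apply (RInt_correct (V := R_CompleteNormedModule)), Ex.
    - apply Hc. }
  assert (CP : forall t, continuous P t)
    by (intros t; apply (ex_derive_continuous (V := R_NormedModule)); eexists; apply DP).
  assert (PP : forall t, P (t + 1) = P t).
  { intros t. unfold P.
    rewrite <- (RInt_Chasles (V := R_CompleteNormedModule) phi 0 1 (t + 1)) by apply Ex. rewrite H0.
    assert (Q := RInt_comp_lin (V := R_CompleteNormedModule) phi 1 1 0 t (Ex _ _)).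
    replace (1 * 0 + 1) with 1 in Q by ring. replace (1 * t + 1) with (t + 1) in Q by ring.
    rewrite <- Q. unfold plus; simpl. rewrite Rplus_0_l. apply RInt_ext. intros u _.
    unfold scal; simpl; unfold mult; simpl. rewrite !Rmult_1_l. apply Hp. }
  (* Subtracting the mean puts the primitive back into the class [per0]. *)
  exists (fun t => P t - RInt P 0 1). split; [split; [|split]|].
  - intros t. apply (continuous_minus (V := R_NormedModule)); [apply CP|apply continuous_const].
  - intros t. now rewrite PP.
  - rewrite (RInt_minus (V := R_CompleteNormedModule)).
    + rewrite (RInt_const (V := R_CompleteNormedModule)). unfold minus, plus, opp, scal; simpl; unfold mult; simpl. ring.
    + apply (ex_RInt_continuous (V := R_CompleteNormedModule)); intros; apply CP.
    + apply ex_RInt_const.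
  - intros t. assert (Q := is_derive_minus (K := R_AbsRing) (V := R_NormedModule) P (fun _ => RInt P 0 1) t _ _ (DP t) (is_derive_const _ _)).
    unfold minus, plus, opp, zero in Q; simpl in Q. rewrite Ropp_0, Rplus_0_r in Q. exact Q.
Qed.

(** The substitution t = al (e^u - 1): powers of t + al become exponentials in u, so integrals of
    phi(t) against such powers become Laplace transforms. *)
Definition sub_exp (al : R) (phi : R -> R) (u : R) : C := RtoC (phi (al * (exp u - 1))).

Lemma sub_exp_order al phi : 0 < al -> per0 phi -> exists B, exp_order (sub_exp al phi) B 0.
Proof.
  intros Ha Hp. destruct (per0_bounded phi Hp) as [B [HB H]]. exists B. split.
  - intros t _. apply ccont_RtoC. apply (continuous_comp (fun u => al * (exp u - 1)) phi); [|apply Hp].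
    apply (ex_derive_continuous (V := R_NormedModule)). auto_derive; trivial.
  - intros t Ht. unfold sub_exp. rewrite Cmod_R, Rmult_0_l, exp_0, Rmult_1_r. apply H.
    assert (1 <= exp t) by (rewrite <- exp_0; now apply exp_le_compat). nra.
Qed.

Lemma rder_ext f g t l : (forall u, f u = g u) -> rder f t l -> rder g t l.
Proof.
  intros E [H1 H2]. split.
  - apply (is_derive_ext (fun u => Re (f u))); [intros u; now rewrite E|exact H1].
  - apply (is_derive_ext (fun u => Im (f u))); [intros u; now rewrite E|exact H2].
Qed.

Lemma rder_RtoC (f : R -> R) (t l : R) : is_derive f t l -> rder (fun u => RtoC (f u)) t (RtoC l).
Proof. intros H. split; [exact H|exact (is_derive_const (K := R_AbsRing) (V := R_NormedModule) 0 t)]. Qed.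

Lemma rder_plus f g t l m : rder f t l -> rder g t m -> rder (fun u => f u + g u)%C t (l + m)%C.
Proof.
  intros [F1 F2] [G1 G2]. split.
  - exact (is_derive_plus (K := R_AbsRing) (V := R_NormedModule) _ _ t _ _ F1 G1).
  - exact (is_derive_plus (K := R_AbsRing) (V := R_NormedModule) _ _ t _ _ F2 G2).
Qed.

Lemma rder_mult f g t l m : rder f t l -> rder g t m ->
  rder (fun u => f u * g u)%C t (l * g t + f t * m)%C.
Proof.
  intros [F1 F2] [G1 G2].
  assert (M : forall (a b : R -> R) a' b', is_derive a t a' -> is_derive b t b' ->
     is_derive (fun u => a u * b u) t (a' * b t + a t * b'))
    by (intros a b a' b' Da Db; exact (is_derive_mult (K := R_AbsRing) a b t a' b' Da Db Rmult_comm)).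
  split.
  - refine (eq_ind _ (fun v => is_derive _ t v) (is_derive_minus (K := R_AbsRing) (V := R_NormedModule) _ _ t _ _
      (M _ _ _ _ F1 G1) (M _ _ _ _ F2 G2)) _ _).
    unfold minus, plus, opp, Re, Im; simpl. ring.
  - refine (eq_ind _ (fun v => is_derive _ t v) (is_derive_plus (K := R_AbsRing) (V := R_NormedModule) _ _ t _ _
      (M _ _ _ _ F1 G2) (M _ _ _ _ F2 G1)) _ _).
    unfold plus, Re, Im; simpl. ring.
Qed.

(* Integration by parts of [int phi(t) (t+al)^(-w) dt] in the variable [t + al = al e^u]. *)
Lemma periodic_laplace_step al phi Phi w : 0 < al -> per0 phi -> per0 Phi ->
  (forall t, is_derive Phi t (phi t)) -> 1 < Re w ->
  LT (sub_exp al phi) (w - 1) = (/ RtoC al * (w * LT (sub_exp al Phi) w - RtoC (Phi 0)))%C.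
Proof.
  intros Ha Hphi HPhi HD Hw.
  destruct (sub_exp_order al phi Ha Hphi) as [B1 O1]. destruct (sub_exp_order al Phi Ha HPhi) as [B2 O2].
  assert (A1 := LT_able _ _ _ (w - 1) O1 ltac:(simpl; unfold Re in Hw; simpl in Hw; lra)).
  assert (A2 := LT_able _ _ _ w O2 ltac:(lra)).
  set (F := lt_fun (sub_exp al Phi) w).
  set (f := fun u => (RtoC al * lt_fun (sub_exp al phi) (w - 1) u - w * lt_fun (sub_exp al Phi) w u)%C).
  assert (Hf : hint_able f) by (apply hint_able_minus; apply hint_able_scal; assumption).
  assert (I : is_hint f (- F 0)%C).
  { apply (Hint_FTC F f B2 (Re w - 0)); [lra| |apply Hf|].
    - intros t _. unfold F, f, lt_fun, sub_exp.
      assert (DPhi : is_derive (fun u => Phi (al * (exp u - 1))) t (al * exp t * phi (al * (exp t - 1)))).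
      { apply (is_derive_comp Phi (fun u => al * (exp u - 1)) t); [apply HD|].
        auto_derive; trivial. ring. }
      apply (rder_ext (fun u => cexp (0 + - w * RtoC u) * RtoC (Phi (al * (exp u - 1))%R))%C);
        [intros u; now rewrite Cplus_0_l|].
      eapply rder_eq; [|exact (rder_mult _ _ _ _ _ (rder_cexp_lin 0 (- w) t) (rder_RtoC _ _ _ DPhi))].
      replace (- (w - 1) * RtoC t)%C with (- w * RtoC t + RtoC t)%C by ring.
      rewrite !Cplus_0_l, cexp_plus, cexp_RtoC, !RtoC_mult. ring.
    - apply (exp_order_hdom _ _ _ w O2 ltac:(lra)). }
  apply is_hint_Hint in I. unfold f in I.
  rewrite (Hint_minus _ _ (hint_able_scal _ _ A1) (hint_able_scal _ _ A2)), (Hint_scal _ _ A1), (Hint_scal _ _ A2) in I.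
  fold (LT (sub_exp al phi) (w - 1)) in I. fold (LT (sub_exp al Phi) w) in I.
  assert (EF : F 0 = RtoC (Phi 0)).
  { unfold F, lt_fun, sub_exp. rewrite Cmult_0_r, cexp_0, exp_0, Rminus_diag, Rmult_0_r. ring. }
  rewrite EF in I.
  assert (Hal : RtoC al <> 0%C) by (intro Q; apply RtoC_inj in Q; lra).
  replace (LT (sub_exp al phi) (w - 1))
    with (/ RtoC al * ((RtoC al * LT (sub_exp al phi) (w - 1) - w * LT (sub_exp al Phi) w) + w * LT (sub_exp al Phi) w))%C
    by (field; assumption).
  rewrite I. ring.
Qed.

(** Each integration by parts expresses the transform at w through that of the primitive at w + 1,
    which moves the boundary of the half-plane one unit to the left. *)
Lemma periodic_laplace_extend al k : 0 < al -> forall phi, per0 phi ->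
  exists J : C -> C, (forall w, 1 - INR k < Re w -> exists l, cder J w l) /\
    forall w, 1 < Re w -> J w = LT (sub_exp al phi) (w - 1).
Proof.
  intros Ha. induction k as [|k IH]; intros phi Hphi.
  - destruct (sub_exp_order al phi Ha Hphi) as [B O].
    exists (fun w => LT (sub_exp al phi) (w - 1)). split; [|auto]. intros w Hw. simpl INR in Hw.
    destruct (LT_cder _ _ _ (w - 1) O) as [l Hl]; [rewrite Re_minus, Re_RtoC; lra|].
    eexists. apply (cder_comp (LT (sub_exp al phi)) (fun w => w - 1)%C w l (1 - 0) Hl).
    apply cder_minus; [apply cder_id|apply cder_const].
  - destruct (per0_primitive phi Hphi) as [Phi [HPhi HD]].
    destruct (IH Phi HPhi) as [J [HJ1 HJ2]].
    exists (fun w => / RtoC al * (w * J (w + 1) - RtoC (Phi 0)))%C. split.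
    + intros w Hw. rewrite S_INR in Hw.
      destruct (HJ1 (w + 1)%C) as [l Hl]; [rewrite Re_plus, Re_RtoC; lra|].
      eexists. apply cder_mult; [apply cder_const|]. apply cder_minus; [|apply cder_const].
      apply cder_mult; [apply cder_id|].
      apply (cder_comp J (fun w => w + 1)%C w l (1 + 0) Hl).
      apply cder_plus; [apply cder_id|apply cder_const].
    + intros w Hw. rewrite HJ2 by (rewrite Re_plus, Re_RtoC; lra).
      replace (w + 1 - 1)%C with w by ring.
      rewrite (periodic_laplace_step al phi Phi w) by assumption. reflexivity.
Qed.

(** The extensions for different k agree where both are holomorphic, by the identity theorem, and
    are glued by choosing at each point a sufficiently large k. *)
Lemma periodic_laplace_entire al phi : 0 < al -> per0 phi ->
  exists J : C -> C, (forall w, exists l, cder J w l) /\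
    forall w, 1 < Re w -> J w = LT (sub_exp al phi) (w - 1).
Proof.
  intros Ha Hphi.
  set (Js := fun k => proj1_sig (constructive_indefinite_description _ (periodic_laplace_extend al k Ha phi Hphi))).
  assert (HJ : forall k, (forall w, 1 - INR k < Re w -> exists l, cder (Js k) w l) /\
    forall w, 1 < Re w -> Js k w = LT (sub_exp al phi) (w - 1))
    by (intros k; exact (proj2_sig (constructive_indefinite_description _ (periodic_laplace_extend al k Ha phi Hphi)))).
  clearbody Js.
  assert (Ag : forall k m w, 1 - INR k < Re w -> 1 - INR m < Re w -> Js k w = Js m w).
  { intros k m w Hk Hm.
    assert (E : (Js k w - Js m w)%C = 0%C).
    { assert (Hk0 := pos_INR k). assert (Hm0 := pos_INR m).
      (* The puncture may be any point other than w; w + 1 is taken. *)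
      apply (identity_strip (fun z => Js k z - Js m z)%C (w + 1)%C (1 - Rmin (INR k) (INR m)) 1 2 (Rmax (Re w) 2 + 1)).
      - assert (H : 0 <= Rmin (INR k) (INR m)) by (apply Rmin_glb; assumption). lra.
      - lra.
      - assert (H := Rmax_r (Re w) 2). lra.
      - intros z Hz _. assert (M1 := Rmin_l (INR k) (INR m)). assert (M2 := Rmin_r (INR k) (INR m)).
        destruct (proj1 (HJ k) z ltac:(lra)) as [l1 H1]. destruct (proj1 (HJ m) z ltac:(lra)) as [l2 H2].
        exists (l1 - l2)%C. now apply cder_minus.
      - intros z Hz _. rewrite (proj2 (HJ k)), (proj2 (HJ m)) by lra. ring.
      - assert (H1 := Rmax_l (Re w) 2). unfold Rmin. destruct (Rle_dec (INR k) (INR m)); lra.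
      - intros Q. apply (f_equal Re) in Q. rewrite Re_plus, Re_RtoC in Q. lra. }
    replace (Js k w) with (Js k w - Js m w + Js m w)%C by ring. rewrite E. ring. }
  (* The value 2 instead of 1 leaves room for the unit disc about w inside the half-plane of
     [Js (kk w)], as differentiability at w requires. *)
  assert (Kx : forall w : C, exists k, 2 - INR k < Re w).
  { intros w. destruct (INR_unbounded (2 - Re w)) as [k Hk]. exists k. lra. }
  set (kk := fun w => proj1_sig (constructive_indefinite_description _ (Kx w))).
  assert (Hkk : forall w, 2 - INR (kk w) < Re w) by (intros w; exact (proj2_sig (constructive_indefinite_description _ (Kx w)))).
  clearbody kk. exists (fun w => Js (kk w) w). split.
  - intros w. destruct (proj1 (HJ (kk w)) w) as [l Hl]; [specialize (Hkk w); lra|].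
    exists l. apply (cder_ext_loc (Js (kk w))); [|exact Hl].
    exists 1; split; [lra|]. intros z Hz. apply Ag.
    + assert (Q := Rle_lt_trans _ _ _ (Rabs_Re_minus _ _) Hz). apply Rabs_def2 in Q. specialize (Hkk w). lra.
    + specialize (Hkk z). lra.
  - intros w Hw. now apply (HJ (kk w)).
Qed.

(** Minus the second periodic Bernoulli function; the constant 1/6 makes its mean zero. *)
Definition bump (t : R) : R := frac_part t * (1 - frac_part t) - / 6.

Lemma bump_interval (k : Z) (t : R) : IZR k <= t <= IZR k + 1 ->
  bump t = (t - IZR k) * (IZR k + 1 - t) - / 6.
Proof.
  intros Ht. unfold bump, frac_part.
  destruct (Req_dec t (IZR k + 1)) as [->|Hne].
  - rewrite <- (plus_IZR k 1). rewrite <- (Int_part_spec (IZR (k + 1)) (k + 1)) by (rewrite plus_IZR; lra).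
    ring.
  - rewrite <- (Int_part_spec t k) by lra. ring.
Qed.

Lemma bump_per0 : per0 bump.
Proof.
  assert (F : forall t, exists k, IZR k <= t < IZR k + 1).
  { intros t. exists (Int_part t). destruct (base_Int_part t). lra. }
  split; [|split].
  - intros t. destruct (F t) as [k Hk]. destruct (Req_dec t (IZR k)) as [E|E].
    + apply continuous_eps. intros eps He. exists (Rmin 1 eps); split; [now apply Rmin_pos; lra|].
      intros u Hu. assert (H1 := Rlt_le_trans _ _ _ Hu (Rmin_l _ _)). assert (H2 := Rlt_le_trans _ _ _ Hu (Rmin_r _ _)).
      rewrite (bump_interval k t) by lra. apply Rabs_def2 in H1, H2.
      destruct (Rle_dec (IZR k) u).
      * rewrite (bump_interval k u) by lra. rewrite E. apply Rabs_def1; nra.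
      * assert (Hk1 : IZR (k - 1) = IZR k - 1) by (rewrite minus_IZR; reflexivity).
        rewrite (bump_interval (k - 1) u) by lra. rewrite E, Hk1. apply Rabs_def1; nra.
    + apply (ccont_ext_loc (fun u => RtoC ((u - IZR k) * (IZR k + 1 - u) - / 6)) (fun u => RtoC (bump u))).
      * exists (Rmin (t - IZR k) (IZR k + 1 - t)); split; [apply Rmin_pos; lra|].
        intros u Hu. f_equal. symmetry. apply bump_interval.
        assert (H1 := Rlt_le_trans _ _ _ Hu (Rmin_l _ _)). assert (H2 := Rlt_le_trans _ _ _ Hu (Rmin_r _ _)).
        apply Rabs_def2 in H1, H2. lra.
      * apply ccont_RtoC, (ex_derive_continuous (V := R_NormedModule)). auto_derive; trivial.
  - intros t. destruct (F t) as [k Hk]. rewrite (bump_interval k t) by lra.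
    rewrite (bump_interval (k + 1) (t + 1)) by (rewrite plus_IZR; lra). rewrite plus_IZR. ring.
  - apply is_RInt_unique.
    apply (is_RInt_ext (fun t => t - t ^ 2 - / 6)).
    + intros t Ht. rewrite Rmin_left, Rmax_right in Ht by lra. rewrite (bump_interval 0 t) by (simpl; lra). simpl. ring.
    + replace 0 with (minus (1 ^ 2 / 2 - 1 ^ 3 / 3 - 1 / 6) (0 ^ 2 / 2 - 0 ^ 3 / 3 - 0 / 6)) at 2
        by (unfold minus, plus, opp; simpl; field).
      apply (is_RInt_derive (V := R_CompleteNormedModule) (fun t => t ^ 2 / 2 - t ^ 3 / 3 - t / 6)).
      * intros t _. auto_derive; trivial. field.
      * intros t _. apply (ex_derive_continuous (V := R_NormedModule)). auto_derive; trivial.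
Qed.

Lemma Cminus_eq_0 (z w : C) : (z - w)%C = 0%C -> z = w.
Proof. intros H. replace z with (z - w + w)%C by ring. rewrite H. ring. Qed.

Lemma Hint_cexp (w : C) : Re w < 0 ->
  hint_able (fun u => cexp (w * RtoC u)) /\ Hint (fun u => cexp (w * RtoC u)) = (- / w)%C.
Proof.
  intros Hw. assert (Hw0 : w <> 0%C) by (intros ->; simpl in Hw; lra).
  assert (Hd : hdom (fun u => cexp (w * RtoC u)) 1 (- Re w)).
  { split; [lra|split].
    - intros t _. apply ccont_cexp_scal.
    - intros t _. rewrite Cmod_cexp, Re_mult, Re_RtoC, Im_RtoC. right. rewrite Rmult_1_l. f_equal. ring. }
  split; [eapply hdom_able, Hd|]. apply is_hint_Hint.
  replace (- / w)%C with (- (/ w * cexp (0 + w * RtoC 0)))%C.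
  2:{ rewrite Cplus_0_l, Cmult_0_r, cexp_0. ring. }
  apply (Hint_FTC (fun u => / w * cexp (0 + w * RtoC u))%C _ (Cmod (/ w)) (- Re w)); [lra| |apply Hd|].
  - intros t _.
    assert (D := rder_cexp_lin 0 w t).
    assert (Dc : rder (fun _ => / w)%C t 0).
    { split; exact (is_derive_const (K := R_AbsRing) (V := R_NormedModule) _ t). }
    eapply rder_eq; [|exact (rder_mult _ _ _ _ _ Dc D)]. rewrite Cplus_0_l. field. assumption.
  - intros t _. rewrite Cmod_mult, Cmod_cexp, Cplus_0_l, Re_mult, Re_RtoC, Im_RtoC. right. do 2 f_equal. ring.
Qed.

Definition cvanish (a : nat -> C) : Prop :=
  forall eps, 0 < eps -> exists N, forall n, (N <= n)%nat -> Cmod (a n) < eps.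

Lemma cvanish_plus a b : cvanish a -> cvanish b -> cvanish (fun n => a n + b n)%C.
Proof.
  intros Ha Hb eps He. destruct (Ha (eps/2) ltac:(lra)) as [N1 H1]. destruct (Hb (eps/2) ltac:(lra)) as [N2 H2].
  exists (N1 + N2)%nat. intros n Hn. specialize (H1 n ltac:(lia)). specialize (H2 n ltac:(lia)).
  eapply Rle_lt_trans; [apply Cmod_triangle|]. lra.
Qed.

Lemma cvanish_scal c a : cvanish a -> cvanish (fun n => c * a n)%C.
Proof.
  intros Ha eps He. assert (Hc := Cmod_ge_0 c).
  destruct (Ha (eps / (Cmod c + 1)) ltac:(apply Rdiv_lt_0_compat; lra)) as [N H].
  exists N. intros n Hn. specialize (H n Hn). rewrite Cmod_mult.
  apply Rle_lt_trans with (Cmod c * (eps / (Cmod c + 1))); [apply Rmult_le_compat_l; lra|].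
  apply Rmult_lt_reg_r with (Cmod c + 1); [lra|].
  unfold Rdiv. rewrite Rmult_assoc, Rmult_assoc, Rinv_l by lra. nra.
Qed.

Lemma cvanish_le a b : (forall n, Cmod (a n) <= Cmod (b n)) -> cvanish b -> cvanish a.
Proof.
  intros H Hb eps He. destruct (Hb eps He) as [N HN]. exists N. intros n Hn.
  eapply Rle_lt_trans; [apply H|now apply HN].
Qed.

Lemma cvanish_cpow al w : 0 < al -> Re w < 0 -> cvanish (fun n => cpow (INR n + al) w).
Proof.
  intros Ha Hw eps He.
  destruct (exp_decay_small 1 (- Re w) (eps / 2)) as [M [HM B]]; try lra.
  destruct (INR_unbounded (exp M)) as [N HN]. exists N. intros n Hn.
  apply le_INR in Hn. rewrite Cmod_cpow.
  assert (HL : M <= ln (INR n + al)).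
  { rewrite <- (ln_exp M). apply ln_le; [apply exp_pos|]. lra. }
  specialize (B _ HL). rewrite Rmult_1_l, Ropp_involutive in B. lra.
Qed.

(** The Peano kernel {t} (1 - {t}) against (t + al)^(-s-2) dt in the variable t + al = al e^u,
    without the constant factor al^(-s-1). Adding 1/6 to [bump] restores the zeros at the
    integers. *)
Definition bump_fun (al : R) (s : C) (u : R) : C :=
  (cexp (- (s + 1) * RtoC u) * RtoC (bump (al * (exp u - 1))%R + / 6))%C.

Lemma bump_fun_ccont al s t : ccont (bump_fun al s) t.
Proof.
  apply ccont_mult; [apply ccont_cexp_scal|]. apply ccont_RtoC.
  apply (continuous_plus (V := R_NormedModule)); [|apply continuous_const].
  apply (continuous_comp (fun u => al * (exp u - 1)) bump); [|apply bump_per0].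
  apply (ex_derive_continuous (V := R_NormedModule)). auto_derive; trivial.
Qed.

(* The trapezoidal rule on [n, n+1], whose error has the Peano kernel [(t-n)(n+1-t)/2]. *)
Lemma bump_fun_step (al : R) (s : C) (n : nat) : 0 < al -> s <> 1%C ->
  let y := INR n + al in
  (s * (s + 1) / 2 * cpow al (- s - 1) * Cint (bump_fun al s) (ln (y / al)) (ln ((y + 1) / al)) =
   (cpow y (- s) + cpow (y + 1) (- s)) / 2 - (cpow (y + 1) (1 - s) - cpow y (1 - s)) / (1 - s))%C.
Proof.
  intros Ha Hs y. assert (Hn := pos_INR n).
  assert (Hy : 0 < y) by (unfold y; lra).
  assert (Hs1 : (1 - s)%C <> 0%C).
  { intro Q. apply Hs. symmetry. now apply Cminus_eq_0. }
  assert (Hya : 0 < y / al) by now apply Rdiv_lt_0_compat.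
  assert (Hya1 : 0 < (y + 1) / al) by (apply Rdiv_lt_0_compat; lra).
  set (Q := fun tau => (tau - y) * (y + 1 - tau)).
  (* Two integrations by parts give this explicit primitive: its terms contain Q, Q' and, through
     Q'' = -2, the power integrated with the factor 1 / (1 - s). *)
  set (Rf := fun u => ((- s / 2) * RtoC (Q (al * exp u)%R) +
     (RtoC (- / 2 * ((2 * y + 1 - 2 * (al * exp u)) * (al * exp u)))%R + (- / (1 - s)) * RtoC ((al * exp u) ^ 2)%R))%C).
  set (K := fun u => (cexp (0 + - (s + 1) * RtoC u) * Rf u)%C).
  assert (Hle : ln (y / al) <= ln ((y + 1) / al)).
  { apply ln_le; [assumption|]. apply Rmult_le_compat_r; [left; now apply Rinv_0_lt_compat|lra]. }
  replace (s * (s + 1) / 2 * cpow al (- s - 1) * Cint (bump_fun al s) (ln (y / al)) (ln ((y + 1) / al)))%C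
    with (cpow al (- s - 1) * (s * (s + 1) / 2 * Cint (bump_fun al s) (ln (y / al)) (ln ((y + 1) / al))))%C
    by (unfold Cdiv; ring).
  rewrite <- Cint_scal by (intros; apply bump_fun_ccont).
  rewrite (Cint_ext _ (fun u => s * (s + 1) / 2 * (cexp (- (s + 1) * RtoC u) * RtoC (Q (al * exp u)%R)))%C).
  2:{ intros u Hu. rewrite Rmin_left, Rmax_right in Hu by assumption. unfold bump_fun. do 3 f_equal.
      assert (E1 : y < al * exp u).
      { apply Rmult_lt_reg_l with (/ al); [now apply Rinv_0_lt_compat|].
        rewrite <- Rmult_assoc, Rinv_l, Rmult_1_l, Rmult_comm by lra. fold (y / al).
        rewrite <- (exp_ln (y / al)) by assumption. apply exp_increasing. lra. }
      assert (E2 : al * exp u < y + 1).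
      { apply Rmult_lt_reg_l with (/ al); [now apply Rinv_0_lt_compat|].
        rewrite <- Rmult_assoc, Rinv_l, Rmult_1_l, (Rmult_comm (/ al)) by lra. fold ((y + 1) / al).
        rewrite <- (exp_ln ((y + 1) / al)) by assumption. apply exp_increasing. lra. }
      rewrite (bump_interval (Z.of_nat n)); rewrite <- INR_IZR_INZ; unfold y in *; [unfold Q, y; ring|lra]. }
  rewrite (Cint_FTC K).
  - assert (KE : forall z, 0 < z -> (cpow al (- s - 1) * K (ln (z / al)%R) =
      cpow z (- s - 1) * ((- s / 2) * RtoC (Q z) + (RtoC (- / 2 * ((2 * y + 1 - 2 * z) * z))%R + (- / (1 - s)) * RtoC (z ^ 2)%R)))%C).
    { intros z Hz. assert (Hza : 0 < z / al) by now apply Rdiv_lt_0_compat.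
      unfold K, Rf. rewrite exp_ln by assumption. replace (al * (z / al)) with z by (field; lra).
      rewrite Cmult_assoc. f_equal. rewrite Cplus_0_l.
      replace (- (s + 1) * RtoC (ln (z / al)%R))%C with ((- s - 1) * RtoC (ln (z / al)%R))%C by ring.
      change (cexp ((- s - 1) * RtoC (ln (z / al)%R))) with (cpow (z / al) (- s - 1)).
      rewrite <- cpow_mult_base by assumption. f_equal. field. lra. }
    replace (cpow al (- s - 1) * (K (ln ((y + 1) / al)%R) - K (ln (y / al)%R)))%C
      with (cpow al (- s - 1) * K (ln ((y + 1) / al)%R) - cpow al (- s - 1) * K (ln (y / al)%R))%C by ring.
    rewrite !KE by lra.
    assert (P1 : forall z, 0 < z -> cpow z (- s) = (RtoC z * cpow z (- s - 1))%C).
    { intros z Hz. replace (- s)%C with (RtoC (INR 1) + (- s - 1))%C at 1 by (simpl; ring).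
      rewrite cpow_plus, cpow_nat by assumption. now rewrite pow_1. }
    assert (P2 : forall z, 0 < z -> cpow z (1 - s) = (RtoC z * RtoC z * cpow z (- s - 1))%C).
    { intros z Hz. replace (1 - s)%C with (RtoC (INR 1) + - s)%C by (simpl; ring).
      rewrite cpow_plus, cpow_nat, P1 by assumption. rewrite pow_1. ring. }
    rewrite !P1, !P2 by lra. unfold Q.
    replace ((y - y) * (y + 1 - y)) with 0 by ring. replace ((y + 1 - y) * (y + 1 - (y + 1))) with 0 by ring.
    replace (- / 2 * ((2 * y + 1 - 2 * y) * y)) with (- (y / 2)) by field.
    replace (- / 2 * ((2 * y + 1 - 2 * (y + 1)) * (y + 1))) with ((y + 1) / 2) by field.
    rewrite RtoC_opp, !RtoC_div, !RtoC_pow by lra. field. assumption.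
  - intros t _. unfold K.
    assert (Dc : forall c : C, rder (fun _ => c) t 0).
    { intros c. split; exact (is_derive_const (K := R_AbsRing) (V := R_NormedModule) _ t). }
    assert (D1 : is_derive (fun u => Q (al * exp u)) t ((2 * y + 1 - 2 * (al * exp t)) * (al * exp t))).
    { unfold Q. auto_derive; trivial. ring. }
    assert (D2 : is_derive (fun u => - / 2 * ((2 * y + 1 - 2 * (al * exp u)) * (al * exp u))) t
       (- / 2 * ((2 * y + 1 - 4 * (al * exp t)) * (al * exp t)))).
    { auto_derive; trivial. ring. }
    assert (D3 : is_derive (fun u => (al * exp u) ^ 2) t (2 * (al * exp t) * (al * exp t))).
    { auto_derive; trivial. ring. }
    assert (DR := rder_plus _ _ _ _ _ (rder_mult _ _ _ _ _ (Dc (- s / 2)%C) (rder_RtoC _ _ _ D1))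
      (rder_plus _ _ _ _ _ (rder_RtoC _ _ _ D2) (rder_mult _ _ _ _ _ (Dc (- / (1 - s))%C) (rder_RtoC _ _ _ D3)))).
    eapply rder_eq; [|exact (rder_mult _ _ _ _ _ (rder_cexp_lin 0 (- (s + 1)) t) DR)].
    unfold Q. rewrite !Cplus_0_l. set (tau := al * exp t). set (X := cexp (- (s + 1) * RtoC t)).
    assert (E2 : RtoC (/ 2) = (/ 2)%C) by (rewrite RtoC_inv by lra; reflexivity).
    repeat rewrite ?RtoC_mult, ?RtoC_plus, ?RtoC_minus, ?RtoC_opp, ?RtoC_pow. rewrite E2. field. assumption.
  - intros t _. apply ccont_mult; [apply ccont_const|]. apply ccont_mult; [apply ccont_cexp_scal|].
    apply ccont_RtoC. unfold Q. apply (ex_derive_continuous (V := R_NormedModule)). auto_derive; trivial.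
Qed.

(** Euler-Maclaurin summation to second order: the trapezoidal identities on unit intervals are
    added, and the power terms telescope. *)
Lemma hurwitz_partial (al : R) (s : C) (M : nat) : 0 < al -> s <> 1%C ->
  csum_n (fun n => cpow (INR n + al) (- s)) M =
  ((cpow al (- s) + cpow (INR M + al) (- s)) / 2 + (cpow (INR M + al) (1 - s) - cpow al (1 - s)) / (1 - s)
   + s * (s + 1) / 2 * cpow al (- s - 1) * Cint (bump_fun al s) 0 (ln ((INR M + al) / al)))%C.
Proof.
  intros Ha Hs.
  assert (Hs1 : (1 - s)%C <> 0%C).
  { intro Q. apply Hs. symmetry. now apply Cminus_eq_0. }
  induction M as [|M IH].
  - rewrite csum_n_0. simpl INR. rewrite Rplus_0_l, Rdiv_diag, ln_1, Cint_point by lra. field. assumption.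
  - rewrite csum_n_S, IH.
    rewrite <- (Cint_Chasles (bump_fun al s) 0 (ln ((INR M + al) / al)) (ln ((INR (S M) + al) / al)))
      by (intros; apply bump_fun_ccont).
    rewrite (Cmult_plus_distr_l (s * (s + 1) / 2 * cpow al (- s - 1))).
    assert (St := bump_fun_step al s M Ha Hs). cbv zeta in St.
    replace (INR M + al + 1) with (INR (S M) + al) in St by (rewrite S_INR; ring).
    rewrite St. field. assumption.
Qed.

(** For Re s > 1 the terms at the upper end of [hurwitz_partial] vanish in the limit, and the
    integral is the transform of [bump] plus that of its added mean. The former extends to an entire
    function, so 1 / (1 - s) is the only source of a pole. *)
Theorem hurwitz_exists al : 0 < al -> exists F, is_hurwitz_continuation al F.
Proof.
  intros Ha. destruct (periodic_laplace_entire al bump Ha bump_per0) as [J [HJ1 HJ2]].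
  (* The last term is the contribution of the mean 1/6 of the Peano kernel: s (s + 1) / 2 times 1 /
     (6 (s + 1)) is s / 12, with no pole left at s = -1. *)
  exists (fun s => cpow al (- s) * / 2 + (- / (1 - s)) * cpow al (1 - s)
    + (s * (s + 1) * / 2 * cpow al (- s - 1) * J (s + 2) + s * / 12 * cpow al (- s - 1)))%C.
  assert (Dcp : forall f w l, cder f w l -> exists m, cder (fun z => cpow al (f z)) w m).
  { intros f w l Hf. eexists. unfold cpow. apply cder_cexp_comp. apply (cder_mult f (fun _ => RtoC (ln al)) w l 0 Hf).
    apply cder_const. }
  split.
  - intros w Hw.
    assert (Hw1 : (1 - w)%C <> 0%C).
    { intro Q. apply Hw. symmetry. now apply Cminus_eq_0. }
    assert (D1 := cder_opp _ _ _ (cder_id w)).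
    assert (D2 := cder_minus _ _ _ _ _ (cder_const 1 w) (cder_id w)).
    assert (D3 := cder_minus _ _ _ _ _ D1 (cder_const 1 w)).
    assert (D4 := cder_plus _ _ _ _ _ (cder_id w) (cder_const 1 w)).
    assert (D5 := cder_plus _ _ _ _ _ (cder_id w) (cder_const 2 w)).
    destruct (Dcp _ _ _ D1) as [m1 M1]. destruct (Dcp _ _ _ D2) as [m2 M2]. destruct (Dcp _ _ _ D3) as [m3 M3].
    destruct (HJ1 (w + 2)%C) as [l Hl].
    assert (DJ := cder_comp J (fun z => z + 2)%C w _ _ Hl D5).
    assert (Di := cder_inv (fun z => 1 - z)%C w _ Hw1 D2).
    eexists. apply cder_plus; [apply cder_plus|apply cder_plus].
    + exact (cder_mult _ _ _ _ _ M1 (cder_const (/ 2) w)).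
    + exact (cder_mult _ _ _ _ _ (cder_opp _ _ _ Di) M2).
    + exact (cder_mult _ _ _ _ _ (cder_mult _ _ _ _ _ (cder_mult _ _ _ _ _ (cder_mult _ _ _ _ _ (cder_id w) D4)
        (cder_const (/ 2) w)) M3) DJ).
    + exact (cder_mult _ _ _ _ _ (cder_mult _ _ _ _ _ (cder_id w) (cder_const (/ 12) w)) M3).
  - intros s Hs.
    assert (Hs1 : s <> 1%C) by (intros ->; simpl in Hs; lra).
    assert (Hs2 : (s + 1)%C <> 0%C) by (intros Q; apply (f_equal Re) in Q; simpl in Q; unfold Re in Hs; lra).
    assert (Hs3 : (1 - s)%C <> 0%C).
    { intro Q. apply Hs1. symmetry. now apply Cminus_eq_0. }
    rewrite HJ2 by (rewrite Re_plus, Re_RtoC; lra).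
    replace (s + 2 - 1)%C with (s + 1)%C by ring.
    destruct (sub_exp_order al bump Ha bump_per0) as [B O].
    assert (Re (s + 1)%C = Re s + 1) as HR1 by reflexivity.
    assert (A1 := LT_able _ _ _ (s + 1) O ltac:(lra)).
    destruct (Hint_cexp (- (s + 1))) as [A2 H2]; [rewrite Re_opp; lra|].
    assert (HB : hint_able (bump_fun al s) /\ Hint (bump_fun al s) = (LT (sub_exp al bump) (s + 1) + / 6 * / (s + 1))%C).
    { assert (E : forall u, (lt_fun (sub_exp al bump) (s + 1) u + / 6 * cexp (- (s + 1) * RtoC u))%C = bump_fun al s u).
      { intros u. unfold lt_fun, sub_exp, bump_fun. rewrite RtoC_plus, (RtoC_inv 6) by lra. ring. }
      split.
      - eapply hint_able_ext; [exact E|]. apply hint_able_plus; [assumption|now apply hint_able_scal].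
      - rewrite (Hint_ext _ _ (fun t _ => eq_sym (E t))), (Hint_plus _ _ A1 (hint_able_scal _ _ A2)), (Hint_scal _ _ A2), H2.
        unfold LT. f_equal. field. assumption. }
    destruct HB as [HBa HBe]. destruct (proj2 HBa) as (Kb & db & Db).
    assert (T := proj2 (hdom_is_hint _ _ _ Db)). 
    set (u := fun M => ln ((INR M + al) / al)).
    assert (Hu : forall M, 0 <= u M).
    { intros M. unfold u. rewrite <- ln_1. apply ln_le; [lra|]. assert (H := pos_INR M).
      apply Rmult_le_reg_r with al; [assumption|]. unfold Rdiv. rewrite Rmult_assoc, Rinv_l; lra. }
    assert (VI : cvanish (fun M => Cint (bump_fun al s) 0 (u M) - Hint (bump_fun al s))%C).
    { apply (cvanish_le _ (fun M => RtoC (Kb / db) * cpow (/ al) (RtoC (- db)) * cpow (INR M + al) (RtoC (- db)))%C).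
      - intros M. eapply Rle_trans; [apply T, Hu|].
        assert (HK := hdom_K_ge0 _ _ _ Db). destruct Db as [Hdb _].
        rewrite !Cmod_mult, !Cmod_cpow, Cmod_R, Re_RtoC.
        rewrite (Rabs_right (Kb / db)) by (apply Rle_ge, Rmult_le_pos; [assumption|left; now apply Rinv_0_lt_compat]).
        rewrite Rmult_assoc, <- exp_plus. right. f_equal. f_equal. unfold u, Rdiv.
        rewrite ln_mult; [ring| |now apply Rinv_0_lt_compat]. assert (H := pos_INR M). lra.
      - apply (cvanish_scal (RtoC (Kb / db) * cpow (/ al) (RtoC (- db)))%C). apply cvanish_cpow; [assumption|].
        destruct Db as [Hdb _]. rewrite Re_RtoC. lra. }
    assert (V1 := cvanish_cpow al (- s) Ha ltac:(rewrite Re_opp; lra)).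
    assert (V2 := cvanish_cpow al (1 - s) Ha ltac:(rewrite Re_minus, Re_RtoC; lra)).
    assert (V := cvanish_plus _ _ (cvanish_scal (/ 2) _ V1)
       (cvanish_plus _ _ (cvanish_scal (/ (1 - s)) _ V2) (cvanish_scal (s * (s + 1) / 2 * cpow al (- s - 1)) _ VI))).
    apply cseries_eps. intros eps He. destruct (V eps He) as [N HN]. exists N. intros M HM.
    eapply Rle_lt_trans; [|exact (HN M HM)]. right. f_equal.
    rewrite hurwitz_partial by assumption. fold (u M). rewrite HBe. 
    assert (E12 : (/ 12 = / 6 * / 2)%C) by field. rewrite E12. field. split; assumption.
Qed.

(** The two half-lines have their own majorants and rates, because the free exponent in the kernel
    bounds has to be chosen differently at +oo and -oo. *)
Lemma Rint_series (f : nat -> R -> C) (F : R -> C) (M M' : nat -> R) (del del' : R) :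
  0 < del -> 0 < del' -> (forall n t, ccont (f n) t) -> (forall t, ccont F t) ->
  (forall n t, 0 <= t -> Cmod (f n t) <= M n * exp (- del * t)) -> ex_series M ->
  (forall n t, 0 <= t -> Cmod (f n (- t)) <= M' n * exp (- del' * t)) -> ex_series M' ->
  (forall t, cseries (fun n => f n t) (F t)) ->
  hint_able F /\ hint_able (fun u => F (- u)) /\ cseries (fun n => Rint (f n)) (Rint F).
Proof.
  intros Hd Hd' Hf HF Hb EM Hb' EM' Hs.
  destruct (Hint_series f F M del) as [A1 S1]; try assumption.
  { intros n t _. apply Hf. } { intros t _. apply HF. } { intros t _. apply Hs. }
  destruct (Hint_series (fun n u => f n (- u)) (fun u => F (- u)) M' del') as [A2 S2]; try assumption.
  { intros n t _. apply ccont_flip, Hf. } { intros t _. apply ccont_flip, HF. } { intros t _. apply Hs. }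
  split; [assumption|split; [assumption|]]. now apply cseries_plus.
Qed.

(** Apply 1 + y <= e^y at y = u - ln p. The constant p^p e^(-p) is the maximum of e^(pu) e^(-e^u),
    attained at u = ln p. *)
Lemma exp_exp_decay (p u : R) : 0 < p -> exp (- exp u) <= exp (p * ln p - p) * exp (- p * u).
Proof.
  intros Hp. rewrite <- exp_plus. apply exp_le_compat.
  assert (H := exp_ineq1_le (u - ln p)). unfold Rminus in H at 2. rewrite exp_plus, exp_Ropp, exp_ln in H by assumption.
  apply Rmult_le_compat_l with (r := p) in H; [|lra].
  replace (p * (exp u * / p)) with (exp u) in H by (field; lra). lra.
Qed.

(** * The two theta kernels *)

(** [kerA th] is the function A of the overview, [kerA1] is A + 1/2, and [kerA 0] is B. The closed
    form makes positivity and smoothness immediate. *)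
Definition kerA1 (th t : R) : R := t * poisson th t / (2 * PI).
Definition kerA (th t : R) : R := kerA1 th t - / 2.

Lemma cgeom_series (z : C) : Re z < 0 ->
  cseries (fun k => cexp (RtoC (INR (S k)) * z)) (cexp z * / (1 - cexp z))%C.
Proof.
  intros Hz.
  assert (Hq : (1 - cexp z)%C <> 0%C).
  { intro Q. apply Cminus_eq_0 in Q. apply (f_equal Cmod) in Q. rewrite Cmod_1, Cmod_cexp in Q.
    assert (exp (Re z) < exp 0) by (apply exp_increasing; lra). rewrite exp_0 in H. lra. }
  assert (E : forall n, (csum_n (fun k => cexp (RtoC (INR (S k)) * z)) n - cexp z * / (1 - cexp z))%C
     = (- / (1 - cexp z) * cexp (RtoC (INR (S (S n))) * z))%C).
  { intros n. replace (cexp (RtoC (INR (S (S n))) * z)) with (cexp z * cexp (RtoC (INR (S n)) * z))%C.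
    2:{ rewrite <- cexp_plus. f_equal. rewrite (S_INR (S n)), RtoC_plus. ring. }
    induction n as [|n IH].
    - rewrite csum_n_0. simpl INR. rewrite Cmult_1_l. field. assumption.
    - rewrite csum_n_S.
      replace (cexp (RtoC (INR (S (S n))) * z)) with (cexp z * cexp (RtoC (INR (S n)) * z))%C.
      2:{ rewrite <- cexp_plus. f_equal. rewrite (S_INR (S n)), RtoC_plus. ring. }
      set (X := cexp (RtoC (INR (S n)) * z)) in *. set (S1 := csum_n _ n) in *.
      replace (S1 + cexp z * X - cexp z * / (1 - cexp z))%C with ((S1 - cexp z * / (1 - cexp z)) + cexp z * X)%C by ring.
      rewrite IH. field. assumption. }
  apply cseries_eps.
  assert (V : cvanish (fun n => - / (1 - cexp z) * cexp (RtoC (INR (S (S n))) * z))%C).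
  { apply (cvanish_scal _ (fun n => cexp (RtoC (INR (S (S n))) * z))). intros eps He.
    destruct (exp_decay_small 1 (- Re z) (eps / 2)) as [M [HM B]]; try lra.
    destruct (INR_unbounded M) as [N HN]. exists N. intros n Hn.
    rewrite Cmod_cexp, Re_mult, Re_RtoC, Im_RtoC.
    assert (HL : M <= INR (S (S n))) by (apply le_INR in Hn; rewrite !S_INR; lra).
    specialize (B _ HL). rewrite Rmult_1_l, Ropp_involutive in B.
    replace (INR (S (S n)) * Re z - 0 * Im z) with (Re z * INR (S (S n))) by ring. lra. }
  intros eps He. destruct (V eps He) as [N HN]. exists N. intros n Hn. rewrite E. now apply HN.
Qed.

(** The real part of the geometric series with ratio e^z, z = -2 pi t + 2 pi i th. *)
Lemma kerA_series (th t : R) : 0 < t ->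
  is_series (fun k => exp (- (2 * PI * INR (S k) * t)) * cos (2 * PI * INR (S k) * th)) (kerA th t).
Proof.
  intros Ht. assert (Hpi := PI_RGT_0).
  assert (Hy : 0 < 2 * PI * t) by (apply Rmult_lt_0_compat; lra).
  set (z := (- (2 * PI * t), 2 * PI * th) : C).
  assert (G := cseries_Re _ _ (cgeom_series z ltac:(simpl; lra))).
  assert (D := poisson_den_pos th t Ht).
  replace (kerA th t) with (Re (cexp z * / (1 - cexp z))%C).
  - eapply is_series_ext; [|exact G]. intros k. unfold z, cexp; simpl.
    f_equal; f_equal; ring.
  - unfold kerA, kerA1, poisson, sinh, cosh in *. unfold z, cexp. rewrite exp_Ropp in *. cbn [Re Im fst snd].
    rewrite exp_Ropp.
    set (E := exp (2 * PI * t)) in *. set (c := cos (2 * PI * th)) in *. set (sn := sin (2 * PI * th)).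
    assert (Hcs : sn * sn = 1 - c * c) by (unfold sn, c; generalize (sin2_cos2 (2 * PI * th)); unfold Rsqr; lra).
    assert (HE : 1 < E) by (unfold E; rewrite <- exp_0; apply exp_increasing; lra).
    assert (D2 : 0 < E * E + 1 - 2 * c * E).
    { apply Rmult_lt_compat_l with (r := 2 * E) in D; [|lra].
      replace (2 * E * ((E + / E) / 2 - c)) with (E * E + 1 - 2 * c * E) in D by (field; lra). lra. }
    unfold Re, Cinv, Cmult; simpl.
    assert (D3 : (1 + - (/ E * c)) * ((1 + - (/ E * c)) * 1) + (0 + - (/ E * sn)) * ((0 + - (/ E * sn)) * 1)
      = (E * E + 1 - 2 * c * E) / (E * E)).
    { replace ((1 + - (/ E * c)) * ((1 + - (/ E * c)) * 1) + (0 + - (/ E * sn)) * ((0 + - (/ E * sn)) * 1))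
        with (1 - 2 * (/ E * c) + / E * / E * (c * c + sn * sn)) by ring.
      rewrite Hcs. field. lra. }
    rewrite D3.
    replace (/ E * c * ((1 + - (/ E * c)) / ((E * E + 1 - 2 * c * E) / (E * E))) -
      / E * sn * (- (0 + - (/ E * sn)) / ((E * E + 1 - 2 * c * E) / (E * E))))
      with ((E * c - (c * c + sn * sn)) / (E * E + 1 - 2 * c * E)) by (field; lra).
    rewrite Hcs. field. repeat split; lra.
Qed.

Lemma kerA_decay (th t0 t : R) : 0 < t0 <= t ->
  Rabs (kerA th t) <= / (1 - exp (- (2 * PI * t0))) * exp (- (2 * PI * t)).
Proof.
  intros Ht. assert (Hpi := PI_RGT_0).
  set (q := exp (- (2 * PI * t))).
  assert (Hq : 0 < q <= exp (- (2 * PI * t0))) by (split; [apply exp_pos|apply exp_le_compat; nra]).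
  assert (Hq1 : exp (- (2 * PI * t0)) < 1) by (rewrite <- exp_0; apply exp_increasing; nra).
  assert (Hqa : Rabs q < 1) by (rewrite Rabs_right; lra).
  assert (G : is_series (fun k => q * q ^ k) (q * / (1 - q))).
  { apply (is_series_scal_l (K := R_AbsRing) (V := R_NormedModule) q). now apply is_series_geom. }
  assert (H := cseries_Cmod_le (fun k => RtoC (exp (- (2 * PI * INR (S k) * t)) * cos (2 * PI * INR (S k) * th)))
    (fun k => q * q ^ k) (RtoC (kerA th t))).
  rewrite Cmod_R in H. rewrite (is_series_unique _ _ G) in H.
  eapply Rle_trans; [apply H|].
  - intros k. rewrite Cmod_R, Rabs_mult, (Rabs_right (exp _)) by (left; apply exp_pos).
    replace (exp (- (2 * PI * INR (S k) * t))) with (q * q ^ k).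
    + rewrite <- (Rmult_1_r (q * q ^ k)) at 2. apply Rmult_le_compat_l.
      * apply Rmult_le_pos; [lra|apply pow_le; lra].
      * apply Rabs_le, COS_bound.
    + change (q ^ S k = exp (- (2 * PI * INR (S k) * t))). unfold q. generalize (S k). intros n.
      induction n as [|n IH]; [simpl; rewrite Rmult_0_r, Rmult_0_l, Ropp_0, exp_0; reflexivity|].
      simpl pow. rewrite IH, <- exp_plus, S_INR. f_equal. ring.
  - eexists; exact G.
  - apply is_series_RtoC, kerA_series. lra.
  - rewrite Rmult_comm. apply Rmult_le_compat_r; [lra|]. apply Rinv_le_contravar; lra.
Qed.

Lemma kerA_exp_decay (th x p : R) : 0 < x -> 0 < p -> exists K, 0 <= K /\ forall u, 0 <= u ->
  Rabs (kerA th (x * exp u)) <= K * exp (- p * u).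
Proof.
  intros Hx Hp. assert (Hpi := PI_RGT_0).
  assert (Hq1 : exp (- (2 * PI * x)) < 1).
  { rewrite <- exp_0; apply exp_increasing. assert (0 < 2 * PI * x) by (apply Rmult_lt_0_compat; lra). lra. }
  set (c := ln (2 * PI * x)).
  exists (/ (1 - exp (- (2 * PI * x))) * (exp (p * ln p - p) * exp (- p * c))). split.
  - apply Rmult_le_pos; [left; apply Rinv_0_lt_compat; lra|]. apply Rmult_le_pos; left; apply exp_pos.
  - intros u Hu. assert (H1 : 1 <= exp u) by (rewrite <- exp_0; now apply exp_le_compat).
    eapply Rle_trans; [apply (kerA_decay th x); split; [assumption|nra]|].
    rewrite (Rmult_assoc (/ (1 - exp (- (2 * PI * x))))). apply Rmult_le_compat_l.
    + left; apply Rinv_0_lt_compat; lra.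
    + replace (2 * PI * (x * exp u)) with (exp (u + c)).
      2:{ unfold c. rewrite exp_plus, exp_ln; [ring|]. apply Rmult_lt_0_compat; lra. }
      eapply Rle_trans; [exact (exp_exp_decay p (u + c) Hp)|]. right. rewrite <- !exp_plus. f_equal. ring.
Qed.

Lemma kerA1_pos (th t : R) : 0 < t -> 0 <= kerA1 th t.
Proof.
  intros Ht. assert (Hpi := PI_RGT_0). unfold kerA1, poisson.
  assert (D := poisson_den_pos th t Ht).
  assert (S := sinh_gt_0 (2 * PI * t) ltac:(apply Rmult_lt_0_compat; lra)).
  apply Rmult_le_pos; [|left; apply Rinv_0_lt_compat; lra]. apply Rmult_le_pos; [lra|].
  apply Rmult_le_pos; [apply Rmult_le_pos; lra|]. left. apply Rinv_0_lt_compat. now apply Rmult_lt_0_compat.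
Qed.

(** For 0 < th < 1 no lattice point is 0, so the lattice sum is bounded uniformly in t by the sum of
    the 1 / v^2, and the factor t in front of it remains. *)
Lemma kerA1_linear (th : R) : 0 < th < 1 -> exists K, 0 <= K /\ forall t, 0 < t -> kerA1 th t <= K * t.
Proof.
  intros Hth. assert (Hpi := PI_RGT_0).
  set (b := fun m => Rpower (INR m + th) (- (2)) + Rpower (INR m + (1 - th)) (- (2))).
  assert (Eb : ex_series b).
  { apply (ex_series_plus (K := R_AbsRing) (V := R_NormedModule)); apply ex_series_hurwitz; lra. }
  assert (Hb : forall t m, 0 < t -> 0 <= lat_term th t m <= b m).
  { intros t m Ht. unfold lat_term, b. assert (Hm := pos_INR m). rewrite !Rpower_m2 by lra.
    replace (INR m + 1 - th) with (INR m + (1 - th)) by ring.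
    assert (0 < t ^ 2) by now apply pow_lt.
    assert (P1 : 0 < (INR m + th) ^ 2) by (apply pow_lt; lra).
    assert (P2 : 0 < (INR m + (1 - th)) ^ 2) by (apply pow_lt; lra).
    split.
    - apply Rplus_le_le_0_compat; left; apply Rinv_0_lt_compat; lra.
    - apply Rplus_le_compat; apply Rinv_le_contravar; lra. }
  assert (H0 : 0 <= Series b).
  { apply Rle_trans with (b 0%nat); [apply Rle_trans with (2 := proj2 (Hb 1 0%nat Rlt_0_1)); apply Hb; lra|].
    rewrite <- (sum_O b). apply sum_n_le_Series; [|exact Eb]. intros k. specialize (Hb 1 k Rlt_0_1). lra. }
  exists (Series b / (2 * PI)). split.
  - apply Rmult_le_pos; [assumption|left; apply Rinv_0_lt_compat; lra].
  - intros t Ht. unfold kerA1. rewrite <- (is_series_unique _ _ (poisson_series th t Ht ltac:(lra))).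
    assert (Q := Series_le _ _ (fun m => Hb t m Ht) Eb).
    unfold Rdiv. replace (Series b * / (2 * PI) * t) with (t * Series b * / (2 * PI)) by ring.
    apply Rmult_le_compat_r; [left; apply Rinv_0_lt_compat; lra|]. apply Rmult_le_compat_l; lra.
Qed.

Lemma kerA1_continuous (th : R) (f : R -> R) (u : R) : continuous f u -> 0 < f u ->
  continuous (fun v => kerA1 th (f v)) u.
Proof.
  intros Hf H0. apply (continuous_comp f (kerA1 th)); [assumption|].
  apply (ex_derive_continuous (V := R_NormedModule)). unfold kerA1, poisson, sinh, cosh.
  assert (D := poisson_den_pos th (f u) H0). unfold cosh in D. auto_derive. 
  apply Rmult_integral_contrapositive. split; lra.
Qed.

Lemma kerA_continuous (th : R) (f : R -> R) (u : R) : continuous f u -> 0 < f u ->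
  continuous (fun v => kerA th (f v)) u.
Proof.
  intros Hf H0. apply (continuous_minus (V := R_NormedModule)); [now apply kerA1_continuous|apply continuous_const].
Qed.

Lemma continuous_exp_opp (u : R) : continuous (fun v => exp (- v)) u.
Proof. apply (ex_derive_continuous (V := R_NormedModule)). auto_derive; trivial. Qed.

(** The two halves of the line: [gA1] is A + 1/2 at t = e^(-u) < 1, where it is small, and [gA] is A
    at t = e^u > 1, where it decays faster than any power. *)
Definition gA1 (th u : R) : C := RtoC (kerA1 th (exp (- u))).
Definition gA (th u : R) : C := RtoC (kerA th (exp u)).

Lemma gA1_order th : 0 < th < 1 -> exists K, exp_order (gA1 th) K (- (1)).
Proof.
  intros Hth. destruct (kerA1_linear th Hth) as [K [HK B]]. exists K. split.
  - intros t _. apply ccont_RtoC, kerA1_continuous; [apply continuous_exp_opp|apply exp_pos].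
  - intros t Ht. unfold gA1. rewrite Cmod_R, Rabs_right by (apply Rle_ge, kerA1_pos, exp_pos).
    replace (- (1) * t) with (- t) by ring. apply B, exp_pos.
Qed.

Lemma gA_order th p : exists K, exp_order (gA th) K p.
Proof.
  destruct (kerA_exp_decay th 1 (Rabs p + 1)) as [K [HK B]]; [lra|generalize (Rabs_pos p); lra|].
  exists K. split.
  - intros t _. apply ccont_RtoC, kerA_continuous; [apply continuous_exp_R|apply exp_pos].
  - intros t Ht. unfold gA. rewrite Cmod_R, <- (Rmult_1_l (exp t)). eapply Rle_trans; [now apply B|].
    apply Rmult_le_compat_l; [assumption|]. apply exp_le_compat.
    assert (Q := Rle_abs (- p)). rewrite Rabs_Ropp in Q. nra.
Qed.

(* Analytic continuation to [Re s > -1], [s <> 0], of the Mellin transform of [kerA th] ([Re s > 0]),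
   resp. [kerA1 th] ([-1 < Re s < 0]). *)
Definition melA (th : R) (s : C) : C := (LT (gA1 th) s + LT (gA th) (- s) - / (2 * s))%C.

(** The larger of e^(2u) and v^2 is at least their weighted geometric mean e^(kap u) v^(2 - kap).
    The free exponent [kap] trades decay in u for summability in v. *)
Lemma cauchy_majorant (kap v u : R) : 0 <= kap <= 2 -> 0 < v ->
  / (exp (2 * u) + v ^ 2) <= exp (- kap * u) * Rpower v (- (2 - kap)).
Proof.
  intros Hk Hv. unfold Rpower. rewrite <- exp_plus.
  replace (- kap * u + - (2 - kap) * ln v) with (- (kap * u + (2 - kap) * ln v)) by ring.
  rewrite exp_Ropp. apply Rinv_le_contravar; [apply exp_pos|].
  replace (v ^ 2) with (exp (2 * ln v)).
  2:{ replace (2 * ln v) with (ln v + ln v) by ring. rewrite exp_plus, exp_ln by assumption. ring. }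
  assert (P1 := exp_pos (2 * u)). assert (P2 := exp_pos (2 * ln v)).
  destruct (Rle_dec u (ln v)).
  - apply Rle_trans with (exp (2 * ln v)); [|lra]. apply exp_le_compat. nra.
  - apply Rle_trans with (exp (2 * u)); [|lra]. apply exp_le_compat. nra.
Qed.

Lemma cauchy_exp_le (s : C) (kap v u : R) : 0 <= kap <= 2 -> 0 < v ->
  Cmod (cauchy_exp s v u) <= Rpower v (- (2 - kap)) * exp ((Re s + 1 - kap) * u).
Proof.
  intros Hk Hv. unfold cauchy_exp. rewrite Cmod_mult, Cmod_cexp, Cmod_R, Re_mult, Re_RtoC, Im_RtoC.
  assert (M := cauchy_majorant kap v u Hk Hv). assert (P := exp_pos u).
  assert (P2 : 0 < exp (2 * u) + v ^ 2) by (generalize (exp_pos (2 * u)) (pow2_ge_0 v); lra).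
  rewrite Rabs_right by (left; apply Rdiv_lt_0_compat; assumption).
  replace (Rpower v (- (2 - kap)) * exp ((Re s + 1 - kap) * u))
    with (exp (Re s * u - Im s * 0) * (exp u * (exp (- kap * u) * Rpower v (- (2 - kap))))).
  - apply Rmult_le_compat_l; [left; apply exp_pos|]. apply Rmult_le_compat_l; [lra|exact M].
  - replace (exp (Re s * u - Im s * 0) * (exp u * (exp (- kap * u) * Rpower v (- (2 - kap)))))
      with (Rpower v (- (2 - kap)) * (exp (Re s * u - Im s * 0) * exp u * exp (- kap * u))) by ring.
    rewrite <- !exp_plus. do 2 f_equal. ring.
Qed.

Lemma cauchy_exp_ccont (s : C) (v u : R) : 0 < v -> ccont (cauchy_exp s v) u.
Proof.
  intros Hv. apply ccont_mult; [apply ccont_cexp_scal|]. apply ccont_RtoC.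
  apply (ex_derive_continuous (V := R_NormedModule)). auto_derive.
  generalize (exp_pos (2 * u)) (pow_lt v 2 Hv). simpl. lra.
Qed.

Lemma kerA1_mellin_series (th : R) (s : C) (u : R) : 0 < th < 1 ->
  cseries (fun m => RtoC (/ (2 * PI)) * (cauchy_exp s (INR m + th) u + cauchy_exp s (INR m + (1 - th)) u))%C
    (cexp (s * RtoC u) * RtoC (kerA1 th (exp u)))%C.
Proof.
  intros Hth. assert (Hpi := PI_RGT_0).
  assert (H := cseries_scal (cexp (s * RtoC u) * RtoC (exp u / (2 * PI)))%C _ _
    (is_series_RtoC _ _ (poisson_series th (exp u) (exp_pos u) ltac:(lra)))).
  replace (cexp (s * RtoC u) * RtoC (kerA1 th (exp u)))%C
    with (cexp (s * RtoC u) * RtoC (exp u / (2 * PI)) * RtoC (poisson th (exp u)))%C.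
  - eapply cseries_ext; [|exact H]. intros m. unfold cauchy_exp, lat_term.
    replace (INR m + 1 - th) with (INR m + (1 - th)) by ring.
    replace (exp (2 * u)) with (exp u ^ 2) by (replace (2 * u) with (u + u) by ring; rewrite exp_plus; ring).
    unfold Rdiv. rewrite !RtoC_mult, RtoC_plus. ring.
  - unfold kerA1. rewrite <- Cmult_assoc, <- RtoC_mult. do 2 f_equal. field. lra.
Qed.

(** Here the transform of A + 1/2 converges on the whole line. Each Cauchy kernel of the Poisson
    expansion integrates to a multiple of v^(s-1), and these powers sum to the Hurwitz values at 1 -
    s. *)
Lemma melA_strip (th : R) (s : C) (Fa Fb : C -> C) : 0 < th < 1 ->
  is_hurwitz_continuation th Fa -> is_hurwitz_continuation (1 - th) Fb -> -1 < Re s < 0 ->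
  (Fa (1 - s) + Fb (1 - s))%C = (4 * ccos (RtoC PI * s / 2) * melA th s)%C.
Proof.
  intros Hth Ha Hb Hs. assert (Hpi := PI_RGT_0).
  (* Decay at +oo needs kap > Re s + 1, and summability over v needs kap < 1; this is the midpoint.
     At -oo the exponent 0 serves. *)
  set (kap := 1 + Re s / 2).
  set (F := fun u => (cexp (s * RtoC u) * RtoC (kerA1 th (exp u)))%C).
  set (f := fun (m : nat) u => (RtoC (/ (2 * PI)) * (cauchy_exp s (INR m + th) u + cauchy_exp s (INR m + (1 - th)) u))%C).
  assert (Hab : Rabs (Re s) < 1) by (apply Rabs_def1; lra).
  set (Mk := fun (k : R) (m : nat) => / (2 * PI) * (Rpower (INR m + th) (- (2 - k)) + Rpower (INR m + (1 - th)) (- (2 - k)))).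
  assert (Bd : forall k m u, 0 <= k <= 2 -> Cmod (f m u) <= Mk k m * exp ((Re s + 1 - k) * u)).
  { intros k m u Hk. assert (Hm := pos_INR m). unfold f, Mk.
    rewrite Cmod_mult, Cmod_R, Rabs_right by (left; apply Rinv_0_lt_compat; lra).
    rewrite Rmult_assoc. apply Rmult_le_compat_l; [left; apply Rinv_0_lt_compat; lra|].
    eapply Rle_trans; [apply Cmod_triangle|]. rewrite Rmult_plus_distr_r.
    apply Rplus_le_compat; apply cauchy_exp_le; lra. }
  assert (EM : forall k, 0 <= k < 1 -> ex_series (Mk k)).
  { intros k Hk. apply (ex_series_scal_l (K := R_AbsRing) (V := R_NormedModule) (/ (2 * PI))).
    apply (ex_series_plus (K := R_AbsRing) (V := R_NormedModule)); apply ex_series_hurwitz; lra. }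
  assert (cF : forall t, ccont F t).
  { intros t. apply ccont_mult; [apply ccont_cexp_scal|].
    apply ccont_RtoC, kerA1_continuous; [apply continuous_exp_R|apply exp_pos]. }
  destruct (Rint_series f F (Mk kap) (Mk 0) (- Re s / 2) (Re s + 1)) as (A1 & A2 & S).
  { lra. } { lra. }
  { intros n t. assert (Hn := pos_INR n). apply ccont_mult; [apply ccont_const|].
    apply ccont_plus; apply cauchy_exp_ccont; lra. }
  { exact cF. }
  { intros n t Ht. eapply Rle_trans; [apply (Bd kap); unfold kap; lra|]. right. do 2 f_equal. unfold kap. field. }
  { apply EM. unfold kap. lra. }
  { intros n t Ht. eapply Rle_trans; [apply (Bd 0); lra|]. right. do 2 f_equal. ring. }
  { apply EM. lra. }
  { intros t. apply (kerA1_mellin_series th s t Hth). }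
  assert (Hs0 : s <> 0%C) by (intros ->; simpl in Hs; lra).
  assert (Hc : ccos (RtoC PI * s / 2) <> 0%C).
  { intro Q. destruct (ccos_half_zero s Q) as [k Hk]. rewrite Hk in Hs. rewrite Re_RtoC in Hs.
    assert (Q1 : IZR k < 0) by lra. assert (Q2 : -1 < IZR k) by lra. apply lt_IZR in Q1, Q2. lia. }
  assert (E1 : Rint F = melA th s).
  { unfold melA, Rint, LT. destruct (gA1_order th Hth) as [K1 O1]. destruct (gA_order th (- (1))) as [K2 O2].
    destruct (Hint_cexp s ltac:(lra)) as [H1 H2].
    (* On the right half-line A + 1/2 is split into A and the constant, whose transform is -1 / (2
       s). *)
    assert (E2 : Hint F = (Hint (lt_fun (gA th) (- s)) + / 2 * (- / s))%C).
    { rewrite <- H2, <- Hint_scal, <- Hint_plus; try assumption.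
      - apply Hint_ext. intros t _. unfold F, lt_fun, gA, kerA. rewrite RtoC_minus, RtoC_inv by lra.
        replace (- - s * RtoC t)%C with (s * RtoC t)%C by ring. ring.
      - apply (LT_able _ _ _ _ O2). rewrite Re_opp. lra.
      - now apply hint_able_scal. }
    rewrite E2.
    rewrite (Hint_ext (fun u => F (- u)) (lt_fun (gA1 th) s)).
    - field. assumption.
    - intros t _. unfold F, lt_fun, gA1. rewrite RtoC_opp. f_equal. f_equal. ring. }
  rewrite <- E1.
  assert (S2 := cseries_plus _ _ _ _ (proj2 Ha (1 - s)%C ltac:(rewrite Re_minus, Re_RtoC; lra))
                 (proj2 Hb (1 - s)%C ltac:(rewrite Re_minus, Re_RtoC; lra))).
  apply (cseries_scal (RtoC (/ 4) * / ccos (RtoC PI * s / 2))%C) in S2.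
  assert (E3 : Rint F = (RtoC (/ 4) * / ccos (RtoC PI * s / 2) * (Fa (1 - s) + Fb (1 - s)))%C).
  { apply (cseries_unique _ _ _ S). eapply cseries_ext; [|exact S2]. intros m. simpl.
    assert (Hm := pos_INR m).
    assert (R1 := cauchy_exp_rable s (INR m + th) ltac:(lra) Hab).
    assert (R2 := cauchy_exp_rable s (INR m + (1 - th)) ltac:(lra) Hab).
    unfold f. rewrite (Rint_scal _ _ (rable_plus _ _ R1 R2)), (Rint_plus _ _ R1 R2), !cauchy_integral by (try assumption; lra).
    replace (- (1 - s))%C with (s - 1)%C by ring.
    rewrite (RtoC_inv (2 * PI)), RtoC_inv, RtoC_mult by lra.
    assert (RtoC PI <> 0%C) by (intro Q; apply RtoC_inj in Q; lra).
    field. split; assumption. }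
  rewrite E3, RtoC_inv by lra. field. assumption.
Qed.

Lemma cder_ccos_half (s : C) : exists l, cder (fun w => ccos (RtoC PI * w / 2)) s l.
Proof.
  unfold ccos.
  assert (D : exists m, cder (fun w => Ci * (RtoC PI * w / 2))%C s m).
  { eexists. apply cder_mult; [apply cder_const|]. unfold Cdiv. apply cder_mult; [|apply cder_const].
    apply cder_mult; [apply cder_const|apply cder_id]. }
  destruct D as [m D]. eexists. unfold Cdiv at 1. apply cder_mult; [|apply cder_const].
  apply cder_plus; apply cder_cexp_comp; [exact D|exact (cder_opp _ _ _ D)].
Qed.

Lemma LT_opp_cder g K p s : exp_order g K p -> p < - Re s -> exists l, cder (fun w => LT g (- w)) s l.
Proof.
  intros O Hs. destruct (LT_cder g K p (- s) O) as [l Hl]; [rewrite Re_opp; lra|].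
  eexists. exact (cder_comp (LT g) (fun w => - w)%C s _ _ Hl (cder_opp _ _ _ (cder_id s))).
Qed.

Lemma melA_cder (th : R) (s : C) : 0 < th < 1 -> -1 < Re s -> s <> 0%C -> exists l, cder (melA th) s l.
Proof.
  intros Hth Hs H0. destruct (gA1_order th Hth) as [K1 O1]. destruct (gA_order th (- Re s - 1)) as [K2 O2].
  destruct (LT_cder _ _ _ s O1 ltac:(lra)) as [l1 D1].
  destruct (LT_opp_cder _ _ _ s O2 ltac:(lra)) as [l2 D2].
  eexists. apply (cder_minus (fun w => LT (gA1 th) w + LT (gA th) (- w))%C (fun w => / (2 * w))%C);
    [exact (cder_plus _ _ _ _ _ D1 D2)|].
  apply (cder_inv (fun w => 2 * w)%C).
  - apply Cmult_neq_0; [intro Q; apply RtoC_inj in Q; lra|assumption].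
  - apply cder_mult; [apply cder_const|apply cder_id].
Qed.

(** The functional equation of the Hurwitz zeta function, combined for th and 1 - th. Both sides are
    holomorphic for Re s > -1 except at 0 and agree for -1 < Re s < 0, where the series argument
    applies. *)
Theorem melA_functional (th : R) (s : C) (Fa Fb : C -> C) : 0 < th < 1 ->
  is_hurwitz_continuation th Fa -> is_hurwitz_continuation (1 - th) Fb -> -1 < Re s -> s <> 0%C ->
  (Fa (1 - s) + Fb (1 - s))%C = (4 * ccos (RtoC PI * s / 2) * melA th s)%C.
Proof.
  intros Hth Ha Hb Hs H0. apply Cminus_eq_0.
  apply (identity_strip (fun w => Fa (1 - w) + Fb (1 - w) - 4 * ccos (RtoC PI * w / 2) * melA th w)%C
    0%C (-1) (-1) 0 (Rmax (Re s) 0 + 1)).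
  - lra.
  - lra.
  - assert (H := Rmax_r (Re s) 0). lra.
  - intros w Hw Hw0.
    assert (N1 : (1 - w)%C <> 1%C).
    { intro Q. apply Hw0. replace w with (RtoC 1 - (1 - w))%C by ring. rewrite Q. ring. }
    destruct (proj1 Ha _ N1) as [l1 D1]. destruct (proj1 Hb _ N1) as [l2 D2].
    assert (Dm : cder (fun z => 1 - z)%C w (0 - 1)) by exact (cder_minus _ _ _ _ _ (cder_const 1 w) (cder_id w)).
    destruct (cder_ccos_half w) as [l3 D3]. destruct (melA_cder th w Hth ltac:(lra) Hw0) as [l4 D4].
    eexists. apply cder_minus.
    + apply cder_plus.
      * exact (cder_comp Fa (fun z => 1 - z)%C w _ _ D1 Dm).
      * exact (cder_comp Fb (fun z => 1 - z)%C w _ _ D2 Dm).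
    + apply cder_mult; [|exact D4]. apply cder_mult; [apply cder_const|exact D3].
  - intros w Hw _. rewrite (melA_strip th w Fa Fb Hth Ha Hb) by lra. ring.
  - assert (H := Rmax_l (Re s) 0). lra.
  - exact H0.
Qed.

(** * Laurent expansion of the kernel 1 / (e^(2 pi y) - 1) *)

(** Sums over i < n, empty for n = 0, as the case N = 0 occurs. *)
Fixpoint rsum (f : nat -> R) (n : nat) : R := match n with O => 0 | S m => rsum f m + f m end.
Fixpoint csum0 (f : nat -> C) (n : nat) : C := match n with O => RtoC 0 | S m => (csum0 f m + f m)%C end.

Lemma RtoC_rsum f n : RtoC (rsum f n) = csum0 (fun i => RtoC (f i)) n.
Proof. induction n as [|n IH]; [reflexivity|]. simpl. now rewrite RtoC_plus, IH. Qed.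

Lemma rsum_ext f g n : (forall i, f i = g i) -> rsum f n = rsum g n.
Proof. intros H. induction n as [|n IH]; [reflexivity|]. simpl. now rewrite IH, H. Qed.

Lemma csum0_ext f g n : (forall i, (i < n)%nat -> f i = g i) -> csum0 f n = csum0 g n.
Proof.
  induction n as [|n IH]; intros H; [reflexivity|]. simpl.
  rewrite IH by (intros; apply H; lia). now rewrite H by lia.
Qed.

Lemma csum0_scal c f n : csum0 (fun i => c * f i)%C n = (c * csum0 f n)%C.
Proof. induction n as [|n IH]; simpl; [ring|]. rewrite IH. ring. Qed.

Lemma csum0_plus f g n : csum0 (fun i => f i + g i)%C n = (csum0 f n + csum0 g n)%C.
Proof. induction n as [|n IH]; simpl; [ring|]. rewrite IH. ring. Qed.

(** The value zeta(2j) for j >= 1, as a real series. *)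
Definition zev (j : nat) : R := Series (fun k => / (INR k + 1) ^ (2 * j)).

Definition kerP (N : nat) (y : R) : R :=
  - / 2 + / (2 * PI * y) + rsum (fun i => (-1) ^ i * y ^ (2 * i + 1) * zev (S i) / PI) N.
Definition kerBN (N : nat) (y : R) : R := kerA 0 y - kerP N y.
(** With n = k + 1, the remainder after N steps of the geometric expansion in y / n of the Cauchy
    kernel y / (pi (y^2 + n^2)). *)
Definition bterm (N k : nat) (y : R) : R :=
  (-1) ^ N * y ^ (2 * N + 1) / (PI * (INR k + 1) ^ (2 * N) * (y ^ 2 + (INR k + 1) ^ 2)).

Lemma zev_series (j : nat) : (1 <= j)%nat -> is_series (fun k => / (INR k + 1) ^ (2 * j)) (zev j).
Proof.
  intros Hj. apply Series_correct. apply ex_series_compare with (2 := ex_series_inv_sq).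
  intros k. assert (Hk := pos_INR k).
  assert (P : 0 < (INR k + 1) ^ 2) by (apply pow_lt; lra).
  split; [left; apply Rinv_0_lt_compat, pow_lt; lra|]. apply Rinv_le_contravar; [assumption|].
  apply Rle_pow; [lra|lia].
Qed.

Lemma bterm_step N k y : 0 < y -> bterm (S N) k y = bterm N k y - (-1) ^ N * y ^ (2 * N + 1) / PI * / (INR k + 1) ^ (2 * S N).
Proof.
  intros Hy. unfold bterm. assert (Hk := pos_INR k). assert (Hpi := PI_RGT_0).
  replace (2 * S N)%nat with (2 * N + 2)%nat by lia. replace (2 * N + 2 + 1)%nat with (2 * N + 1 + 2)%nat by lia.
  rewrite !(pow_add _ (2 * N)), !(pow_add y (2 * N + 1)), (pow_add y (2 * N)).
  assert (P : 0 < (INR k + 1) ^ (2 * N)) by (apply pow_lt; lra).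
  set (m := (2 * N)%nat) in *. clearbody m. simpl pow. field. repeat split; nra.
Qed.

(** For N = 0 this is the Poisson expansion at th = 0. Each further N removes one geometric term
    from every kernel; these terms sum to the multiple of zeta(2N + 2) by which [kerP] grows. *)
Lemma kerBN_series (N : nat) (y : R) : 0 < y -> is_series (fun k => bterm N k y) (kerBN N y).
Proof.
  intros Hy. assert (Hpi := PI_RGT_0). induction N as [|N IH].
  - assert (H := poisson_series 0 y Hy ltac:(lra)).
    assert (Ey : 0 < y ^ 2) by now apply pow_lt.
    assert (E0 : ex_series (fun k => / (y ^ 2 + (INR k + 1) ^ 2))).
    { apply ex_series_compare with (2 := ex_series_inv_sq). intros k. assert (Hk := pos_INR k).
      assert (P : 0 < (INR k + 1) ^ 2) by (apply pow_lt; lra).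
      split; [left; apply Rinv_0_lt_compat; lra|]. apply Rinv_le_contravar; lra. }
    assert (S0 := Series_correct _ E0). set (X := Series (fun k => / (y ^ 2 + (INR k + 1) ^ 2))) in *.
    assert (E1 : ex_series (fun k => / (y ^ 2 + INR k ^ 2))).
    { apply ex_series_incr_1. eapply ex_series_ext; [|exact E0]. intros k. now rewrite S_INR. }
    assert (S1 : Series (fun k => / (y ^ 2 + INR k ^ 2)) = / y ^ 2 + X).
    { rewrite (Series_incr_1 _ E1). f_equal; [simpl; f_equal; ring|].
      unfold X. apply Series_ext. intros k. now rewrite S_INR. }
    (* At th = 0 the lattice point 0 occurs once and gives the polar term 1 / y^2; every n >= 1
       occurs twice. *)
    assert (Q : poisson 0 y = / y ^ 2 + 2 * X).
    { rewrite <- (is_series_unique _ _ H).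
      rewrite (Series_ext _ (fun k => / (y ^ 2 + INR k ^ 2) + / (y ^ 2 + (INR k + 1) ^ 2))).
      - rewrite Series_plus, S1 by assumption. unfold X. ring.
      - intros k. unfold lat_term. do 2 f_equal; [|]; f_equal; f_equal; ring. }
    replace (kerBN 0 y) with (y / PI * X).
    + assert (Eq : forall k, y / PI * / (y ^ 2 + (INR k + 1) ^ 2) = bterm 0 k y).
      { intros k. unfold bterm. simpl pow. assert (Hk := pos_INR k). field. split; nra. }
      apply (is_series_ext _ _ _ Eq).
      exact (is_series_scal_l (K := R_AbsRing) (V := R_NormedModule) (y / PI) _ _ S0).
    + unfold kerBN, kerP, kerA, kerA1. simpl rsum. rewrite Q. field. split; lra.
  - assert (Z := is_series_scal_l (K := R_AbsRing) (V := R_NormedModule) ((-1) ^ N * y ^ (2 * N + 1) / PI) _ _ (zev_series (S N) ltac:(lia))).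
    assert (D := is_series_minus _ _ _ _ IH Z).
    replace (kerBN (S N) y) with (minus (kerBN N y) (scal ((-1) ^ N * y ^ (2 * N + 1) / PI) (zev (S N)))).
    + eapply is_series_ext; [|exact D]. intros k. rewrite bterm_step by assumption. reflexivity.
    + unfold kerBN, kerP, minus, plus, opp, scal; simpl; unfold mult; simpl. field. lra.
Qed.

Definition bcoef (N : nat) (x : R) (k : nat) : R := (-1) ^ N * x ^ (2 * N + 1) / (PI * (INR k + 1) ^ (2 * N + 2)).

Lemma exp_mult_nat (c : R) (n : nat) : exp c ^ n = exp (INR n * c).
Proof.
  induction n as [|n IH]; [simpl; rewrite Rmult_0_l, exp_0; reflexivity|].
  simpl pow. rewrite IH, S_INR, <- exp_plus. f_equal. ring.
Qed.

(** Under y = x / t a Cauchy kernel in y with parameter n becomes one in t with parameter x / n, and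
    the factor y^(2N) lowers the exponent nu by 2N. *)
Lemma bterm_cauchy (N k : nat) (x : R) (nu : C) (u : R) : 0 < x ->
  (cexp (nu * RtoC u) * RtoC (bterm N k (x * exp (- u))))%C =
  (RtoC (bcoef N x k) * cauchy_exp (nu - RtoC (2 * INR N)) (x / (INR k + 1)) u)%C.
Proof.
  intros Hx. assert (Hk := pos_INR k). assert (Hpi := PI_RGT_0).
  unfold cauchy_exp.
  replace ((nu - RtoC (2 * INR N)) * RtoC u)%C with (nu * RtoC u + RtoC (- (2 * INR N * u)))%C.
  2:{ rewrite RtoC_opp, !RtoC_mult. ring. }
  rewrite cexp_plus, cexp_RtoC.
  replace (RtoC (bcoef N x k) * (cexp (nu * RtoC u) * RtoC (exp (- (2 * INR N * u))) *
      RtoC (exp u / (exp (2 * u) + (x / (INR k + 1)) ^ 2))))%C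
    with (cexp (nu * RtoC u) * RtoC (bcoef N x k * (exp (- (2 * INR N * u)) * (exp u / (exp (2 * u) + (x / (INR k + 1)) ^ 2)))))%C
    by (rewrite !RtoC_mult; ring).
  do 2 f_equal. unfold bterm, bcoef.
  rewrite !Rpow_mult_distr, exp_mult_nat, plus_INR, mult_INR.
  replace ((INR 2 * INR N + INR 1) * - u) with (- (2 * INR N * u) + - u) by (simpl; ring).
  rewrite exp_plus, (exp_Ropp u). set (E := exp (- (2 * INR N * u))).
  replace (exp (2 * u)) with (exp u * exp u) by (rewrite <- exp_plus; f_equal; ring).
  assert (Hu := exp_pos u). rewrite (pow_add (INR k + 1) (2 * N) 2).
  assert (P : 0 < (INR k + 1) ^ (2 * N)) by (apply pow_lt; lra).
  replace (exp (- u)) with (/ exp u) by (now rewrite exp_Ropp). simpl (_ ^ 2).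
  field. repeat split; try lra; nra.
Qed.

Lemma bcoef_abs N x k : 0 < x -> Rabs (bcoef N x k) = x ^ (2 * N + 1) / PI * / (INR k + 1) ^ (2 * N + 2).
Proof.
  intros Hx. assert (Hpi := PI_RGT_0). assert (Hk := pos_INR k). unfold bcoef, Rdiv.
  assert (P : 0 < (INR k + 1) ^ (2 * N + 2)) by (apply pow_lt; lra).
  rewrite !Rabs_mult, pow_1_abs, Rmult_1_l, Rabs_inv, !Rabs_right; [field; lra| |].
  - left. apply Rmult_lt_0_compat; lra.
  - left. now apply pow_lt.
Qed.

(* Each Lambert-type term, bounded with a free exponent [kap] trading decay in [u] for decay in [k]. *)
Lemma bterm_majorant (N k : nat) (x : R) (nu : C) (kap u : R) : 0 < x -> 0 <= kap <= 2 ->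
  Cmod (cexp (nu * RtoC u) * RtoC (bterm N k (x * exp (- u)))) <=
  x ^ (2 * N + 1) / PI * Rpower x (- (2 - kap)) * Rpower (INR k + 1) (- (2 * INR N + kap)) *
  exp ((Re nu - 2 * INR N + 1 - kap) * u).
Proof.
  intros Hx Hkap. assert (Hk := pos_INR k). assert (Hpi := PI_RGT_0).
  rewrite bterm_cauchy, Cmod_mult, Cmod_R, bcoef_abs by assumption.
  assert (C1 := cauchy_exp_le (nu - RtoC (2 * INR N)) kap (x / (INR k + 1)) u Hkap ltac:(apply Rdiv_lt_0_compat; lra)).
  rewrite Re_minus, Re_RtoC in C1.
  assert (E : Rpower (x / (INR k + 1)) (- (2 - kap)) = Rpower x (- (2 - kap)) * Rpower (INR k + 1) (2 - kap)).
  { unfold Rpower. rewrite <- exp_plus. f_equal. unfold Rdiv.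
    rewrite ln_mult, ln_Rinv; [ring|lra|assumption|apply Rinv_0_lt_compat; lra]. }
  rewrite E in C1.
  assert (E2 : / (INR k + 1) ^ (2 * N + 2) * Rpower (INR k + 1) (2 - kap) = Rpower (INR k + 1) (- (2 * INR N + kap))).
  { rewrite <- (Rpower_pow (2 * N + 2)) by lra. rewrite <- Rpower_Ropp, <- Rpower_plus. f_equal.
    rewrite plus_INR, mult_INR. simpl. ring. }
  rewrite <- E2.
  assert (P0 : 0 <= x ^ (2 * N + 1) / PI * / (INR k + 1) ^ (2 * N + 2)).
  { apply Rmult_le_pos; [apply Rmult_le_pos; [left; now apply pow_lt|left; apply Rinv_0_lt_compat; lra]|].
    left. apply Rinv_0_lt_compat, pow_lt. lra. }
  eapply Rle_trans; [apply Rmult_le_compat_l; [exact P0|exact C1]|]. right. ring.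
Qed.

Lemma bterm_majorant_summable (N : nat) (c kap : R) : 1 < 2 * INR N + kap ->
  ex_series (fun k => c * Rpower (INR k + 1) (- (2 * INR N + kap))).
Proof.
  intros H. apply (ex_series_scal_l (K := R_AbsRing) (V := R_NormedModule) c).
  apply ex_series_hurwitz; lra.
Qed.

Lemma rsum_continuous (f : nat -> R -> R) n u : (forall i, continuous (f i) u) ->
  continuous (fun v => rsum (fun i => f i v) n) u.
Proof.
  intros H. induction n as [|n IH]; [apply continuous_const|].
  exact (continuous_plus (V := R_NormedModule) _ _ _ IH (H n)).
Qed.

Lemma kerBN_continuous N (f : R -> R) u : continuous f u -> 0 < f u -> continuous (fun v => kerBN N (f v)) u.
Proof.
  intros Hf H0. assert (Hpi := PI_RGT_0). apply (continuous_minus (V := R_NormedModule)); [now apply kerA_continuous|].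
  unfold kerP. apply (continuous_plus (V := R_NormedModule)).
  - apply (continuous_comp f (fun y => - / 2 + / (2 * PI * y))); [assumption|].
    apply (ex_derive_continuous (V := R_NormedModule)). auto_derive.
    apply Rmult_integral_contrapositive. split; lra.
  - apply (rsum_continuous (fun i v => (-1) ^ i * f v ^ (2 * i + 1) * zev (S i) / PI)). intros i.
    apply (continuous_comp f (fun y => (-1) ^ i * y ^ (2 * i + 1) * zev (S i) / PI)); [assumption|].
    apply (ex_derive_continuous (V := R_NormedModule)). auto_derive; trivial.
Qed.

Lemma continuous_scal_exp (c : R) (u : R) : continuous (fun v => c * exp v) u.
Proof. apply (ex_derive_continuous (V := R_NormedModule)). auto_derive; trivial. Qed.
Lemma continuous_scal_exp_opp (c : R) (u : R) : continuous (fun v => c * exp (- v)) u.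
Proof. apply (ex_derive_continuous (V := R_NormedModule)). auto_derive; trivial. Qed.

Definition gB (x u : R) : C := RtoC (kerA 0 (x * exp u)).
Definition gBN (N : nat) (x u : R) : C := RtoC (kerBN N (x * exp (- u))).

Lemma gB_order x p : 0 < x -> exists K, exp_order (gB x) K p.
Proof.
  intros Hx. destruct (kerA_exp_decay 0 x (Rabs p + 1)) as [K [HK B]]; [assumption|generalize (Rabs_pos p); lra|].
  exists K. split.
  - intros t _. apply ccont_RtoC, kerA_continuous; [apply continuous_scal_exp|].
    apply Rmult_lt_0_compat; [assumption|apply exp_pos].
  - intros t Ht. unfold gB. rewrite Cmod_R. eapply Rle_trans; [now apply B|].
    apply Rmult_le_compat_l; [assumption|]. apply exp_le_compat.
    assert (Q := Rle_abs (- p)). rewrite Rabs_Ropp in Q. nra.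
Qed.

Lemma gBN_ccont N x u : 0 < x -> ccont (gBN N x) u.
Proof.
  intros Hx. apply ccont_RtoC, kerBN_continuous; [apply continuous_scal_exp_opp|].
  apply Rmult_lt_0_compat; [assumption|apply exp_pos].
Qed.

Lemma gBN_order N x : 0 < x -> exists K, exp_order (gBN N x) K (- (2 * INR N + 1)).
Proof.
  intros Hx.
  set (c := x ^ (2 * N + 1) / PI * Rpower x (- (2 - 2))).
  assert (Es := bterm_majorant_summable N c 2 ltac:(generalize (pos_INR N); lra)).
  exists (Series (fun k => c * Rpower (INR k + 1) (- (2 * INR N + 2)))). split.
  - intros t _. now apply gBN_ccont.
  - intros t Ht.
    assert (S := is_series_RtoC _ _ (kerBN_series N (x * exp (- t)) ltac:(apply Rmult_lt_0_compat; [assumption|apply exp_pos]))).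
    rewrite <- Series_scal_r.
    apply (cseries_Cmod_le _ (fun k => c * Rpower (INR k + 1) (- (2 * INR N + 2)) * exp (- (2 * INR N + 1) * t)) _) with (3 := S).
    + intros k. assert (M := bterm_majorant N k x 0 2 t Hx ltac:(lra)).
      rewrite Cmult_0_l, cexp_0, Cmult_1_l in M. eapply Rle_trans; [exact M|]. right. unfold c. simpl Re.
      f_equal. f_equal. ring.
    + now apply ex_series_scal_r.
Qed.

(* The coefficient of [t^(-(2i+1))] in the expansion of [B(x/t) = kerA 0 (x/t)] as [t] tends to infinity. *)
Definition pcoef (x : R) (i : nat) : R := (-1) ^ i * x ^ (2 * i + 1) * zev (S i) / PI.

Lemma kerP_exp N x u : 0 < x ->
  kerP N (x * exp (- u)) = - / 2 + / (2 * PI * x) * exp u + rsum (fun i => pcoef x i * exp (- ((2 * INR i + 1) * u))) N.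
Proof.
  intros Hx. assert (Hpi := PI_RGT_0). unfold kerP. f_equal.
  - f_equal. rewrite exp_Ropp. assert (H := exp_pos u). field. repeat split; lra.
  - apply rsum_ext. intros i. unfold pcoef.
    rewrite Rpow_mult_distr, exp_mult_nat, plus_INR, mult_INR.
    replace ((INR 2 * INR i + INR 1) * - u) with (- ((2 * INR i + 1) * u)) by (simpl; ring). field. lra.
Qed.

(* Analytic continuation, to [Re nu < 2N+1] minus finitely many integers, of the Mellin transform of
   [t |-> B(x/t)]; the subtracted fractions are the Mellin transforms over (0, 1) of the terms of [kerP]. *)
Definition melB (N : nat) (x : R) (nu : C) : C :=
  (LT (gB x) nu + LT (gBN N x) (- nu) + / 2 * / nu - RtoC (/ (2 * PI * x)) * / (nu + 1)
   - csum0 (fun i => RtoC (pcoef x i) * / (nu - RtoC (2 * INR i + 1))) N)%C.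

Lemma ccos_plus_PI (z : C) : ccos (z + RtoC PI) = (- ccos z)%C.
Proof.
  unfold ccos. rewrite !Cmult_plus_distr_l, Copp_plus_distr, !cexp_plus, (cexp_opp (Ci * RtoC PI)), cexp_Ci, cos_PI, sin_PI.
  replace (-1, 0) with (- RtoC 1)%C by (apply C_ext; simpl; ring). field.
Qed.

Lemma csin_plus_PI (z : C) : csin (z + RtoC PI) = (- csin z)%C.
Proof.
  unfold csin. rewrite !Cmult_plus_distr_l, Copp_plus_distr, !cexp_plus, (cexp_opp (Ci * RtoC PI)), cexp_Ci, cos_PI, sin_PI.
  replace (-1, 0) with (- RtoC 1)%C by (apply C_ext; simpl; ring). field. apply Ci_neq0.
Qed.

Lemma ccos_half_shift (nu : C) (N : nat) :
  (ccos (RtoC PI * nu / 2) = RtoC ((-1) ^ N) * ccos (RtoC PI * (nu - RtoC (2 * INR N)) / 2))%C.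
Proof.
  induction N as [|N IH].
  - simpl. rewrite Cmult_1_l. do 2 f_equal. rewrite Rmult_0_r. ring.
  - rewrite IH. replace (RtoC PI * (nu - RtoC (2 * INR N)) / 2)%C
      with (RtoC PI * (nu - RtoC (2 * INR (S N))) / 2 + RtoC PI)%C.
    + rewrite ccos_plus_PI. change ((-1) ^ S N) with (-1 * (-1) ^ N). rewrite (RtoC_mult (-1)). replace (RtoC (-1)) with (- RtoC 1)%C by (apply C_ext; simpl; ring). ring.
    + rewrite S_INR, !RtoC_mult, RtoC_plus. field.
Qed.

Lemma csin_half_shift (nu : C) (N : nat) :
  (csin (RtoC PI * nu / 2) = RtoC ((-1) ^ N) * csin (RtoC PI * (nu - RtoC (2 * INR N)) / 2))%C.
Proof.
  induction N as [|N IH].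
  - simpl. rewrite Cmult_1_l. do 2 f_equal. rewrite Rmult_0_r. ring.
  - rewrite IH. replace (RtoC PI * (nu - RtoC (2 * INR N)) / 2)%C
      with (RtoC PI * (nu - RtoC (2 * INR (S N))) / 2 + RtoC PI)%C.
    + rewrite csin_plus_PI. change ((-1) ^ S N) with (-1 * (-1) ^ N). rewrite (RtoC_mult (-1)). replace (RtoC (-1)) with (- RtoC 1)%C by (apply C_ext; simpl; ring). ring.
    + rewrite S_INR, !RtoC_mult, RtoC_plus. field.
Qed.

Lemma ccos_half_plus_one (s : C) : ccos (RtoC PI * (s + 1) / 2) = (- csin (RtoC PI * s / 2))%C.
Proof.
  unfold ccos, csin.
  replace (Ci * (RtoC PI * (s + 1) / 2))%C with (Ci * (RtoC PI * s / 2) + Ci * RtoC (PI / 2))%C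
    by (rewrite RtoC_div by lra; field).
  rewrite Copp_plus_distr, !cexp_plus, (cexp_opp (Ci * RtoC (PI / 2))), cexp_Ci, cos_PI2, sin_PI2.
  replace (0, 1) with Ci by reflexivity.
  set (X := cexp (Ci * (RtoC PI * s / 2))). set (Y := cexp (- (Ci * (RtoC PI * s / 2)))).
  replace (/ Ci)%C with (- Ci)%C by (apply C_ext; simpl; field).
  replace ((X - Y) / (2 * Ci))%C with (- Ci * (X - Y) / 2)%C; [field|].
  replace (/ (2 * Ci))%C with (/ 2 * - Ci)%C by (apply C_ext; simpl; field). 
  unfold Cdiv. replace (/ (2 * Ci))%C with (- Ci * / 2)%C by (apply C_ext; simpl; field). ring.
Qed.

Lemma Cneg_neg (z : C) : z = (- - z)%C.
Proof. ring. Qed.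

Lemma hint_able_csum0 (f : nat -> R -> C) n : (forall i, (i < n)%nat -> hint_able (f i)) ->
  hint_able (fun u => csum0 (fun i => f i u) n) /\
  Hint (fun u => csum0 (fun i => f i u) n) = csum0 (fun i => Hint (f i)) n.
Proof.
  induction n as [|n IH]; intros H.
  - assert (D : hdom (fun _ => RtoC 0) 0 1).
    { split; [lra|split; [intros t _; apply ccont_const|]]. intros t _. rewrite Cmod_0, Rmult_0_l. apply Rle_refl. }
    split; [eapply hdom_able, D|]. simpl. assert (Q := Hint_Cmod_le _ _ _ D).
    unfold Rdiv in Q. rewrite Rmult_0_l in Q. apply Cmod_eq_0, Rle_antisym; [exact Q|apply Cmod_ge_0].
  - destruct IH as [I1 I2]; [intros; apply H; lia|]. simpl. split.
    + apply hint_able_plus; [exact I1|apply H; lia].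
    + rewrite Hint_plus, I2 by (try exact I1; apply H; lia). reflexivity.
Qed.

(** The fastest growing power in [kerP N (x * exp u)] for N >= 1 is e^((2N-1)u), whence the
    condition on Re nu. The value is the part that [melB] subtracts. *)
Lemma kerP_laplace (N : nat) (x : R) (nu : C) : 0 < x -> 0 < Re nu -> 2 * INR N - 1 < Re nu ->
  let f := fun u => (cexp (- nu * RtoC u) * RtoC (kerP N (x * exp u)))%C in
  hint_able f /\ Hint f = (- / 2 * / nu + RtoC (/ (2 * PI * x)) * / (nu + 1)
    + csum0 (fun i => RtoC (pcoef x i) * / (nu - RtoC (2 * INR i + 1))) N)%C.
Proof.
  intros Hx Hn1 Hn2 f.
  set (g := fun (i : nat) u => (RtoC (pcoef x i) * cexp (- (nu - RtoC (2 * INR i + 1)) * RtoC u))%C).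
  assert (Hg : forall i, (i < N)%nat -> hint_able (g i) /\
     Hint (g i) = (RtoC (pcoef x i) * / (nu - RtoC (2 * INR i + 1)))%C).
  { intros i Hi. apply lt_INR in Hi. assert (Hr : 2 * INR i + 1 < Re nu).
    { assert (INR i + 1 <= INR N); [|lra]. rewrite <- S_INR. apply le_INR. apply INR_lt in Hi. lia. }
    destruct (Hint_cexp (- (nu - RtoC (2 * INR i + 1)))) as [A B]; [rewrite Re_opp, Re_minus, Re_RtoC; lra|].
    split; [now apply hint_able_scal|]. unfold g. rewrite Hint_scal, B by assumption. field.
    intro Q. apply Cminus_eq_0 in Q. rewrite Q, Re_RtoC in Hr. lra. }
  destruct (Hint_cexp (- nu)) as [A1 B1]; [rewrite Re_opp; lra|].
  destruct (Hint_cexp (- (nu + 1))) as [A2 B2]; [rewrite Re_opp, Re_plus, Re_RtoC; lra|].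
  destruct (hint_able_csum0 g N) as [A3 B3]; [intros i Hi; now apply Hg|].
  set (h := fun u => (- / 2 * cexp (- nu * RtoC u) + RtoC (/ (2 * PI * x)) * cexp (- (nu + 1) * RtoC u)
     + csum0 (fun i => g i u) N)%C).
  assert (E : forall u, h u = f u).
  { intros u. unfold h, f. replace (x * exp u) with (x * exp (- - u)) by (now rewrite Ropp_involutive).
    rewrite kerP_exp, !RtoC_plus, RtoC_rsum, !RtoC_mult, RtoC_opp, (RtoC_inv 2) by (assumption || lra).
    rewrite !Cmult_plus_distr_l, <- csum0_scal. f_equal; [f_equal; [ring|]|].
    - replace (- (nu + 1) * RtoC u)%C with (- nu * RtoC u + RtoC (- u))%C by (rewrite RtoC_opp; ring).
      rewrite cexp_plus, cexp_RtoC. ring.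
    - apply csum0_ext. intros i _. unfold g. rewrite RtoC_mult.
      replace (- (nu - RtoC (2 * INR i + 1)) * RtoC u)%C with (- nu * RtoC u + RtoC (- ((2 * INR i + 1) * - u)))%C
        by (rewrite !RtoC_opp, !RtoC_mult, RtoC_opp; ring).
      rewrite cexp_plus, cexp_RtoC. ring. }
  assert (A1' := hint_able_scal (- / 2)%C _ A1). assert (A2' := hint_able_scal (RtoC (/ (2 * PI * x))) _ A2).
  assert (A4 := hint_able_plus _ _ A1' A2'). assert (Ah : hint_able h) by exact (hint_able_plus _ _ A4 A3).
  split; [now apply (hint_able_ext h)|].
  rewrite <- (Hint_ext h f) by (intros; apply E). unfold h.
  rewrite (Hint_plus _ _ A4 A3), (Hint_plus _ _ A1' A2'), (Hint_scal _ _ A1), (Hint_scal _ _ A2), B1, B2, B3.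
  rewrite (csum0_ext _ _ N (fun i Hi => proj2 (Hg i Hi))). f_equal.
  assert (nu <> 0%C) by (intros ->; simpl in Hn1; lra).
  assert ((nu + 1)%C <> 0%C) by (intro Q; apply (f_equal Re) in Q; rewrite Re_plus, !Re_RtoC in Q; lra).
  field. split; assumption.
Qed.

(** Summability over k needs 2N + kap > 1, decay at -oo needs kap < r + 1. For N >= 1 the value 0 is
    enough; for N = 0 the room between 1 and 1 + r is used. *)
Lemma kap_exists (N : nat) (r : R) : 0 < r + 2 * INR N -> -1 < r -> r < 1 ->
  exists kap, 0 <= kap <= 2 /\ 1 < 2 * INR N + kap /\ kap < r + 1.
Proof.
  intros H1 H2 H3. destruct N as [|N].
  - exists (1 + r / 2). simpl in *. lra.
  - exists 0. rewrite S_INR. assert (H := pos_INR N). lra.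
Qed.

(** The transform of B_N over the whole line can be computed in two ways: as [melB], and termwise
    through [cauchy_integral]. In the latter x / n, n = k + 1, yields x^nu n^(-nu-1), hence zeta(nu
    + 1). *)
Lemma melB_interior (N : nat) (x : R) (nu : C) (F1 : C -> C) : 0 < x ->
  is_hurwitz_continuation 1 F1 ->
  0 < Re nu -> 2 * INR N - 1 < Re nu < 2 * INR N + 1 ->
  (2 * ccos (RtoC PI * nu / 2) * melB N x nu)%C = (cpow x nu * F1 (nu + 1))%C.
Proof.
  intros Hx HF1 Hn0 Hn. assert (Hpi := PI_RGT_0).
  destruct (kap_exists N (Re nu - 2 * INR N)) as (kap & Hk1 & Hk2 & Hk3); try lra.
  set (F := fun u => (cexp (nu * RtoC u) * RtoC (kerBN N (x * exp (- u))))%C).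
  set (f := fun (k : nat) u => (cexp (nu * RtoC u) * RtoC (bterm N k (x * exp (- u))))%C).
  set (c := fun ka => x ^ (2 * N + 1) / PI * Rpower x (- (2 - ka))).
  assert (Bd : forall ka k u, 0 <= ka <= 2 ->
    Cmod (f k u) <= c ka * Rpower (INR k + 1) (- (2 * INR N + ka)) * exp ((Re nu - 2 * INR N + 1 - ka) * u)).
  { intros ka k u Hka. now apply bterm_majorant. }
  assert (Hab : Rabs (Re (nu - RtoC (2 * INR N))) < 1) by (rewrite Re_minus, Re_RtoC; apply Rabs_def1; lra).
  assert (Ef : forall k u, f k u = (RtoC (bcoef N x k) * cauchy_exp (nu - RtoC (2 * INR N)) (x / (INR k + 1)) u)%C)
    by (intros; now apply bterm_cauchy).
  assert (Hv : forall k, 0 < x / (INR k + 1)) by (intros k; assert (H := pos_INR k); apply Rdiv_lt_0_compat; lra).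
  destruct (Rint_series f F (fun k => c 2 * Rpower (INR k + 1) (- (2 * INR N + 2)))
     (fun k => c kap * Rpower (INR k + 1) (- (2 * INR N + kap))) (1 - (Re nu - 2 * INR N)) (Re nu - 2 * INR N + 1 - kap))
    as (A1 & A2 & S).
  { lra. } { lra. }
  { intros k t. apply (ccont_ext (fun u => RtoC (bcoef N x k) * cauchy_exp (nu - RtoC (2 * INR N)) (x / (INR k + 1)) u)%C).
    - intros u. now rewrite Ef.
    - apply ccont_mult; [apply ccont_const|now apply cauchy_exp_ccont]. }
  { intros t. apply ccont_mult; [apply ccont_cexp_scal|now apply gBN_ccont]. }
  { intros k t Ht. eapply Rle_trans; [apply (Bd 2); lra|]. right. f_equal. f_equal. ring. }
  { apply bterm_majorant_summable. assert (H := pos_INR N). lra. }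
  { intros k t Ht. eapply Rle_trans; [apply (Bd kap); lra|]. right. f_equal. f_equal. ring. }
  { now apply bterm_majorant_summable. }
  { intros t. apply cseries_scal. apply is_series_RtoC, kerBN_series.
    apply Rmult_lt_0_compat; [assumption|apply exp_pos]. }
  destruct (kerP_laplace N x nu Hx Hn0 ltac:(lra)) as [P1 P2].
  destruct (gB_order x 0 Hx) as [K1 O1]. destruct (gBN_order N x Hx) as [K2 O2].
  assert (E1 : Rint F = melB N x nu).
  { unfold melB, Rint, LT.
    rewrite (Hint_ext F (lt_fun (gBN N x) (- nu))).
    2:{ intros t _. unfold F, lt_fun, gBN. do 2 f_equal. ring. }
    (* On the left half-line B_N is split into B minus [kerP], whose transforms converge separately
       since Re nu > 2N - 1 and Re nu > 0. *)
    rewrite (Hint_ext (fun u => F (- u)) (fun u => lt_fun (gB x) nu u - cexp (- nu * RtoC u) * RtoC (kerP N (x * exp u)))%C).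
    2:{ intros t _. unfold F, lt_fun, gB, kerBN. rewrite Ropp_involutive, RtoC_minus, RtoC_opp.
        replace (nu * - RtoC t)%C with (- nu * RtoC t)%C by ring. ring. }
    rewrite Hint_minus; [rewrite P2; ring| |exact P1].
    apply (LT_able _ _ _ _ O1). lra. }
  assert (Hc : ccos (RtoC PI * nu / 2) <> 0%C).
  { intro Q. destruct (ccos_half_zero nu Q) as [k Hk]. rewrite Hk, Re_RtoC in Hn.
    rewrite INR_IZR_INZ in Hn. destruct Hn as [N1 N2].
    assert (Q1 : IZR (2 * Z.of_nat N - 1) < IZR (2 * k + 1)) by (rewrite minus_IZR, plus_IZR, !mult_IZR; lra).
    assert (Q2 : IZR (2 * k + 1) < IZR (2 * Z.of_nat N + 1)) by (rewrite !plus_IZR, !mult_IZR; lra).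
    apply lt_IZR in Q1, Q2. lia. }
  assert (S2 := cseries_scal (cpow x nu * / (2 * ccos (RtoC PI * nu / 2)))%C _ _
     (proj2 HF1 (nu + 1)%C ltac:(rewrite Re_plus, Re_RtoC; lra))).
  assert (E3 : Rint F = (cpow x nu * / (2 * ccos (RtoC PI * nu / 2)) * F1 (nu + 1))%C).
  { apply (cseries_unique _ _ _ S). eapply cseries_ext; [|exact S2]. intros k. simpl.
    assert (Hk := pos_INR k).
    rewrite (Rint_ext _ _ (Ef k)), Rint_scal, cauchy_integral by (try apply cauchy_exp_rable; auto).
    rewrite (ccos_half_shift nu N) in Hc |- *.
    set (a := (nu - RtoC (2 * INR N))%C) in *.
    assert (Hc2 : ccos (RtoC PI * a / 2) <> 0%C) by (intro Q; apply Hc; rewrite Q; ring).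
    unfold Rdiv at 1. rewrite cpow_mult_base by (try assumption; apply Rinv_0_lt_compat; lra).
    rewrite cpow_inv_base by lra.
    assert (X1 : (cpow x nu = RtoC (x ^ (2 * N + 1)) * cpow x (a - 1))%C).
    { rewrite <- cpow_nat, <- cpow_plus by assumption. f_equal. unfold a.
      replace (INR (2 * N + 1)) with (2 * INR N + 1) by (rewrite plus_INR, mult_INR; simpl; ring).
      rewrite RtoC_plus. ring. }
    assert (X2 : (cpow (INR k + 1) (- (nu + 1)) = / RtoC ((INR k + 1) ^ (2 * N + 2)) * / cpow (INR k + 1) (a - 1))%C).
    { rewrite <- cpow_nat, <- !cpow_opp, <- cpow_plus by lra. f_equal. unfold a.
      replace (INR (2 * N + 2)) with (2 * INR N + 2) by (rewrite plus_INR, mult_INR; simpl; ring).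
      rewrite RtoC_plus. ring. }
    rewrite X1, X2. unfold bcoef.
    assert (P0 : 0 < (INR k + 1) ^ (2 * N + 2)) by (apply pow_lt; lra).
    assert (P3 : (-1) ^ N <> 0) by (apply pow_nonzero; lra).
    set (w := (INR k + 1) ^ (2 * N + 2)) in *. set (sg := (-1) ^ N) in *.
    assert (Hsg : sg * sg = 1) by (unfold sg; rewrite <- Rpow_mult_distr; replace (-1 * -1) with 1 by ring; apply pow1).
    unfold Rdiv. rewrite !RtoC_mult, RtoC_inv, RtoC_mult by (apply Rmult_integral_contrapositive; lra).
    assert (Q1 : RtoC PI <> 0%C) by (intro Q; apply RtoC_inj in Q; lra).
    assert (Q2 : RtoC w <> 0%C) by (intro Q; apply RtoC_inj in Q; lra).
    assert (Q3 : RtoC sg <> 0%C) by (intro Q; apply RtoC_inj in Q; lra).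
    assert (Q4 := cpow_neq_0 (INR k + 1) (a - 1)).
    apply (f_equal RtoC) in Hsg. rewrite RtoC_mult in Hsg.
    transitivity (RtoC sg * RtoC sg * (RtoC (x ^ (2 * N + 1)) * cpow x (a - 1)) /
       (2 * (RtoC sg * ccos (RtoC PI * a / 2)) * RtoC w * cpow (INR k + 1) (a - 1)))%C.
    - rewrite Hsg. field. repeat split; assumption.
    - field. repeat split; assumption. }
  rewrite <- E1, E3. field. assumption.
Qed.

Lemma csum0_cder (f : nat -> C -> C) (z : C) n : (forall i, (i < n)%nat -> exists l, cder (f i) z l) ->
  exists l, cder (fun w => csum0 (fun i => f i w) n) z l.
Proof.
  induction n as [|n IH]; intros H.
  - eexists. apply (cder_const 0).
  - destruct IH as [l Hl]; [intros; apply H; lia|]. destruct (H n) as [m Hm]; [lia|].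
    exists (l + m)%C. now apply cder_plus.
Qed.

Lemma melB_cder (N : nat) (x : R) (nu : C) : 0 < x -> Re nu < 2 * INR N + 1 ->
  (forall k : Z, nu <> RtoC (IZR k)) -> exists l, cder (melB N x) nu l.
Proof.
  intros Hx Hn Hz. destruct (gB_order x (Re nu - 1) Hx) as [K1 O1]. destruct (gBN_order N x Hx) as [K2 O2].
  destruct (LT_cder _ _ _ nu O1 ltac:(lra)) as [l1 D1].
  destruct (LT_opp_cder _ _ _ nu O2 ltac:(lra)) as [l2 D2].
  destruct (csum0_cder (fun i w => RtoC (pcoef x i) * / (w - RtoC (2 * INR i + 1)))%C nu N) as [l3 D3].
  { intros i _. eexists. apply cder_mult; [apply cder_const|].
    apply (cder_inv (fun w => w - RtoC (2 * INR i + 1))%C).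
    - intro Q. apply Cminus_eq_0 in Q. apply (Hz (2 * Z.of_nat i + 1)%Z).
      rewrite Q, INR_IZR_INZ, plus_IZR, mult_IZR. reflexivity.
    - apply cder_minus; [apply cder_id|apply cder_const]. }
  eexists. unfold melB. apply cder_minus; [apply cder_minus; [apply cder_plus; [apply cder_plus|]|]|].
  - exact D1.
  - exact D2.
  - apply cder_mult; [apply cder_const|]. apply cder_inv_id. exact (Hz 0%Z).
  - apply cder_mult; [apply cder_const|]. apply (cder_inv (fun w => w + 1)%C).
    + intro Q. apply (Hz (-1)%Z). apply Cminus_eq_0. rewrite <- Q. apply C_ext; simpl; ring.
    + apply cder_plus; [apply cder_id|apply cder_const].
  - exact D3.
Qed.

Lemma cder_zero_right (f : C -> C) (z l : C) (e : R) : cder f z l -> 0 < e ->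
  (forall eps, 0 < eps < e -> f (z + RtoC eps)%C = 0%C) -> f z = 0%C.
Proof.
  intros H He Hz. apply Cmod_eq_0, Rle_antisym; [|apply Cmod_ge_0].
  apply le_epsilon. intros eta Heta. rewrite Rplus_0_l.
  destruct (cder_cont _ _ _ H eta Heta) as [d [Hd Hc]].
  set (h := Rmin e d / 2). assert (Hh : 0 < h < e /\ h < d).
  { assert (Q := Rmin_pos _ _ He Hd). assert (Q1 := Rmin_l e d). assert (Q2 := Rmin_r e d). unfold h. lra. }
  specialize (Hc (z + RtoC h)%C). rewrite (Hz h) in Hc by lra.
  replace (z + RtoC h - z)%C with (RtoC h) in Hc by ring. rewrite Cmod_R, Rabs_right in Hc by lra.
  specialize (Hc ltac:(lra)). replace (0 - f z)%C with (- f z)%C in Hc by ring. rewrite Cmod_opp in Hc. lra.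
Qed.

Lemma cder_cpow (x : R) (s : C) : exists l, cder (cpow x) s l.
Proof.
  eexists. unfold cpow. apply cder_cexp_comp. apply cder_mult; [apply cder_id|apply cder_const].
Qed.

(** On the edges Re nu = 2N - 1 and Re nu = 0 the integrand of [melB_interior] need not decay at
    -oo. Both sides are continuous at nu, and the equality holds at nu + eps for small eps > 0. *)
Theorem melB_value (N : nat) (x : R) (nu : C) (F1 : C -> C) : 0 < x ->
  is_hurwitz_continuation 1 F1 ->
  0 <= Re nu -> 2 * INR N - 1 <= Re nu < 2 * INR N + 1 -> (forall k : Z, nu <> RtoC (IZR k)) ->
  (2 * ccos (RtoC PI * nu / 2) * melB N x nu)%C = (cpow x nu * F1 (nu + 1))%C.
Proof.
  intros Hx HF1 Hn0 Hn Hz. apply Cminus_eq_0.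
  destruct (cder_ccos_half nu) as [l1 D1]. destruct (melB_cder N x nu Hx ltac:(lra) Hz) as [l2 D2].
  destruct (cder_cpow x nu) as [l3 D3].
  destruct (proj1 HF1 (nu + 1)%C) as [l4 D4].
  { intro Q. apply (Hz 0%Z). apply Cminus_eq_0. replace (nu - 0)%C with (nu + 1 - 1)%C by ring. rewrite Q. ring. }
  assert (D5 := cder_comp F1 (fun w => w + 1)%C nu _ _ D4 (cder_plus _ _ _ _ _ (cder_id nu) (cder_const 1 nu))).
  eapply (cder_zero_right (fun w => 2 * ccos (RtoC PI * w / 2) * melB N x w - cpow x w * F1 (w + 1))%C nu _
    (2 * INR N + 1 - Re nu)).
  - apply cder_minus; [|exact (cder_mult _ _ _ _ _ D3 D5)].
    exact (cder_mult _ _ _ _ _ (cder_mult _ _ _ _ _ (cder_const 2 nu) D1) D2).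
  - lra.
  - intros eps He. cbv beta. rewrite (melB_interior N x (nu + RtoC eps) F1) by (try assumption; rewrite Re_plus, Re_RtoC; lra).
    ring.
Qed.

(** * Mellin transform of a product of two Cauchy kernels *)

(** With t = e^u, the product of the kernels t / (t^2 + v^2) and t / (t^2 + y^2). *)
Definition g2 (v y u : R) : R := exp (2 * u) / ((exp (2 * u) + v ^ 2) * (exp (2 * u) + y ^ 2)).
Definition cauchy2 (a : C) (v y u : R) : C := (cexp (a * RtoC u) * RtoC (g2 v y u))%C.

Lemma g2_continuous v y u : 0 < v -> 0 < y -> continuous (g2 v y) u.
Proof.
  intros Hv Hy. apply (ex_derive_continuous (V := R_NormedModule)). unfold g2. auto_derive.
  assert (P := exp_pos (2 * u)). assert (0 < v ^ 2) by now apply pow_lt. assert (0 < y ^ 2) by now apply pow_lt.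
  apply Rmult_integral_contrapositive. simpl in *. split; lra.
Qed.

Lemma g2_bounds v y u : 0 < v -> 0 < y ->
  0 <= g2 v y u /\ g2 v y u <= exp (- (2) * u) /\ g2 v y u <= / (v ^ 2 * y ^ 2) * exp (2 * u).
Proof.
  intros Hv Hy. unfold g2.
  assert (P := exp_pos (2 * u)). assert (P1 : 0 < v ^ 2) by now apply pow_lt. assert (P2 : 0 < y ^ 2) by now apply pow_lt.
  set (E := exp (2 * u)) in *. set (V := v ^ 2) in *. set (Y := y ^ 2) in *.
  assert (D : 0 < (E + V) * (E + Y)) by (apply Rmult_lt_0_compat; lra).
  split; [|split].
  - left. now apply Rdiv_lt_0_compat.
  - replace (- (2) * u) with (- (2 * u)) by ring. rewrite exp_Ropp. fold E.
    apply Rmult_le_reg_r with ((E + V) * (E + Y)); [assumption|].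
    unfold Rdiv. rewrite Rmult_assoc, Rinv_l, Rmult_1_r by lra.
    apply Rmult_le_reg_l with E; [assumption|]. rewrite <- Rmult_assoc, Rinv_r, Rmult_1_l by lra. nra.
  - unfold Rdiv. rewrite Rmult_comm. apply Rmult_le_compat_r; [lra|].
    assert (0 < V * Y) by now apply Rmult_lt_0_compat. apply Rinv_le_contravar; nra.
Qed.

Lemma cauchy2_split (a : C) (v y u : R) : 0 < v -> 0 < y -> v <> y ->
  cauchy2 a v y u = (RtoC (/ (v ^ 2 - y ^ 2)) * (cauchy_exp (a + 1) y u + - (1) * cauchy_exp (a + 1) v u))%C.
Proof.
  intros Hv Hy Hne. unfold cauchy2, cauchy_exp, g2.
  replace ((a + 1) * RtoC u)%C with (a * RtoC u + RtoC u)%C by ring.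
  rewrite cexp_plus, cexp_RtoC.
  transitivity (cexp (a * RtoC u) * RtoC (/ (v ^ 2 - y ^ 2) * (exp u * (exp u / (exp (2 * u) + y ^ 2)) -
    exp u * (exp u / (exp (2 * u) + v ^ 2)))))%C.
  - do 2 f_equal. replace (exp (2 * u)) with (exp u * exp u) by (rewrite <- exp_plus; f_equal; ring).
    assert (P := exp_pos u). assert (P1 : 0 < v ^ 2) by now apply pow_lt. assert (P2 : 0 < y ^ 2) by now apply pow_lt.
    assert (v ^ 2 - y ^ 2 <> 0) by (replace (v ^ 2 - y ^ 2) with ((v - y) * (v + y)) by ring;
      apply Rmult_integral_contrapositive; split; lra).
    field. repeat split; try assumption; simpl in *; nra.
  - rewrite RtoC_mult, RtoC_minus, !RtoC_mult. ring.
Qed.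

Lemma cauchy2_rable (a : C) (v y : R) : 0 < v -> 0 < y -> -2 < Re a < 2 -> rable (cauchy2 a v y).
Proof.
  intros Hv Hy Ha. exists (1 + / (v ^ 2 * y ^ 2)), (2 - Rabs (Re a)).
  assert (P1 : 0 < / (v ^ 2 * y ^ 2)) by (apply Rinv_0_lt_compat, Rmult_lt_0_compat; now apply pow_lt).
  split; [|split].
  - assert (Rabs (Re a) < 2) by (apply Rabs_def1; lra). lra.
  - intros t. apply ccont_mult; [apply ccont_cexp_scal|]. now apply ccont_RtoC, g2_continuous.
  - intros t. destruct (g2_bounds v y t Hv Hy) as (B0 & B1 & B2).
    unfold cauchy2. rewrite Cmod_mult, Cmod_cexp, Cmod_R, Re_mult, Re_RtoC, Im_RtoC, Rabs_right by (apply Rle_ge; assumption).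
    replace (- (2 - Rabs (Re a)) * Rabs t) with (Rabs (Re a) * Rabs t + - (2) * Rabs t) by ring.
    rewrite exp_plus.
    replace ((1 + / (v ^ 2 * y ^ 2)) * (exp (Rabs (Re a) * Rabs t) * exp (- (2) * Rabs t)))
      with (exp (Rabs (Re a) * Rabs t) * ((1 + / (v ^ 2 * y ^ 2)) * exp (- (2) * Rabs t))) by ring.
    apply Rmult_le_compat; [left; apply exp_pos|assumption| |].
    + apply exp_le_compat. rewrite <- Rabs_mult, Rmult_0_r, Rminus_0_r. apply Rle_abs.
    + assert (P := exp_pos (- (2) * Rabs t)). destruct (Rle_dec 0 t).
      * rewrite Rabs_right in * by lra. nra.
      * rewrite Rabs_left in * by lra. replace (- (2) * - t) with (2 * t) in * by ring. nra.
Qed.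

(** Partial fractions evaluate the integral only for -2 < Re a < 0, where the two pieces converge
    separately. The product converges for -2 < Re a < 2, and the identity theorem extends the value.
    The factor sin(pi a / 2) stays on the left because it vanishes at a = 0. The puncture 3 lies
    outside the strip. *)
Theorem cauchy2_integral (a : C) (v y : R) : 0 < v -> 0 < y -> v <> y -> -2 < Re a < 2 ->
  (csin (RtoC PI * a / 2) * Rint (cauchy2 a v y))%C =
  (RtoC (PI / 2) * (RtoC (/ (v ^ 2 - y ^ 2)) * (cpow v a - cpow y a)))%C.
Proof.
  intros Hv Hy Hne Ha. assert (Hpi := PI_RGT_0). apply Cminus_eq_0.
  apply (identity_strip (fun a => csin (RtoC PI * a / 2) * Rint (cauchy2 a v y) -
    RtoC (PI / 2) * (RtoC (/ (v ^ 2 - y ^ 2)) * (cpow v a - cpow y a)))%C (RtoC 3) (-2) (-2) 0 2); try lra.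
  - intros w Hw _.
    assert (O1 : exp_order (fun u => RtoC (g2 v y u)) 1 (- (2))).
    { split; [intros t _; now apply ccont_RtoC, g2_continuous|]. intros t _.
      destruct (g2_bounds v y t Hv Hy) as (B0 & B1 & B2). rewrite Cmod_R, Rabs_right by (apply Rle_ge; assumption). lra. }
    assert (O2 : exp_order (fun u => RtoC (g2 v y (- u))) (/ (v ^ 2 * y ^ 2)) (- (2))).
    { split.
      - intros t _. apply (ccont_flip (fun u => RtoC (g2 v y u))). now apply ccont_RtoC, g2_continuous.
      - intros t _. destruct (g2_bounds v y (- t) Hv Hy) as (B0 & B1 & B2).
        rewrite Cmod_R, Rabs_right by (apply Rle_ge; assumption).
        replace (- (2) * t) with (2 * - t) by ring. exact B2. }
    destruct (LT_opp_cder _ _ _ w O1 ltac:(lra)) as [l1 D1].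
    destruct (LT_cder _ _ _ w O2 ltac:(lra)) as [l2 D2].
    assert (D3 := cder_plus _ _ _ _ _ D1 D2).
    destruct (cder_ccos_half (w - 1)) as [l4 D4].
    (* The sine is written as cos(pi (z - 1) / 2), so the derivative of the cosine can be reused. *)
    assert (D5 : cder (fun z => csin (RtoC PI * z / 2)) w (l4 * (1 - 0))%C).
    { apply (cder_ext (fun z => ccos (RtoC PI * (z - 1) / 2))).
      - intros z. replace (RtoC PI * z / 2)%C with (RtoC PI * (z - 1 + 1) / 2)%C by (do 2 f_equal; ring).
        rewrite (Cneg_neg (csin _)), <- ccos_half_plus_one.
        replace (RtoC PI * (z - 1 + 1 + 1) / 2)%C with (RtoC PI * (z - 1) / 2 + RtoC PI)%C by field.
        rewrite ccos_plus_PI. ring.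
      - exact (cder_comp (fun z => ccos (RtoC PI * z / 2)) (fun z => z - 1)%C w _ _ D4
          (cder_minus _ _ _ _ _ (cder_id w) (cder_const 1 w))). }
    destruct (cder_cpow v w) as [l6 D6]. destruct (cder_cpow y w) as [l7 D7].
    eexists. apply cder_minus.
    + apply cder_mult; [exact D5|].
      apply (cder_ext (fun z => LT (fun u => RtoC (g2 v y u)) (- z) + LT (fun u => RtoC (g2 v y (- u))) z)%C); [|exact D3].
      intros z. unfold Rint, LT, lt_fun, cauchy2. f_equal; apply Hint_ext; intros t _.
      * do 2 f_equal. ring.
      * rewrite RtoC_opp. do 2 f_equal. ring.
    + apply cder_mult; [apply cder_const|]. exact (cder_mult _ _ _ _ _ (cder_const _ w) (cder_minus _ _ _ _ _ D6 D7)).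
  - intros w Hw _.
    assert (Hr : Rabs (Re (w + 1)%C) < 1) by (rewrite Re_plus, Re_RtoC; apply Rabs_def1; lra).
    assert (Q1 := cauchy_exp_rable (w + 1) y Hy Hr). assert (Q2 := cauchy_exp_rable (w + 1) v Hv Hr).
    rewrite (Rint_ext _ _ (fun u => cauchy2_split w v y u Hv Hy Hne)).
    assert (Q3 := rable_scal (- (1))%C _ Q2).
    rewrite (Rint_scal _ _ (rable_plus _ _ Q1 Q3)), (Rint_plus _ _ Q1 Q3), (Rint_scal _ _ Q2), !cauchy_integral by assumption.
    rewrite ccos_half_plus_one. replace (w + 1 - 1)%C with w by ring.
    assert (Hs : csin (RtoC PI * w / 2) <> 0%C).
    { intro Q. destruct (csin_half_zero w Q) as [k Hk]. rewrite Hk, Re_RtoC in Hw.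
      assert (Z1 : IZR k < 0) by lra. assert (Z2 : -1 < IZR k) by lra. apply lt_IZR in Z1, Z2. lia. }
    rewrite (RtoC_div PI 2) by lra. field. assumption.
  - intro Q. rewrite Q, Re_RtoC in Ha. lra.
Qed.

(** * The Bessel function as an integral over the line *)

Lemma is_hint_RInt_gen (f : R -> C) (l : C) : hcont f -> is_hint f l ->
  @RInt_gen C_R_CompleteNormedModule f (at_point 0) (Rbar_locally p_infty) = l.
Proof.
  intros Hc H. apply (is_RInt_gen_unique (V := C_R_CompleteNormedModule)).
  apply (filterlimi_locally (U := C_R_CompleteNormedModule)). intros eps.
  destruct (H (eps / 2)) as [M [HM B]]; [generalize (cond_pos eps); lra|].
  apply (Filter_prod _ _ _ (fun a => a = 0) (fun b => M < b)); [reflexivity|now exists M|].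
  intros a b -> Hb. simpl. exists (Cint f 0 b). split.
  - destruct (ccont_ex_RInt f 0 b) as [E1 E2]; [apply hcont_Cint; lra || assumption|].
    apply (is_RInt_fct_extend_pair (U := R_NormedModule) (V := R_NormedModule) f 0 b).
    + apply (RInt_correct (V := R_CompleteNormedModule)), E1.
    + apply (RInt_correct (V := R_CompleteNormedModule)), E2.
  - specialize (B b ltac:(lra)). assert (He := cond_pos eps).
    split.
    + change (Rabs (Re (Cint f 0 b) - Re l) < eps). rewrite <- Re_minus.
      eapply Rle_lt_trans; [apply re_le_Cmod|]. lra.
    + change (Rabs (Im (Cint f 0 b) - Im l) < eps). rewrite <- Im_minus.
      eapply Rle_lt_trans; [apply im_le_Cmod|]. lra.
Qed.

Lemma double_exp_majorant (p c : R) : 0 <= p -> 0 < c -> exists K, 0 <= K /\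
  forall u, exp (p * u) * exp (- (c * exp u)) <= K * exp (- u).
Proof.
  intros Hp Hc. exists (exp ((p + 1) * ln (p + 1) - (p + 1)) * exp (- (p + 1) * ln c)). split.
  - apply Rmult_le_pos; left; apply exp_pos.
  - intros u. replace (c * exp u) with (exp (u + ln c)) by (rewrite exp_plus, exp_ln by assumption; ring).
    assert (H := exp_exp_decay (p + 1) (u + ln c) ltac:(lra)).
    apply Rle_trans with (exp (p * u) * (exp ((p + 1) * ln (p + 1) - (p + 1)) * exp (- (p + 1) * (u + ln c)))).
    + apply Rmult_le_compat_l; [left; apply exp_pos|exact H].
    + right. rewrite <- !exp_plus. f_equal. ring.
Qed.

Definition bessel_fun (nu : C) (y u : R) : C := (cexp (nu * RtoC u) * RtoC (exp (- (y * cosh u))))%C.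

Lemma cosh_ge_exp (u : R) : exp (Rabs u) / 2 <= cosh u.
Proof. unfold cosh. generalize (exp_cosh_ge u). lra. Qed.

Lemma bessel_fun_rdom nu y : 0 < y -> exists K, rdom (bessel_fun nu y) K 1.
Proof.
  intros Hy. destruct (double_exp_majorant (Rabs (Re nu)) (y / 2)) as [K [HK B]]; [apply Rabs_pos|lra|].
  exists K. split; [lra|split].
  - intros t. apply ccont_mult; [apply ccont_cexp_scal|]. apply ccont_RtoC.
    unfold cosh. apply (ex_derive_continuous (V := R_NormedModule)). auto_derive; trivial.
  - intros t. unfold bessel_fun. rewrite Cmod_mult, Cmod_cexp, Cmod_R, Re_mult, Re_RtoC, Im_RtoC.
    rewrite Rabs_right by (left; apply exp_pos).
    replace (- (1) * Rabs t) with (- Rabs t) by ring.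
    eapply Rle_trans; [|apply B]. apply Rmult_le_compat; [left; apply exp_pos|left; apply exp_pos| |].
    + apply exp_le_compat. rewrite <- Rabs_mult, Rmult_0_r, Rminus_0_r. apply Rle_abs.
    + apply exp_le_compat. assert (H := cosh_ge_exp t). nra.
Qed.

(** As cosh is even, folding the line at 0 turns e^(nu u) into 2 cosh(nu t), whence the factor
    1/2. *)
Lemma BesselK_Rint nu y : 0 < y -> BesselK nu y = (/ 2 * Rint (bessel_fun nu y))%C.
Proof.
  intros Hy. destruct (bessel_fun_rdom nu y Hy) as [K D].
  assert (A1 := hdom_able _ _ _ (rdom_right _ _ _ D)). assert (A2 := hdom_able _ _ _ (rdom_left _ _ _ D)).
  assert (A3 := hint_able_plus _ _ A1 A2). assert (A4 := hint_able_scal (/ 2)%C _ A3).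
  assert (E : forall t, (/ 2 * (bessel_fun nu y t + bessel_fun nu y (- t)))%C =
    (RtoC (exp (- (y * cosh t))) * ccosh (nu * RtoC t))%C).
  { intros t. unfold bessel_fun, ccosh. replace (cosh (- t)) with (cosh t)
      by (unfold cosh; rewrite Ropp_involutive; f_equal; ring).
    replace (nu * RtoC (- t))%C with (- (nu * RtoC t))%C by (rewrite RtoC_opp; ring). field. }
  unfold BesselK. apply is_hint_RInt_gen.
  - apply (hcont_ext _ _ E), A4.
  - replace (/ 2 * Rint (bessel_fun nu y))%C with (Hint (fun t => / 2 * (bessel_fun nu y t + bessel_fun nu y (- t)%R))%C).
    + intros eps He. destruct (hint_able_spec _ A4 eps He) as [M [HM B]]. exists M; split; [assumption|].
      intros b Hb. rewrite <- (Cint_ext _ _ 0 b (fun t _ => E t)). now apply B.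
    + rewrite (Hint_scal _ _ A3), (Hint_plus _ _ A1 A2). reflexivity.
Qed.

Definition theta_fun (nu : C) (p q u : R) : C :=
  (cexp (nu * RtoC u) * RtoC (exp (- (2 * PI * (p * exp u))) * exp (- (2 * PI * (q * exp (- u))))))%C.

(** The translation by ln(S / p), where S^2 = p q, balances the two exponentials: p e^u and q e^(-u)
    become S e^u and S e^(-u), whose sum is 2 S cosh u. *)
Lemma theta_fun_shift nu p q S u : 0 < p -> 0 < S -> S * S = p * q ->
  theta_fun nu p q (u + ln (S / p)) = (cpow (S / p) nu * bessel_fun nu (4 * PI * S) u)%C.
Proof.
  intros Hp HS Hpq. unfold theta_fun, bessel_fun, cpow.
  assert (HSp : 0 < S / p) by now apply Rdiv_lt_0_compat.
  rewrite RtoC_plus, Cmult_plus_distr_l, cexp_plus, <- exp_plus.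
  replace (- (2 * PI * (p * exp (u + ln (S / p)))) + - (2 * PI * (q * exp (- (u + ln (S / p))))))
    with (- (4 * PI * S * cosh u)); [ring|].
  rewrite Ropp_plus_distr, !exp_plus, (exp_Ropp (ln (S / p))), exp_ln by assumption. unfold cosh.
  replace (q * (exp (- u) * / (S / p))) with (S * exp (- u)).
  - field. lra.
  - replace q with (S * S / p) by (rewrite Hpq; field; lra). field. split; lra.
Qed.

Lemma theta_fun_integral nu p q S : 0 < p -> 0 < S -> S * S = p * q ->
  rable (theta_fun nu p q) /\ Rint (theta_fun nu p q) = (2 * (cpow (S / p) nu * BesselK nu (4 * PI * S)))%C.
Proof.
  intros Hp HS Hpq. assert (Hpi := PI_RGT_0).
  assert (Hy : 0 < 4 * PI * S) by (apply Rmult_lt_0_compat; lra).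
  destruct (bessel_fun_rdom nu _ Hy) as [K D].
  assert (D1 := rdom_scal (cpow (S / p) nu) _ _ _ D).
  assert (D2 := rdom_shift _ _ _ (- ln (S / p)) D1).
  assert (D3 : rdom (theta_fun nu p q) (Cmod (cpow (S / p) nu) * K * exp (1 * Rabs (- ln (S / p)))) 1).
  { eapply rdom_ext; [|exact D2]. intros u. cbv beta. rewrite <- (theta_fun_shift nu p q S) by assumption. f_equal. ring. }
  split; [do 2 eexists; exact D3|].
  rewrite <- (Rint_shift _ _ _ (ln (S / p)) D3).
  rewrite (Rint_ext _ _ (fun u => theta_fun_shift nu p q S u Hp HS Hpq)), Rint_scal by (do 2 eexists; exact D).
  rewrite BesselK_Rint by assumption. field.
Qed.

(** * Divisor sums *)

Definition dvd (d n : nat) : bool := Nat.eqb (Nat.modulo n d) 0.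

Lemma fold_right_Cplus (l : list C) (a : C) : fold_right Cplus a l = (fold_right Cplus (RtoC 0) l + a)%C.
Proof. induction l as [|z l IH]; simpl; [ring|]. rewrite IH. ring. Qed.

Lemma divisor_sum_csum0 (n : nat) (f : nat -> C) :
  divisor_sum n f = csum0 (fun i => if dvd (S i) n then f (S i) else RtoC 0) n.
Proof.
  unfold divisor_sum. fold (dvd). change (fun d => Nat.eqb (Nat.modulo n d) 0) with (fun d => dvd d n).
  (* Only the two ranges are generalized; the divisibility test keeps the original n during the
     induction. *)
  generalize n at 2 4. intros k. induction k as [|k IH]; [reflexivity|].
  rewrite seq_S, filter_app, map_app, fold_right_app. simpl csum0. rewrite <- IH. simpl.
  destruct (dvd (S k) n); simpl; rewrite fold_right_Cplus; ring.
Qed.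

Lemma csum1_csum0 (N : nat) (f : nat -> C) : csum1 N f = csum0 (fun i => f (S i)) N.
Proof.
  unfold csum1. induction N as [|N IH]; [reflexivity|].
  rewrite seq_S, map_app, fold_right_app. simpl. rewrite fold_right_Cplus, IH. ring.
Qed.

Lemma csum0_Cmod_le (f : nat -> C) (b : R) n : (forall i, (i < n)%nat -> Cmod (f i) <= b) ->
  Cmod (csum0 f n) <= INR n * b.
Proof.
  induction n as [|n IH]; intros H; [simpl; rewrite Cmod_0; lra|].
  rewrite S_INR. simpl. eapply Rle_trans; [apply Cmod_triangle|].
  specialize (IH ltac:(intros; apply H; lia)). specialize (H n ltac:(lia)). lra.
Qed.

Lemma csum0_csum_n (f : nat -> C) n : csum0 f (S n) = csum_n f n.
Proof.
  induction n as [|n IH]; [simpl; rewrite csum_n_0; ring|].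
  rewrite csum_n_S, <- IH. reflexivity.
Qed.

Lemma csum0_swap (f : nat -> nat -> C) n m :
  csum0 (fun i => csum0 (fun j => f i j) m) n = csum0 (fun j => csum0 (fun i => f i j) n) m.
Proof.
  induction n as [|n IH].
  - simpl. induction m as [|m IHm]; [reflexivity|]. simpl. rewrite <- IHm. ring.
  - simpl. rewrite IH, <- csum0_plus. reflexivity.
Qed.

Lemma csum0_extend (f : nat -> C) n m : (n <= m)%nat -> (forall i, (n <= i)%nat -> f i = RtoC 0) ->
  csum0 f m = csum0 f n.
Proof.
  intros Hnm H. induction Hnm as [|m Hm IH]; [reflexivity|]. simpl. rewrite IH, (H m Hm). ring.
Qed.

(** Among 1, ..., X the multiples of d are d, 2d, ..., floor(X / d) d. Positions are counted from 0,
    so the quotient q is found at index q - 1. *)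
Lemma csum0_multiples (d X : nat) (g : nat -> C) : (1 <= d)%nat ->
  csum0 (fun n => if dvd d (S n) then g (Nat.div (S n) d - 1)%nat else RtoC 0) X = csum0 g (Nat.div X d).
Proof.
  intros Hd. induction X as [|X IH]; [rewrite Nat.Div0.div_0_l; reflexivity|].
  simpl csum0. rewrite IH. unfold dvd.
  assert (E1 := Nat.div_mod X d ltac:(lia)). assert (E2 := Nat.div_mod (S X) d ltac:(lia)).
  assert (M1 := Nat.mod_upper_bound X d ltac:(lia)). assert (M2 := Nat.mod_upper_bound (S X) d ltac:(lia)).
  destruct (Nat.eqb_spec (Nat.modulo (S X) d) 0) as [Z|NZ].
  - assert (Q : Nat.div (S X) d = S (Nat.div X d)) by nia.
    rewrite Q. simpl csum0. do 2 f_equal. lia.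
  - assert (Q : Nat.div (S X) d = Nat.div X d) by nia. rewrite Q. ring.
Qed.

Lemma divisor_sum_partial (al be : nat -> C) X :
  csum0 (fun k => divisor_sum (S k) (fun d => al (d - 1)%nat * be (Nat.div (S k) d - 1)%nat)%C) X =
  csum0 (fun i => (al i * csum0 be (Nat.div X (S i)))%C) X.
Proof.
  rewrite (csum0_ext _ (fun k => csum0 (fun i => if dvd (S i) (S k) then (al i * be (Nat.div (S k) (S i) - 1)%nat)%C else RtoC 0) X)).
  - rewrite csum0_swap. apply csum0_ext. intros i _. rewrite <- (csum0_multiples (S i) X be) by lia.
    rewrite <- csum0_scal. apply csum0_ext. intros k _. destruct (dvd (S i) (S k)); [reflexivity|ring].
  - intros k Hk. rewrite divisor_sum_csum0.
    rewrite (csum0_ext _ (fun i => if dvd (S i) (S k) then (al i * be (Nat.div (S k) (S i) - 1)%nat)%C else RtoC 0)).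
    (* A number greater than k + 1 does not divide k + 1, so the range of divisors may be extended
       to X, and the order of summation exchanged. *)
    + symmetry. apply csum0_extend; [lia|]. intros i Hi. unfold dvd.
      rewrite Nat.mod_small by lia. reflexivity.
    + intros i _. replace (S i - 1)%nat with i by lia. reflexivity.
Qed.

Lemma csum0_tail (f : nat -> C) n m : (n <= m)%nat ->
  csum0 f m = (csum0 f n + csum0 (fun i => f (n + i)%nat) (m - n))%C.
Proof.
  intros H. replace m with (n + (m - n))%nat at 1 by lia. generalize (m - n)%nat as k. intros k.
  induction k as [|k IH]; [rewrite Nat.add_0_r; simpl; ring|].
  rewrite Nat.add_succ_r. simpl. rewrite IH. ring.
Qed.

Lemma csum0_Cmod_rsum (f : nat -> C) (b : nat -> R) n : (forall i, Cmod (f i) <= b i) ->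
  Cmod (csum0 f n) <= rsum b n.
Proof.
  intros H. induction n as [|n IH]; [simpl; rewrite Cmod_0; lra|].
  simpl. eapply Rle_trans; [apply Cmod_triangle|]. specialize (H n). lra.
Qed.

Lemma rsum_sum_n (b : nat -> R) n : rsum b (S n) = sum_n b n.
Proof.
  induction n as [|n IH]; [simpl; rewrite sum_O; ring|]. rewrite sum_Sn, <- IH. reflexivity.
Qed.

Lemma rsum_tail (b : nat -> R) n k : rsum (fun i => b (n + i)%nat) k = rsum b (n + k) - rsum b n.
Proof.
  induction k as [|k IH]; [rewrite Nat.add_0_r; simpl; ring|].
  rewrite Nat.add_succ_r. simpl. rewrite IH. ring.
Qed.

Lemma rsum_le_Series (b : nat -> R) n : (forall k, 0 <= b k) -> ex_series b -> rsum b n <= Series b.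
Proof.
  intros Hb Eb. destruct n as [|n].
  - simpl. apply Rle_trans with (sum_n b 0); [rewrite sum_O; apply Hb|now apply sum_n_le_Series].
  - rewrite rsum_sum_n. now apply sum_n_le_Series.
Qed.

Lemma rsum_scal (c : R) b n : rsum (fun i => c * b i) n = c * rsum b n.
Proof. induction n as [|n IH]; simpl; [ring|]. rewrite IH. ring. Qed.

(* Summed over n <= X, the Dirichlet convolution is [sum_d al(d) B(X/d)] with [B] the partial sums of [be];
   split at a fixed [d <= D] and let [X] tend to infinity. *)
Theorem dirichlet_product (al be : nat -> C) (a : nat -> R) (b : nat -> R) (A B : C) :
  (forall k, Cmod (al k) <= a k) -> ex_series a -> (forall k, Cmod (be k) <= b k) -> ex_series b ->
  cseries al A -> cseries be B ->
  cseries (fun k => divisor_sum (S k) (fun d => al (d - 1)%nat * be (Nat.div (S k) d - 1)%nat)%C) (A * B)%C.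
Proof.
  intros Ha Ea Hb Eb SA SB.
  assert (a0 : forall k, 0 <= a k) by (intros k; apply Rle_trans with (2 := Ha k); apply Cmod_ge_0).
  assert (b0 : forall k, 0 <= b k) by (intros k; apply Rle_trans with (2 := Hb k); apply Cmod_ge_0).
  set (TA := Series a). set (TB := Series b).
  assert (HTA : 0 <= TA) by (apply Rle_trans with (rsum a 0); [simpl; lra|now apply rsum_le_Series]).
  assert (HTB : 0 <= TB) by (apply Rle_trans with (rsum b 0); [simpl; lra|now apply rsum_le_Series]).
  assert (HB : forall n, Cmod (B - csum0 be n) <= TB).
  { intros [|n].
    - simpl. replace (B - 0)%C with B by ring. exact (cseries_Cmod_le be b B Hb Eb SB).
    - rewrite csum0_csum_n. eapply Rle_trans; [exact (cseries_tail_le be b B Hb Eb SB n)|].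
      assert (0 <= sum_n b n) by (rewrite sum_n_Reals; apply cond_pos_sum; exact b0). fold TB. lra. }
  apply cseries_eps. intros eps He.
  set (e1 := eps / (3 * (TB + 1))). assert (He1 : 0 < e1) by (apply Rdiv_lt_0_compat; lra).
  set (e2 := eps / (3 * (TA + 1))). assert (He2 : 0 < e2) by (apply Rdiv_lt_0_compat; lra).
  destruct (Series_tail_small a e1 Ea He1) as [D HD].
  assert (SB' := SB). rewrite cseries_eps in SB'. destruct (SB' e2 He2) as [K HK].
  (* Then X >= (D + 1) (K + 2), so X / d >= K + 2 for every d <= D + 1 and the inner partial sums
     are within e2 of B; also n >= D, for the tail of [al]. *)
  exists (S D * S (S K) + D)%nat. intros n Hn.
  rewrite <- csum0_csum_n, divisor_sum_partial. set (X := S n).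
  assert (HX : (S D * S (S K) <= X)%nat) by (unfold X; lia).
  assert (HXD : (S D <= X)%nat) by nia.
  rewrite Cmod_minus_sym.
  replace (A * B - csum0 (fun i => al i * csum0 be (Nat.div X (S i))) X)%C
    with ((A - csum0 al X) * B + csum0 (fun i => al i * (B - csum0 be (Nat.div X (S i)))) X)%C.
  2:{ rewrite (csum0_ext (fun i => al i * (B - csum0 be (Nat.div X (S i))))%C
        (fun i => B * al i + - (1) * (al i * csum0 be (Nat.div X (S i))))%C) by (intros; ring).
      rewrite csum0_plus, !csum0_scal. ring. }
  assert (P1 : Cmod ((A - csum0 al X) * B) <= e1 * TB).
  { rewrite Cmod_mult. apply Rmult_le_compat; try apply Cmod_ge_0; [|exact (cseries_Cmod_le be b B Hb Eb SB)].
    unfold X. rewrite csum0_csum_n. eapply Rle_trans; [exact (cseries_tail_le al a A Ha Ea SA n)|].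
    specialize (HD n ltac:(nia)). left. eapply Rle_lt_trans; [apply Rle_abs|exact HD]. }
  rewrite (csum0_tail (fun i => al i * (B - csum0 be (Nat.div X (S i))))%C (S D) X HXD).
  assert (P2 : Cmod (csum0 (fun i => al i * (B - csum0 be (Nat.div X (S i))))%C (S D)) <= TA * e2).
  { rewrite (csum0_ext _ (fun i => if Nat.ltb i (S D) then (al i * (B - csum0 be (Nat.div X (S i))))%C else RtoC 0)).
    2:{ intros i Hi. apply Nat.ltb_lt in Hi. now rewrite Hi. }
    eapply Rle_trans; [apply (csum0_Cmod_rsum _ (fun i => e2 * a i))|].
    - intros i. destruct (Nat.ltb_spec i (S D)) as [Hi|Hi].
      + rewrite Cmod_mult, Rmult_comm. apply Rmult_le_compat; try apply Cmod_ge_0; [|apply Ha].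
        assert (Hq : (S (S K) <= Nat.div X (S i))%nat) by (apply Nat.div_le_lower_bound; nia).
        destruct (Nat.div X (S i)) as [|q]; [lia|]. rewrite csum0_csum_n, Cmod_minus_sym.
        left. apply HK. lia.
      + rewrite Cmod_0. apply Rmult_le_pos; [lra|apply a0].
    - rewrite rsum_scal, Rmult_comm. apply Rmult_le_compat_r; [lra|]. now apply rsum_le_Series. }
  assert (P3 : Cmod (csum0 (fun i => al (S D + i)%nat * (B - csum0 be (Nat.div X (S (S D + i)))))%C (X - S D)) <= TB * e1).
  { eapply Rle_trans; [apply (csum0_Cmod_rsum _ (fun i => TB * a (S D + i)%nat))|].
    - intros i. rewrite Cmod_mult, Rmult_comm. apply Rmult_le_compat; try apply Cmod_ge_0; [apply HB|apply Ha].
    - rewrite rsum_scal. apply Rmult_le_compat_l; [assumption|].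
      rewrite (rsum_tail a (S D)). assert (Q := rsum_le_Series a (S D + (X - S D)) a0 Ea).
      specialize (HD D (Nat.le_refl _)). rewrite <- rsum_sum_n in HD. assert (Q2 := Rle_abs (Series a - rsum a (S D))). lra. }
  eapply Rle_lt_trans; [apply Cmod_triangle|].
  assert (T := Cmod_triangle (csum0 (fun i => al i * (B - csum0 be (Nat.div X (S i))))%C (S D))
    (csum0 (fun i => al (S D + i)%nat * (B - csum0 be (Nat.div X (S (S D + i)))))%C (X - S D))).
  assert (Z1 : e1 * TB <= eps / 3).
  { unfold e1. apply Rmult_le_reg_r with (3 * (TB + 1)); [lra|].
    replace (eps / (3 * (TB + 1)) * TB * (3 * (TB + 1))) with (eps * TB) by (field; lra). nra. }
  assert (Z2 : TA * e2 < eps / 3).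
  { unfold e2. apply Rmult_lt_reg_r with (3 * (TA + 1)); [lra|].
    replace (TA * (eps / (3 * (TA + 1))) * (3 * (TA + 1))) with (eps * TA) by (field; lra). nra. }
  lra.
Qed.

(** The sixth power of y / 6 <= e^(y / 6); 46656 is 6^6. At y = c sqrt(n x) the sixth power has
    order n^3, which leaves n^(-2) after multiplication by n. *)
Lemma exp_pow6_bound (y : R) : 0 < y -> exp (- y) <= 46656 * / y ^ 6.
Proof.
  intros Hy. rewrite exp_Ropp.
  assert (H := exp_ineq1_le (y / 6)).
  assert (H1 : (y / 6) ^ 6 <= exp (y / 6) ^ 6) by (apply pow_incr; lra).
  rewrite exp_mult_nat in H1. replace (INR 6 * (y / 6)) with y in H1 by (simpl; field).
  assert (P : 0 < y ^ 6) by now apply pow_lt.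
  assert (Q : y ^ 6 / 46656 <= exp y) by (replace (y ^ 6 / 46656) with ((y / 6) ^ 6) by field; exact H1).
  replace (46656 * / y ^ 6) with (/ (y ^ 6 / 46656)) by (field; lra).
  apply Rinv_le_contravar; [|exact Q]. lra.
Qed.

Lemma ex_series_exp_sqrt (c x : R) : 0 < c -> 0 < x ->
  ex_series (fun k => INR (S k) * exp (- (c * sqrt (INR (S k) * x)))).
Proof.
  intros Hc Hx.
  apply ex_series_compare with (b := fun k => 46656 / (c ^ 6 * x ^ 3) * / (INR k + 1) ^ 2).
  - intros k. assert (Hk := pos_INR k). rewrite S_INR. set (n := INR k + 1) in *.
    assert (Hn : 0 < n) by (unfold n; lra). assert (Hnx : 0 < n * x) by now apply Rmult_lt_0_compat.
    assert (Hs := sqrt_lt_R0 _ Hnx). assert (Hss := sqrt_sqrt (n * x) ltac:(lra)).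
    split; [apply Rmult_le_pos; [lra|left; apply exp_pos]|].
    eapply Rle_trans; [apply Rmult_le_compat_l; [lra|apply exp_pow6_bound; now apply Rmult_lt_0_compat]|].
    replace ((c * sqrt (n * x)) ^ 6) with (c ^ 6 * ((sqrt (n * x) * sqrt (n * x)) ^ 3)) by ring.
    rewrite Hss. right. field. repeat split; lra.
  - apply (ex_series_scal_l (K := R_AbsRing) (V := R_NormedModule)). apply ex_series_inv_sq.
Qed.

(** Half of the exponent is estimated by the arithmetic-geometric mean inequality d U + m x W >= 2
    sqrt(n x) and gives decay in n. The other half, with d, m >= 1, keeps decay in u independent of
    d and m. *)
Lemma theta_fun_le (d m n x u : R) : 1 <= d -> 1 <= m -> n = d * m -> 0 < x ->
  exp (- (2 * PI * (d * exp u))) * exp (- (2 * PI * (m * x * exp (- u)))) <=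
  exp (- (2 * PI * sqrt (n * x))) * (exp (- (PI * exp u)) * exp (- (PI * x * exp (- u)))).
Proof.
  intros Hd Hm Hn Hx. assert (Hpi := PI_RGT_0). rewrite <- !exp_plus. apply exp_le_compat.
  assert (Hu := exp_pos u). assert (Hv := exp_pos (- u)).
  assert (Huv : exp u * exp (- u) = 1) by (rewrite <- exp_plus, Rplus_opp_r; apply exp_0).
  set (U := exp u) in *. set (W := exp (- u)) in *. 
  assert (Hnx : 0 < n * x) by (rewrite Hn; apply Rmult_lt_0_compat; nra).
  assert (Hs := sqrt_lt_R0 _ Hnx). assert (Hss := sqrt_sqrt (n * x) ltac:(lra)).
  set (s := sqrt (n * x)) in *.
  assert (Hmx : 0 < m * x) by (apply Rmult_lt_0_compat; lra).
  assert (AG : 2 * s <= d * U + m * x * W).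
  { apply Rsqr_incr_0_var; [unfold Rsqr|apply Rplus_le_le_0_compat; left; apply Rmult_lt_0_compat; lra].
    assert (E : d * U * (m * x * W) = n * x) by (rewrite Hn; replace (d * U * (m * x * W)) with (d * m * x * (U * W)) by ring; rewrite Huv; ring).
    assert (0 <= (d * U - m * x * W) ^ 2) by apply pow2_ge_0. nra. }
  assert (A1 : U <= d * U) by nra. assert (A2 : x * W <= m * x * W) by (replace (m * x * W) with (m * (x * W)) by ring; nra).
  assert (Hsum : 2 * s + (U + x * W) <= 2 * (d * U + m * x * W)) by lra.
  apply Rmult_le_compat_l with (r := PI) in Hsum; [|lra].
  lra.
Qed.

Lemma theta_majorant (sig x : R) : 0 < x -> exists K, 0 <= K /\ forall u,
  exp (sig * u) * (exp (- (PI * exp u)) * exp (- (PI * x * exp (- u)))) <= K * exp (- (1) * Rabs u).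
Proof.
  intros Hx. assert (Hpi := PI_RGT_0).
  destruct (double_exp_majorant (Rabs sig) PI) as [K1 [HK1 B1]]; [apply Rabs_pos|lra|].
  destruct (double_exp_majorant (Rabs sig) (PI * x)) as [K2 [HK2 B2]]; [apply Rabs_pos|apply Rmult_lt_0_compat; lra|].
  exists (K1 + K2). split; [lra|]. intros u.
  assert (S1 : exp (sig * u) <= exp (Rabs sig * Rabs u)) by (apply exp_le_compat; rewrite <- Rabs_mult; apply Rle_abs).
  assert (E1 : exp (- (PI * exp u)) <= 1) by (rewrite <- exp_0; apply exp_le_compat; generalize (exp_pos u); nra).
  assert (E2 : exp (- (PI * x * exp (- u))) <= 1).
  { rewrite <- exp_0; apply exp_le_compat. assert (0 < PI * x) by (apply Rmult_lt_0_compat; lra).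
    generalize (exp_pos (- u)). nra. }
  assert (P0 := exp_pos (sig * u)). assert (P1 := exp_pos (- (PI * exp u))). assert (P2 := exp_pos (- (PI * x * exp (- u)))).
  assert (P3 := exp_pos (- (1) * Rabs u)).
  destruct (Rle_dec 0 u) as [H|H].
  - rewrite (Rabs_right u) in S1, P3 |- * by lra. specialize (B1 u).
    replace (- (1) * u) with (- u) in * by ring.
    apply Rle_trans with (K1 * exp (- u)); [|apply Rmult_le_compat_r; lra].
    eapply Rle_trans; [|exact B1]. apply Rmult_le_compat; nra.
  - rewrite (Rabs_left u) in S1, P3 |- * by lra. specialize (B2 (- u)).
    replace (- (1) * - u) with u in * by ring. rewrite Ropp_involutive in B2.
    apply Rle_trans with (K2 * exp u); [|apply Rmult_le_compat_r; lra].
    eapply Rle_trans; [|exact B2]. apply Rmult_le_compat; nra.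
Qed.

(** * The Bessel series as an integral of A times B *)

Lemma kerA_continuous_exp th u : continuous (fun v => kerA th (exp v)) u.
Proof. apply kerA_continuous; [apply continuous_exp_R|apply exp_pos]. Qed.

Definition lhs_fun (th x : R) (nu : C) (u : R) : C :=
  (cexp (nu * RtoC u) * RtoC (kerA th (exp u) * kerA 0 (x * exp (- u))))%C.

(** The Dirichlet convolution of the expansion of A at e^u with that of B at x e^(-u); only the
    factor belonging to d carries a cosine. *)
Lemma kerA_product_series (th x : R) (nu : C) (u : R) : 0 < x ->
  cseries (fun k => divisor_sum (S k) (fun d => RtoC (cos (2 * PI * INR d * th)) *
     theta_fun nu (INR d) (INR (Nat.div (S k) d) * x) u)%C) (lhs_fun th x nu u).
Proof.
  intros Hx. assert (Hpi := PI_RGT_0). assert (Hu := exp_pos u).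
  assert (Hy : 0 < x * exp (- u)) by (apply Rmult_lt_0_compat; [assumption|apply exp_pos]).
  assert (geo : forall y, 0 < y -> ex_series (fun k => exp (- (2 * PI * INR (S k) * y)))).
  { intros y H. assert (S := kerA_series 0 y H).
    exists (kerA 0 y). assert (E : forall k, exp (- (2 * PI * INR (Datatypes.S k) * y)) * cos (2 * PI * INR (Datatypes.S k) * 0) = exp (- (2 * PI * INR (Datatypes.S k) * y))).
    { intros k. rewrite Rmult_0_r, cos_0. ring. }
    exact (is_series_ext _ _ _ E S). }
  assert (S1 := is_series_RtoC _ _ (kerA_series th (exp u) Hu)).
  assert (S2 := is_series_RtoC _ _ (kerA_series 0 _ Hy)).
  assert (bd : forall y t k, Cmod (RtoC (exp (- (2 * PI * INR (S k) * y)) * cos t)) <= exp (- (2 * PI * INR (S k) * y))).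
  { intros y t k. rewrite Cmod_R, Rabs_mult, (Rabs_right (exp _)) by (left; apply exp_pos).
    rewrite <- (Rmult_1_r (exp _)) at 2. apply Rmult_le_compat_l; [left; apply exp_pos|]. apply Rabs_le, COS_bound. }
  assert (DP := dirichlet_product _ _ _ _ _ _ (fun k => bd (exp u) _ k) (geo _ Hu) (fun k => bd (x * exp (- u)) _ k) (geo _ Hy) S1 S2).
  apply (cseries_scal (cexp (nu * RtoC u))) in DP.
  unfold lhs_fun. rewrite RtoC_mult. eapply cseries_ext; [|exact DP]. intros k. cbv beta.
  rewrite !divisor_sum_csum0, <- csum0_scal. apply csum0_ext. intros i Hi.
  destruct (dvd (S i) (S k)) eqn:Ed; [|ring].
  unfold dvd in Ed. apply Nat.eqb_eq in Ed.
  assert (Q := Nat.div_mod (S k) (S i) ltac:(lia)). rewrite Ed in Q.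
  assert (Qd : (1 <= Nat.div (S k) (S i))%nat) by nia.
  replace (S (S i - 1)) with (S i) by lia. replace (S (Nat.div (S k) (S i) - 1)) with (Nat.div (S k) (S i)) by lia.
  unfold theta_fun. rewrite Rmult_0_r, cos_0, Rmult_1_r, !RtoC_mult.
  replace (2 * PI * INR (S i) * exp u) with (2 * PI * (INR (S i) * exp u)) by ring.
  replace (2 * PI * INR (Nat.div (S k) (S i)) * (x * exp (- u))) with (2 * PI * (INR (Nat.div (S k) (S i)) * x * exp (- u))) by ring.
  ring.
Qed.

Lemma rable_0 : rable (fun _ => RtoC 0).
Proof.
  exists 0, 1. split; [lra|split; [intros t; apply ccont_const|]].
  intros t. rewrite Cmod_0, Rmult_0_l. apply Rle_refl.
Qed.

Lemma Rint_0 : Rint (fun _ => RtoC 0) = RtoC 0.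
Proof.
  rewrite <- (Rint_ext (fun _ => RtoC 0 * RtoC 0)%C) by (intros; ring).
  rewrite (Rint_scal _ _ rable_0). ring.
Qed.

Lemma Rint_csum0 (f : nat -> R -> C) n : (forall i, (i < n)%nat -> rable (f i)) ->
  rable (fun u => csum0 (fun i => f i u) n) /\
  Rint (fun u => csum0 (fun i => f i u) n) = csum0 (fun i => Rint (f i)) n.
Proof.
  induction n as [|n IH]; intros H.
  - split; [apply rable_0|apply Rint_0].
  - destruct IH as [I1 I2]; [intros; apply H; lia|]. simpl.
    assert (Hn := H n ltac:(lia)). split.
    + now apply rable_plus.
    + rewrite (Rint_plus _ _ I1 Hn), I2. reflexivity.
Qed.

Lemma dvd_div_mult d n : dvd (S d) n = true -> INR n = INR (S d) * INR (Nat.div n (S d)).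
Proof.
  intros H. unfold dvd in H. apply Nat.eqb_eq in H. rewrite <- mult_INR. f_equal.
  assert (Q := Nat.div_mod n (S d) ltac:(lia)). lia.
Qed.

(** Convertible to the local [lhs_term] of the final statement, so that its convergence can be used
    there directly. *)
Definition lhs_summand (th x : R) (nu : C) (n : nat) : C :=
  Cmult (Cmult (cpow (INR n) (Cdiv nu (RtoC 2)))
               (BesselK nu (4 * PI * sqrt (INR n * x))))
        (divisor_sum n (fun d => Cmult (cpow (INR d) (Copp nu))
                                       (RtoC (cos (2 * PI * INR d * th))))).

Definition lhs_part (th x : R) (nu : C) (k : nat) (u : R) : C :=
  divisor_sum (S k) (fun d => RtoC (cos (2 * PI * INR d * th)) *
     theta_fun nu (INR d) (INR (Nat.div (S k) d) * x) u)%C.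

(** For n = d m the balancing number is S = sqrt(n x) for every divisor d. Hence the Bessel factor
    is common, and (S / d)^nu splits into x^(nu/2) n^(nu/2) d^(-nu). *)
Lemma lhs_part_integral (th x : R) (nu : C) (k : nat) : 0 < x ->
  rable (lhs_part th x nu k) /\
  Rint (lhs_part th x nu k) = (2 * cpow x (nu / 2) * lhs_summand th x nu (S k))%C.
Proof.
  intros Hx. set (n := S k). set (s := sqrt (INR n * x)).
  assert (Hn : 0 < INR n) by (apply lt_0_INR; unfold n; lia).
  assert (Hnx : 0 < INR n * x) by now apply Rmult_lt_0_compat.
  assert (Hs : 0 < s) by now apply sqrt_lt_R0.
  assert (Hss : s * s = INR n * x) by (apply sqrt_sqrt; lra).
  set (g := fun (i : nat) u => if dvd (S i) n then
     (RtoC (cos (2 * PI * INR (S i) * th)) * theta_fun nu (INR (S i)) (INR (Nat.div n (S i)) * x) u)%C else RtoC 0).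
  assert (E : forall u, csum0 (fun i => g i u) n = lhs_part th x nu k u).
  { intros u. unfold lhs_part. rewrite divisor_sum_csum0. reflexivity. }
  assert (Hd : forall i, 0 < INR (S i)) by (intros i; apply lt_0_INR; lia).
  assert (TI : forall i, dvd (S i) n = true -> rable (theta_fun nu (INR (S i)) (INR (Nat.div n (S i)) * x)) /\
     Rint (theta_fun nu (INR (S i)) (INR (Nat.div n (S i)) * x)) =
       (2 * (cpow (s / INR (S i)) nu * BesselK nu (4 * PI * s)))%C).
  { intros i Hi. apply theta_fun_integral; [apply Hd|assumption|].
    rewrite Hss, (dvd_div_mult _ _ Hi). ring. }
  assert (G : forall i, (i < n)%nat -> rable (g i)).
  { intros i _. unfold g. destruct (dvd (S i) n) eqn:Ed; [|apply rable_0]. apply rable_scal. now apply TI. }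
  destruct (Rint_csum0 g n G) as [R1 R2].
  assert (E' : forall u, csum0 (fun i => g i u) n = lhs_part th x nu k u) by exact E.
  split.
  - destruct R1 as (K & d & D). exists K, d. now apply (rdom_ext _ _ _ _ E).
  - rewrite <- (Rint_ext _ _ E), R2. unfold lhs_summand. fold n. fold s.
    rewrite divisor_sum_csum0.
    assert (X : (cpow x (nu / 2) * cpow (INR n) (nu / 2) = cpow s nu)%C).
    { rewrite Cmult_comm, <- cpow_mult_base, <- Hss, cpow_mult_base, <- cpow_plus by assumption. f_equal. field. }
    replace (2 * cpow x (nu / 2) * (cpow (INR n) (nu / 2) * BesselK nu (4 * PI * s) *
       csum0 (fun i => if dvd (S i) n then (cpow (INR (S i)) (- nu) * RtoC (cos (2 * PI * INR (S i) * th)))%C else RtoC 0) n))%C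
      with (2 * cpow s nu * BesselK nu (4 * PI * s) *
       csum0 (fun i => if dvd (S i) n then (cpow (INR (S i)) (- nu) * RtoC (cos (2 * PI * INR (S i) * th)))%C else RtoC 0) n)%C
      by (rewrite <- X; ring).
    rewrite <- csum0_scal. apply csum0_ext. intros i _. unfold g.
    destruct (dvd (S i) n) eqn:Ed.
    + destruct (TI i Ed) as [T1 T2]. rewrite (Rint_scal _ _ T1), T2.
      unfold Rdiv. rewrite cpow_mult_base, cpow_inv_base, <- cpow_opp by (try apply Rinv_0_lt_compat; auto). ring.
    + rewrite Rint_0. ring.
Qed.

(** A divisor sum for n has at most n terms, each at most e^(-2 pi sqrt(n x)) times one function of
    u, so the parts are summable uniformly and may be integrated termwise. *)
Theorem lhs_integral (th x : R) (nu : C) : 0 < x ->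
  hint_able (lhs_fun th x nu) /\ hint_able (fun u => lhs_fun th x nu (- u)) /\
  exists L, cseries (fun k => lhs_summand th x nu (S k)) L /\
    (RtoC (8 * PI) * cpow x (nu / 2) * L = RtoC (4 * PI) * Rint (lhs_fun th x nu))%C.
Proof.
  intros Hx. assert (Hpi := PI_RGT_0).
  destruct (theta_majorant (Re nu) x Hx) as [K [HK B]].
  set (M := fun k => K * (INR (S k) * exp (- (2 * PI * sqrt (INR (S k) * x))))).
  assert (EM : ex_series M).
  { apply (ex_series_scal_l (K := R_AbsRing) (V := R_NormedModule) K). apply ex_series_exp_sqrt; lra. }
  assert (Bd : forall k u, Cmod (lhs_part th x nu k u) <= M k * exp (- (1) * Rabs u)).
  { intros k u. unfold lhs_part. rewrite divisor_sum_csum0.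
    apply Rle_trans with (INR (S k) * (exp (- (2 * PI * sqrt (INR (S k) * x))) * (K * exp (- (1) * Rabs u)))).
    2:{ right. unfold M. ring. }
    apply csum0_Cmod_le. intros i Hi.
    assert (P : 0 <= exp (- (2 * PI * sqrt (INR (S k) * x))) * (K * exp (- (1) * Rabs u))).
    { apply Rmult_le_pos; [left; apply exp_pos|]. apply Rmult_le_pos; [assumption|left; apply exp_pos]. }
    destruct (dvd (S i) (S k)) eqn:Ed; [|rewrite Cmod_0; exact P].
    rewrite Cmod_mult, Cmod_R.
    rewrite <- (Rmult_1_l (exp (- (2 * PI * sqrt (INR (S k) * x))) * (K * exp (- (1) * Rabs u)))).
    apply Rmult_le_compat; [apply Rabs_pos|apply Cmod_ge_0|apply Rabs_le, COS_bound|].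
    unfold theta_fun. rewrite Cmod_mult, Cmod_cexp, Cmod_R, Re_mult, Re_RtoC, Im_RtoC.
    rewrite Rabs_right by (apply Rle_ge, Rmult_le_pos; left; apply exp_pos).
    assert (Hn := dvd_div_mult _ _ Ed).
    assert (H1 : 1 <= INR (S i)) by (rewrite S_INR; generalize (pos_INR i); lra).
    assert (H2 : 1 <= INR (Nat.div (S k) (S i))).
    { assert (1 <= Nat.div (S k) (S i))%nat; [|now apply (le_INR 1)].
      apply Nat.div_le_lower_bound; lia. }
    assert (T := theta_fun_le _ _ _ x u H1 H2 Hn Hx). specialize (B u).
    replace (Re nu * u - Im nu * 0) with (Re nu * u) by ring.
    apply Rle_trans with (exp (Re nu * u) * (exp (- (2 * PI * sqrt (INR (S k) * x))) *
       (exp (- (PI * exp u)) * exp (- (PI * x * exp (- u)))))).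
    - apply Rmult_le_compat_l; [left; apply exp_pos|exact T].
    - replace (exp (Re nu * u) * (exp (- (2 * PI * sqrt (INR (S k) * x))) *
        (exp (- (PI * exp u)) * exp (- (PI * x * exp (- u))))))
        with (exp (- (2 * PI * sqrt (INR (S k) * x))) * (exp (Re nu * u) *
        (exp (- (PI * exp u)) * exp (- (PI * x * exp (- u)))))) by ring.
      apply Rmult_le_compat_l; [left; apply exp_pos|exact B]. }
  destruct (Rint_series (lhs_part th x nu) (lhs_fun th x nu) M M 1 1) as (A1 & A2 & S).
  { lra. } { lra. }
  { intros k t. destruct (lhs_part_integral th x nu k Hx) as [(K' & d' & D) _]. apply D. }
  { intros t. apply ccont_mult; [apply ccont_cexp_scal|]. apply ccont_RtoC.
    apply (continuous_mult (K := R_AbsRing)); [apply kerA_continuous_exp|].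
    apply kerA_continuous; [apply continuous_scal_exp_opp|]. apply Rmult_lt_0_compat; [assumption|apply exp_pos]. }
  { intros k t Ht. assert (Q := Bd k t). rewrite Rabs_right in Q by lra. exact Q. }
  { exact EM. }
  { intros k t Ht. assert (Q := Bd k (- t)). rewrite Rabs_Ropp, Rabs_right in Q by lra. exact Q. }
  { exact EM. }
  { intros t. now apply kerA_product_series. }
  split; [exact A1|split; [exact A2|]].
  assert (Hc := cpow_neq_0 x (nu / 2)).
  exists (/ (2 * cpow x (nu / 2)) * Rint (lhs_fun th x nu))%C. split.
  - apply (cseries_scal (/ (2 * cpow x (nu / 2)))%C) in S. eapply cseries_ext; [|exact S].
    intros k. cbv beta. rewrite (proj2 (lhs_part_integral th x nu k Hx)). field. assumption.
  - rewrite !RtoC_mult. replace (RtoC 8) with (2 * RtoC 4)%C by (apply C_ext; simpl; ring).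
    field. assumption.
Qed.

(** * The double series *)

Lemma cauchy2_bterm (N k : nat) (x v : R) (nu : C) (u : R) : 0 < x ->
  (cauchy_exp nu v u * RtoC (bterm N k (x * exp (- u))))%C =
  (RtoC (bcoef N x k) * cauchy2 (nu - RtoC (2 * INR N)) v (x / (INR k + 1)) u)%C.
Proof.
  intros Hx. assert (H := bterm_cauchy N k x nu u Hx). unfold cauchy_exp at 1.
  replace (cexp (nu * RtoC u) * RtoC (exp u / (exp (2 * u) + v ^ 2)) * RtoC (bterm N k (x * exp (- u))))%C
    with (RtoC (exp u / (exp (2 * u) + v ^ 2)) * (cexp (nu * RtoC u) * RtoC (bterm N k (x * exp (- u)))))%C by ring.
  rewrite H. unfold cauchy_exp, cauchy2, g2.
  replace (exp (2 * u) / ((exp (2 * u) + v ^ 2) * (exp (2 * u) + (x / (INR k + 1)) ^ 2)))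
    with ((exp u / (exp (2 * u) + v ^ 2)) * (exp u / (exp (2 * u) + (x / (INR k + 1)) ^ 2))).
  - rewrite (RtoC_mult (exp u / (exp (2 * u) + v ^ 2))). ring.
  - replace (exp (2 * u)) with (exp u * exp u) at 3 by (rewrite <- exp_plus; f_equal; ring).
    assert (P := exp_pos (2 * u)). assert (P1 := pow2_ge_0 v). assert (P2 := pow2_ge_0 (x / (INR k + 1))).
    set (y := x / (INR k + 1)) in *. field. split; lra.
Qed.

(** The integrand behind the row d = k + 1 of the double series: A + 1/2 times one Cauchy kernel of
    B_N. *)
Definition row_fun (th x : R) (nu : C) (N k : nat) (u : R) : C :=
  (cexp (nu * RtoC u) * RtoC (kerA1 th (exp u)) * RtoC (bterm N k (x * exp (- u))))%C.

Definition cell (a : C) (x d v : R) : C :=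
  Cdiv (Cminus (cpow (d * v) a) (cpow x a)) (RtoC (d ^ 2 * v ^ 2 - x ^ 2)).

(** With y = x / d the integral of the product kernel is a summand of the double series up to powers
    of d; v = y would mean d v = x. *)
Lemma cauchy2_cell (a : C) (x d v : R) : 0 < x -> 0 < d -> 0 < v -> d * v <> x -> -2 < Re a < 2 ->
  (csin (RtoC PI * a / 2) * Rint (cauchy2 a v (x / d)) =
   RtoC (PI / 2) * (RtoC (d ^ 2) * cpow d (- a) * cell a x d v))%C.
Proof.
  intros Hx Hd Hv Hne Ha. assert (Hy : 0 < x / d) by now apply Rdiv_lt_0_compat.
  assert (Hvy : v <> x / d) by (intros E; apply Hne; rewrite E; field; lra).
  rewrite (cauchy2_integral a v (x / d) Hv Hy Hvy Ha). f_equal. unfold cell.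
  rewrite cpow_mult_base by assumption.
  replace (cpow x a) with (cpow (x / d) a * cpow d a)%C.
  2:{ rewrite <- cpow_mult_base by assumption. f_equal. field. lra. }
  replace (d ^ 2 * v ^ 2 - x ^ 2) with (d ^ 2 * (v ^ 2 - (x / d) ^ 2)) by (field; lra).
  assert (H1 : v ^ 2 - (x / d) ^ 2 <> 0).
  { replace (v ^ 2 - (x / d) ^ 2) with ((v - x / d) * (v + x / d)) by ring.
    apply Rmult_integral_contrapositive. split; lra. }
  assert (H2 : d ^ 2 <> 0) by (apply pow_nonzero; lra).
  set (w := v ^ 2 - (x / d) ^ 2) in *. set (d2 := d ^ 2) in *.
  rewrite RtoC_mult, RtoC_inv, cpow_opp by assumption.
  assert (Q1 : RtoC w <> 0%C) by (intro Q; apply RtoC_inj in Q; contradiction).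
  assert (Q2 : RtoC d2 <> 0%C) by (intro Q; apply RtoC_inj in Q; contradiction).
  assert (Q3 := cpow_neq_0 d a). field. repeat split; assumption.
Qed.

(** The factor t^2 / (t^2 + y^2) is estimated by 1, and the other one keeps its decay in v, which
    the sum over m needs. *)
Lemma cauchy2_le_right (a : C) (v y kap u : R) : 0 < v -> 0 < y -> 0 <= kap <= 2 ->
  Cmod (cauchy2 a v y u) <= Rpower v (- (2 - kap)) * exp (- (kap - Re a) * u).
Proof.
  intros Hv Hy Hk. destruct (g2_bounds v y u Hv Hy) as (B0 & _ & _).
  unfold cauchy2. rewrite Cmod_mult, Cmod_cexp, Cmod_R, Re_mult, Re_RtoC, Im_RtoC, Rabs_right by (apply Rle_ge; assumption).
  assert (M := cauchy_majorant kap v u Hk Hv).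
  assert (P := exp_pos (2 * u)). assert (P1 := pow2_ge_0 v). assert (P2 : 0 < y ^ 2) by now apply pow_lt.
  assert (G : g2 v y u <= / (exp (2 * u) + v ^ 2)).
  { unfold g2. apply Rmult_le_reg_r with ((exp (2 * u) + v ^ 2) * (exp (2 * u) + y ^ 2)); [apply Rmult_lt_0_compat; lra|].
    unfold Rdiv. rewrite Rmult_assoc, Rinv_l, Rmult_1_r by (apply Rgt_not_eq, Rmult_lt_0_compat; lra).
    rewrite <- Rmult_assoc, Rinv_l, Rmult_1_l by lra. lra. }
  replace (Rpower v (- (2 - kap)) * exp (- (kap - Re a) * u))
    with (exp (Re a * u - Im a * 0) * (exp (- kap * u) * Rpower v (- (2 - kap)))).
  - apply Rmult_le_compat_l; [left; apply exp_pos|lra].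
  - rewrite (Rmult_comm (exp (- kap * u))), <- Rmult_assoc, (Rmult_comm (exp (Re a * u - Im a * 0))), Rmult_assoc, <- exp_plus.
    do 2 f_equal. ring.
Qed.

Lemma cauchy2_le_left (a : C) (v y u : R) : 0 < v -> 0 < y ->
  Cmod (cauchy2 a v y (- u)) <= / y ^ 2 * Rpower v (- (2)) * exp (- (Re a + 2) * u).
Proof.
  intros Hv Hy. destruct (g2_bounds v y (- u) Hv Hy) as (B0 & _ & B2).
  unfold cauchy2. rewrite Cmod_mult, Cmod_cexp, Cmod_R, Re_mult, Re_RtoC, Im_RtoC, Rabs_right by (apply Rle_ge; assumption).
  rewrite Rpower_m2 by assumption.
  replace (/ y ^ 2 * / v ^ 2 * exp (- (Re a + 2) * u)) with (exp (Re a * - u - Im a * 0) * (/ (v ^ 2 * y ^ 2) * exp (2 * - u))).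
  - apply Rmult_le_compat_l; [left; apply exp_pos|exact B2].
  - replace (- (Re a + 2) * u) with ((Re a * - u - Im a * 0) + 2 * - u) by ring. rewrite exp_plus.
    assert (0 < v ^ 2) by now apply pow_lt. assert (0 < y ^ 2) by now apply pow_lt. field. split; lra.
Qed.

Lemma row_fun_ccont th x nu N k t : 0 < x -> ccont (row_fun th x nu N k) t.
Proof.
  intros Hx. apply ccont_mult; [apply ccont_mult|].
  - apply ccont_cexp_scal.
  - apply ccont_RtoC, kerA1_continuous; [apply continuous_exp_R|apply exp_pos].
  - apply ccont_RtoC. apply (continuous_comp (fun u => x * exp (- u)) (bterm N k)); [apply continuous_scal_exp_opp|].
    apply (ex_derive_continuous (V := R_NormedModule)). unfold bterm. assert (Hpi := PI_RGT_0). assert (Hk := pos_INR k).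
    assert (P1 : 0 < (INR k + 1) ^ (2 * N)) by (apply pow_lt; lra).
    set (y := x * exp (- t)). assert (P2 := pow2_ge_0 y). assert (P3 : 0 < (INR k + 1) ^ 2) by (apply pow_lt; lra).
    set (w := (INR k + 1) ^ (2 * N)) in *. set (w2 := (INR k + 1) ^ 2) in *. auto_derive.
    assert (0 < PI * w) by (apply Rmult_lt_0_compat; lra). simpl in *.
    repeat split; try (apply Rgt_not_eq); try (apply Rmult_lt_0_compat); lra.
Qed.

(** The Poisson expansion of A + 1/2 is integrated termwise against one kernel of B_N. The sign
    (-1)^N occurs both in [bcoef] and in the shift of the sine by N half-periods, and cancels. *)
Lemma row_integral (th x : R) (nu : C) (N k : nat) : 0 < th < 1 -> 0 < x ->
  -2 < Re nu - 2 * INR N < 1 ->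
  (forall m : nat, INR (S k) * (INR m + th) <> x /\ INR (S k) * (INR m + (1 - th)) <> x) ->
  csin (RtoC PI * nu / 2) <> 0%C ->
  let a := (nu - RtoC (2 * INR N))%C in
  cseries (fun m => cell a x (INR (S k)) (INR m + th) + cell a x (INR (S k)) (INR m + (1 - th)))%C
    (RtoC (4 * PI / x ^ (2 * N + 1)) * csin (RtoC PI * nu / 2) / cpow (INR (S k)) (- nu) * Rint (row_fun th x nu N k))%C.
Proof.
  intros Hth Hx Ha Hne Hs a. assert (Hpi := PI_RGT_0). set (d := INR (S k)) in *.
  assert (Hd : 0 < d) by (apply lt_0_INR; lia).
  assert (Hdk : INR k + 1 = d) by (unfold d; now rewrite S_INR).
  assert (HRa : Re a = Re nu - 2 * INR N) by (unfold a; now rewrite Re_minus, Re_RtoC).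
  set (y := x / d). assert (Hy : 0 < y) by now apply Rdiv_lt_0_compat.
  (* Decay at +oo needs kap > Re a, and summability over m needs kap < 1. The midpoint of Re a and 1
     satisfies both; the maximum with 0 keeps the exponent in range. *)
  set (kap := Rmax 0 ((Re a + 1) / 2)).
  assert (Hk : 0 <= kap < 1 /\ Re a < kap).
  { unfold kap. assert (Q1 := Rmax_l 0 ((Re a + 1) / 2)). assert (Q2 := Rmax_r 0 ((Re a + 1) / 2)).
    split; [split; [assumption|apply Rmax_lub_lt; lra]|lra]. }
  set (b := bcoef N x k / (2 * PI)).
  set (f := fun (m : nat) u => (RtoC b * (cauchy2 a (INR m + th) y u + cauchy2 a (INR m + (1 - th)) y u))%C).
  assert (Hv : forall m t, 0 < t -> 0 < INR m + t) by (intros m t Ht; generalize (pos_INR m); lra).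
  set (Mr := fun m => Rabs b * (Rpower (INR m + th) (- (2 - kap)) + Rpower (INR m + (1 - th)) (- (2 - kap)))).
  set (Ml := fun m => (Rabs b * / y ^ 2) * (Rpower (INR m + th) (- (2)) + Rpower (INR m + (1 - th)) (- (2)))).
  assert (cc : forall v t, 0 < v -> ccont (cauchy2 a v y) t).
  { intros v t Hv0. apply ccont_mult; [apply ccont_cexp_scal|]. now apply ccont_RtoC, g2_continuous. }
  destruct (Rint_series f (row_fun th x nu N k) Mr Ml (kap - Re a) (Re a + 2)) as (_ & _ & S).
  { lra. } { lra. }
  { intros m t. apply ccont_mult; [apply ccont_const|]. apply ccont_plus; apply cc, Hv; lra. }
  { intros t. now apply row_fun_ccont. }
  { intros m t Ht. unfold f, Mr. rewrite Cmod_mult, Cmod_R, Rmult_assoc. apply Rmult_le_compat_l; [apply Rabs_pos|].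
    eapply Rle_trans; [apply Cmod_triangle|]. rewrite Rmult_plus_distr_r.
    apply Rplus_le_compat; apply cauchy2_le_right; try assumption; try lra; apply Hv; lra. }
  { apply (ex_series_scal_l (K := R_AbsRing) (V := R_NormedModule) (Rabs b)).
    apply (ex_series_plus (K := R_AbsRing) (V := R_NormedModule)); apply ex_series_hurwitz; lra. }
  { intros m t Ht. unfold f, Ml. rewrite Cmod_mult, Cmod_R, !Rmult_assoc. apply Rmult_le_compat_l; [apply Rabs_pos|].
    eapply Rle_trans; [apply Cmod_triangle|].
    rewrite Rmult_plus_distr_r, Rmult_plus_distr_l, <- !Rmult_assoc.
    apply Rplus_le_compat; apply cauchy2_le_left; try assumption; apply Hv; lra. }
  { apply (ex_series_scal_l (K := R_AbsRing) (V := R_NormedModule) (Rabs b * / y ^ 2)).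
    apply (ex_series_plus (K := R_AbsRing) (V := R_NormedModule)); apply ex_series_hurwitz; lra. }
  { intros t. assert (Q := cseries_scal (RtoC (bterm N k (x * exp (- t)))) _ _ (kerA1_mellin_series th nu t Hth)).
    unfold row_fun. rewrite Cmult_comm. eapply cseries_ext; [|exact Q]. intros m. cbv beta.
    assert (Q1 := cauchy2_bterm N k x (INR m + th) nu t Hx). assert (Q2 := cauchy2_bterm N k x (INR m + (1 - th)) nu t Hx).
    rewrite Hdk in Q1, Q2. fold y a in Q1, Q2. unfold f, b, Rdiv.
    rewrite RtoC_mult.
    transitivity (RtoC (/ (2 * PI)) * (cauchy_exp nu (INR m + th) t * RtoC (bterm N k (x * exp (- t))) +
      cauchy_exp nu (INR m + (1 - th)) t * RtoC (bterm N k (x * exp (- t)))))%C; [ring|].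
    rewrite Q1, Q2. ring. }
  apply (cseries_scal (RtoC (4 * PI / x ^ (2 * N + 1)) * csin (RtoC PI * nu / 2) / cpow d (- nu))%C) in S.
  eapply cseries_ext; [|exact S]. intros m. cbv beta.
  destruct (Hne m) as [N1 N2].
  assert (R1 := cauchy2_rable a (INR m + th) y (Hv m th ltac:(lra)) Hy ltac:(lra)).
  assert (R2 := cauchy2_rable a (INR m + (1 - th)) y (Hv m (1 - th) ltac:(lra)) Hy ltac:(lra)).
  assert (I1 := cauchy2_cell a x d (INR m + th) Hx Hd (Hv m th ltac:(lra)) N1 ltac:(lra)).
  assert (I2 := cauchy2_cell a x d (INR m + (1 - th)) Hx Hd (Hv m (1 - th) ltac:(lra)) N2 ltac:(lra)).
  fold y in I1, I2. unfold f. rewrite (Rint_scal _ _ (rable_plus _ _ R1 R2)), (Rint_plus _ _ R1 R2).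
  rewrite (csin_half_shift nu N) in Hs |- *. fold a in Hs |- *.
  set (sn := csin (RtoC PI * a / 2)) in *.
  assert (Hsn : sn <> 0%C) by (intro Q; apply Hs; rewrite Q; ring).
  replace (RtoC (4 * PI / x ^ (2 * N + 1)) * (RtoC ((-1) ^ N) * sn) / cpow d (- nu) *
     (RtoC b * (Rint (cauchy2 a (INR m + th) y) + Rint (cauchy2 a (INR m + (1 - th)) y))))%C
    with (RtoC (4 * PI / x ^ (2 * N + 1)) * RtoC ((-1) ^ N) / cpow d (- nu) * RtoC b *
     (sn * Rint (cauchy2 a (INR m + th) y) + sn * Rint (cauchy2 a (INR m + (1 - th)) y)))%C by (unfold Cdiv; ring).
  rewrite I1, I2.
  assert (Px : 0 < x ^ (2 * N + 1)) by now apply pow_lt.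
  assert (Pd : 0 < d ^ (2 * N)) by now apply pow_lt.
  assert (Hc : (cpow d (- nu) = / RtoC (d ^ (2 * N)) * cpow d (- a))%C).
  { rewrite <- cpow_nat, <- cpow_opp, <- cpow_plus by assumption. f_equal. unfold a. rewrite mult_INR.
    replace (INR 2) with 2 by (simpl; ring). ring. }
  assert (Hb : RtoC b = (RtoC ((-1) ^ N) * RtoC (x ^ (2 * N + 1)) / (2 * RtoC PI * RtoC PI * RtoC (d ^ (2 * N)) * RtoC (d ^ 2)))%C).
  { unfold b, bcoef. rewrite Hdk. assert (0 < d ^ 2) by now apply pow_lt.
    rewrite <- !RtoC_mult, <- RtoC_div by (apply Rgt_not_eq; assert (0 < 2 * PI * PI * d ^ (2 * N)) by (apply Rmult_lt_0_compat; [nra|assumption]); apply Rmult_lt_0_compat; assumption).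
    f_equal. rewrite (pow_add d (2 * N) 2). field. repeat split; lra. }
  assert (Hsg : (RtoC ((-1) ^ N) * RtoC ((-1) ^ N) = 1)%C).
  { rewrite <- RtoC_mult, <- Rpow_mult_distr. replace (-1 * -1) with 1 by ring. now rewrite pow1. }
  rewrite Hc, Hb, !RtoC_div, RtoC_mult by lra.
  assert (Q1 : RtoC (x ^ (2 * N + 1)) <> 0%C) by (intro Q; apply RtoC_inj in Q; lra).
  assert (Q2 : RtoC (d ^ (2 * N)) <> 0%C) by (intro Q; apply RtoC_inj in Q; lra).
  assert (Q3 : RtoC (d ^ 2) <> 0%C) by (intro Q; apply RtoC_inj in Q; assert (0 < d ^ 2) by (now apply pow_lt); lra).
  assert (Q4 := cpow_neq_0 d (- a)).
  assert (Q5 : RtoC PI <> 0%C) by (intro Q; apply RtoC_inj in Q; lra).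
  set (c1 := cell a x d (INR m + th)). set (c2 := cell a x d (INR m + (1 - th))).
  transitivity (RtoC ((-1) ^ N) * RtoC ((-1) ^ N) * (c1 + c2))%C; [|rewrite Hsg; ring].
  replace (RtoC 4) with (2 * RtoC 2)%C by (apply C_ext; simpl; ring).
  field. repeat split; assumption.
Qed.

Definition col_fun (th x : R) (nu : C) (N : nat) (u : R) : C :=
  (cexp (nu * RtoC u) * RtoC (kerA1 th (exp u)) * RtoC (kerBN N (x * exp (- u))))%C.

Lemma kerA1_bounded (th : R) : exists K, 0 <= K /\ forall u, 0 <= u -> kerA1 th (exp u) <= K.
Proof.
  destruct (kerA_exp_decay th 1 1 ltac:(lra) ltac:(lra)) as [K [HK B]].
  exists (K + / 2). split; [lra|]. intros u Hu. specialize (B u Hu). rewrite Rmult_1_l in B.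
  assert (Q := Rle_abs (kerA th (exp u))). change (kerA1 th (exp u) - / 2 <= Rabs (kerA th (exp u))) in Q.
  assert (E : exp (- (1) * u) <= 1) by (apply Rle_trans with (exp 0); [apply exp_le_compat; lra|rewrite exp_0; lra]).
  assert (K * exp (- (1) * u) <= K * 1) by now apply Rmult_le_compat_l. lra.
Qed.

Lemma col_fun_ccont th x nu N t : 0 < x -> ccont (col_fun th x nu N) t.
Proof.
  intros Hx. apply ccont_mult; [apply ccont_mult|].
  - apply ccont_cexp_scal.
  - apply ccont_RtoC, kerA1_continuous; [apply continuous_exp_R|apply exp_pos].
  - apply ccont_RtoC, kerBN_continuous; [apply continuous_scal_exp_opp|].
    apply Rmult_lt_0_compat; [assumption|apply exp_pos].
Qed.

(** The outer sum, over d, under the integral sign. At +oo A + 1/2 is bounded and B_N decays; at -oo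
    the linear bound on A + 1/2 provides one additional unit of decay. *)
Lemma col_integral (th x : R) (nu : C) (N : nat) : 0 < th < 1 -> 0 < x -> 0 <= Re nu ->
  -1 <= Re nu - 2 * INR N < 1 ->
  hint_able (col_fun th x nu N) /\ hint_able (fun u => col_fun th x nu N (- u)) /\
  cseries (fun k => Rint (row_fun th x nu N k)) (Rint (col_fun th x nu N)).
Proof.
  intros Hth Hx H0 Ha. assert (Hpi := PI_RGT_0).
  destruct (kerA1_bounded th) as [K1 [HK1 B1]]. destruct (kerA1_linear th Hth) as [K2 [HK2 B2]].
  (* With r = Re nu - 2N the upper limit for [kap] is r + 2, one more than for B_N alone; this
     admits r = -1 for N >= 1 and Re nu = 0 for N = 0. *)
  assert (Hkap : exists kap, 0 <= kap <= 2 /\ 1 < 2 * INR N + kap /\ kap < Re nu - 2 * INR N + 2).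
  { destruct N as [|N]; [exists (3/2); simpl in *; lra|]. exists 0. rewrite S_INR in *. assert (Q := pos_INR N). lra. }
  destruct Hkap as (kap & Hk1 & Hk2 & Hk3).
  set (Mr := fun k => K1 * (x ^ (2 * N + 1) / PI * Rpower x (- (2 - 2)) * Rpower (INR k + 1) (- (2 * INR N + 2)))).
  set (Ml := fun k => K2 * (x ^ (2 * N + 1) / PI * Rpower x (- (2 - kap)) * Rpower (INR k + 1) (- (2 * INR N + kap)))).
  assert (E : forall k u, Cmod (row_fun th x nu N k u) =
    kerA1 th (exp u) * Cmod (cexp (nu * RtoC u) * RtoC (bterm N k (x * exp (- u))))).
  { intros k u. unfold row_fun. rewrite !Cmod_mult, !Cmod_R, (Rabs_right (kerA1 _ _)) by (apply Rle_ge, kerA1_pos, exp_pos). ring. }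
  apply (Rint_series (row_fun th x nu N) (col_fun th x nu N) Mr Ml
    (1 - (Re nu - 2 * INR N)) (Re nu - 2 * INR N + 2 - kap)).
  - lra.
  - lra.
  - intros. now apply row_fun_ccont.
  - intros. now apply col_fun_ccont.
  - intros k t Ht. rewrite E. unfold Mr. rewrite Rmult_assoc.
    apply Rmult_le_compat; [apply kerA1_pos, exp_pos|apply Cmod_ge_0|auto|].
    eapply Rle_trans; [apply bterm_majorant with (kap := 2); [assumption|lra]|]. apply Req_le. f_equal. f_equal. ring.
  - apply (ex_series_scal_l (K := R_AbsRing) (V := R_NormedModule) K1). apply bterm_majorant_summable.
    generalize (pos_INR N); lra.
  - intros k t Ht. rewrite E. unfold Ml.
    replace (K2 * (x ^ (2 * N + 1) / PI * Rpower x (- (2 - kap)) * Rpower (INR k + 1) (- (2 * INR N + kap))) *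
      exp (- (Re nu - 2 * INR N + 2 - kap) * t)) with (K2 * exp (- t) * (x ^ (2 * N + 1) / PI * Rpower x (- (2 - kap)) * Rpower (INR k + 1) (- (2 * INR N + kap)) *
      exp ((Re nu - 2 * INR N + 1 - kap) * - t))).
    + apply Rmult_le_compat; [apply kerA1_pos, exp_pos|apply Cmod_ge_0|apply B2, exp_pos|].
      now apply bterm_majorant.
    + replace (- (Re nu - 2 * INR N + 2 - kap) * t) with (- t + (Re nu - 2 * INR N + 1 - kap) * - t) by ring.
      rewrite exp_plus. ring.
  - apply (ex_series_scal_l (K := R_AbsRing) (V := R_NormedModule) K2). now apply bterm_majorant_summable.
  - intros t. assert (P : 0 < x * exp (- t)) by (apply Rmult_lt_0_compat; [assumption|apply exp_pos]).
    apply (cseries_scal (cexp (nu * RtoC t) * RtoC (kerA1 th (exp t)))%C _ _).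
    now apply is_series_RtoC, kerBN_series.
Qed.

(** * The strip 2N - 1 <= Re nu < 2N + 1 *)

(** The common shape of the two half-lines in [lhs_decomposition], so that integrability of the
    pieces is handled only once. *)
Lemma Hint_laplace_combination (f h g k : R -> C) (s0 s1 t : C) (sig : nat -> C) (c1 : C) (c : nat -> C) (N : nat) :
  hint_able h -> hint_able (lt_fun g s0) -> hint_able (lt_fun g s1) -> hint_able (lt_fun k t) ->
  (forall i, (i < N)%nat -> hint_able (lt_fun g (sig i))) ->
  (forall u, f u = (h u + (- / 2 * lt_fun g s0 u + (c1 * lt_fun g s1 u +
     (csum0 (fun i => c i * lt_fun g (sig i) u) N + - / 2 * lt_fun k t u))))%C) ->
  Hint f = (Hint h + (- / 2 * LT g s0 + (c1 * LT g s1 + (csum0 (fun i => c i * LT g (sig i)) N + - / 2 * LT k t))))%C.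
Proof.
  intros Hh H0 H1 Ht Hi E. rewrite (Hint_ext f _ (fun u _ => E u)).
  destruct (hint_able_csum0 (fun i u => c i * lt_fun g (sig i) u)%C N) as [S1 S2].
  { intros i Hl. now apply hint_able_scal, Hi. }
  assert (A1 := hint_able_scal (- / 2)%C _ Ht). assert (A2 := hint_able_plus _ _ S1 A1).
  assert (A3 := hint_able_scal c1 _ H1). assert (A4 := hint_able_plus _ _ A3 A2).
  assert (A5 := hint_able_scal (- / 2)%C _ H0). assert (A6 := hint_able_plus _ _ A5 A4).
  rewrite (Hint_plus _ _ Hh A6), (Hint_plus _ _ A5 A4), (Hint_plus _ _ A3 A2), (Hint_plus _ _ S1 A1).
  rewrite (Hint_scal _ _ H0), (Hint_scal _ _ H1), (Hint_scal _ _ Ht), S2. unfold LT.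
  do 4 f_equal. apply csum0_ext. intros i Hl. apply Hint_scal. now apply Hi.
Qed.

(** For t > 1 the splitting is A B = (A + 1/2) B_N + A P - B_N / 2. Here A and B_N both decay, so no
    piece contains P alone. *)
Lemma lhs_fun_right (th x : R) (nu : C) (N : nat) (u : R) : 0 < x ->
  lhs_fun th x nu u = (col_fun th x nu N u + (- / 2 * lt_fun (gA th) (- nu) u +
    (RtoC (/ (2 * PI * x)) * lt_fun (gA th) (- (nu + 1)) u +
    (csum0 (fun i => RtoC (pcoef x i) * lt_fun (gA th) (- (nu - RtoC (2 * INR i + 1))) u) N +
     - / 2 * lt_fun (gBN N x) (- nu) u))))%C.
Proof.
  intros Hx. unfold lhs_fun, col_fun, lt_fun, gA, gBN.
  assert (EB : kerA 0 (x * exp (- u)) = kerBN N (x * exp (- u)) + kerP N (x * exp (- u))) by (unfold kerBN; ring).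
  assert (EA : kerA1 th (exp u) = kerA th (exp u) + / 2) by (unfold kerA; ring).
  assert (ES : csum0 (fun i => RtoC (pcoef x i) * (cexp (- - (nu - RtoC (2 * INR i + 1)) * RtoC u) * RtoC (kerA th (exp u))))%C N =
    (cexp (nu * RtoC u) * RtoC (kerA th (exp u)) * RtoC (rsum (fun i => (pcoef x i * exp (- ((2 * INR i + 1) * u)))%R) N))%C).
  { rewrite RtoC_rsum, <- csum0_scal. apply csum0_ext. intros i _.
    replace (- - (nu - RtoC (2 * INR i + 1)) * RtoC u)%C with (nu * RtoC u + RtoC (- ((2 * INR i + 1) * u)))%C
      by (rewrite RtoC_opp, RtoC_mult; ring).
    rewrite cexp_plus, cexp_RtoC, RtoC_mult. ring. }
  rewrite ES, EB, EA, (kerP_exp N x u Hx).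
  replace (- - (nu + 1) * RtoC u)%C with (nu * RtoC u + RtoC u)%C by ring.
  replace (- - nu * RtoC u)%C with (nu * RtoC u)%C by ring.
  rewrite cexp_plus, cexp_RtoC, !RtoC_mult, !RtoC_plus, RtoC_mult, RtoC_opp, !RtoC_inv by lra. ring.
Qed.

(** For t < 1 the splitting is A B = (A + 1/2) B_N + (A + 1/2) P - B / 2. Now A + 1/2 and B are the
    small factors. *)
Lemma lhs_fun_left (th x : R) (nu : C) (N : nat) (u : R) : 0 < x ->
  lhs_fun th x nu (- u) = (col_fun th x nu N (- u) + (- / 2 * lt_fun (gA1 th) nu u +
    (RtoC (/ (2 * PI * x)) * lt_fun (gA1 th) (nu + 1) u +
    (csum0 (fun i => RtoC (pcoef x i) * lt_fun (gA1 th) (nu - RtoC (2 * INR i + 1)) u) N +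
     - / 2 * lt_fun (gB x) nu u))))%C.
Proof.
  intros Hx. unfold lhs_fun, col_fun, lt_fun, gA1, gB.
  assert (EB : kerBN N (x * exp (- - u)) = kerA 0 (x * exp u) - kerP N (x * exp (- - u))) by (unfold kerBN; now rewrite Ropp_involutive).
  assert (EA : kerA th (exp (- u)) = kerA1 th (exp (- u)) - / 2) by reflexivity.
  assert (ES : csum0 (fun i => RtoC (pcoef x i) * (cexp (- (nu - RtoC (2 * INR i + 1)) * RtoC u) * RtoC (kerA1 th (exp (- u)))))%C N =
    (cexp (nu * RtoC (- u)) * RtoC (kerA1 th (exp (- u))) * RtoC (rsum (fun i => (pcoef x i * exp (- ((2 * INR i + 1) * - u)))%R) N))%C).
  { rewrite RtoC_rsum, <- csum0_scal. apply csum0_ext. intros i _.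
    replace (- (nu - RtoC (2 * INR i + 1)) * RtoC u)%C with (nu * RtoC (- u) + RtoC (- ((2 * INR i + 1) * - u)))%C
      by (rewrite !RtoC_opp, RtoC_mult, RtoC_opp; ring).
    rewrite cexp_plus, cexp_RtoC, RtoC_mult. ring. }
  rewrite ES, EB, EA, (kerP_exp N x (- u) Hx), Ropp_involutive.
  replace (- (nu + 1) * RtoC u)%C with (nu * RtoC (- u) + RtoC (- u))%C by (rewrite RtoC_opp; ring).
  replace (- nu * RtoC u)%C with (nu * RtoC (- u))%C by (rewrite RtoC_opp; ring).
  rewrite cexp_plus, cexp_RtoC, !RtoC_mult, !RtoC_minus, !RtoC_plus, RtoC_mult, (RtoC_opp (/ 2)), !RtoC_inv by lra. ring.
Qed.

Lemma csum0_minus f g n : csum0 (fun i => f i - g i)%C n = (csum0 f n - csum0 g n)%C.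
Proof. induction n as [|n IH]; simpl; [ring|rewrite IH; ring]. Qed.

(** The two half-line splittings differ by P / 2. The explicit fractions in [melA] and [melB] are
    exactly the transforms of this difference and cancel pairwise. *)
Theorem lhs_decomposition (th x : R) (nu : C) (N : nat) : 0 < th < 1 -> 0 < x -> 0 <= Re nu ->
  2 * INR N - 1 <= Re nu < 2 * INR N + 1 -> (forall k : Z, nu <> RtoC (IZR k)) ->
  Rint (lhs_fun th x nu) = (Rint (col_fun th x nu N) - / 2 * melA th nu + RtoC (/ (2 * PI * x)) * melA th (nu + 1)
    + csum0 (fun i => RtoC (pcoef x i) * melA th (nu - RtoC (2 * INR i + 1))) N - / 2 * melB N x nu)%C.
Proof.
  intros Hth Hx H0 Hn Hz.
  destruct (col_integral th x nu N Hth Hx H0 ltac:(lra)) as (C1 & C2 & _).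
  assert (AA : forall s, hint_able (lt_fun (gA th) s)).
  { intros s. destruct (gA_order th (Re s - 1)) as [K HK]. apply (LT_able _ _ _ s HK). lra. }
  assert (AA1 : forall s, -1 < Re s -> hint_able (lt_fun (gA1 th) s)).
  { intros s Hs. destruct (gA1_order th Hth) as [K HK]. apply (LT_able _ _ _ s HK). lra. }
  assert (AB : hint_able (lt_fun (gB x) nu)).
  { destruct (gB_order x (Re nu - 1) Hx) as [K HK]. apply (LT_able _ _ _ nu HK). lra. }
  assert (ABN : hint_able (lt_fun (gBN N x) (- nu))).
  { destruct (gBN_order N x Hx) as [K HK]. apply (LT_able _ _ _ _ HK). rewrite Re_opp. lra. }
  assert (HI : forall i, (i < N)%nat -> hint_able (lt_fun (gA1 th) (nu - RtoC (2 * INR i + 1)))).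
  { intros i Hi. apply AA1. rewrite Re_minus, Re_RtoC.
    assert (INR i + 1 <= INR N) by (rewrite <- S_INR; apply le_INR; lia). lra. }
  unfold Rint at 1.
  rewrite (Hint_laplace_combination _ _ _ _ _ _ _ (fun i => - (nu - RtoC (2 * INR i + 1)))%C _ (fun i => RtoC (pcoef x i)) N C1 (AA _) (AA _) ABN
    (fun i _ => AA _) (fun u => lhs_fun_right th x nu N u Hx)).
  rewrite (Hint_laplace_combination (fun u => lhs_fun th x nu (- u)) _ _ _ nu (nu + 1)%C _ (fun i => (nu - RtoC (2 * INR i + 1)))%C _ (fun i => RtoC (pcoef x i)) N C2
    (AA1 nu ltac:(lra)) (AA1 (nu + 1)%C ltac:(rewrite Re_plus, Re_RtoC; lra)) AB
    HI
    (fun u => lhs_fun_left th x nu N u Hx)).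
  assert (N0 : nu <> 0%C) by apply (Hz 0%Z).
  assert (N1 : (nu + 1)%C <> 0%C).
  { intro Q. apply (Hz (-1)%Z). apply Cminus_eq_0. rewrite <- Q. apply C_ext; simpl; ring. }
  assert (Ni : forall i, (nu - RtoC (2 * INR i + 1))%C <> 0%C).
  { intros i Q. apply (Hz (2 * Z.of_nat i + 1)%Z). apply Cminus_eq_0 in Q. rewrite Q. f_equal.
    rewrite plus_IZR, mult_IZR, <- INR_IZR_INZ. reflexivity. }
  assert (ES : csum0 (fun i => RtoC (pcoef x i) * melA th (nu - RtoC (2 * INR i + 1)))%C N =
    (csum0 (fun i => RtoC (pcoef x i) * LT (gA th) (- (nu - RtoC (2 * INR i + 1)))) N +
     csum0 (fun i => RtoC (pcoef x i) * LT (gA1 th) (nu - RtoC (2 * INR i + 1))) N -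
     / 2 * csum0 (fun i => RtoC (pcoef x i) * / (nu - RtoC (2 * INR i + 1))) N)%C).
  { rewrite <- csum0_scal, <- csum0_plus, <- csum0_minus. apply csum0_ext. intros i _. unfold melA. field. apply Ni. }
  rewrite ES. unfold melA, melB, Rint. field. split; assumption.
Qed.

(** The sign (-1)^i arising here matches the one in [pcoef], so the sum with zeta(2j) has constant
    sign and the common denominator sin(pi nu / 2). *)
Lemma ccos_half_odd_shift (nu : C) (i : nat) :
  ccos (RtoC PI * (nu - RtoC (2 * INR i + 1)) / 2) = (RtoC ((-1) ^ i) * csin (RtoC PI * nu / 2))%C.
Proof.
  rewrite (csin_half_shift nu (S i)).
  replace (nu - RtoC (2 * INR i + 1))%C with (nu - RtoC (2 * INR (S i)) + 1)%C
    by (rewrite S_INR; apply C_ext; simpl; ring).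
  rewrite ccos_half_plus_one.
  assert (E : (RtoC ((-1) ^ i) * RtoC ((-1) ^ S i) = - RtoC 1)%C).
  { rewrite <- RtoC_mult. simpl pow. replace ((-1) ^ i * (-1 * (-1) ^ i)) with (- (((-1) * (-1)) ^ i)) by (rewrite Rpow_mult_distr; ring).
    replace (-1 * -1) with 1 by ring. rewrite pow1. apply RtoC_opp. }
  rewrite Cmult_assoc, E. ring.
Qed.

(** The functional equation is read at three kinds of points: nu gives the values at 1 - nu, nu + 1
    those at -nu, and nu - (2i + 1) those at 2(i + 1) - nu. The term with zeta(nu + 1) comes from
    [melB]. The last summand is written with cancelling powers of x so that its final factor is the
    sum found in [double_series_strip]. *)
Theorem strip_formula (th x : R) (nu : C) (N : nat) (Fa Fb F1 : C -> C) : 0 < th < 1 -> 0 < x -> 0 <= Re nu ->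
  2 * INR N - 1 <= Re nu < 2 * INR N + 1 -> (forall k : Z, nu <> RtoC (IZR k)) ->
  is_hurwitz_continuation th Fa -> is_hurwitz_continuation (1 - th) Fb -> is_hurwitz_continuation 1 F1 ->
  let Zt w := (Fa w + Fb w)%C in
  let c := ccos (RtoC PI * nu / 2) in
  let s := csin (RtoC PI * nu / 2) in
  (RtoC (4 * PI) * Rint (lhs_fun th x nu) =
   - (RtoC PI / c * F1 (nu + 1) * cpow x nu) + - (RtoC PI / (2 * c) * Zt (1 - nu))
   + - (1 / (RtoC (2 * x) * s) * Zt (- nu))
   + 1 / s * csum0 (fun i => RtoC (zev (S i)) * Zt (RtoC (2 * INR (S i)) - nu) * RtoC (x ^ (2 * i + 1))) N
   + 1 / s * RtoC (x ^ (2 * N + 1)) * (RtoC (4 * PI / x ^ (2 * N + 1)) * s * Rint (col_fun th x nu N)))%C.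
Proof.
  intros Hth Hx H0 Hn Hz HFa HFb HF1 Zt c s. assert (Hpi := PI_RGT_0).
  assert (Hc : c <> 0%C).
  { intro Q. apply ccos_half_zero in Q as [k Q]. apply (Hz (2 * k + 1)%Z). rewrite Q, plus_IZR, mult_IZR. reflexivity. }
  assert (Hs : s <> 0%C).
  { intro Q. apply csin_half_zero in Q as [k Q]. apply (Hz (2 * k)%Z). rewrite Q, mult_IZR. reflexivity. }
  assert (N0 : nu <> 0%C) by apply (Hz 0%Z).
  assert (N1 : (nu + 1)%C <> 0%C).
  { intro Q. apply (Hz (-1)%Z). apply Cminus_eq_0. rewrite <- Q. apply C_ext; simpl; ring. }
  assert (Ni : forall i, (nu - RtoC (2 * INR i + 1))%C <> 0%C).
  { intros i Q. apply (Hz (2 * Z.of_nat i + 1)%Z). apply Cminus_eq_0 in Q. rewrite Q. f_equal.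
    rewrite plus_IZR, mult_IZR, <- INR_IZR_INZ. reflexivity. }
  assert (R2 : RtoC 2 <> 0%C) by (intro Q; apply RtoC_inj in Q; lra).
  assert (R4 : RtoC 4 <> 0%C) by (intro Q; apply RtoC_inj in Q; lra).
  assert (RP : RtoC PI <> 0%C) by (intro Q; apply RtoC_inj in Q; lra).
  assert (Rx : RtoC x <> 0%C) by (intro Q; apply RtoC_inj in Q; lra).
  assert (E0 : melA th nu = (Zt (1 - nu) / (4 * c))%C).
  { unfold Zt. rewrite (melA_functional th nu Fa Fb Hth HFa HFb ltac:(lra) N0). fold c. field. repeat split; assumption. }
  assert (E1 : melA th (nu + 1) = (- (Zt (- nu) / (4 * s)))%C).
  { assert (Q := melA_functional th (nu + 1) Fa Fb Hth HFa HFb ltac:(rewrite Re_plus, Re_RtoC; lra) N1).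
    replace (1 - (nu + 1))%C with (- nu)%C in Q by ring. unfold Zt. rewrite Q, ccos_half_plus_one. fold s. field. repeat split; assumption. }
  assert (E2 : (RtoC (4 * PI) * csum0 (fun i => RtoC (pcoef x i) * melA th (nu - RtoC (2 * INR i + 1))) N =
    1 / s * csum0 (fun i => RtoC (zev (S i)) * Zt (RtoC (2 * INR (S i)) - nu) * RtoC (x ^ (2 * i + 1))) N)%C).
  { rewrite <- !csum0_scal. apply csum0_ext. intros i Hi.
    assert (Q := melA_functional th (nu - RtoC (2 * INR i + 1)) Fa Fb Hth HFa HFb
      ltac:(rewrite Re_minus, Re_RtoC; assert (INR i + 1 <= INR N) by (rewrite <- S_INR; apply le_INR; lia); lra) (Ni i)).
    replace (1 - (nu - RtoC (2 * INR i + 1)))%C with (RtoC (2 * INR (S i)) - nu)%C in Q by (rewrite S_INR; apply C_ext; simpl; ring).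
    unfold Zt. rewrite Q, ccos_half_odd_shift. fold s. unfold pcoef. rewrite RtoC_div, !RtoC_mult by lra. field. repeat split; assumption. }
  assert (E3 : melB N x nu = (cpow x nu * F1 (nu + 1) / (2 * c))%C).
  { rewrite <- (melB_value N x nu F1 Hx HF1 H0 Hn Hz). fold c. field. repeat split; assumption. }
  rewrite (lhs_decomposition th x nu N Hth Hx H0 Hn Hz), E0, E1, E3.
  assert (Px : 0 < x ^ (2 * N + 1)) by now apply pow_lt.
  assert (RPx : RtoC (x ^ (2 * N + 1)) <> 0%C) by (intro Q; apply RtoC_inj in Q; lra).
  rewrite <- E2. rewrite RtoC_inv, RtoC_div by (try lra; apply Rgt_not_eq; apply Rmult_lt_0_compat; lra).
  rewrite !RtoC_mult.
  replace (RtoC 4) with (2 * RtoC 2)%C by (apply C_ext; simpl; ring).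
  field. repeat split; assumption.
Qed.

(** Iterated convergence: [T k] is the sum over m in the row d = k + 1, and the rows are summed
    afterwards with the weight d^(-nu). *)
Definition double_series (th x : R) (nu : C) (N : nat) (T : nat -> C) (Ssum : C) : Prop :=
  let a := (nu - RtoC (2 * INR N))%C in
  (forall k, cseries (fun m => cell a x (INR (S k)) (INR m + th) + cell a x (INR (S k)) (INR m + (1 - th)))%C (T k)) /\
  cseries (fun k => cpow (INR (S k)) (- nu) * T k)%C Ssum.

Lemma double_series_strip (th x : R) (nu : C) (N : nat) : 0 < th < 1 -> 0 < x -> 0 <= Re nu ->
  2 * INR N - 1 <= Re nu < 2 * INR N + 1 -> (forall k : Z, nu <> RtoC (IZR k)) ->
  (forall k m : nat, INR (S k) * (INR m + th) <> x /\ INR (S k) * (INR m + (1 - th)) <> x) ->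
  exists T, double_series th x nu N T (RtoC (4 * PI / x ^ (2 * N + 1)) * csin (RtoC PI * nu / 2) * Rint (col_fun th x nu N)).
Proof.
  intros Hth Hx H0 Hn Hz Hne. set (s := csin (RtoC PI * nu / 2)).
  assert (Hs : s <> 0%C).
  { intro Q. apply csin_half_zero in Q as [k Q]. apply (Hz (2 * k)%Z). rewrite Q, mult_IZR. reflexivity. }
  exists (fun k => RtoC (4 * PI / x ^ (2 * N + 1)) * s / cpow (INR (S k)) (- nu) * Rint (row_fun th x nu N k))%C.
  split.
  - intros k. apply row_integral; try assumption; [lra|apply Hne].
  - destruct (col_integral th x nu N Hth Hx H0 ltac:(lra)) as (_ & _ & S).
    apply (cseries_scal (RtoC (4 * PI / x ^ (2 * N + 1)) * s)%C) in S.
    eapply cseries_ext; [|exact S]. intros k. cbv beta. field. apply cpow_neq_0.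
Qed.

(** * From N to N + 1 *)

(** With w = d v: (w^(a-2) - x^(a-2)) / (w^2 - x^2) is 1 / x^2 times the difference of (w^a - x^a) /
    (w^2 - x^2) and w^(a-2). *)
Lemma cell_shift (a : C) (x d v : R) : 0 < x -> 0 < d -> 0 < v -> d * v <> x ->
  cell (a - RtoC 2) x d v = ((cell a x d v - cpow (d * v) (a - RtoC 2)) / RtoC (x ^ 2))%C.
Proof.
  intros Hx Hd Hv Hne. assert (Hdv : 0 < d * v) by now apply Rmult_lt_0_compat.
  assert (D : d ^ 2 * v ^ 2 - x ^ 2 <> 0).
  { replace (d ^ 2 * v ^ 2 - x ^ 2) with ((d * v - x) * (d * v + x)) by ring.
    apply Rmult_integral_contrapositive_currified; [intro Q; apply Hne; lra|lra]. }
  assert (P : forall y, 0 < y -> cpow y a = (RtoC (y ^ 2) * cpow y (a - RtoC 2))%C).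
  { intros y Hy. rewrite <- cpow_nat, <- cpow_plus by assumption. f_equal. replace (INR 2) with 2 by (simpl; ring). ring. }
  unfold cell. rewrite (P (d * v)), (P x) by assumption.
  assert (R1 : RtoC (d ^ 2 * v ^ 2 - x ^ 2) <> 0%C) by (intro Q; apply RtoC_inj in Q; lra).
  assert (R2 : RtoC (x ^ 2) <> 0%C) by (intro Q; apply RtoC_inj in Q; assert (0 < x ^ 2) by (now apply pow_lt); lra).
  replace ((d * v) ^ 2) with ((d ^ 2 * v ^ 2 - x ^ 2) + x ^ 2) by ring. rewrite RtoC_plus.
  field. repeat split; assumption.
Qed.

(** The split-off powers (d v)^(-w) sum over m to d^(-w) times the two Hurwitz values at w, where Re
    w > 1. Over d the weight d^(-nu) d^(-w) equals d^(-2(N+1)), whence zeta(2N + 2). *)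
Lemma double_series_shift (th x : R) (nu : C) (N : nat) (T : nat -> C) (Ssum : C) (Fa Fb : C -> C) :
  0 < th < 1 -> 0 < x -> Re nu < 2 * INR N + 1 ->
  is_hurwitz_continuation th Fa -> is_hurwitz_continuation (1 - th) Fb ->
  (forall k m : nat, INR (S k) * (INR m + th) <> x /\ INR (S k) * (INR m + (1 - th)) <> x) ->
  double_series th x nu N T Ssum ->
  let w := (RtoC (2 * INR (S N)) - nu)%C in
  exists T', double_series th x nu (S N) T' ((Ssum - RtoC (zev (S N)) * (Fa w + Fb w)) / RtoC (x ^ 2)).
Proof.
  intros Hth Hx Hn HFa HFb Hne [H1 H2] w.
  set (a := (nu - RtoC (2 * INR N))%C) in *.
  assert (Ea : (nu - RtoC (2 * INR (S N)))%C = (a - RtoC 2)%C).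
  { unfold a. rewrite S_INR. apply C_ext; simpl; ring. }
  assert (Ew : (a - RtoC 2)%C = (- w)%C) by (rewrite <- Ea; unfold w; ring).
  assert (Hw : 1 < Re w) by (unfold w; rewrite Re_minus, Re_RtoC, S_INR; lra).
  assert (R2 : RtoC (x ^ 2) <> 0%C) by (intro Q; apply RtoC_inj in Q; assert (0 < x ^ 2) by (now apply pow_lt); lra).
  exists (fun k => ((T k - cpow (INR (S k)) (- w) * (Fa w + Fb w)) / RtoC (x ^ 2))%C).
  assert (Hd : forall k, 0 < INR (S k)) by (intros; apply lt_0_INR; lia).
  split.
  - intros k. rewrite Ea.
    assert (Q := cseries_plus _ _ _ _ (proj2 HFa w Hw) (proj2 HFb w Hw)).
    apply (cseries_scal (cpow (INR (S k)) (- w))) in Q.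
    assert (Q1 := cseries_minus _ _ _ _ (H1 k) Q). apply (cseries_scal (/ RtoC (x ^ 2))%C) in Q1.
    replace ((T k - cpow (INR (S k)) (- w) * (Fa w + Fb w)) / RtoC (x ^ 2))%C with
      (/ RtoC (x ^ 2) * (T k - cpow (INR (S k)) (- w) * (Fa w + Fb w)))%C by (unfold Cdiv; ring).
    eapply cseries_ext; [|exact Q1]. intros m. cbv beta. assert (Hm := pos_INR m).
    rewrite !cell_shift by (try assumption; try apply Hd; try apply Hne; lra).
    rewrite Ew, !cpow_mult_base by (try apply Hd; lra). unfold Cdiv. ring.
  - assert (Q := is_series_RtoC _ _ (zev_series (S N) ltac:(lia))).
    apply (cseries_scal (Fa w + Fb w)%C) in Q.
    assert (Q1 := cseries_minus _ _ _ _ H2 Q). apply (cseries_scal (/ RtoC (x ^ 2))%C) in Q1.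
    replace ((Ssum - RtoC (zev (S N)) * (Fa w + Fb w)) / RtoC (x ^ 2))%C with
      (/ RtoC (x ^ 2) * (Ssum - (Fa w + Fb w) * RtoC (zev (S N))))%C by (unfold Cdiv; ring).
    eapply cseries_ext; [|exact Q1]. intros k. cbv beta.
    assert (E : RtoC (/ (INR k + 1) ^ (2 * S N)) = (cpow (INR (S k)) (- nu) * cpow (INR (S k)) (- w))%C).
    { rewrite <- S_INR. rewrite RtoC_inv by (apply pow_nonzero, Rgt_not_eq, Hd).
      rewrite <- cpow_nat, <- cpow_opp, <- cpow_plus by apply Hd. f_equal. unfold w. rewrite mult_INR.
      replace (INR 2) with 2 by (simpl; ring). ring. }
    rewrite E. unfold Cdiv. ring.
Qed.

(** Raising N by one adds to the finite sum exactly what [double_series_shift] removes from the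
    double series; the division by x^2 there is compensated by x^(2N+3). *)
Theorem shifted_formula (th x : R) (nu : C) (N0 j : nat) (Fa Fb F1 : C -> C) : 0 < th < 1 -> 0 < x -> 0 <= Re nu ->
  2 * INR N0 - 1 <= Re nu < 2 * INR N0 + 1 -> (forall k : Z, nu <> RtoC (IZR k)) ->
  is_hurwitz_continuation th Fa -> is_hurwitz_continuation (1 - th) Fb -> is_hurwitz_continuation 1 F1 ->
  (forall k m : nat, INR (S k) * (INR m + th) <> x /\ INR (S k) * (INR m + (1 - th)) <> x) ->
  let Zt w := (Fa w + Fb w)%C in
  let c := ccos (RtoC PI * nu / 2) in
  let s := csin (RtoC PI * nu / 2) in
  let N := (N0 + j)%nat in
  exists T Ssum, double_series th x nu N T Ssum /\
  (RtoC (4 * PI) * Rint (lhs_fun th x nu) =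
   - (RtoC PI / c * F1 (nu + 1) * cpow x nu) + - (RtoC PI / (2 * c) * Zt (1 - nu))
   + - (1 / (RtoC (2 * x) * s) * Zt (- nu))
   + 1 / s * csum0 (fun i => RtoC (zev (S i)) * Zt (RtoC (2 * INR (S i)) - nu) * RtoC (x ^ (2 * i + 1))) N
   + 1 / s * RtoC (x ^ (2 * N + 1)) * Ssum)%C.
Proof.
  intros Hth Hx H0 Hn Hz HFa HFb HF1 Hne Zt c s. induction j as [|j IH]; intros N.
  - unfold N. rewrite Nat.add_0_r.
    destruct (double_series_strip th x nu N0 Hth Hx H0 Hn Hz Hne) as [T HT].
    eexists T, _. split; [exact HT|]. exact (strip_formula th x nu N0 Fa Fb F1 Hth Hx H0 Hn Hz HFa HFb HF1).
  - destruct IH as (T & Ssum & D & E). unfold N. rewrite Nat.add_succ_r. set (M := (N0 + j)%nat) in *.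
    assert (HM : Re nu < 2 * INR M + 1) by (unfold M; rewrite plus_INR; generalize (pos_INR j); lra).
    destruct (double_series_shift th x nu M T Ssum Fa Fb Hth Hx HM HFa HFb Hne D) as [T' D'].
    eexists T', _. split; [exact D'|]. rewrite E. cbn [csum0]. fold (Zt (RtoC (2 * INR (S M)) - nu)%C).
    assert (R2 : RtoC (x ^ 2) <> 0%C) by (intro Q; apply RtoC_inj in Q; assert (0 < x ^ 2) by (now apply pow_lt); lra).
    replace (2 * S M + 1)%nat with (2 * M + 1 + 2)%nat by lia. rewrite (pow_add x (2 * M + 1) 2), (RtoC_mult (x ^ (2 * M + 1))).
    assert (Hs : s <> 0%C).
    { intro Q. apply csin_half_zero in Q as [k Q]. apply (Hz (2 * k)%Z). rewrite Q, mult_IZR. reflexivity. }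
    assert (Hc : c <> 0%C).
    { intro Q. apply ccos_half_zero in Q as [k Q]. apply (Hz (2 * k + 1)%Z). rewrite Q, plus_IZR, mult_IZR. reflexivity. }
    assert (Rx : RtoC (2 * x) <> 0%C) by (intro Q; apply RtoC_inj in Q; lra).
    field. repeat split; assumption.
Qed.

(** * Zeta values at even integers and the final identity *)

Lemma RiemannZeta_even (j : nat) : (1 <= j)%nat -> RiemannZeta (RtoC (2 * INR j)) = RtoC (zev j).
Proof.
  intros Hj. destruct (hurwitz_exists 1 ltac:(lra)) as [F HF].
  assert (H1 : 1 <= INR j) by now apply (le_INR 1).
  unfold RiemannZeta. rewrite (HurwitzZeta_eq 1 F _ HF) by (intro Q; apply RtoC_inj in Q; lra).
  eapply cseries_unique; [apply (proj2 HF); rewrite Re_RtoC; lra|].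
  eapply cseries_ext; [|exact (is_series_RtoC _ _ (zev_series j Hj))]. intros k. cbv beta.
  assert (Hk := pos_INR k). rewrite cpow_opp. replace (2 * INR j) with (INR (2 * j)) by (rewrite mult_INR; simpl; ring).
  rewrite cpow_nat by lra. apply RtoC_inv, pow_nonzero. lra.
Qed.

Theorem theorem3p4 (x theta : R) (nu : C) (N : Z)
  (hx : 0 < x) (htheta0 : 0 < theta) (htheta1 : theta < 1)
  (hnu : forall k : Z, nu <> RtoC (IZR k)) (hRe : 0 <= Re nu)
  (hN : (Int_part ((Re nu + 1) / 2) <= N)%Z)
  (hxset : forall n r : nat, (1 <= n)%nat -> (1 <= r)%nat ->
             x <> (INR n - theta) * INR r)
  (hxset' : forall n r : nat, (1 <= n)%nat -> (1 <= r)%nat ->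
             x <> (INR n - (1 - theta)) * INR r) :
  let a := Cminus nu (RtoC (2 * IZR N)) in
  let inner (d m : nat) : C :=
    Cplus
      (Cdiv (Cminus (cpow (INR d * (INR m + theta)) a) (cpow x a))
            (RtoC ((INR d) ^ 2 * (INR m + theta) ^ 2 - x ^ 2)))
      (Cdiv (Cminus (cpow (INR d * (INR m + 1 - theta)) a) (cpow x a))
            (RtoC ((INR d) ^ 2 * (INR m + 1 - theta) ^ 2 - x ^ 2))) in
  let lhs_term (n : nat) : C :=
    Cmult (Cmult (cpow (INR n) (Cdiv nu (RtoC 2)))
                 (BesselK nu (4 * PI * sqrt (INR n * x))))
          (divisor_sum n (fun d => Cmult (cpow (INR d) (Copp nu))
                                         (RtoC (cos (2 * PI * INR d * theta))))) in
  let c := ccos (Cdiv (Cmult (RtoC PI) nu) (RtoC 2)) in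
  let s := csin (Cdiv (Cmult (RtoC PI) nu) (RtoC 2)) in
  exists (T : nat -> C) (Ssum L : C),
    (forall d : nat, (1 <= d)%nat -> cseries (fun m => inner d m) (T d)) /\
    cseries (fun k => Cmult (cpow (INR (S k)) (Copp nu)) (T (S k))) Ssum /\
    cseries (fun k => lhs_term (S k)) L /\
    Cmult (Cmult (RtoC (8 * PI)) (cpow x (Cdiv nu (RtoC 2)))) L =
      Cplus (Cplus (Cplus (Cplus
        (Copp (Cmult (Cmult (Cdiv (RtoC PI) c) (RiemannZeta (Cplus nu (RtoC 1))))
                     (cpow x nu)))
        (Copp (Cmult (Cdiv (RtoC PI) (Cmult (RtoC 2) c))
                     (Cplus (HurwitzZeta (Cminus (RtoC 1) nu) theta)
                            (HurwitzZeta (Cminus (RtoC 1) nu) (1 - theta))))))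
        (Copp (Cmult (Cdiv (RtoC 1) (Cmult (RtoC (2 * x)) s))
                     (Cplus (HurwitzZeta (Copp nu) theta)
                            (HurwitzZeta (Copp nu) (1 - theta))))))
        (Cmult (Cdiv (RtoC 1) s)
           (csum1 (Z.to_nat N) (fun j =>
              Cmult (Cmult (RiemannZeta (RtoC (2 * INR j)))
                           (Cplus (HurwitzZeta (Cminus (RtoC (2 * INR j)) nu) theta)
                                  (HurwitzZeta (Cminus (RtoC (2 * INR j)) nu) (1 - theta))))
                    (RtoC (x ^ (2 * j - 1)))))))
        (Cmult (Cmult (Cdiv (RtoC 1) s) (RtoC (x ^ (2 * Z.to_nat N + 1)))) Ssum).
Proof.
  intros a inner lhs_term c s.
  (* The floor z0 is characterized by 2 z0 - 1 <= Re nu < 2 z0 + 1, the strip required by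
     [shifted_formula]; Re nu >= 0 makes it nonnegative. *)
  destruct (base_Int_part ((Re nu + 1) / 2)) as [I1 I2].
  set (z0 := Int_part ((Re nu + 1) / 2)) in *.
  assert (Hz0 : (0 <= z0)%Z) by (apply Z.lt_succ_r, lt_IZR; unfold Z.succ; rewrite plus_IZR; lra).
  assert (EN : IZR N = INR (Z.to_nat N)) by (rewrite INR_IZR_INZ, Z2Nat.id; [reflexivity|lia]).
  assert (EN0 : IZR z0 = INR (Z.to_nat z0)) by (rewrite INR_IZR_INZ, Z2Nat.id; [reflexivity|lia]).
  destruct (hurwitz_exists theta htheta0) as [Fa HFa].
  destruct (hurwitz_exists (1 - theta) ltac:(lra)) as [Fb HFb].
  destruct (hurwitz_exists 1 ltac:(lra)) as [F1 HF1].
  (* The excluded products are read with n = m + 1: n - theta is m + (1 - theta), and n - (1 -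
     theta) is m + theta. *)
  assert (Hne : forall k m : nat, INR (S k) * (INR m + theta) <> x /\ INR (S k) * (INR m + (1 - theta)) <> x).
  { intros k m. split; intros Q.
    - apply (hxset' (S m) (S k)); [lia|lia|]. rewrite <- Q, (S_INR m). ring.
    - apply (hxset (S m) (S k)); [lia|lia|]. rewrite <- Q, (S_INR m). ring. }
  destruct (shifted_formula theta x nu (Z.to_nat z0) (Z.to_nat N - Z.to_nat z0) Fa Fb F1)
    as (T & Ssum & [D1 D2] & E); try assumption; try lra.
  replace (Z.to_nat z0 + (Z.to_nat N - Z.to_nat z0))%nat with (Z.to_nat N) in * by lia.
  destruct (lhs_integral theta x nu hx) as (_ & _ & L & HL & EL).
  (* The rows of [double_series] are numbered by k = d - 1, whereas the statement numbers them by d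
     itself. *)
  exists (fun d => T (pred d)), Ssum, L. split; [|split; [exact D2|split; [exact HL|]]].
  - intros [|k] Hd; [lia|]. eapply cseries_ext; [|exact (D1 k)]. intros m.
    unfold inner, cell, a. rewrite EN. replace (INR m + 1 - theta) with (INR m + (1 - theta)) by ring. reflexivity.
  - rewrite EL, E. clear E EL.
    (* As nu is not an integer, no argument of a zeta function depending on nu meets the pole at
       1. *)
    assert (ZR : forall w (n : Z), w = (nu + RtoC (IZR n))%C \/ w = (RtoC (IZR n) - nu)%C -> w <> RtoC 1).
    { intros w n [->| ->] Q.
      - apply (hnu (1 - n)%Z). rewrite minus_IZR, RtoC_minus, <- Q. ring.
      - apply (hnu (n - 1)%Z). rewrite minus_IZR, RtoC_minus, <- Q. ring. }
    assert (ZE : forall w (n : Z), w = (RtoC (IZR n) - nu)%C ->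
      (HurwitzZeta w theta + HurwitzZeta w (1 - theta))%C = (Fa w + Fb w)%C).
    { intros w n Hw. assert (Q := ZR w n (or_intror Hw)).
      now rewrite (HurwitzZeta_eq _ _ _ HFa Q), (HurwitzZeta_eq _ _ _ HFb Q). }
    rewrite (ZE (1 - nu)%C 1%Z eq_refl), (ZE (- nu)%C 0%Z) by (apply C_ext; simpl; ring).
    unfold RiemannZeta at 1. rewrite (HurwitzZeta_eq _ _ _ HF1 (ZR (nu + 1)%C 1%Z (or_introl eq_refl))).
    rewrite csum1_csum0. do 3 f_equal. apply csum0_ext. intros i _. cbv beta.
    rewrite RiemannZeta_even by lia.
    rewrite (ZE (RtoC (2 * INR (S i)) - nu)%C (2 * Z.of_nat (S i))%Z) by (rewrite mult_IZR, <- INR_IZR_INZ; reflexivity).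
    do 3 f_equal. lia.
Qed.
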